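(* The following equalities hold: $$\inf\{F(\Omega):\Omega\subset\mathbb{R}^2\ \text{bounded, open and Lipschitz}\}=0,$$ $$\sup\{F(\Omega):\Omega\subset\mathbb{R}^2\ \text{bounded, open and Lipschitz}\}=+\infty,$$ where $F(\Omega)=\dfrac{\mu_1(\Omega)|\Omega|}{\sigma_1(\Omega)P(\Omega)}$, the infimum and supremum being taken over those $\Omega$ for which $\sigma_1(\Omega)>0$.
   Context: For a bounded open Lipschitz set $\Omega\subset\mathbb{R}^2$, $|\Omega|$ is its Lebesgue measure and $P(\Omega)$ its perimeter. The Neumann eigenvalues $0=\mu_0(\Omega)\le\mu_1(\Omega)\le\mu_2(\Omega)\le\cdots$ (counted with multiplicity) are those of $-\Delta u=\mu u$ in $\Omega$, $\partial_\nu u=0$ on $\partial\Omega$. The Steklov eigenvalues $0=\sigma_0(\Omega)\le\sigma_1(\Omega)\le\sigma_2(\Omega)\le\cdots$ (counted with multiplicity) are those of $\Delta v=0$ in $\Omega$, $\partial_\nu v=\sigma v$ on $\partial\Omega$ ($\nu$ the outward normal). *)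

(* Defs.v *)
From HB Require Import structures.
From mathcomp Require Import all_boot all_order all_algebra.
From mathcomp Require Import all_classical all_reals all_analysis.

Set Implicit Arguments.
Unset Strict Implicit.
Unset Printing Implicit Defensive.

Import Order.TTheory GRing.Theory Num.Theory.
Import numFieldNormedType.Exports.

Local Open Scope classical_set_scope.
Local Open Scope ring_scope.

(* This is R * R with the sigma-algebra on which lebesgue_measure \x
   lebesgue_measure lives; it is convertible to R * R. *)
Notation plane R := (measurableTypeR R * measurableTypeR R)%type.

(* The norm that the library puts on R * R is the sup norm; distances and
   diameters below are Euclidean. *)
Definition dot {R : realType} (x y : R * R) : R := x.1 * y.1 + x.2 * y.2.
Definition eucl_dist {R : realType} (x y : R * R) : R :=
  Num.sqrt (dot (x - y) (x - y)).

Section hausdorff1.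
Context {R : realType}.
Implicit Types (A B X U : set (plane R)) (x y : plane R).
Local Open Scope ereal_scope.

Definition eucl_diam A : \bar R :=
  ereal_sup ([set 0] `|` [set (eucl_dist p.1 p.2)%:E | p in A `*` A]).

(* Sets of diameter > delta have infinite cost, so that mu_ext takes the
   infimum over the countable covers by sets of diameter <= delta. As mu_ext
   uses measurable covers, the infimum is over covers by Borel sets: this
   changes nothing, a set and its closure having the same diameter. *)
Definition diam_cost (delta : R) A : \bar R :=
  if eucl_diam A <= delta%:E then eucl_diam A else +oo.

(* One-dimensional Hausdorff measure; in dimension 1 the normalising constant
   is 1, so that segments get their length. *)
Definition hausdorff1 A : \bar R :=
  ereal_sup [set mu_ext (diam_cost delta) A | delta in [set d | (0 < d)%R]].

Lemma eucl_diam_ge0 A : 0 <= eucl_diam A.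
Proof. by apply: ereal_sup_ubound; left. Qed.

Lemma eucl_dist_le_diam A x y : A x -> A y -> (eucl_dist x y)%:E <= eucl_diam A.
Proof. by move=> Ax Ay; apply: ereal_sup_ubound; right; exists (x, y). Qed.

Lemma eucl_diam0 : eucl_diam set0 = 0.
Proof.
apply/eqP; rewrite eq_le eucl_diam_ge0 andbT; apply: ge_ereal_sup => z /= [->//|].
by case=> -[a b] [].
Qed.

Let cost_ge0 d A : 0 <= diam_cost d A.
Proof. by rewrite /diam_cost; case: ifP => _ //; exact: eucl_diam_ge0. Qed.

Let cost0 d : (0 < d)%R -> diam_cost d set0 = 0.
Proof. by move=> d0; rewrite /diam_cost eucl_diam0 lee_fin ltW. Qed.

Let le_cost d e A : (d <= e)%R -> diam_cost e A <= diam_cost d A.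
Proof.
move=> de; rewrite /diam_cost; case: (leP _ d%:E) => Ad; last by rewrite leey.
by rewrite (le_trans Ad)// lee_fin.
Qed.

Let le_hausdorff1_mu_ext d A : (0 < d)%R -> mu_ext (diam_cost d) A <= hausdorff1 A.
Proof. by move=> d0; apply: ereal_sup_ubound; exists d. Qed.

Let le_mu_ext_cost d e A : (d <= e)%R ->
  mu_ext (diam_cost e) A <= mu_ext (diam_cost d) A.
Proof.
move=> de; apply: le_ereal_inf_tmp => _ /= [U cU <-].
apply: (@le_trans _ _ (\sum_(k <oo) diam_cost e (U k))).
  by apply: ereal_inf_lbound; exists U.
by apply: lee_nneseries => *; [exact: cost_ge0|exact: le_cost].
Qed.

Lemma hausdorff1_ge0 A : 0 <= hausdorff1 A.
Proof. by apply: le_trans (le_hausdorff1_mu_ext A ltr01); exact: mu_ext_ge0. Qed.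

Lemma hausdorff1_0 : hausdorff1 set0 = 0.
Proof.
apply/eqP; rewrite eq_le hausdorff1_ge0 andbT.
by apply: ge_ereal_sup => _ [d /= d0 <-]; rewrite mu_ext0//; exact: cost0.
Qed.

Lemma le_hausdorff1 : {homo hausdorff1 : A B / A `<=` B >-> A <= B}.
Proof.
move=> A B AB; apply: ge_ereal_sup => _ [d /= d0 <-].
by apply: le_trans (le_hausdorff1_mu_ext B d0); exact: le_mu_ext.
Qed.

Lemma hausdorff1_sigma_subadditive : sigma_subadditive hausdorff1.
Proof.
move=> F; apply: ge_ereal_sup => _ [d /= d0 <-].
apply: (le_trans (mu_ext_sigma_subadditive (cost_ge0 d) F)).
apply: lee_nneseries => [n _ _|n _]; last exact: le_hausdorff1_mu_ext.
by apply: mu_ext_ge0.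
Qed.

HB.instance Definition _ := isOuterMeasure.Build R (plane R) hausdorff1
  hausdorff1_0 hausdorff1_ge0 le_hausdorff1 hausdorff1_sigma_subadditive.

Lemma hausdorff1_metric A B (e : R) : (0 < e)%R ->
  (forall x y, A x -> B y -> (e <= eucl_dist x y)%R) ->
  hausdorff1 A + hausdorff1 B <= hausdorff1 (A `|` B).
Proof.
move=> e0 AB.
have step d : (0 < d < e)%R -> mu_ext (diam_cost d) A + mu_ext (diam_cost d) B <=
    mu_ext (diam_cost d) (A `|` B).
  move=> /andP[d0 de]; apply: le_ereal_inf_tmp => _ /= [U [mU cU] <-].
  pose V S n := if `[< U n `&` S !=set0 >] then U n else set0.
  have cV S : S `<=` A `|` B -> measurable_cover S (V S).
    move=> SAB; split=> [n|x Sx].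
      by rewrite /V; case: ifP => _; [exact: mU|exact: measurable0].
    have [n _ Unx] := cU _ (SAB _ Sx); exists n => //.
    by rewrite /V ifT//; apply/asboolP; exists x.
  apply: (@le_trans _ _ (\sum_(k <oo) diam_cost d (V A k) +
                         \sum_(k <oo) diam_cost d (V B k))).
    apply: leeD; apply: ereal_inf_lbound; eexists; try reflexivity.
      by apply: cV => x; left.
    by apply: cV => x; right.
  rewrite -nneseriesD//; apply: lee_nneseries => [n _ _|n _].
    by apply: adde_ge0.
  rewrite /V; case: asboolP => [[x [Ux Ax]]|_]; last first.
    by rewrite cost0// add0e; case: ifP => // _; rewrite cost0.
  case: asboolP => [[y [Uy By]]|_]; last by rewrite cost0// adde0.
  rewrite {3}/diam_cost ifF ?leey//; apply/negbTE; rewrite -ltNge.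
  apply: lt_le_trans (eucl_dist_le_diam Ux Uy); rewrite lte_fin.
  exact: lt_le_trans de (AB _ _ Ax By).
have step2 d1 d2 : (0 < d1)%R -> (0 < d2)%R ->
    mu_ext (diam_cost d1) A + mu_ext (diam_cost d2) B <= hausdorff1 (A `|` B).
  move=> d10 d20; pose d : R := (Num.min (Num.min d1 d2) (e / 2))%R.
  have d0 : (0 < d)%R by rewrite !lt_min d10 d20 divr_gt0.
  have de : (d < e)%R by rewrite gt_min ltr_pdivrMr// ltr_pMr// ltr1n orbT.
  apply: le_trans (le_hausdorff1_mu_ext _ d0).
  have dd : (0 < d < e)%R by rewrite d0.
  apply: le_trans (step _ dd).
  by apply: leeD; apply: le_mu_ext_cost; rewrite !ge_min lexx ?orbT.
have [->|AfinB] := eqVneq (hausdorff1 (A `|` B)) +oo; first by rewrite leey.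
have fin S : S `<=` A `|` B -> hausdorff1 S \is a fin_num.
  move=> SAB; rewrite ge0_fin_numE ?hausdorff1_ge0//.
  by apply: le_lt_trans (le_hausdorff1 SAB) _; rewrite ltey.
have fA := fin A (@subsetUl _ _ _); have fB := fin B (@subsetUr _ _ _).
rewrite -leeBrDr//; apply: ge_ereal_sup => _ [d1 /= d10 <-].
rewrite leeBrDr// addeC.
have fm : mu_ext (diam_cost d1) A \is a fin_num.
  rewrite ge0_fin_numE ?mu_ext_ge0//.
  by apply: le_lt_trans (le_hausdorff1_mu_ext _ d10) _; rewrite -ge0_fin_numE ?hausdorff1_ge0.
rewrite -leeBrDr//; apply: ge_ereal_sup => _ [d2 /= d20 <-].
by rewrite leeBrDr// addeC step2.
Qed.

Let caratheodory_gt (phi : plane R -> R) (a : R) :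
  (forall x y, (phi x - phi y <= eucl_dist x y)%R) ->
  hausdorff1.-caratheodory [set x | (a < phi x)%R].
Proof.
move=> phiL; apply: le_caratheodory_measurable => X.
set S := [set x | _].
change (hausdorff1 (X `&` S) + hausdorff1 (X `&` ~` S) <= hausdorff1 X).
have [->|Xfin] := eqVneq (hausdorff1 X) +oo; first by rewrite leey.
have Xoo : hausdorff1 X < +oo by rewrite ltey.
pose b (n : nat) : R := (a + n.+1%:R^-1)%R.
have bS n : (b n.+1 < b n)%R.
  by rewrite ltrD2l ltf_pV2 ?posrE ?ltr0n// ltr_nat.
have ab n : (a < b n)%R by rewrite ltrDl invr_gt0 ltr0n.
have bd i j : (i <= j)%N -> (b j <= b i)%R.
  by move=> ij; rewrite lerD2l lef_pV2 ?posrE ?ltr0n// ler_nat.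
pose Y n := X `&` [set x | (b n < phi x)%R].
pose Q n := X `&` [set x | (b n.+1 < phi x <= b n)%R].
have YX n : hausdorff1 (Y n) <= hausdorff1 X.
  by apply: le_hausdorff1; exact: subIsetl.
have sep n : hausdorff1 (Q n.+1) + hausdorff1 (Y n) <= hausdorff1 (Y n.+2).
  rewrite addeC.
  apply: (@le_trans _ _ (hausdorff1 (Y n `|` Q n.+1))).
    apply: (@hausdorff1_metric _ _ (b n - b n.+1)%R); first by rewrite subr_gt0.
    move=> x y [_ /= xn] [_ /= /andP[_ yn]].
    by apply: le_trans (phiL x y); rewrite lerB// ltW.
  apply: le_hausdorff1 => x [[Xx /= xn]|[Xx /= /andP[xn _]]]; split => //=.
  by rewrite (lt_trans _ xn)// (lt_trans (bS _)).
have sumQ n : \sum_(0 <= k < n.+1) hausdorff1 (Q k) <=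
    hausdorff1 (Y n) + hausdorff1 (Y n.+1).
  elim: n => [|n IHn].
    rewrite big_nat1; apply: (@le_trans _ _ (hausdorff1 (Y 1%N))).
      by apply: le_hausdorff1 => x [Xx /= /andP[? _]].
    by rewrite leeDr ?hausdorff1_ge0.
  rewrite big_nat_recr//=; apply: le_trans (leeD2r _ IHn) _.
  rewrite [X in X + _]addeC -addeA leeD2l//.
  by rewrite addeC; exact: sep.
have sumQoo : \sum_(0 <= k <oo) hausdorff1 (Q k) < +oo.
  apply: (@le_lt_trans _ _ (hausdorff1 X + hausdorff1 X)); last first.
    by rewrite lte_add_pinfty.
  apply: lime_le; first by apply: is_cvg_nneseries => *; exact: hausdorff1_ge0.
  near=> n; have /prednK <- : (0 < n)%N by near: n; exact: nbhs_infty_gt.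
  by apply: le_trans (sumQ _) _; exact: leeD.
have tail := nneseries_tail_cvg sumQoo (fun k _ => hausdorff1_ge0 (Q k)).
have key n : hausdorff1 (X `&` S) + hausdorff1 (X `&` ~` S) <=
    hausdorff1 X + \sum_(n <= k <oo) hausdorff1 (Q k).
  have XS : hausdorff1 (X `&` S) <=
      hausdorff1 (Y n) + \sum_(n <= k <oo) hausdorff1 (Q k).
    apply: (@le_trans _ _ (hausdorff1 (Y n `|` \bigcup_(k in ~` `I_n) Q k))).
      apply: le_hausdorff1 => x [Xx /= ax].
      have [xn|xn] := ltP (b n) (phi x); first by left.
      right.
      have exm : exists m, (b m < phi x)%R.
        have := @archi_boundP _ (phi x - a)^-1.
        rewrite invr_ge0 subr_ge0 (ltW ax) => /(_ isT) hm.
        exists (Num.bound (phi x - a)^-1); rewrite /b -ltrBrDl.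
        rewrite -[ltRHS]invrK ltf_pV2 ?posrE ?ltr0n ?invr_gt0 ?subr_gt0//.
        by rewrite (lt_trans hm)// ltr_nat.
      case: (ex_minnP exm) => -[|m] bm mmin.
        by have := lt_le_trans bm (le_trans xn (bd _ _ (leq0n n))); rewrite ltxx.
      exists m.
        move=> /= mn.
        by have := lt_le_trans bm (le_trans xn (bd _ _ mn)); rewrite ltxx.
      split=> //=; rewrite bm/= leNgt; apply/negP => /mmin.
      by rewrite ltnn.
    apply: (le_trans (outer_measureU2 _ _ _)); rewrite leeD2l//.
    exact: outer_measure_sigma_subadditive_tail.
  apply: le_trans (leeD2r _ XS) _; rewrite addeAC leeD2r//.
  apply: (@le_trans _ _ (hausdorff1 (Y n `|` X `&` ~` S))).
    apply: (@hausdorff1_metric _ _ (b n - a)%R); first by rewrite subr_gt0.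
    move=> x y [_ /= xn] [_ /= /negP]; rewrite -leNgt => ya.
    by apply: le_trans (phiL x y); rewrite lerB// ltW.
  by apply: le_hausdorff1 => x [[]|[]].
have : hausdorff1 X + \sum_(n <= k <oo) hausdorff1 (Q k) @[n --> \oo]
    --> hausdorff1 X + 0.
  apply: cvgeD => //; last exact: cvg_cst.
  by rewrite fin_num_adde_defl.
rewrite adde0 => cv; rewrite -(cvg_lim _ cv)//; apply: lime_ge.
  by apply/cvg_ex; eexists; exact: cv.
by apply: nearW => n; exact: key.
Unshelve. all: by end_near. Qed.

Let proj_le_eucl_dist x y :
  (x.1 - y.1 <= eucl_dist x y)%R /\ (x.2 - y.2 <= eucl_dist x y)%R.
Proof.
by split; apply: le_trans (ler_norm _) _; rewrite -sqrtr_sqr ler_wsqrtr//=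
  expr2 ?lerDl ?lerDr sqr_ge0.
Qed.

Lemma measurable_hausdorff1 A : measurable A -> hausdorff1.-caratheodory A.
Proof.
have cara (phi : plane R -> R) : (forall x y, (phi x - phi y <= eucl_dist x y)%R) ->
    forall B : set R, measurable B -> hausdorff1.-caratheodory (phi @^-1` B).
  move=> phiL B; rewrite [measurable](_ : _ = (@ocitv R).-sigma.-measurable)//.
  rewrite measurable_realfun.RGenOInfty.measurableE.
  move: B; apply: smallest_sub => [|_ [a ->]].
    split=> [|B|F] /=.
    - exact: caratheodory_measurable_set0.
    - by rewrite setTD; exact: caratheodory_measurable_setC.
    - by rewrite preimage_bigcup; exact: caratheodory_measurable_bigcup.
  have := caratheodory_gt a phiL; congr (_.-caratheodory _).
  by apply/seteqP; split => x /=; rewrite in_itv/= andbT.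
move: A; apply: smallest_sub.
  split=> [|A|F].
  - exact: caratheodory_measurable_set0.
  - by rewrite setTD; exact: caratheodory_measurable_setC.
  - exact: caratheodory_measurable_bigcup.
by move=> _ [|] [B mB <-]; rewrite setTI; apply: (cara _ _ _ mB) => x y;
  have [] := proj_le_eucl_dist x y.
Qed.

Let hausdorff1_sigma_additive : semi_sigma_additive hausdorff1.
Proof.
move=> F mF tF mUF; apply: (@caratheodory_measure_sigma_additive R _ hausdorff1) => //.
  by move=> i; exact: (measurable_hausdorff1 (mF i)).
exact: (measurable_hausdorff1 mUF).
Qed.

HB.instance Definition _ := isMeasure.Build _ (plane R) R hausdorff1
  hausdorff1_0 hausdorff1_ge0 hausdorff1_sigma_additive.

End hausdorff1.

Definition leb2 {R : realType} : {measure set (plane R) -> \bar R} :=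
  (lebesgue_measure \x lebesgue_measure)%E.

Section domains.
Context {R : realType}.
Implicit Types (Omega A : set (R * R)) (x p : R * R).

Definition boundary A : set (R * R) := closure A `\` interior A.

(* Near each boundary point p, in coordinates centred at p and rotated so that
   the axes are (c, s) and (- s, c), Omega is the strict epigraph of a
   Lipschitz function. *)
Definition lipschitz_boundary Omega := forall p, boundary Omega p ->
  exists (c s r k : R) (gamma : R -> R),
    [/\ c ^+ 2 + s ^+ 2 = 1, 0 < r, k.-lipschitz gamma &
        forall x, eucl_dist x p < r ->
          (Omega x <-> gamma (dot (c, s) (x - p)) < dot (- s, c) (x - p))].

Definition bounded_lipschitz_open Omega :=
  [/\ Omega !=set0, open Omega, bounded_set Omega & lipschitz_boundary Omega].

(* For a Lipschitz set this is also the De Giorgi perimeter. *)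
Definition perimeter Omega : \bar R := hausdorff1 (boundary Omega).

End domains.

Section sobolev.
Context {R : realType}.
Implicit Types (Omega : set (R * R)) (f u g : R * R -> R)
  (G : R * R -> R * R).

Definition grad f (x : R * R) : R * R := ('D_(1, 0) f x, 'D_(0, 1) f x).

Fixpoint Ck (k : nat) f : Prop :=
  if k is j.+1 then
    [/\ forall x : R * R, derivable f x (1, 0) /\ derivable f x (0, 1),
        Ck j (fun x => (grad f x).1) & Ck j (fun x => (grad f x).2)]
  else continuous f.

Definition smooth f := forall k, Ck k f.

Definition test_function Omega f :=
  let support := closure [set x | f x != 0] in
  [/\ smooth f, compact support & support `<=` Omega].

Definition L2 (mu : {measure set (plane R) -> \bar R}) (D : set (plane R)) u :=
  measurable_fun D (u : plane R -> R) /\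
  mu.-integrable D (fun x => (u x ^+ 2)%:E).

Definition weak_gradient Omega u G := forall f, test_function Omega f ->
  \int[leb2]_(x in Omega) (u x * (grad f x).1) =
    - (\int[leb2]_(x in Omega) ((G x).1 * f x)) /\
  \int[leb2]_(x in Omega) (u x * (grad f x).2) =
    - (\int[leb2]_(x in Omega) ((G x).2 * f x)).

(* u belongs to the Sobolev space H^1(Omega) and has weak gradient G. *)
Definition sobolev Omega u G :=
  [/\ L2 leb2 Omega u, L2 leb2 Omega (fun x => (G x).1),
      L2 leb2 Omega (fun x => (G x).2) & weak_gradient Omega u G].

(* g is the trace on the boundary of the element u of H^1(Omega) whose weak
   gradient is G, i.e., the value at u of the continuous extension to
   H^1(Omega) of the restriction map f |-> f | boundary on the functions that
   are smooth up to the boundary, which are dense in H^1(Omega). *)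
Definition trace Omega u G g :=
  L2 hausdorff1 (boundary Omega) g /\
  exists2 f : nat -> R * R -> R, (forall n, smooth (f n)) &
    [/\ (\int[leb2]_(x in Omega) ((f n x - u x) ^+ 2)%:E)%E
          @[n --> \oo] --> 0%E,
        (\int[leb2]_(x in Omega)
           (dot (grad (f n) x - G x) (grad (f n) x - G x))%:E)%E
          @[n --> \oo] --> 0%E &
        (\int[hausdorff1]_(x in boundary Omega) ((f n x - g x) ^+ 2)%:E)%E
          @[n --> \oo] --> 0%E].

End sobolev.

Section eigenvalues.
Context {R : realType}.
Implicit Types (Omega : set (R * R)) (u v : R * R -> R) (lambda t : R).

(* On a Lipschitz set the two boundary value problems are understood in the
   weak sense, in H^1(Omega). The zero function is not excluded here: the
   linear independence required in nth_eigenvalue does it. *)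
Definition neumann_eigenfunction Omega lambda u :=
  exists2 G, sobolev Omega u G &
    forall w H, sobolev Omega w H ->
      \int[leb2]_(x in Omega) dot (G x) (H x) =
        lambda * \int[leb2]_(x in Omega) (u x * w x).

Definition steklov_eigenfunction Omega lambda v :=
  exists G g, [/\ sobolev Omega v G, trace Omega v G g &
    forall w H h, sobolev Omega w H -> trace Omega w H h ->
      \int[leb2]_(x in Omega) dot (G x) (H x) =
        lambda * \int[hausdorff1]_(x in boundary Omega) (g x * h x)].

Definition free_ae Omega (n : nat) (u : 'I_n -> R * R -> R) :=
  forall c : 'I_n -> R,
    {ae leb2, forall x : plane R, Omega x -> \sum_(i < n) c i * u i x = 0} ->
    forall i, c i = 0.

(* The entry of index k, starting from 0, of the nondecreasing list of the
   eigenvalues repeated according to multiplicity: the least t such that at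
   least k + 1 eigenvalues, counted with multiplicity, are <= t. *)
Definition nth_eigenvalue Omega (eigenfunction : R -> (R * R -> R) -> Prop)
    (k : nat) : \bar R :=
  ereal_inf [set t%:E | t in [set t |
    exists (lambda : 'I_k.+1 -> R) (u : 'I_k.+1 -> R * R -> R),
      free_ae Omega u /\
      forall i, eigenfunction (lambda i) (u i) /\ lambda i <= t]].

Definition neumann_eigenvalue Omega :=
  nth_eigenvalue Omega (neumann_eigenfunction Omega).

Definition steklov_eigenvalue Omega :=
  nth_eigenvalue Omega (steklov_eigenfunction Omega).

(* All four quantities are finite on the sets considered. *)
Definition neumann_steklov_ratio Omega : R :=
  fine (neumann_eigenvalue Omega 1) * fine (leb2 Omega) /
  (fine (steklov_eigenvalue Omega 1) * fine (perimeter Omega)).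

End eigenvalues.

(* Main.v *)
Require Import Defs.
From HB Require Import structures.
From mathcomp Require Import all_boot all_order all_algebra.
From mathcomp Require Import all_classical all_reals all_analysis.
From mathcomp Require Import measurable_realfun.
From mathcomp Require Import ring lra.

Set Implicit Arguments.
Unset Strict Implicit.
Unset Printing Implicit Defensive.

Import Order.TTheory GRing.Theory Num.Theory.
Import numFieldNormedType.Exports.

Local Open Scope classical_set_scope.
Local Open Scope ring_scope.

(* Omega is a dumbbell: the unit square and an L x h rectangle joined by a
   corridor of length l and width w, with l = e, h = e^2, w = e^6 and e -> 0.
   A function that is constant on both chambers and a ramp in the corridor has
   energy O(w / l), and Poincare and trace inequalities with explicit constants
   bound the eigenvalues from below.
   - If L = e^-2, the chambers have comparable areas, so mu_1 |Omega| = O(w / l),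
     while sigma_1 >= c w and P(Omega) >= L, so F(Omega) = O(1 / (l L)) = O(e).
   - If L = 1, the small chamber has area h but its boundary has length of order
     1: mu_1 >= c w / h, whereas sigma_1 P(Omega) = O(w / l), so
     F(Omega) >= c l / h = c / e.
   The eigenfunction needed for an upper bound is a minimizer of the Rayleigh
   quotient. No compact embedding is used: below the level of the test function,
   the quotient controls everything but finitely many mean values, along which
   a minimizing sequence can be made to converge. *)

(** * Smooth functions and test functions *)

(** An eigenvalue of index 1 is an infimum over free pairs of weak eigenfunctions, so the two kinds
    of bounds have different needs. For a lower bound, every eigenfunction below the level must be
    constant: this follows from a Poincare inequality modulo constants, whose constant contains 1 /
    w because the chambers communicate through the corridor only. For an upper bound, a second
    eigenfunction must exist, since otherwise the infimum could be +oo. The inequalities used there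
    are modulo the means over the three rooms, so that the gaps between these means do not enter;
    their constants are of order L^2 (Neumann) and l^2 / w + L^2 / h (Steklov), and a minimizer
    exists once this constant times the energy 4 w / l of the ramp is small. This governs the powers
    of e: L^2 w / l = e when L = e^-2, and l + w / (h l) = e + e^3 when L = 1; moreover L h = 1
    gives the long chamber area 1. Smooth approximants of functions of H^1 are used only where the
    definition of the trace provides them; elsewhere everything is read off the weak gradient,
    tested against products of one-variable functions. *)

Section smooth1.
Context {R : realType}.
Implicit Types (f g : R -> R) (k : nat) (a b c x t : R) (p : {poly R}).

(** Asking for some derivative instead of iterating [derive1] lets an explicit family closed under
    derivation, such as [flat], serve as its own witness. *)
Fixpoint C1k k f : Prop :=
  if k is j.+1 then exists2 f', (forall x, is_derive x 1 f (f' x)) & C1k j f'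
  else continuous f.

Definition smooth1 f := forall k, C1k k f.

Lemma is_derive_continuous f f' : (forall x, is_derive x (1 : R) f (f' x)) -> continuous f.
Proof. by move=> ff' x; apply: differentiable_continuous; apply/derivable1_diffP; have [] := ff' x. Qed.

Lemma C1kS k f : C1k k.+1 f -> C1k k f.
Proof.
elim: k f => [|k IHk] f [f' ff' f'k] /=; first exact: is_derive_continuous ff'.
by exists f' => //; exact: IHk.
Qed.

Lemma C1k_cst k c : C1k k (cst c).
Proof.
elim: k c => [|k IHk] c /=; first by move=> x; exact: cvg_cst.
by exists (cst 0) => [x|]; [exact: is_derive_cst|exact: IHk].
Qed.

Lemma C1kD k f g : C1k k f -> C1k k g -> C1k k (fun x => f x + g x).
Proof.
elim: k f g => [|k IHk] f g /=; first by move=> cf cg x; apply: cvgD; [exact: cf|exact: cg].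
move=> [f' ff' f'k] [g' gg' g'k]; exists (fun x => f' x + g' x); last exact: IHk.
by move=> x; apply: is_deriveD.
Qed.

Lemma C1kM k f g : C1k k f -> C1k k g -> C1k k (fun x => f x * g x).
Proof.
elim: k f g => [|k IHk] f g; first by move=> cf cg x; apply: cvgM; [exact: cf|exact: cg].
move=> fk gk; have f1 := C1kS fk; have g1 := C1kS gk.
case: fk => [f' ff' f'k]; case: gk => [g' gg' g'k].
exists (fun x => f x * g' x + g x * f' x) => [x|]; first exact: is_deriveM.
by apply: C1kD; apply: IHk.
Qed.

Lemma C1k_affine k f a b : C1k k f -> C1k k (fun x => f (a * x + b)).
Proof.
elim: k f => [|k IHk] f.
  move=> cf x; apply: continuous_comp; last exact: cf.
  by apply: cvgD; [apply: cvgM; [exact: cvg_cst|exact: cvg_id]|exact: cvg_cst].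
case=> f' ff' f'k; exists (fun x => f' (a * x + b) * a) => [x|]; last first.
  by apply: C1kM; [exact: IHk|exact: C1k_cst].
apply: (@is_derive1_comp R f (fun x => a * x + b)).
by apply/is_derive1_caratheodory; exists (cst a); split => [z|//=|//]; [rewrite /cst; ring|exact: cvg_cst].
Qed.

(** Derivatives are unique, so the witnesses of [C1k] at the different orders all start with
    [derive1 f]. *)
Lemma smooth1_derive f : smooth1 f ->
  (forall x, is_derive x (1 : R) f (derive1 f x)) /\ smooth1 (derive1 f).
Proof.
move=> sf; have [f' ff' _] := sf 1%N.
have D x : is_derive x (1 : R) f (derive1 f x).
  by rewrite derive1E (@derive_val _ _ _ _ _ _ _ (ff' x)); exact: ff'.
split=> // k; have [g fg gk] := sf k.+1.
suff -> : derive1 f = g by [].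
by apply/funext => x; rewrite derive1E (@derive_val _ _ _ _ _ _ _ (fg x)).
Qed.

Lemma smooth1_continuous f : smooth1 f -> continuous f.
Proof. by move=> /(_ 0%N). Qed.

(** From t^n / n! <= e^t, coefficient by coefficient. It makes e^(-1/t) beat every polynomial in 1/t
    as t decreases to 0. *)
Lemma horner_le_expR p : exists2 C : R, 0 <= C &
  forall t, 0 <= t -> `|p.[t]| <= C * expR t.
Proof.
exists (\sum_(i < size p) `|p`_i| * i`!%:R).
  by apply: sumr_ge0 => i _; rewrite mulr_ge0.
move=> t t0; rewrite horner_coef (le_trans (ler_norm_sum _ _ _))// mulr_suml.
apply: ler_sum => i _; rewrite normrM -mulrA ler_wpM2l//.
rewrite ger0_norm ?exprn_ge0//; case: (val i) => [|n].
  by rewrite expr0 fact0 mul1r (le_trans _ (expR_ge1Dx t))// lerDl.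
have := expR_ge1Dxn n t0.
have f0 : 0 < n.+1`!%:R :> R by rewrite ltr0n fact_gt0.
move=> H; rewrite mulrC -ler_pdivrMr// mulrC.
by apply: le_trans H; rewrite mulrC lerDr.
Qed.

(** For [p = 1] this is the classical smooth function that is flat at 0. The polynomial parameter
    makes the family closed under derivation. *)
Definition flat p t : R := if 0 < t then p.[t^-1] * expR (- t^-1) else 0.

(* d/dt (p(1/t) e^(-1/t)) = (p - p')(1/t) (1/t)^2 e^(-1/t) *)
Lemma is_derive_flat p t : is_derive t (1 : R) (flat p) (flat ('X^2 * (p - p^`())) t).
Proof.
have [t0|t0|t0] := ltgtP 0 t; last rewrite -{}t0.
- have -> : flat ('X^2 * (p - p^`())) t =
    p.[t^-1] * (t ^- 2 * expR (- t^-1)) + expR (- t^-1) * (p^`().[t^-1] * - t ^- 2).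
    rewrite /flat t0 -exprVn; set u := t^-1; rewrite hornerM hornerXn hornerD hornerN.
    by ring.
  have tV : is_derive t (1 : R) GRing.inv (- t ^- 2).
    have := @is_deriveV R id t 1 1 _ (is_derive_id _ _).
    by rewrite /= gt_eqF// => /(_ isT) H; apply: (is_derive_eq H); rewrite [LHS]mulr1.
  apply: (@near_eq_is_derive _ _ _ ((horner p \o GRing.inv) * (expR \o (-%R \o GRing.inv)))).
    near=> x; rewrite /flat ifT//; near: x; exact: lt_nbhsr.
  have tP : is_derive t (1 : R) (horner p \o GRing.inv) (p^`().[t^-1] * - t ^- 2).
    by apply: is_derive1_comp => //; exact: is_derive_poly.
  have tNV : is_derive t (1 : R) (-%R \o GRing.inv) (t ^- 2).
    by have H := is_deriveN tV; apply: (is_derive_eq H); rewrite opprK.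
  have tE : is_derive t (1 : R) (expR \o (-%R \o GRing.inv)) (t ^- 2 * expR (- t^-1)).
    have H := is_derive1_comp (is_derive_expR _) tNV.
    by apply: (is_derive_eq H); rewrite mulrC.
  exact: is_deriveM.
- have -> : flat ('X^2 * (p - p^`())) t = 0 by rewrite /flat ltNge ltW.
  apply: (@near_eq_is_derive _ _ _ (cst (0 : R))).
  near=> x; rewrite /flat ltNge (_ : x <= 0)//; apply: ltW; near: x; exact: lt_nbhsl.
have -> : flat ('X^2 * (p - p^`())) 0 = 0 by rewrite /flat ltxx.
have [C C0 HC] := horner_le_expR ('X^2 * p).
(* At 0: the exponential bound for ['X^2 * p] leaves a factor h^2, so the difference quotient is
   O(h). *)
have key h : `|flat p h| <= C * (h ^+ 2).
  rewrite /flat; case: ifPn => [h0|_]; last by rewrite normr0 mulr_ge0// sqr_ge0.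
  have hV : 0 <= h^-1 by rewrite invr_ge0 ltW.
  have := HC _ hV; rewrite hornerM hornerXn normrM exprVn ger0_norm ?invr_ge0 ?sqr_ge0//.
  rewrite ler_pdivrMl ?exprn_gt0// => H.
  rewrite normrM (ger0_norm (expR_ge0 _)) expRN ler_pdivrMr ?expR_gt0//.
  by apply: le_trans H _; rewrite le_eqVlt; apply/orP; left; apply/eqP; ring.
have lim0 : h^-1 *: ((flat p \o shift 0) (h *: (1 : R)) - flat p 0) @[h --> 0^'] --> (0 : R).
  apply/cvgr0Pnorm_le => e e0; near=> h.
  rewrite /flat ltxx subr0 /= -/(flat p _) addr0 [h *: 1]mulr1.
  have h0 : h != 0 by near: h; exact: nbhs_dnbhs_neq.
  rewrite normrZ normfV ler_pdivrMl ?normr_gt0// (le_trans (key h))//.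
  rewrite -real_normK ?num_real// expr2 mulrCA ler_wpM2l//.
  have hd : `|h| < e / (C + 1).
    near: h; apply: dnbhs0_lt; rewrite divr_gt0// ltr_wpDl//.
  have := hd; rewrite ltr_pdivlMr ?ltr_wpDl//; have := normr_ge0 h; nra.
by split; [apply/cvg_ex; exists 0|exact/cvg_lim].
Unshelve. all: by end_near. Qed.

Lemma C1k_flat k p : C1k k (flat p).
Proof.
elim: k p => [|k IHk] p /=; first exact: is_derive_continuous (is_derive_flat p).
by eexists; [exact: is_derive_flat|exact: IHk].
Qed.

(** The factors are [flat 1] at (n + 1) (x - a) - 1 and (n + 1) (b - x) - 1. The shift by 1 keeps
    the support at distance 1 / (n + 1) from a and b, hence compact in the open interval, and the
    limit is the indicator of that interval. *)
Definition bump a b (n : nat) x : R :=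
  flat 1 (n.+1%:R * x + (- n.+1%:R * a - 1)) * flat 1 (- n.+1%:R * x + (n.+1%:R * b - 1)).

Lemma smooth1_bump a b n : smooth1 (bump a b n).
Proof. by move=> k; apply: C1kM; apply: C1k_affine; exact: C1k_flat. Qed.

Let flat1 t : 0 <= flat 1 t <= 1.
Proof.
rewrite /flat hornerC mul1r; case: ifPn => [t0|_]; last by rewrite lexx ler01.
by rewrite expR_ge0 -expR0 ler_expR oppr_le0 invr_ge0 ltW.
Qed.

Lemma bump_ge0 a b n x : 0 <= bump a b n x.
Proof. rewrite /bump; set s := flat 1 _; set t := flat 1 _.
have /andP[s0 s1] : 0 <= s <= 1 := flat1 _; have /andP[t0 t1] : 0 <= t <= 1 := flat1 _.
exact: mulr_ge0. Qed.

Lemma bump_le1 a b n x : bump a b n x <= 1.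
Proof.
rewrite /bump; set s := flat 1 _; set t := flat 1 _.
have /andP[s0 s1] : 0 <= s <= 1 := flat1 _; have /andP[t0 t1] : 0 <= t <= 1 := flat1 _.
by rewrite mulr_ile1.
Qed.

Lemma bump_eq0 a b n x : ~ (a + n.+1%:R^-1 < x < b - n.+1%:R^-1) -> bump a b n x = 0.
Proof.
have n0 : 0 < n.+1%:R :> R by [].
apply: contra_notP => /eqP; rewrite mulf_eq0 negb_or /flat => /andP[].
case: ifPn => [xa _|_]; last by rewrite eqxx.
case: ifPn => [xb _|_]; last by rewrite eqxx.
apply/andP; split.
  by rewrite -subr_gt0 -(pmulr_rgt0 _ n0) (lt_le_trans xa)// le_eqVlt; apply/orP/or_introl/eqP; field; rewrite gt_eqF.
by rewrite -subr_gt0 -(pmulr_rgt0 _ n0) (lt_le_trans xb)// le_eqVlt; apply/orP/or_introl/eqP; field; rewrite gt_eqF.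
Qed.

Lemma bump_eq0_itv a b n x : ~ (a < x < b) -> bump a b n x = 0.
Proof.
move=> H; apply: bump_eq0 => /andP[xa xb]; apply: H; have n0 : 0 < n.+1%:R^-1 :> R by [].
by rewrite (lt_trans _ xa) ?ltrDl// (lt_trans xb)// gtrBl.
Qed.

Let flat1_cvg c : 0 < c -> (flat 1 (n.+1%:R * c - 1) : R) @[n --> \oo] --> (1 : R).
Proof.
move=> c0.
have h1 : (n.+1%:R * c - 1 : R) @[n --> \oo] --> +oo.
  apply/cvgryPge => A; near=> n.
  have : (A + 1) / c <= n.+1%:R.
    rewrite (@le_trans _ _ n%:R)// ?ler_nat//; near: n; exact: nbhs_infty_ger.
  by rewrite ler_pdivrMr//; lra.
have h2 : (expR (- (n.+1%:R * c - 1)^-1) : R) @[n --> \oo] --> (1 : R).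
  have E : expR (- 0) = 1 :> R by rewrite oppr0 expR0.
  rewrite -[X in _ --> X]E; apply: continuous_cvg; first exact: continuous_expR.
  by apply: cvgN; apply/gtr0_cvgV0 => //; near=> n; near: n; move/cvgryPgt : h1; exact.
apply: cvg_trans h2; apply: near_eq_cvg; near=> n.
rewrite /flat hornerC mul1r ifT//; near: n; move/cvgryPgt : h1; exact.
Unshelve. all: by end_near. Qed.

Lemma bump_cvg a b x : bump a b n x @[n --> \oo] --> (\1_[set` `]a, b[] x : R).
Proof.
rewrite indicE; have [|xab] := boolP (x \in [set` `]a, b[]).
  rewrite inE/= in_itv/= => /andP[ax xb]; rewrite -[1%:R]mulr1; apply: cvgM.
    rewrite (_ : (fun n => _) = fun n => flat 1 (n.+1%:R * (x - a) - 1)); last first.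
      by apply/funext => n; congr flat; ring.
    by apply: flat1_cvg => //; rewrite subr_gt0.
  rewrite (_ : (fun n => _) = fun n => flat 1 (n.+1%:R * (b - x) - 1)); last first.
    by apply/funext => n; congr flat; ring.
  by apply: flat1_cvg => //; rewrite subr_gt0.
rewrite (_ : (fun n => _) = cst 0); first exact: cvg_cst.
apply/funext => n; apply: bump_eq0_itv => H; move/negP: xab; apply.
by rewrite inE/= in_itv.
Qed.

End smooth1.

Section primitive.
Context {R : realType}.
Implicit Types (chi f g : R -> R) (a b p q x : R).
Notation mu := (@lebesgue_measure R).

Lemma integrable_supported chi a b : continuous chi ->
  (forall x, ~ (a < x < b) -> chi x = 0) -> mu.-integrable setT (EFin \o chi).
Proof.
move=> cchi chi0.
have -> : EFin \o chi = (EFin \o chi) \_ [set` `[a, b]].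
  apply/funext => x; rewrite patchE; case: ifPn => //; rewrite notin_setE /= in_itv/= => xab.
  by rewrite chi0// => /andP[/ltW ax /ltW xb]; apply: xab; rewrite ax xb.
have mab : measurable ([set` `[a, b]] : set R) by [].
have H := @integrable_mkcond _ _ _ mu _ (EFin \o chi) mab; apply/H.
apply: continuous_compact_integrable; first exact: segment_compact.
exact: continuous_subspaceT.
Qed.

Definition prim chi x := \int[mu]_(t in `]-oo, x]) chi t.

Lemma is_derive_prim chi a b x : continuous chi ->
  (forall x, ~ (a < x < b) -> chi x = 0) -> is_derive x (1 : R) (prim chi) (chi x).
Proof.
move=> cchi chi0; have ichi := integrable_supported cchi chi0.
have [||||dF <-] := @continuous_FTC1 R chi -oo%O x (x + 1).
- by rewrite ltrDl.
- exact: integrableS ichi.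
- exact: ltNyr.
- exact: cchi.
by rewrite derive1E; apply/derivableP.
Qed.

Lemma prim_left chi a b x : (forall x, ~ (a < x < b) -> chi x = 0) ->
  x <= a -> prim chi x = 0.
Proof.
move=> chi0 xa; rewrite /prim /Rintegral; under eq_integral.
  move=> t; rewrite inE/= in_itv/= => tx; rewrite chi0; last first.
    by move=> /andP[at_ _]; have := lt_le_trans at_ (le_trans tx xa); rewrite ltxx.
  over.
by rewrite integral0.
Qed.

Lemma prim_right chi a b x : (forall x, ~ (a < x < b) -> chi x = 0) ->
  b <= x -> prim chi x = \int[mu]_t chi t.
Proof.
move=> chi0 bx; rewrite /prim Rintegral_mkcond; congr (fine _); apply: eq_integral => t _.
rewrite patchE; case: ifPn => //; rewrite notin_setE/= in_itv/= => tx.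
by rewrite chi0// => /andP[_ tb]; apply: tx; exact: ltW (lt_le_trans tb bx).
Qed.

Lemma prim_bound chi x : mu.-integrable setT (EFin \o chi) -> (forall x, 0 <= chi x) ->
  0 <= prim chi x <= \int[mu]_t chi t.
Proof.
move=> ichi chi0; apply/andP; split; first by apply: Rintegral_ge0 => *; exact: chi0.
have mx : measurable ([set` `]-oo, x]] : set R) by [].
rewrite fine_le//.
- by apply: integrable_fin_num => //; exact: integrableS ichi.
- exact: integrable_fin_num.
apply: ge0_subset_integral => //; first exact: measurable_int ichi.
by move=> t _; rewrite lee_fin.
Qed.

Lemma C1k_prim k chi a b : smooth1 chi -> (forall x, ~ (a < x < b) -> chi x = 0) ->
  C1k k (prim chi).
Proof.
move=> schi chi0; have D x := is_derive_prim x (smooth1_continuous schi) chi0.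
case: k => [|k]; first exact: is_derive_continuous D.
by exists chi => //; exact: schi.
Qed.

Lemma integrable_bump a b n : mu.-integrable setT (EFin \o bump a b n).
Proof. exact: (integrable_supported (smooth1_continuous (smooth1_bump a b n)) (@bump_eq0_itv R a b n)). Qed.

Lemma bump_le_indic a b n x : bump a b n x <= \1_[set` `]a, b[] x.
Proof.
rewrite indicE; have [_|xab] := boolP (x \in [set` `]a, b[]); first exact: bump_le1.
by rewrite bump_eq0_itv// => H; move/negP: xab; apply; rewrite inE/= in_itv.
Qed.

Definition mass a b n := \int[mu]_t bump a b n t.

Lemma Rintegral_indic_oo a b : a <= b -> b - a = \int[mu]_t \1_[set` `]a, b[] t.
Proof.
move=> ab; rewrite /Rintegral integral_indic//= setIT lebesgue_measure_itv/= lte_fin. case: ltgtP ab => //= -> _; by rewrite subrr.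
Qed.

Lemma mass_bound a b n : a <= b -> 0 <= mass a b n <= b - a.
Proof.
move=> ab; apply/andP; split; first by apply: Rintegral_ge0 => x _; exact: bump_ge0.
have -> : b - a = \int[mu]_t \1_[set` `]a, b[] t.
  exact: Rintegral_indic_oo.
apply: le_Rintegral => //; first exact: integrable_bump.
  exact: integrable_indic_itv.
by move=> x _; exact: bump_le_indic.
Qed.

Lemma mass_cvg a b : a <= b -> mass a b n @[n --> \oo] --> b - a.
Proof.
move=> ab.
have -> : b - a = \int[mu]_t \1_[set` `]a, b[] t.
  exact: Rintegral_indic_oo.
have iI : mu.-integrable setT (EFin \o \1_[set` `]a, b[]) by exact: integrable_indic_itv.
apply: fine_cvg; rewrite fineK; last exact: integrable_fin_num.
have := @dominated_cvg _ _ R mu setT measurableT (fun n x => (bump a b n x)%:E)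
  (EFin \o \1_[set` `]a, b[]) (EFin \o \1_[set` `]a, b[]); apply => //.
- by move=> n; exact: measurable_int (integrable_bump a b n).
- by move=> x _; apply: cvg_EFin; [exact: nearW|exact: bump_cvg].
- by move=> n x _ /=; rewrite lee_fin ger0_norm ?bump_ge0// bump_le_indic.
Qed.

(* The derivative of plateau is close to (b - a) 1_(p,q) - (q - p) 1_(a,b), of
   mean 0. *)
Definition plateau a b p q n x :=
  mass a b n * prim (bump p q n) x - mass p q n * prim (bump a b n) x.

Lemma smooth1_plateau a b p q n : smooth1 (plateau a b p q n).
Proof.
move=> k; have -> : plateau a b p q n = (fun x => cst (mass a b n) x * prim (bump p q n) x +
    cst (- mass p q n) x * prim (bump a b n) x).
  by apply/funext => x; rewrite /plateau /cst mulNr.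
have P c d : C1k k (prim (bump c d n)) := C1k_prim k (smooth1_bump c d n) (@bump_eq0_itv R c d n).
by apply: C1kD; apply: C1kM; [exact: C1k_cst|exact: P|exact: C1k_cst|exact: P].
Qed.

Lemma is_derive_plateau a b p q n x : is_derive x (1 : R) (plateau a b p q n)
  (mass a b n * bump p q n x - mass p q n * bump a b n x).
Proof.
have D c d := is_derive_prim x (smooth1_continuous (smooth1_bump c d n)) (@bump_eq0_itv R c d n).
exact: (is_deriveB (is_deriveZ (mass a b n) (D p q)) (is_deriveZ (mass p q n) (D a b))).
Qed.

(** Beyond the supports both primitives have reached their masses and the two products cancel: this
    is why each primitive is weighted by the mass of the other. *)
Lemma plateau_eq0 a b p q n x : a <= p -> q <= b ->
  ~ (a + n.+1%:R^-1 < x < b - n.+1%:R^-1) -> plateau a b p q n x = 0.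
Proof.
move=> ap qb xab; rewrite /plateau.
have B0 (c d y : R) (H : ~ (c + n.+1%:R^-1 < y < d - n.+1%:R^-1)) := bump_eq0 H.
have [xa|xa] := leP x (a + n.+1%:R^-1).
  rewrite (prim_left (B0 p q)) ?(prim_left (B0 a b)) ?mulr0 ?subr0//.
  by apply: le_trans xa _; rewrite lerD2r.
have bx : b - n.+1%:R^-1 <= x by rewrite leNgt; apply/negP => xb; apply: xab; rewrite xa.
rewrite (prim_right (B0 p q)) ?(prim_right (B0 a b)) -/(mass _ _ _)//.
  by rewrite mulrC subrr.
by apply: le_trans bx; rewrite lerD2r.
Qed.

Lemma plateau_bound a b p q n x : a <= b -> p <= q ->
  `|plateau a b p q n x| <= (b - a) * (q - p).
Proof.
move=> ab pq; rewrite /plateau.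
have := prim_bound x (integrable_bump p q n) (bump_ge0 p q n).
have := prim_bound x (integrable_bump a b n) (bump_ge0 a b n).
rewrite -/(mass p q n) -/(mass a b n).
have := mass_bound n ab; have := mass_bound n pq.
move: (mass p q n) (mass a b n) (prim _ _) (prim _ _) => m1 m2 u v.
move=> /andP[m10 m11] /andP[m20 m21] /andP[v0 v1] /andP[u0 u1].
rewrite ler_norml; apply/andP; split.
  have : m1 * v <= m1 * m2 by rewrite ler_wpM2l.
  have : m1 * m2 <= (q - p) * (b - a) by rewrite ler_pM.
  have : 0 <= m2 * u by rewrite mulr_ge0.
  lra.
have : m2 * u <= m2 * m1 by rewrite ler_wpM2l.
have : m2 * m1 <= (b - a) * (q - p) by rewrite ler_pM.
have : 0 <= m1 * v by rewrite mulr_ge0.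
lra.
Qed.

End primitive.

Section tensor.
Context {R : realType}.
Implicit Types (f g : R -> R) (F : R * R -> R) (x : R * R).

Lemma partial1E F x : (derivable F x (1, 0) <-> derivable (fun t => F (t, x.2)) x.1 1) /\
  'D_(1, 0) F x = 'D_1 (fun t => F (t, x.2)) x.1.
Proof.
suff E : (fun h : R => h^-1 *: ((F \o shift x) (h *: ((1, 0) : R * R)) - F x)) =
    (fun h => h^-1 *: (((fun t => F (t, x.2)) \o shift x.1) (h *: (1 : R)) - F (x.1, x.2))).
  by rewrite /derivable /derive E.
by apply/funext => h /=; case: x => x1 x2; rewrite /shift/= -[(1, 0) : R * R]/(_, _)/=
  [h *: _](_ : _ = (h *: (1 : R), h *: (0 : R)))// scaler0 [(_, _) + _](_ : _ = (h *: (1 : R) + x1, 0 + x2))// add0r.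
Qed.

Lemma partial2E F x : (derivable F x (0, 1) <-> derivable (fun t => F (x.1, t)) x.2 1) /\
  'D_(0, 1) F x = 'D_1 (fun t => F (x.1, t)) x.2.
Proof.
suff E : (fun h : R => h^-1 *: ((F \o shift x) (h *: ((0, 1) : R * R)) - F x)) =
    (fun h => h^-1 *: (((fun t => F (x.1, t)) \o shift x.2) (h *: (1 : R)) - F (x.1, x.2))).
  by rewrite /derivable /derive E.
by apply/funext => h /=; case: x => x1 x2; rewrite /shift/=
  [h *: _](_ : _ = (h *: (0 : R), h *: (1 : R)))// scaler0 [(_, _) + _](_ : _ = (0 + x1, h *: (1 : R) + x2))// add0r.
Qed.

Definition tensor f g x := f x.1 * g x.2.

Lemma derive_tensor f g x : smooth1 f -> smooth1 g ->
  [/\ derivable (tensor f g) x (1, 0), derivable (tensor f g) x (0, 1)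
    & grad (tensor f g) x = (derive1 f x.1 * g x.2, f x.1 * derive1 g x.2)].
Proof.
move=> sf sg; have [df _] := smooth1_derive sf; have [dg _] := smooth1_derive sg.
have D1 : is_derive x.1 (1 : R) (fun t => tensor f g (t, x.2)) (derive1 f x.1 * g x.2).
  have H := is_deriveM (df x.1) (is_derive_cst (g x.2) x.1 1).
  by apply: (is_derive_eq H); rewrite scaler0 add0r [LHS]mulrC.
have D2 : is_derive x.2 (1 : R) (fun t => tensor f g (x.1, t)) (f x.1 * derive1 g x.2).
  exact: (is_deriveZ (f x.1) (dg x.2)).
have [P1 Q1] := partial1E (tensor f g) x; have [P2 Q2] := partial2E (tensor f g) x.
split; [by apply/P1; case: D1|by apply/P2; case: D2|].
by rewrite /grad Q1 Q2 (@derive_val _ _ _ _ _ _ _ D1) (@derive_val _ _ _ _ _ _ _ D2).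
Qed.

Lemma smooth_tensor f g : smooth1 f -> smooth1 g -> smooth (tensor f g).
Proof.
move=> sf sg k; elim: k f g sf sg => [|k IHk] f g sf sg /=.
  move=> x; apply: cvgM; apply: continuous_comp.
  - exact: cvg_fst.
  - exact: smooth1_continuous.
  - exact: cvg_snd.
  - exact: smooth1_continuous.
have D x := derive_tensor x sf sg.
have [_ sf'] := smooth1_derive sf; have [_ sg'] := smooth1_derive sg.
split; first by move=> x; have [d1 d2 _] := D x; exact: conj d1 d2.
  have -> : (fun x => (grad (tensor f g) x).1) = tensor (derive1 f) g.
    by apply/funext => x; case: (D x) => _ _ ->.
  exact: IHk.
have -> : (fun x => (grad (tensor f g) x).2) = tensor f (derive1 g).
  by apply/funext => x; case: (D x) => _ _ ->.
exact: IHk.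
Qed.

Lemma test_tensor (Omega : set (R * R)) f g a b c d : smooth1 f -> smooth1 g ->
  (forall t, ~ (a < t < b) -> f t = 0) -> (forall t, ~ (c < t < d) -> g t = 0) ->
  [set` `[a, b]] `*` [set` `[c, d]] `<=` Omega -> test_function Omega (tensor f g).
Proof.
move=> sf sg f0 g0 sub.
have K : compact ([set` `[a, b]] `*` [set` `[c, d]] : set (R * R)).
  by apply: compact_setX; exact: segment_compact.
have KC := compact_closed (@norm_hausdorff _ _) K.
have sK : closure [set x | tensor f g x != 0] `<=` [set` `[a, b]] `*` [set` `[c, d]].
  have -> : [set` `[a, b]] `*` [set` `[c, d]] = closure ([set` `[a, b]] `*` [set` `[c, d]]) by apply/closure_id.
apply: closure_subset => -[x y]/=.
  rewrite /tensor/= mulf_eq0 negb_or => /andP[fx gy].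
  have hx : a < x < b by apply: contrapT => /f0 H; rewrite H eqxx in fx.
  have hy : c < y < d by apply: contrapT => /g0 H; rewrite H eqxx in gy.
  by case/andP: hx => /ltW ? /ltW ?; case/andP: hy => /ltW ? /ltW ?; split; rewrite /= in_itv/=; apply/andP.
split; [exact: smooth_tensor| |exact: subset_trans sK sub].
exact: subclosed_compact (@closed_closure _ _) K sK.
Qed.

End tensor.

(** * Hausdorff measure of segments *)

Section hausdorff_segment.
Context {R : realType}.
Implicit Types (x y : R * R) (s t c : R).
Local Open Scope ereal_scope.
Notation mu := (@lebesgue_measure R).
Notation H1 := (@hausdorff1 R).

(** [e] is an isometric parametrization of a line and [p] the coordinate along it, which does not
    increase distances. Horizontal and vertical lines will be the instances. *)
Variables (e : R -> R * R) (p : R * R -> R).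
Hypothesis me : measurable_fun setT (e : measurableTypeR R -> plane R).
Hypothesis mp : measurable_fun setT (p : plane R -> measurableTypeR R).
Hypothesis eK : forall s, p (e s) = s.
Hypothesis e_dist : forall s t, eucl_dist (e s) (e t) = `|s - t|%R.
Hypothesis p_le : forall x y, (p x - p y <= eucl_dist x y)%R.

Lemma measurable_image_line (A : set R) : measurable (range e : set (plane R)) ->
  measurable A -> measurable (e @` A : set (plane R)).
Proof.
move=> mr mA; have -> : e @` A = range e `&` p @^-1` A.
  apply/seteqP; split => [_ [s As <-]|x [[s _ <-]]].
    by split; [exists s|rewrite /preimage/= eK].
  by rewrite /preimage/= eK => As; exists s.
by apply: measurableI => //; rewrite -[X in measurable X]setTI; exact: mp.
Qed.

Hypothesis mrange : measurable (range e : set (plane R)).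

Lemma diam_image_itv s t : (s <= t)%R -> eucl_diam (e @` [set` `]s, t]]) <= (t - s)%:E.
Proof.
move=> st; apply: ge_ereal_sup => _ [->|[[x y] /= [[u + <-] [v + <-]] <-]].
  by rewrite lee_fin subr_ge0.
rewrite /= !in_itv/= e_dist lee_fin => /andP[su ut] /andP[sv vt].
by rewrite ler_norml; apply/andP; split; lra.
Qed.

(** At every scale d, the image is cut into n + 1 equal pieces of diameter at most d, whose costs
    add up to t - s. *)
Lemma hausdorff1_itv_le s t : (s < t)%R -> H1 (e @` [set` `]s, t]]) <= (t - s)%:E.
Proof.
move=> st; apply: ge_ereal_sup => _ [d /= d0 <-].
have [n nd] : exists n : nat, ((t - s) / n.+1%:R <= d)%R.
  exists (Num.bound ((t - s) / d)); rewrite ler_pdivrMr// mulrC -ler_pdivrMr//.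
  apply: (le_trans (ltW (archi_boundP _))); last by rewrite ler_nat.
  by rewrite divr_ge0 ?subr_ge0// ltW.
set h := ((t - s) / n.+1%:R)%R in nd.
have h0 : (0 < h)%R by rewrite divr_gt0// subr_gt0.
have hn : (h * n.+1%:R = t - s)%R by rewrite divfK.
pose F k := if (k < n.+1)%N then e @` [set` `]s + h * k%:R, s + h * k.+1%:R]]%R else set0.
have cost k : diam_cost d (F k) <= (if (k < n.+1)%N then h else 0%R)%:E.
  rewrite /F; case: ifPn => kn; last first.
    by rewrite /diam_cost eucl_diam0 lee_fin (ltW d0).
  have st' : (s + h * k%:R <= s + h * k.+1%:R)%R.
    by rewrite lerD2l ler_pM2l// ler_nat.
  have := diam_image_itv st'.
  have -> : (s + h * k.+1%:R - (s + h * k%:R) = h)%R by rewrite -natr1; ring.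
  by move=> dh; rewrite /diam_cost (le_trans dh)// lee_fin.
have cost_ge0 k : 0 <= diam_cost d (F k).
  by rewrite /diam_cost; case: ifP => // _; exact: eucl_diam_ge0.
apply: (@le_trans _ _ (\sum_(k <oo) diam_cost d (F k))).
  apply: ereal_inf_lbound; exists F => //; split.
    by move=> k; rewrite /F; case: ifP => _ //; apply: measurable_image_line.
  move=> _ [u /= + <-]; rewrite in_itv/= => /andP[su ut].
  have ex : exists k : nat, (u <= s + h * k.+1%:R)%R.
    by exists n; rewrite hn addrC subrK.
  case: (ex_minnP ex) => k uk kmin; exists k => //; rewrite /F.
  have kn : (k <= n)%N by apply: kmin; rewrite hn addrC subrK.
  rewrite ltnS kn; exists u => //=; rewrite in_itv/= uk andbT.
  case: k uk kmin kn => [|k] uk kmin kn; first by rewrite mulr0 addr0.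
  by rewrite ltNge; apply/negP => /kmin; rewrite ltnn.
apply: (@le_trans _ _ (\sum_(k <oo) (if (k < n.+1)%N then h else 0%R)%:E)).
  by apply: lee_nneseries => *.
rewrite (nneseries_split 0 n.+1); last by move=> k _; rewrite lee_fin; case: ifP => // _; exact: ltW.
rewrite eseries0 ?adde0 => [|k nk _]; last by rewrite add0n in nk; rewrite ltnNge nk.
rewrite add0n big_mkord (eq_bigr (fun=> h%:E)) => [|i _]; last by rewrite ltn_ord.
by rewrite sumEFin sumr_const card_ord -mulr_natr hn.
Qed.

(** The projection of U lies between its infimum and its supremum, which differ by at most the
    diameter of U. When the diameter exceeds 1 the cost is +oo and the whole line will do. *)
Lemma le_proj_diam_cost (U : set (R * R)) : exists2 I : set R,
  measurable I & p @` U `<=` I /\ mu I <= diam_cost 1 U.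
Proof.
have [->|/set0P[x0 Ux0]] := eqVneq U set0.
  exists set0 => //; split; first by rewrite image_set0.
  by rewrite measure0 /diam_cost; case: ifP => // _; exact: eucl_diam_ge0.
have [dU|dU] := boolP (eucl_diam U <= 1); last first.
  by exists setT => //; split => //; rewrite /diam_cost (negbTE dU) leey.
have dfin : eucl_diam U \is a fin_num.
  by rewrite ge0_fin_numE ?eucl_diam_ge0// (le_lt_trans dU)// ltry.
pose D := fine (eucl_diam U).
have pD x y : U x -> U y -> (p x - p y <= D)%R.
  move=> Ux Uy; apply: le_trans (p_le x y) _.
  by rewrite -lee_fin fineK//; exact: eucl_dist_le_diam.
have ub : has_ubound (p @` U) by exists (p x0 + D)%R => _ [x Ux <-]; have := pD _ _ Ux Ux0; lra.
have lb : has_lbound (p @` U) by exists (p x0 - D)%R => _ [x Ux <-]; have := pD _ _ Ux0 Ux; lra.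
exists [set` `[inf (p @` U), sup (p @` U)]] => //; split.
  move=> _ [x Ux <-]; rewrite /= in_itv/=; apply/andP; split.
    by apply: inf_lbound => //; exists x.
  by apply: sup_upper_bound; [split => //; exists (p x0), x0|exists x].
rewrite /diam_cost dU -(fineK dfin) -/D lebesgue_measure_itv/=; case: ifPn => _; last first.
  by rewrite lee_fin /D fine_ge0// eucl_diam_ge0.
rewrite -EFinD lee_fin lerBlDr; apply: ge_sup; first by exists (p x0), x0.
move=> _ [x Ux <-]; rewrite -lerBlDl; apply: lb_le_inf; first by exists (p x0), x0.
by move=> _ [y Uy <-]; have := pD _ _ Ux Uy; lra.
Qed.

(** The scale 1 is fine enough: projecting any cover gives a cover of the interval, and Lebesgue
    measure is subadditive. *)
Lemma hausdorff1_itv_ge s t : (s < t)%R -> (t - s)%:E <= H1 (e @` [set` `]s, t]]).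
Proof.
move=> st; apply: (@le_trans _ _ (mu_ext (diam_cost 1) (e @` [set` `]s, t]]))); last first.
  by apply: ereal_sup_ubound; exists 1%R => /=.
apply: le_ereal_inf_tmp => _ [U [mU cU] <-].
have /choice[I HI] : forall k, exists I : set R, [/\ measurable I, p @` U k `<=` I & mu I <= diam_cost 1 (U k)].
  by move=> k; have [I mI [pI mI']] := le_proj_diam_cost (U k); exists I.

apply: (@le_trans _ _ (\sum_(k <oo) mu (I k))); last first.
  by apply: lee_nneseries => k *; [exact: measure_ge0|have [] := HI k].
have -> : (t - s)%:E = mu [set` `]s, t]] by rewrite lebesgue_measure_itv/= lte_fin st.
apply: measure_sigma_subadditive => //.
  by move=> k; have [] := HI k.
move=> u su; have [k _ Uk] : (\bigcup_k U k) (e u) by apply: cU; exists u.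
by exists k => //; have [_ pI _] := HI k; apply: pI; exists (e u).
Qed.

(** The Hausdorff measure of the line, pushed forward by [p], is a measure that agrees with length
    on half-open intervals, hence is Lebesgue measure. *)
Lemma hausdorff1_image (A : set R) : measurable A -> H1 (e @` A) = mu A.
Proof.
move=> mA.
pose pm := isMeasurableFun.Build _ _ (plane R) (measurableTypeR R) p mp.
pose pf : {mfun plane R >-> measurableTypeR R} := HB.pack p pm.
pose nu : {measure set (measurableTypeR R) -> \bar R} := pushforward (mrestr H1 mrange) pf.
have nuE (B : set R) : nu mp B = H1 (e @` B).
  rewrite /nu /= /pushforward/= /mrestr; congr (H1 _).
  apply/seteqP; split => [x [/= px [s _ xE]]|_ [s Bs <-]].
    by exists s => //; rewrite -(eK s) xE.
  by split => /=; [rewrite eK|exists s].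
rewrite -nuE; apply/esym; apply: lebesgue_measure_unique => // X [[s t] _ <-]/=.
rewrite nuE lebesgue_measure_itv/= lte_fin; case: ifPn => st.
  by apply/eqP; rewrite eq_le -EFinB hausdorff1_itv_ge// hausdorff1_itv_le.
by rewrite set_itv_ge ?image_set0 ?measure0// bnd_simp.
Qed.

Lemma integral_hausdorff1_image (A : set R) (f : R * R -> \bar R) : measurable A ->
  measurable_fun setT (f : plane R -> \bar R) -> (forall x, 0 <= f x) ->
  \int[H1]_(x in e @` A) f x = \int[mu]_(s in A) f (e s).
Proof.
move=> mA mf f0.
have mI : measurable (e @` A : set (plane R)) by exact: measurable_image_line.
pose em := isMeasurableFun.Build _ _ (measurableTypeR R) (plane R) e me.
pose ef : {mfun measurableTypeR R >-> plane R} := HB.pack e em.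
transitivity (\int[pushforward mu ef]_(x in e @` A) f x).
  apply: eq_measure_integral => B mB BA; rewrite /pushforward/=.
  have BE : B = e @` (e @^-1` B).
    by apply/seteqP; split => [x Bx|_ [s Bs <-]//]; have [s As sx] := BA _ Bx; exists s => //=; rewrite sx.
  rewrite {1}BE hausdorff1_image//; rewrite -[X in measurable X]setTI; exact: me.
rewrite ge0_integral_pushforward//.
- congr (integral _ _ _); apply/seteqP; split => [s [r Ar /(congr1 p)]|s As]/=.
    by rewrite !eK => <-.
  by exists s.
- exact: measurable_funTS.
Qed.

End hausdorff_segment.

(** * Lipschitz charts of the dumbbell *)

Section plane_topology.
Context {R : realType}.

Lemma nbhs_planeP (A : set (R * R)) (p : R * R) :
  nbhs p A <-> exists2 r : R, 0 < r & forall x, `|x.1 - p.1| < r -> `|x.2 - p.2| < r -> A x.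
Proof.
split=> [/nbhs_ballP[r r0 H]|[r r0 H]].
  exists r => // x x1 x2; apply: H; split => /=; rewrite /ball/= distrC//.
by apply/nbhs_ballP; exists r => // x [/= x1 x2]; apply: H; rewrite distrC.
Qed.

(** The product sigma-algebra contains the boxes, and an open set is the union of the countably many
    rational boxes that it contains. *)
Lemma open_measurable_plane (U : set (plane R)) : open (U : set (R * R)) -> measurable U.
Proof.
move=> oU.
pose box (q : rat * rat * rat) : set (R * R) :=
  [set x | `|x.1 - ratr q.1.1| < ratr q.2] `&` [set x | `|x.2 - ratr q.1.2| < ratr q.2].
have mbox q : measurable (box q : set (plane R)).
  have -> : box q = [set` `]ratr q.1.1 - ratr q.2, ratr q.1.1 + ratr q.2[] `*`
                    [set` `]ratr q.1.2 - ratr q.2, ratr q.1.2 + ratr q.2[].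
    by apply/seteqP; split => -[x y] /=; rewrite /box/= !in_itv/= !ltr_distl.
  by apply: measurableX.
have -> : U = \bigcup_(q : rat * rat * rat) (if `[< box q `<=` U >] then box q else set0).
  apply/seteqP; split => [x Ux|x [q _]]; last by case: asboolP => // bU bx; exact: bU.
  have /nbhs_planeP[r r0 rU] : nbhs x U by apply: open_nbhs_nbhs; split.
  (* Half of r: the rational centre is within s of x, so the points of the box are within 2 s < r of
     x. *)
  have [s /andP[s0 sr]] : exists q : rat, 0 < (ratr q : R) < r / 2.
    have [|q] := @rat_in_itvoo R 0 (r / 2); first by rewrite divr_gt0.
    by rewrite in_itv/= => ?; exists q.
  have near (t : R) : exists q : rat, `|t - ratr q| < ratr s.
    have [|q] := @rat_in_itvoo R (t - ratr s) (t + ratr s); first by lra.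
    by rewrite in_itv/= => /andP[? ?]; exists q; rewrite distrC ltr_distl; apply/andP; split; lra.
  have [a xa] := near x.1; have [b xb] := near x.2.
  exists (a, b, s) => //; case: asboolP => [_|]; first by split.
  move=> nU; exfalso; apply: nU => y [/= y1 y2]; apply: rU.
    by move: xa y1; rewrite !ltr_norml => /andP[? ?] /andP[? ?]; apply/andP; split; lra.
  by move: xb y2; rewrite !ltr_norml => /andP[? ?] /andP[? ?]; apply/andP; split; lra.
apply: countable_bigcupT_measurable => // q; by case: ifP.
Qed.

Lemma closed_measurable_plane (U : set (plane R)) : closed (U : set (R * R)) -> measurable U.
Proof.
by move=> cU; rewrite -(setCK U); apply: measurableC; apply: open_measurable_plane; exact: closed_openC.
Qed.

Lemma continuous_measurable_plane (f : R * R -> R) : continuous f ->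
  measurable_fun setT (f : plane R -> R).
Proof.
move=> cf; apply: (measurability _ (RGenOInfty.measurableE R)) => _ [_ [a ->] <-].
rewrite setTI; apply: open_measurable_plane.
by apply: open_comp => [x _|]; [exact: cf|rewrite set_itvE; exact: open_gt].
Qed.

Lemma le_eucl_dist (x y : R * R) :
  x.1 - y.1 <= eucl_dist x y /\ x.2 - y.2 <= eucl_dist x y.
Proof.
by split; apply: le_trans (ler_norm _) _; rewrite -sqrtr_sqr ler_wsqrtr//=
  expr2 ?lerDl ?lerDr sqr_ge0.
Qed.

Lemma eucl_distC (x y : R * R) : eucl_dist x y = eucl_dist y x.
Proof. by rewrite /eucl_dist /dot/=; congr Num.sqrt; ring. Qed.

Lemma norm_le_eucl_dist (x y : R * R) :
  `|x.1 - y.1| <= eucl_dist x y /\ `|x.2 - y.2| <= eucl_dist x y.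
Proof.
have [a1 a2] := le_eucl_dist x y; have [b1 b2] := le_eucl_dist y x.
by rewrite eucl_distC in b1 b2; split; rewrite ler_norml; apply/andP; split; lra.
Qed.

Definition hseg (a b c : R) : set (R * R) := (fun s => (s, c)) @` [set` `[a, b]].
Definition vseg (a b c : R) : set (R * R) := (fun s => (c, s)) @` [set` `[a, b]].

Let mh c : measurable_fun setT ((fun s => (s, c)) : measurableTypeR R -> plane R).
Proof. by apply: measurable_fun_pair => //; exact: measurable_cst. Qed.
Let mv c : measurable_fun setT ((fun s => (c, s)) : measurableTypeR R -> plane R).
Proof. by apply: measurable_fun_pair => //; exact: measurable_cst. Qed.
Let m1 : measurable_fun setT (fst : plane R -> measurableTypeR R).
Proof. exact: measurable_fst. Qed.
Let m2 : measurable_fun setT (snd : plane R -> measurableTypeR R).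
Proof. exact: measurable_snd. Qed.
Let dh (c s t : R) : eucl_dist (s, c) (t, c) = `|s - t|.
Proof. by rewrite /eucl_dist /dot/= subrr mul0r addr0 -expr2 sqrtr_sqr. Qed.
Let dv (c s t : R) : eucl_dist (c, s) (c, t) = `|s - t|.
Proof. by rewrite /eucl_dist /dot/= subrr mul0r add0r -expr2 sqrtr_sqr. Qed.
Let mrh c : measurable (range (fun s : R => (s, c)) : set (plane R)).
Proof.
rewrite (_ : range _ = setT `*` [set c]); first exact: measurableX.
by apply/seteqP; split => [_ [s _ <-]//|[s t] [_ /= ->]]; exists s.
Qed.
Let mrv c : measurable (range (fun s : R => (c, s)) : set (plane R)).
Proof.
rewrite (_ : range _ = [set c] `*` setT); first exact: measurableX.
by apply/seteqP; split => [_ [s _ <-]//|[s t] [/= -> _]]; exists t.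
Qed.

Lemma measurable_hseg a b c : measurable (hseg a b c : set (plane R)).
Proof.
exact: (@measurable_image_line R (fun s => (s, c)) fst m1 (fun=> erefl) _ (mrh c)). Qed.

Lemma measurable_vseg a b c : measurable (vseg a b c : set (plane R)).
Proof. exact: (@measurable_image_line R (fun s => (c, s)) snd m2 (fun=> erefl) _ (mrv c)). Qed.

Lemma hausdorff1_hseg a b c : hausdorff1 (hseg a b c) = lebesgue_measure [set` `[a, b]].
Proof.
exact: (@hausdorff1_image R (fun s => (s, c)) fst m1 (fun=> erefl) (dh c) (fun x y => (le_eucl_dist x y).1) (mrh c)).
Qed.

Lemma hausdorff1_vseg a b c : hausdorff1 (vseg a b c) = lebesgue_measure [set` `[a, b]].
Proof.
exact: (@hausdorff1_image R (fun s => (c, s)) snd m2 (fun=> erefl) (dv c) (fun x y => (le_eucl_dist x y).2) (mrv c)).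
Qed.

Lemma integral_hseg a b c (f : R * R -> \bar R) :
  measurable_fun setT (f : plane R -> \bar R) -> (forall x, (0 <= f x)%E) ->
  (\int[hausdorff1]_(x in hseg a b c) f x = \int[lebesgue_measure]_(s in `[a, b]) f (s, c))%E.
Proof.
move=> mf f0; exact: (@integral_hausdorff1_image R (fun s => (s, c)) fst (mh c) m1
  (fun=> erefl) (dh c) (fun x y => (le_eucl_dist x y).1) (mrh c)).
Qed.

Lemma integral_vseg a b c (f : R * R -> \bar R) :
  measurable_fun setT (f : plane R -> \bar R) -> (forall x, (0 <= f x)%E) ->
  (\int[hausdorff1]_(x in vseg a b c) f x = \int[lebesgue_measure]_(s in `[a, b]) f (c, s))%E.
Proof.
move=> mf f0; exact: (@integral_hausdorff1_image R (fun s => (c, s)) snd (mv c) m2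
  (fun=> erefl) (dv c) (fun x y => (le_eucl_dist x y).2) (mrv c)).
Qed.

Definition chart (D : set (R * R)) (p : R * R) := exists (c s r k : R) (gamma : R -> R),
    [/\ c ^+ 2 + s ^+ 2 = 1, 0 < r, k.-lipschitz gamma &
        forall x, eucl_dist x p < r ->
          (D x <-> gamma (dot (c, s) (x - p)) < dot (- s, c) (x - p))].

Definition locally_eq (D : set (R * R)) (p : R * R) (P : R -> R -> Prop) :=
  exists2 r : R, 0 < r & forall x, `|x.1 - p.1| < r -> `|x.2 - p.2| < r ->
    (D x <-> P (x.1 - p.1) (x.2 - p.2)).

Let lipschitz_norm (k : R) : `|k| <= 1 -> 1.-lipschitz (fun t : R => k * `|t|).
Proof.
move=> k1 [x y] _ /=; rewrite -mulrBr normrM mul1r.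
by apply: le_trans (ler_dist_dist x y); rewrite ler_piMl.
Qed.

Lemma chart_halfplane D p c s : c ^+ 2 + s ^+ 2 = 1 ->
  locally_eq D p (fun a b => 0 < - s * a + c * b) -> chart D p.
Proof.
(* The zero function is written k |t| with k = 0, so that [lipschitz_norm] serves for the flat sides
   as for the corners. *)
move=> cs [r r0 H]; exists c, s, r, 1, (fun t => 0 * `|t|); split => //.
  by apply: lipschitz_norm; rewrite normr0.
move=> x xp; have [x1 x2] := norm_le_eucl_dist x p.
by rewrite mul0r; apply: H; apply: le_lt_trans xp.
Qed.

Let sqrt2 : (Num.sqrt 2)^-1 ^+ 2 = 2^-1 :> R.
Proof. by rewrite exprVn sqr_sqrtr. Qed.

(* After a rotation by an odd multiple of 45 degrees, a quadrant is the
   epigraph of |t| and the complement of a closed quadrant that of - |t|. *)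
Lemma chart_corner D p (s1 s2 k : R) : s1 ^+ 2 = 1 -> s2 ^+ 2 = 1 -> k ^+ 2 = 1 ->
  locally_eq D p (fun a b => k * `|s2 * a - s1 * b| < s1 * a + s2 * b) -> chart D p.
Proof.
move=> s11 s21 k1 [r r0 H]; pose q : R := (Num.sqrt 2)^-1.
have q0 : 0 < q by rewrite invr_gt0 sqrtr_gt0.
exists (q * s2), (- (q * s1)), r, 1, (fun t => k * `|t|); split => //.
- by rewrite sqrrN !exprMn s11 s21 sqrt2; field.
- by apply: lipschitz_norm; rewrite -(@expr_le1 _ 2)// real_normK ?num_real// k1.
move=> x xp; have [x1 x2] := norm_le_eucl_dist x p.
have -> : dot (q * s2, - (q * s1)) (x - p) = q * (s2 * (x.1 - p.1) - s1 * (x.2 - p.2)).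
  by rewrite /dot/=; ring.
have -> : dot (- - (q * s1), q * s2) (x - p) = q * (s1 * (x.1 - p.1) + s2 * (x.2 - p.2)).
  by rewrite /dot/=; ring.
rewrite normrM (gtr0_norm q0) mulrCA ltr_pM2l//.
by apply: H; apply: le_lt_trans xp.
Qed.

Let sqr_eq1 (s : R) : s ^+ 2 = 1 -> s = 1 \/ s = -1.
Proof. by move/eqP; rewrite sqrf_eq1 => /orP[/eqP|/eqP]; [left|right]. Qed.

(** For signs s1 and s2, |s2 a - s1 b| = |s1 a - s2 b|, and |x - y| < x + y means that x and y are
    both positive. *)
Lemma chart_convex D p (s1 s2 : R) : s1 ^+ 2 = 1 -> s2 ^+ 2 = 1 ->
  locally_eq D p (fun a b => 0 < s1 * a /\ 0 < s2 * b) -> chart D p.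
Proof.
move=> h1 h2 [r r0 H]; apply: (chart_corner (k := 1) h1 h2) => //; first by rewrite expr1n.
exists r => // x x1 x2; rewrite H// mul1r ltr_norml.
have e1 := sqr_eq1 h1.
have e2 := sqr_eq1 h2.
case: e1 => ->; case: e2 => ->; split => [[? ?]|/andP[? ?]].
all: by [apply/andP; split; lra|split; lra].
Qed.

(** Dually, - |x - y| < x + y means that x or y is positive. *)
Lemma chart_reflex D p (s1 s2 : R) : s1 ^+ 2 = 1 -> s2 ^+ 2 = 1 ->
  locally_eq D p (fun a b => 0 < s1 * a \/ 0 < s2 * b) -> chart D p.
Proof.
move=> h1 h2 [r r0 H]; apply: (chart_corner (k := -1) h1 h2) => //; first by rewrite sqrrN expr1n.
exists r => // x x1 x2; rewrite H// mulN1r ltrNl lter_normr.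
have e1 := sqr_eq1 h1.
have e2 := sqr_eq1 h2.
case: e1 => ->; case: e2 => ->; split => [[?|?]|/orP[?|?]].
all: try (by apply/orP; left; lra).
all: try (by apply/orP; right; lra).
all: try (by left; lra).
all: by right; lra.
Qed.

(** Strict comparisons with finitely many breakpoints persist near p; this makes the shape of the
    dumbbell near a boundary point a matter of linear arithmetic. *)
Lemma order_stable (p : R) (s : seq R) : exists2 r : R, 0 < r & forall x, `|x - p| < r ->
  forall a, a \in s -> (p < a -> x < a) /\ (a < p -> a < x).
Proof.
elim: s => [|b s [r r0 IHs]]; first by exists 1.
have [->|bp] := eqVneq b p.
  exists r => // x /IHs H a; rewrite in_cons => /predU1P[->|/H//].
  by split; rewrite ltxx.
exists (Num.min r `|b - p|); first by rewrite lt_min r0 normr_gt0 subr_eq0.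
move=> x; rewrite lt_min => /andP[/IHs H xb] a; rewrite in_cons => /predU1P[->|/H//].
split=> [pb|bp'].
  by move: xb; rewrite (ger0_norm (_ : 0 <= b - p)) ?subr_ge0 ?ltW// ltr_norml => /andP[_]; lra.
by move: xb; rewrite (ler0_norm (_ : b - p <= 0)) ?subr_le0 ?ltW// ltr_norml => /andP[]; lra.
Qed.

End plane_topology.

Lemma lt_of_neq_le {R : realType} (a b : R) : a <> b -> a <= b -> a < b.
Proof. by move=> /eqP ab; rewrite lt_neqAle ab. Qed.

(** * The dumbbell, its boundary and its charts *)

Section dumbbell.
Context {R : realType}.

Definition rect (a b c d : R) : set (R * R) := [set` `]a, b[] `*` [set` `]c, d[].

(** The corridor is prolonged through both chambers along the common bottom line. The union of the
    three open rectangles then contains the doorways, and part of the long strip will serve to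
    compare mean values. *)
Definition dumbbell (l L w h : R) : set (R * R) :=
  rect (-1) 0 0 1 `|` rect (-1) (l + L) 0 w `|` rect l (l + L) 0 h.

Definition admissible (l L w h : R) := [/\ 0 < l, 0 < L, 0 < w, w < h & h < 1].

Lemma rectE a b c d (x : R * R) :
  rect a b c d x <-> [/\ a < x.1, x.1 < b, c < x.2 & x.2 < d].
Proof.
rewrite /rect/= !in_itv/=.
by split=> [[/andP[? ?] /andP[? ?]]|[-> -> -> ->]].
Qed.

Lemma open_rect a b c d : open (rect a b c d).
Proof.
rewrite (_ : rect a b c d = fst @^-1` [set` `]a, b[] `&` snd @^-1` [set` `]c, d[])//.
apply: openI; apply: open_comp; try exact: interval_open.
  by move=> x _; exact: cvg_fst.
by move=> x _; exact: cvg_snd.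
Qed.

Lemma measurable_rect a b c d : measurable (rect a b c d : set (plane R)).
Proof. by apply: measurableX. Qed.

Variables l L w h : R.
Notation Om := (dumbbell l L w h).
Hypothesis adm : admissible l L w h.

Lemma dumbbellE (x : R * R) : Om x <-> [/\ -1 < x.1, x.1 < l + L, 0 < x.2 &
  [\/ x.2 < w, x.1 < 0 /\ x.2 < 1 | l < x.1 /\ x.2 < h]].
Proof.
case: adm => l0 L0 w0 wh h1.
rewrite /dumbbell/= !rectE; split=> [[[[? ? ? ?]|[? ? ? ?]]|[? ? ? ?]]|[? ? ? [?|[? ?]|[? ?]]]].
- by split; [lra..|apply: Or32].
- by split; [lra..|apply: Or31].
- by split; [lra..|apply: Or33].
- by left; right; split.
- by left; left; split; lra.
- by right; split; lra.
Qed.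

Lemma open_dumbbell : open Om.
Proof. by apply: openU; [apply: openU|]; exact: open_rect. Qed.

Lemma measurable_dumbbell : measurable (Om : set (plane R)).
Proof. exact: open_measurable_plane open_dumbbell. Qed.

(** The inequalities of [dumbbellE] made large: a closed set containing the dumbbell, hence its
    closure. The resulting inclusion of the boundary in [sides] suffices for the charts and for
    upper bounds on the perimeter. *)
Let cl (x : R * R) := [/\ -1 <= x.1, x.1 <= l + L, 0 <= x.2 &
  [\/ x.2 <= w, x.1 <= 0 /\ x.2 <= 1 | l <= x.1 /\ x.2 <= h]].

Let sides (x : R * R) := [\/ [/\ x.2 = 0, -1 <= x.1 & x.1 <= l + L],
   [/\ x.1 = -1, 0 < x.2 & x.2 <= 1], [/\ x.1 = l + L, 0 < x.2 & x.2 <= h] |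
   [\/ [/\ x.2 = w, 0 <= x.1 & x.1 <= l], [/\ x.1 = 0, w < x.2 & x.2 <= 1],
       [/\ x.2 = 1, -1 < x.1 & x.1 < 0] |
     [/\ x.1 = l, w < x.2 & x.2 <= h] \/ [/\ x.2 = h, l < x.1 & x.1 < l + L]]].

Let clP x : cl x -> ~ Om x -> sides x.
Proof.
case: adm => l0 L0 w0 wh h1.
case: x => x y [x1 x2 y0 H] /dumbbellE nO; rewrite /sides; move: x1 x2 y0 H nO => /= x1 x2 y0 H nO.
have [yz|yz] := eqVneq y 0; first by apply: Or41; split.
have {}y0 : 0 < y by rewrite lt_neqAle eq_sym yz.
have [xz|xz] := eqVneq x (-1); first by apply: Or42; split => //; case: H => [|[]|[]]; lra.
have {}x1 : -1 < x by rewrite lt_neqAle eq_sym xz.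
have [xL|xL] := eqVneq x (l + L); first by apply: Or43; split => //; case: H => [|[]|[]]; lra.
have {}x2 : x < l + L by rewrite lt_neqAle xL.
have ny : ~ y < w by move=> yw; apply: nO; split => //; apply: Or31.
have nl : ~ (x < 0 /\ y < 1) by move=> yw; apply: nO; split => //; apply: Or32.
have nr : ~ (l < x /\ y < h) by move=> yw; apply: nO; split => //; apply: Or33.
apply: Or44.
have [yw|yw|yw] := ltgtP y w; [by []| |]; last first.
  apply: Or41; split => //=.
    by rewrite leNgt; apply/negP => ?; apply: nl; split => //; lra.
  by rewrite leNgt; apply/negP => ?; apply: nr; split => //; lra.
case: H => [|[xl yl]|[xl yl]]; first by lra.
  have [x0|x0] := eqVneq x 0; first by apply: Or42; split.
  have {}x0 : x < 0 by rewrite lt_neqAle x0.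
  apply: Or43; split => //; apply/eqP; rewrite eq_le yl/= leNgt; apply/negP => ?.
  exact: nl.
have [x0|x0] := eqVneq x l; first by apply: Or44; left; split.
have {}x0 : l < x by rewrite lt_neqAle eq_sym x0.
apply: Or44; right; split => //; apply/eqP; rewrite eq_le yl/= leNgt; apply/negP => ?.
exact: nr.
Qed.

Let closed_cl : closed [set x | cl x].
Proof.
have le_c (f : R * R -> R) a : continuous f -> closed [set x | f x <= a].
  move=> cf; rewrite (_ : [set x | _] = f @^-1` [set y | y <= a])//.
  by apply: closed_comp; [move=> x _; exact: cf|exact: closed_le].
have ge_c (f : R * R -> R) a : continuous f -> closed [set x | a <= f x].
  move=> cf; rewrite (_ : [set x | _] = f @^-1` [set y | a <= y])//.
  by apply: closed_comp; [move=> x _; exact: cf|exact: closed_ge].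
have c1 : continuous (fst : R * R -> R) by move=> x; exact: cvg_fst.
have c2 : continuous (snd : R * R -> R) by move=> x; exact: cvg_snd.
rewrite (_ : [set x | cl x] = [set x | -1 <= x.1] `&` [set x | x.1 <= l + L] `&` [set x | 0 <= x.2] `&`
  ([set x | x.2 <= w] `|` ([set x | x.1 <= 0] `&` [set x | x.2 <= 1]) `|`
   ([set x | l <= x.1] `&` [set x | x.2 <= h]))).
  by repeat first [apply: closedI|apply: closedU|exact: (le_c _ _ c1)|exact: (le_c _ _ c2)|
    exact: (ge_c _ _ c1)|exact: (ge_c _ _ c2)].
apply/seteqP; split=> x; rewrite /cl/=.
  by move=> [? ? ? [?|?|?]]; split => //; [left; left|left; right|right].
by move=> [[[? ?] ?] [[?|?]|?]]; split => //; [apply: Or31|apply: Or32|apply: Or33].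
Qed.

Let boundary_cl x : boundary Om x -> cl x /\ ~ Om x.
Proof.
case: adm => l0 L0 w0 wh h1.
move=> [cx nx]; split; last first.
  by move=> Ox; apply: nx; rewrite /interior; apply: open_nbhs_nbhs; split => //; exact: open_dumbbell.
have sub : Om `<=` [set x | cl x].
  move=> y /dumbbellE[? ? ? H]; split; [lra..|].
  by case: H => [?|[? ?]|[? ?]]; [apply: Or31|apply: Or32|apply: Or33]; lra.
have := closureS sub cx.
by move: closed_cl; rewrite closure_id => <-.
Qed.

Definition dumbbell_sides : set (R * R) :=
  hseg (-1) (l + L) 0 `|` (vseg 0 1 (-1) `|` (vseg 0 h (l + L) `|` (hseg 0 l w `|`
  (vseg w 1 0 `|` (hseg (-1) 0 1 `|` (vseg w h l `|` hseg l (l + L) h)))))).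

Lemma boundary_dumbbell_sub : boundary Om `<=` dumbbell_sides.
Proof.
have H (a b c s t : R) : s = c -> a <= t -> t <= b -> hseg a b c (t, s).
  by move=> -> at_ tb; exists t => //=; rewrite in_itv/= at_.
have V (a b c s t : R) : s = c -> a <= t -> t <= b -> vseg a b c (s, t).
  by move=> -> at_ tb; exists t => //=; rewrite in_itv/= at_.
move=> [x y] /boundary_cl[/clP/[apply]] [] /=.
- by move=> [? ? ?]; left; apply: H.
- by move=> [? ? ?]; right; left; apply: V => //; lra.
- by move=> [? ? ?]; do 2 right; left; apply: V => //; lra.
- case=> [[? ? ?]|[? ? ?]|[? ? ?]|[[? ? ?]|[? ? ?]]].
  + by do 3 right; left; apply: H.
  + by do 4 right; left; apply: V => //; lra.
  + by do 5 right; left; apply: H => //; lra.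
  + by do 6 right; left; apply: V => //; lra.
  + by do 7 right; apply: H => //; lra.
Qed.

Lemma measurable_boundary (A : set (plane R)) : measurable (boundary A : set (plane R)).
Proof.
apply: measurableD; first by apply: closed_measurable_plane; exact: closed_closure.
by apply: open_measurable_plane; exact: open_interior.
Qed.

(** The bottom side is common to the three rooms: it gives the lower bound on the perimeter, carries
    the Friedrichs inequality, and is where the ramp is measured for the Steklov problem. *)
Lemma bottom_sub_boundary : hseg (-1) (l + L) 0 `<=` boundary Om.
Proof.
case: adm => l0 L0 w0 wh h1.
move=> _ [x /= xI <-]; move: xI; rewrite in_itv/= => /andP[x1 x2]; split; last first.
  move=> /interior_subset/dumbbellE[_ _ /=]; lra.
move=> B /nbhs_planeP[r r0 rB].
pose m := Num.min (Num.min r w) (l + L) / 2.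
have m0 : 0 < m by rewrite divr_gt0// !lt_min r0 w0 addr_gt0.
have mm : [/\ m < r, m < w & m < l + L].
  have : m < Num.min (Num.min r w) (l + L) by rewrite ltr_pdivrMr// ltr_pMr ?ltr1n// !lt_min r0 w0 addr_gt0.
  by rewrite !lt_min => /andP[/andP[]].
case: mm => mr mw mL.
(* A nearby point of the strip: up by m < w, and sideways by m, to the right when x < 0 and to the
   left otherwise, so as to leave both ends. *)
exists (if x < 0 then x + m else x - m, m); split.
  by apply/dumbbellE; split => /=; [case: (ltP x 0) => ?; lra..| |apply: Or31].
apply: rB => /=; last by rewrite subr0 gtr0_norm.
by case: (ltP x 0) => _; rewrite addrAC subrr add0r ?normrN gtr0_norm.
Qed.

Let tri (p x a : R) := (p < a -> x < a) /\ (a < p -> a < x).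

(** Coordinates near the point keep their order with respect to all the breakpoints -1, 0, l, l + L
    and 0, w, h, 1; what remains of the local description is an equivalence between linear
    inequalities. *)
Let local (p1 p2 : R) (P : R -> R -> Prop) :
  (forall x y : R, tri p1 x (-1) -> tri p1 x 0 -> tri p1 x l -> tri p1 x (l + L) ->
     tri p2 y 0 -> tri p2 y w -> tri p2 y h -> tri p2 y 1 ->
     ([/\ -1 < x, x < l + L, 0 < y & [\/ y < w, x < 0 /\ y < 1 | l < x /\ y < h]] <->
      P (x - p1) (y - p2))) -> locally_eq Om (p1, p2) P.
Proof.
move=> H; have [r r0 Hr] := order_stable p1 [:: -1; 0; l; l + L].
have [s s0 Hs] := order_stable p2 [:: 0; w; h; 1].
exists (Num.min r s); first by rewrite lt_min r0.
move=> [x y]; rewrite !lt_min => /= /andP[xr _] /andP[_ ys]; rewrite dumbbellE/=.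
by apply: H; (apply: (Hr _ xr) || apply: (Hs _ ys)); rewrite !inE eqxx ?orbT.
Qed.

(* Near a boundary point each coordinate stays on its side of every breakpoint
   that the point avoids: [up] keeps the breakpoint above it, [dn] the one below. *)
Ltac up H := have {H}[H _] := H; have {H}H := H ltac:(lra).
Ltac dn H := have {H}[_ H] := H; have {H}H := H ltac:(lra).

Ltac loc := (split;
  [move=> [? ? ? [?|[? ?]|[? ?]]]; try (exfalso; lra) |];
  try (move=> [?|?]); try (move=> [? ?]); try (move=> ?); try (exfalso; lra);
  first [by lra|by split; lra|by left; lra|by right; lra|by split; [lra..|apply: Or31; lra]
    |by split; [lra..|apply: Or32; lra]|by split; [lra..|apply: Or33; lra]]).

(** Flat side, convex corner, reflex corner. The two numbers are the direction (c, s) of the side in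
    the first case and the signs of the quadrant in the others. *)
Ltac hp lc s1 s2 := apply: (@chart_halfplane _ _ _ s1 s2); [by ring|apply: lc; clear lc].
Ltac cc lc s1 s2 := apply: (@chart_convex _ _ _ s1 s2); [by ring|by ring|apply: lc; clear lc].
Ltac cr lc s1 s2 := apply: (@chart_reflex _ _ _ s1 s2); [by ring|by ring|apply: lc; clear lc].

Let chart1 p1 p2 : p2 = 0 -> -1 <= p1 -> p1 <= l + L -> chart Om (p1, p2).
Proof.
case: (adm) => l0 L0 w0 wh h1; have lc := @local p1 p2; move: lc; rewrite /tri => lc.
clear -l0 L0 w0 wh h1 lc => E P1 P2.
have [F|/eqP F1] := eqVneq p1 (-1).
    by cc lc (1 : R) (1 : R) => x y _ _ _ A4 _ B2 _ _; up A4; up B2; loc.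
  have [F|/eqP F2] := eqVneq p1 (l + L).
    by cc lc (-1 : R) (1 : R) => x y A1 _ _ _ _ B2 _ _; dn A1; up B2; loc.
  have {F2}F2 := lt_of_neq_le F2 P2.
  have {F1}F1 := lt_of_neq_le (not_eq_sym F1) P1.
  by hp lc (1 : R) (0 : R) => x y A1 _ _ A4 _ B2 _ _; dn A1; up A4; up B2; loc.
Qed.

Let chart2 p1 p2 : p1 = -1 -> 0 < p2 -> p2 <= 1 -> chart Om (p1, p2).
Proof.
case: (adm) => l0 L0 w0 wh h1; have lc := @local p1 p2; move: lc; rewrite /tri => lc.
clear -l0 L0 w0 wh h1 lc => E P1 P2.
have [F|/eqP F] := eqVneq p2 1.
    by cc lc (1 : R) (-1 : R) => x y _ A2 _ A4 B1 _ _ _; up A2; up A4; dn B1; loc.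
  have {F}F := lt_of_neq_le F P2.
  by hp lc (0 : R) (-1 : R) => x y _ A2 _ A4 B1 _ _ B4; up A2; up A4; dn B1; up B4; loc.
Qed.

Let chart3 p1 p2 : p1 = l + L -> 0 < p2 -> p2 <= h -> chart Om (p1, p2).
Proof.
case: (adm) => l0 L0 w0 wh h1; have lc := @local p1 p2; move: lc; rewrite /tri => lc.
clear -l0 L0 w0 wh h1 lc => E P1 P2.
have [F|/eqP F] := eqVneq p2 h.
    by cc lc (-1 : R) (-1 : R) => x y A1 _ A3 _ B1 _ _ _; dn A1; dn A3; dn B1; loc.
  have {F}F := lt_of_neq_le F P2.
  by hp lc (0 : R) (1 : R) => x y A1 _ A3 _ B1 _ B3 _; dn A1; dn A3; dn B1; up B3; loc.
Qed.

(** The ceiling of the corridor; its two ends are the only reflex corners of the dumbbell. *)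
Let chart4 p1 p2 : p2 = w -> 0 <= p1 -> p1 <= l -> chart Om (p1, p2).
Proof.
case: (adm) => l0 L0 w0 wh h1; have lc := @local p1 p2; move: lc; rewrite /tri => lc.
clear -l0 L0 w0 wh h1 lc => E P1 P2.
have [F|/eqP F1] := eqVneq p1 0.
    by cr lc (-1 : R) (-1 : R) => x y A1 _ A3 _ B1 _ _ B4; dn A1; up A3; dn B1; up B4; loc.
  have [F|/eqP F2] := eqVneq p1 l.
    by cr lc (1 : R) (-1 : R) => x y _ A2 _ A4 B1 _ B3 _; dn A2; up A4; dn B1; up B3; loc.
  have {F2}F2 := lt_of_neq_le F2 P2.
  have {F1}F1 := lt_of_neq_le (not_eq_sym F1) P1.
  by hp lc (-1 : R) (0 : R) => x y _ A2 A3 _ B1 _ _ _; dn A2; up A3; dn B1; loc.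
Qed.

Let chart5 p1 p2 : p1 = 0 -> w < p2 -> p2 <= 1 -> chart Om (p1, p2).
Proof.
case: (adm) => l0 L0 w0 wh h1; have lc := @local p1 p2; move: lc; rewrite /tri => lc.
clear -l0 L0 w0 wh h1 lc => E P1 P2.
have [F|/eqP F] := eqVneq p2 1.
    by cc lc (-1 : R) (-1 : R) => x y A1 _ A3 _ _ B2 _ _; dn A1; up A3; dn B2; loc.
  have {F}F := lt_of_neq_le F P2.
  by hp lc (0 : R) (1 : R) => x y A1 _ A3 _ _ B2 _ B4; dn A1; up A3; dn B2; up B4; loc.
Qed.

Let chart6 p1 p2 : p2 = 1 -> -1 < p1 -> p1 < 0 -> chart Om (p1, p2).
Proof.
case: (adm) => l0 L0 w0 wh h1; have lc := @local p1 p2; move: lc; rewrite /tri => lc.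
clear -l0 L0 w0 wh h1 lc => E P1 P2.
by hp lc (-1 : R) (0 : R) => x y A1 A2 _ _ _ B2 _ _; dn A1; up A2; dn B2; loc.
Qed.

Let chart7 p1 p2 : p1 = l -> w < p2 -> p2 <= h -> chart Om (p1, p2).
Proof.
case: (adm) => l0 L0 w0 wh h1; have lc := @local p1 p2; move: lc; rewrite /tri => lc.
clear -l0 L0 w0 wh h1 lc => E P1 P2.
have [F|/eqP F] := eqVneq p2 h.
    by cc lc (1 : R) (-1 : R) => x y _ A2 _ A4 _ B2 _ _; dn A2; up A4; dn B2; loc.
  have {F}F := lt_of_neq_le F P2.
  by hp lc (0 : R) (-1 : R) => x y _ A2 _ A4 _ B2 B3 _; dn A2; up A4; dn B2; up B3; loc.
Qed.

Let chart8 p1 p2 : p2 = h -> l < p1 -> p1 < l + L -> chart Om (p1, p2).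
Proof.
case: (adm) => l0 L0 w0 wh h1; have lc := @local p1 p2; move: lc; rewrite /tri => lc.
clear -l0 L0 w0 wh h1 lc => E P1 P2.
by hp lc (-1 : R) (0 : R) => x y _ _ A3 A4 _ B2 _ _; dn A3; up A4; dn B2; loc.
Qed.

Lemma lipschitz_boundary_dumbbell : lipschitz_boundary Om.
Proof.
move=> [p1 p2] /boundary_cl[cp nO].
case: (clP cp nO) => /= [[]|[]|[]|[[]|[]|[]|[[]|[]]]].
- exact: chart1.
- exact: chart2.
- exact: chart3.
- exact: chart4.
- exact: chart5.
- exact: chart6.
- exact: chart7.
- exact: chart8.
Qed.

Lemma bounded_lipschitz_open_dumbbell : bounded_lipschitz_open Om.
Proof.
case: adm => l0 L0 w0 wh h1.
split; [|exact: open_dumbbell| |exact: lipschitz_boundary_dumbbell].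
  by exists (-1/2, w/2); apply/dumbbellE; split => /=; [lra..|apply: Or31; lra].
exists (l + L + 1); split; first by rewrite num_real.
have bnd (M x y : R) : l + L + 1 < M -> Om (x, y) -> `|x| <= M /\ `|y| <= M.
  move=> HM /dumbbellE[/= ? ? ? H]; rewrite !ler_norml.
  by split; apply/andP; split; case: H => [|[]|[]]; lra.
move=> M HM [x y] /(bnd _ _ _ HM)[? ?] /=.
by rewrite prod_normE ge_max; apply/andP.
Qed.

End dumbbell.

(** * Square integrable functions *)

(** By |x| <= 2^k x^2 + 2^(-k), the increments are absolutely summable. The hypothesis only involves
    squares, whose integrals are what an L^2 bound controls. *)
Lemma summable_cauchy_cvg {R : realType} (v : nat -> R) (M : R) :
  (forall n, \sum_(k < n) 2 ^+ k * (v k.+1 - v k) ^+ 2 <= M)%R -> cvgn v.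
Proof.
move=> vM; have : cvgn (series (fun k => v k.+1 - v k)%R).
  apply: normed_cvg; set f := (X in cvgn X).
  have fE n : f n = (\sum_(0 <= k < n) `|v k.+1 - v k|)%R by [].
  apply: nondecreasing_is_cvgn.
    by apply/nondecreasing_seqP => n; rewrite !fE big_nat_recr//= lerDl.
  exists (M + 2)%R => _ [n _ <-]; rewrite fE big_mkord.
  apply: (@le_trans _ _ (\sum_(k < n) (2 ^+ k * (v k.+1 - v k) ^+ 2 + (2 ^+ k)^-1))%R).
    apply: ler_sum => k _; set x := (X in X <= _).
    have x0 : (0 <= x)%R by exact: normr_ge0.
    have -> : ((v k.+1 - v k) ^+ 2 = x ^+ 2)%R by rewrite /x real_normK ?num_real.
    set t : R := (2 ^+ k)%R; have t0 : (0 < t)%R by rewrite exprn_gt0.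
    have : (0 <= (t * x - 1) ^+ 2 / t)%R by rewrite divr_ge0 ?sqr_ge0 ?ltW.
    have -> : ((t * x - 1) ^+ 2 / t = t * x ^+ 2 - 2 * x + t^-1)%R by field; rewrite gt_eqF.
    lra.
  rewrite big_split/=; apply: lerD; first exact: vM.
  have -> : (\sum_(k < n) (2 ^+ k)^-1 = 2 - 2 * (2 ^+ n)^-1 :> R)%R.
    elim: n => [|n IHn]; first by rewrite big_ord0 expr0 invr1; ring.
    rewrite big_ord_recr/= IHn exprS; field.
    by rewrite expf_neq0.
  by rewrite gerBl mulr_ge0// invr_ge0 exprn_ge0.
rewrite (_ : series _ = (fun n => v n - v 0%N)%R); last first.
  by apply/funext => n; rewrite /series/= telescope_sumr.
move=> /cvg_ex[l vl]; apply/cvg_ex; exists (l + v 0%N)%R.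
have : (v n - v 0%N + v 0%N)%R @[n --> \oo] --> (l + v 0%N)%R.
  by apply: cvgD; [exact: vl|exact: cvg_cst].
by under eq_fun do rewrite subrK.
Qed.

Section square_integrable.
Context {R : realType}.
Variables (mu : {measure set (plane R) -> \bar R}) (D : set (plane R)).
Hypothesis mD : measurable D.
Implicit Types (u v w : R * R -> R).
Local Open Scope ereal_scope.

Definition sqint u : \bar R := \int[mu]_(x in D) (u x ^+ 2)%:E.
Definition ip u v : R := (\int[mu]_(x in D) (u x * v x))%R.

Lemma sqint_ge0 u : 0 <= sqint u.
Proof. by apply: integral_ge0 => x _; rewrite lee_fin sqr_ge0. Qed.

Lemma measurable_sqr u : measurable_fun D (u : plane R -> R) ->
  measurable_fun D (fun x : plane R => (u x ^+ 2)%:E).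
Proof. by move=> mu_; apply/measurable_EFinP; exact: measurable_funX. Qed.

Lemma L2P u : L2 mu D u <-> measurable_fun D (u : plane R -> R) /\ sqint u < +oo.
Proof.
split=> [[mu_ iu]|[mu_ iu]]; split => //; first exact: integrable_lty.
apply/integrableP; split; first exact: measurable_sqr.
by under eq_integral do rewrite gee0_abs ?lee_fin ?sqr_ge0//.
Qed.

Lemma L2_lin k u v : L2 mu D u -> L2 mu D v -> L2 mu D (fun x => k * u x + v x)%R.
Proof.
move=> [mu_ iu] [mv iv]; have m : measurable_fun D ((fun x => k * u x + v x)%R : plane R -> R).
  by apply: measurable_funD => //; apply: measurable_funM.
split => //; apply: (@le_integrable _ _ _ mu D mD _
   (fun x => (2 * k ^+ 2)%:E * (u x ^+ 2)%:E + 2%:E * (v x ^+ 2)%:E)).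
- exact: measurable_sqr.
- move=> x Dx; rewrite -!EFinM -EFinD /= lee_fin [leLHS]ger0_norm ?sqr_ge0//.
  apply: le_trans (ler_norm _).
  by have := sqr_ge0 (k * u x - v x); lra.
- by apply: integrableD => //; apply: integrableZl.
Qed.

Lemma integrable_mul u v : L2 mu D u -> L2 mu D v ->
  mu.-integrable D (fun x => (u x * v x)%:E).
Proof.
move=> [mu_ iu] [mv iv].
apply: (@le_integrable _ _ _ mu D mD _ (fun x => (u x ^+ 2)%:E + (v x ^+ 2)%:E)).
- by apply/measurable_EFinP; exact: measurable_funM.
- move=> x Dx; rewrite -EFinD [leRHS]gee0_abs ?lee_fin ?addr_ge0 ?sqr_ge0//.
  rewrite ler_norml; apply/andP; split.
    by have := sqr_ge0 (u x + v x); have := sqr_ge0 (u x); have := sqr_ge0 (v x); lra.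
  by have := sqr_ge0 (u x - v x); have := sqr_ge0 (u x); have := sqr_ge0 (v x); lra.
- exact: integrableD.
Qed.

Lemma ipC u v : ip u v = ip v u.
Proof. by apply: eq_Rintegral => x _; rewrite mulrC. Qed.

Lemma ip_lin k u v w : L2 mu D u -> L2 mu D v -> L2 mu D w ->
  ip (fun x => k * u x + v x)%R w = (k * ip u w + ip v w)%R.
Proof.
move=> Lu Lv Lw; have iu := integrable_mul Lu Lw; have iv := integrable_mul Lv Lw.
rewrite /ip -RintegralZl// -RintegralD//.
  by apply: eq_Rintegral => x _; ring.
by have := integrableZl mD k iu; apply: eq_integrable => // x _; rewrite -EFinM.
Qed.

Lemma ip_ge0 u : (0 <= ip u u)%R.
Proof. by apply: Rintegral_ge0 => x _; rewrite -expr2 sqr_ge0. Qed.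

Lemma sqint_ip u : L2 mu D u -> sqint u = (ip u u)%:E.
Proof.
move=> Lu; rewrite /ip /Rintegral fineK; first by apply: eq_integral => x _; rewrite expr2.
exact: integrable_fin_num (integrable_mul Lu Lu).
Qed.

Lemma sqintD u v : measurable_fun D (u : plane R -> R) -> measurable_fun D (v : plane R -> R) ->
  sqint (fun x => u x + v x)%R <= 2%:E * sqint u + 2%:E * sqint v.
Proof.
move=> mu_ mv; rewrite /sqint -!ge0_integralZl//; try exact: measurable_sqr; try by move=> x _; rewrite lee_fin sqr_ge0.
rewrite -ge0_integralD//; try by move=> x _; rewrite mule_ge0 ?lee_fin ?sqr_ge0.
- apply: ge0_le_integral => //.
  + by move=> x _; rewrite lee_fin sqr_ge0.
  + by apply: measurable_sqr; exact: measurable_funD.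
  + by apply: emeasurable_funD; apply: measurable_funeM; exact: measurable_sqr.
  + by move=> x _; rewrite -!EFinM -EFinD lee_fin; have := sqr_ge0 (u x - v x); lra.
- by apply: measurable_funeM; exact: measurable_sqr.
- by apply: measurable_funeM; exact: measurable_sqr.
Qed.

Lemma sqintZ k u : measurable_fun D (u : plane R -> R) ->
  sqint (fun x => k * u x)%R = (k ^+ 2)%:E * sqint u.
Proof.
move=> mu_; rewrite /sqint -ge0_integralZl ?lee_fin ?sqr_ge0//.
- by apply: eq_integral => x _; rewrite exprMn EFinM.
- exact: measurable_sqr.
- by move=> x _; rewrite lee_fin sqr_ge0.
Qed.

Lemma sqint_eq0 u : measurable_fun D (u : plane R -> R) -> sqint u = 0 ->
  {ae mu, forall x, D x -> u x = 0%R}.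
Proof.
move=> mu_ u0; have [+ _] := @ae_eq_integral_abs _ _ _ mu D mD (fun x => (u x ^+ 2)%:E) (measurable_sqr mu_).
move=> H; have {}H : ae_eq mu D (fun x => (u x ^+ 2)%:E) (cst 0).
  by apply: H; rewrite -[RHS]u0; apply: eq_integral => x _; rewrite gee0_abs// lee_fin sqr_ge0.
apply: filterS H => x H /H [] /eqP; rewrite sqrf_eq0 => /eqP; exact.
Qed.

Lemma ae0_sqint u : measurable_fun D (u : plane R -> R) -> {ae mu, forall x, D x -> u x = 0%R} ->
  sqint u = 0.
Proof.
move=> mu_ u0; rewrite /sqint -[RHS](integral0 mu D); apply: ge0_ae_eq_integral => //.
- exact: measurable_sqr.
- by move=> x _; rewrite lee_fin sqr_ge0.
- by apply: filterS u0 => x H /H ->; rewrite expr0n.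
Qed.

(** Riesz-Fischer. Along a subsequence whose consecutive squared distances are at most 4^(-k), the
    sum of 2^k (v_(k+1) - v_k)^2 is integrable, hence finite almost everywhere, and
    [summable_cauchy_cvg] gives a pointwise limit. Fatou's lemma turns it into the limit of the
    whole sequence. *)
Lemma L2_complete (u : nat -> R * R -> R) : (forall n, L2 mu D (u n)) ->
  (forall e, (0 < e)%R -> exists n0, forall n m, (n0 <= n)%N -> (n0 <= m)%N ->
    sqint (fun x => u n x - u m x)%R <= e%:E) ->
  exists2 w, L2 mu D w & forall e, (0 < e)%R -> exists n0, forall n, (n0 <= n)%N ->
    sqint (fun x => w x - u n x)%R <= e%:E.
Proof.
move=> Lu cauchy.
have mB f g : measurable_fun D (f : plane R -> R) -> measurable_fun D (g : plane R -> R) ->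
  measurable_fun D ((fun x => f x - g x)%R : plane R -> R) by move=> *; exact: measurable_funB.
have mfu n : measurable_fun D (u n : plane R -> R) by have [] := Lu n.
have /choice[N HN] : forall k : nat, exists n0, forall n m, (n0 <= n)%N -> (n0 <= m)%N ->
    sqint (fun x => u n x - u m x)%R <= ((4 ^+ k)^-1)%:E.
  by move=> k; apply: cauchy; rewrite invr_gt0 exprn_gt0.
(* This index is at least each of N 0, ..., N k, and at least k. *)
pose s k := (\sum_(i < k.+1) N i + k)%N.
have sN k j : (k <= j)%N -> (N k <= s j)%N.
  by move=> kj; rewrite /s (bigD1 (Ordinal (kj : (k < j.+1)%N)))//= -addnA leq_addr.
pose v k := u (s k).
pose gk k (x : plane R) : \bar R := (2 ^+ k * (v k.+1 x - v k x) ^+ 2)%:E.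
have gk0 k x : 0 <= gk k x by rewrite lee_fin mulr_ge0 ?sqr_ge0 ?exprn_ge0.
have mgk k : measurable_fun D (gk k).
  apply/measurable_EFinP; apply: measurable_funM => //; apply: measurable_funX.
  by apply: mB; exact: mfu.
pose g x := \sum_(k <oo) gk k x.
have mg : measurable_fun D g by apply: ge0_emeasurable_sum => // k x _ _; exact: gk0.
have g0 x : 0 <= g x by apply: nneseries_ge0.
have gk_int k : \int[mu]_(x in D) gk k x <= ((2 ^+ k)^-1)%:E.
  rewrite (_ : \int[mu]_(x in D) gk k x = (2 ^+ k)%:E * sqint (fun x => v k.+1 x - v k x)%R); last first.
    rewrite /sqint -ge0_integralZl ?lee_fin ?exprn_ge0//; last by move=> x _; rewrite lee_fin sqr_ge0.
    by apply: measurable_sqr; apply: mB; exact: mfu.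
  have := HN k _ _ (sN k k.+1 (leqnSn k)) (sN k k (leqnn k)).
  move=> /(lee_wpmul2l (_ : 0 <= (2 ^+ k)%:E)); rewrite lee_fin exprn_ge0// => /(_ isT).
  move=> /le_trans; apply; rewrite -EFinM lee_fin.
  have -> : (4 ^+ k = 2 ^+ k * 2 ^+ k :> R)%R by rewrite -exprMn -natrM.
  by rewrite invfM mulrA divff ?mul1r// expf_neq0.
have ig : mu.-integrable D g.
  apply/integrableP; split => //; under eq_integral do rewrite gee0_abs//.
  rewrite integral_nneseries//; apply: (@le_lt_trans _ _ 2%:E); last by rewrite ltry.
  apply: lime_le; first by apply: is_cvg_nneseries => n _ _; exact: integral_ge0.
  apply: nearW => n; apply: le_trans; first by apply: lee_sum => k _; exact: gk_int.
  rewrite sumEFin lee_fin big_mkord.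
  have -> : (\sum_(k < n) (2 ^+ k)^-1 = 2 - 2 * (2 ^+ n)^-1 :> R)%R.
    elim: n => [|n IHn]; first by rewrite big_ord0 expr0 invr1; ring.
    rewrite big_ord_recr/= IHn exprS; field.
    by rewrite expf_neq0.
  by rewrite gerBl mulr_ge0// invr_ge0 exprn_ge0.
pose A := D `&` [set x | g x < +oo].
have mA : measurable A by exact: emeasurable_fun_infty_o.
have gfin x : A x -> exists M : R, forall n, (\sum_(k < n) 2 ^+ k * (v k.+1 x - v k x) ^+ 2 <= M)%R.
  move=> [_ /= gx]; exists (fine (g x)) => n; rewrite -lee_fin fineK ?ge0_fin_numE//.
  by rewrite -sumEFin -(big_mkord xpredT (fun k => gk k x)); exact: nneseries_lim_ge.
(* Set to 0 off A, the sequence converges everywhere on D, so its limit is measurable; A has full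
   measure in D. *)
pose h k (x : plane R) : R := (v k x * \1_A x)%R.
have mI := @measurable_indic _ (plane R) R D A mA.
have mh k : measurable_fun D (h k) by exact: measurable_funM (mfu _) mI.
pose w x : R := limn (fun k => h k x).
have hw x : D x -> (fun k => h k x) @ \oo --> w x.
  move=> Dx; suff : cvgn (fun k => h k x) by [].
  rewrite /h indicE; have [|_] := boolP (x \in A).
    rewrite inE => /gfin[M HM]; have vM := @summable_cauchy_cvg R (fun k => v k x) M HM.
    by rewrite (_ : (fun k => _) = (fun k => v k x))//; apply/funext => k; rewrite mulr1.
  by rewrite (_ : (fun k => _) = cst 0%R); [exact: is_cvg_cst|apply/funext => k; rewrite mulr0].
have mw : measurable_fun D (w : plane R -> R) by exact: measurable_fun_cvg mh hw.
have aeA : {ae mu, forall x, D x -> A x}.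
  apply: filterS (integrable_ae mD ig) => x H Dx; split => //=.
  by rewrite -ge0_fin_numE//; exact: H.
have hv n k : sqint (fun x => h k x - u n x)%R = sqint (fun x => v k x - u n x)%R.
  apply: ge0_ae_eq_integral => //; try (by apply: measurable_sqr; apply: mB; [exact: mh|exact: mfu]);
    try (by apply: measurable_sqr; apply: mB; exact: mfu);
    try by move=> x _; rewrite lee_fin sqr_ge0.
  apply: filterS aeA => x H /H Ax; rewrite /h indicE mem_set//= mulr1//.
have key e : (0 < e)%R -> exists n0, forall n, (n0 <= n)%N ->
    sqint (fun x => w x - u n x)%R <= e%:E.
  move=> e0; have [n0 Hn0] := cauchy _ e0; exists n0 => n nn.
  have := @fatou _ _ R mu D mD (fun k x => ((h k x - u n x) ^+ 2)%:E).
  have -> : \int[mu]_(x in D) limn_einf (fun k => ((h k x - u n x) ^+ 2)%:E) =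
      sqint (fun x => w x - u n x)%R.
    apply: eq_integral => x; rewrite inE => Dx.
    apply: (cvg_limn_einf_sup _).1; apply: cvg_EFin; first exact: nearW.
    rewrite expr2; under eq_fun do rewrite expr2.
    have c : (fun k => h k x - u n x)%R @ \oo --> (w x - u n x)%R.
      by apply: cvgB; [exact: hw|exact: cvg_cst].
    exact: cvgM.
  move=> F; apply: (le_trans (F _ _)).
  - by move=> k; apply: measurable_sqr; exact: mB.
  - by move=> k x _; rewrite lee_fin sqr_ge0.
  rewrite limn_einf_lim; apply: lime_le; first exact: is_cvg_einfs.
  near=> k; apply: (@le_trans _ _ (sqint (fun x => h k x - u n x)%R)).
    by apply: ereal_inf_lbound; exists k => /=.
  rewrite hv; apply: Hn0 => //.
  have sk : (k <= s k)%N by exact: leq_addl.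
  by rewrite (leq_trans _ sk)//; near: k; exact: nbhs_infty_ge.
exists w; last exact: key.
apply/L2P; split => //; have [n0 /(_ n0 (leqnn _)) H] := key _ ltr01.
have -> : w = (fun x => (w x - u n0 x) + u n0 x)%R by apply/funext => x; rewrite subrK.
apply: (le_lt_trans (sqintD (mB _ _ mw (mfu n0)) (mfu n0))).
rewrite lte_add_pinfty// lte_mul_pinfty//; first by rewrite (le_lt_trans H)// ltry.
by have /L2P[] := Lu n0.
Unshelve. all: by end_near. Qed.

End square_integrable.

(** * Poincare inequality on rectangles *)

Section positivity.
Context {R : realType}.
Notation mu := (@lebesgue_measure R).

Lemma derivable_sign (F : R -> R) (x : R) : derivable F x 1 -> 'D_1 F x < 0 ->
  exists2 e, 0 < e & forall q r, x - e < q < x -> x < r < x + e -> F r < F q.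
Proof.
move=> dF dneg; have : (fun h : R => h^-1 *: (F (h *: 1 + x) - F x)) @ 0^' --> 'D_1 F x by exact: dF.
move=> /cvgr_lt /(_ 0 dneg).
move=> /nbhs_ballP[e /= e0 H]; exists e => // q r /andP[q1 q2] /andP[r1 r2].
have Hh h : `|h| < e -> h != 0 -> h^-1 * (F (h + x) - F x) < 0.
  move=> he h0; have := H h; rewrite /ball/= sub0r normrN [h *: 1]mulr1; exact.
have := Hh (r - x); rewrite subrK gtr0_norm ?subr_gt0// => /(_ ltac:(lra) ltac:(lra)).
rewrite pmulr_rlt0 ?invr_gt0 ?subr_gt0// subr_lt0 => Fr.
have := Hh (q - x); rewrite subrK ltr0_norm ?subr_lt0// => /(_ ltac:(lra) ltac:(lra)).
rewrite nmulr_rlt0 ?invr_lt0 ?subr_lt0// subr_gt0 => Fq.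
exact: lt_trans Fr Fq.
Qed.

(** At almost every x the primitive has derivative f x. Were it negative, the primitive would
    decrease between some rationals on either side of x, against the hypothesis. *)
Let ae_ge0_real (f : R -> R) : mu.-integrable setT (EFin \o f) ->
  (forall q r : rat, q < r -> (0 <= \int[mu]_(t in [set` `]ratr q : R, ratr r[]) f t)) ->
  {ae mu, forall x, 0 <= f x}.
Proof.
move=> intf f0; have iS (A : set R) : measurable A -> mu.-integrable A (EFin \o f).
  by move=> mA; apply: integrableS intf.
have locf : locally_integrable [set: R] f.
  split; [|exact: openT|].
    by apply/measurable_EFinP; exact: measurable_int intf.
  move=> K _ cK; have /iS/integrableP[_] : measurable K by apply: closed_measurable; exact: compact_closed.
  exact.
have := @FTC1Ny R f (fun y => iS _ (measurable_itv _)) locf.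
apply: filterS; first exact: (ae_filter_ringOfSetsType mu).
move=> x [dF /esym ->]; rewrite derive1E leNgt; apply/negP => neg.
have [e e0 He] := derivable_sign dF neg.
have [q qI] := @rat_in_itvoo R (x - e) x ltac:(lra).
have [r rI] := @rat_in_itvoo R x (x + e) ltac:(lra).
move: qI rI; rewrite !in_itv/= => qI rI; have := He _ _ qI rI.
have qr : q < r by rewrite -(ltr_rat R); move: qI rI => /andP[_ qx] /andP[xr _]; exact: lt_trans qx xr.
rewrite ltNge -subr_ge0 => /negP; apply.
rewrite (@Rintegral_itvB R f -oo%O (BRight (ratr r)))//; last first.
  by rewrite leBSide/= ltW// ltr_rat.
  exact: iS.
by rewrite -Rintegral_itv_bndo_bndc ?f0//; exact: iS.
Qed.

Lemma ae_ge0_itv (F : R -> \bar R) : mu.-integrable setT F ->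
  (forall q r : rat, q < r -> (0 <= \int[mu]_(t in [set` `]ratr q : R, ratr r[]) F t)%E) ->
  {ae mu, forall x, (0 <= F x)%E}.
Proof.
move=> iF F0; have mF := measurable_int mu iF.
have iG : mu.-integrable setT (EFin \o (fine \o F)).
  apply: le_integrable iF => //.
    by apply/measurable_EFinP; apply: measurableT_comp => //.
  by move=> x _ /=; case: (F x) => //= *; rewrite ?leey// normr0 leey.
have aeG := integrable_ae measurableT iF.
have : {ae mu, forall x, 0 <= fine (F x)}.
  apply: (ae_ge0_real iG) => q r qr; rewrite /Rintegral; apply: fine_ge0.
  have := F0 q r qr; congr (_ <= _)%E; apply: ae_eq_integral => //.
  - exact: measurable_funTS.
  - by apply: measurable_funTS; exact: measurable_int iG.
  - by apply: filterS aeG => x /(_ I) Fx _ /=; rewrite fineK.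
by apply: filterS2 aeG => x /(_ I); case: (F x) => //= r _ H; rewrite lee_fin.
Qed.

Local Open Scope ereal_scope.

(** The one-dimensional statement is used twice: in x, for the integrals of f over each of the
    countably many rational intervals of y; then, for almost every x, in y. *)
Lemma ae_ge0_rect (f : R * R -> R) : leb2.-integrable setT (EFin \o f) ->
  (forall a b c d : R, (a < b)%R -> (c < d)%R -> 0 <= \int[leb2]_(x in rect a b c d) (f x)%:E) ->
  {ae leb2, forall x : plane R, (0 <= f x)%R}.
Proof.
move=> intf f0; have mf := measurable_int _ intf.
have step (c d : rat) : (c < d)%R ->
    {ae mu, forall x, 0 <= \int[mu]_(y in [set` `]ratr c : R, ratr d[]) (f (x, y))%:E}.
  move=> cd; pose g := (EFin \o f) \_ (setT `*` [set` `]ratr c : R, ratr d[] : set (plane R)).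
  have ig : leb2.-integrable setT g.
    apply/(integrable_mkcond _ _).1; first exact: measurableX.
    by apply: integrableS intf => //; exact: measurableX.
  have gE x : fubini_F mu g x = \int[mu]_(y in [set` `]ratr c : R, ratr d[]) (f (x, y))%:E.
    rewrite /fubini_F [RHS]integral_mkcond; apply: eq_integral => y _.
    by rewrite /g !patchE in_setX in_setT.
  have : {ae mu, forall x, 0 <= fubini_F mu g x}.
    apply: ae_ge0_itv; first exact: integrable_fubini_F.
    move=> q r qr; have := f0 (ratr q) (ratr r) (ratr c) (ratr d); rewrite !ltr_rat => /(_ qr cd).
    congr (_ <= _); pose k := (EFin \o f) \_ (rect (ratr q) (ratr r) (ratr c) (ratr d) : set (plane R)).
    have ik : leb2.-integrable setT k.
      apply/(integrable_mkcond _ _).1; first exact: measurable_rect.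
      by apply: integrableS intf => //; exact: measurable_rect.
    rewrite integral_mkcond -(integral12_prod_meas1 ik) [RHS]integral_mkcond.
    apply: eq_integral => x _; rewrite /fubini_F patchE; case: ifPn => xq.
      by apply: eq_integral => y _; rewrite /k /g !patchE /rect !in_setX in_setT xq.
    apply: integral0_eq => y _.
    by rewrite /k !patchE /rect !in_setX (negbTE xq).
  by apply: filterS => x; rewrite gE.
have all_steps : {ae mu, forall x, forall cd : rat * rat, (cd.1 < cd.2)%R ->
    0 <= \int[mu]_(y in [set` `]ratr cd.1 : R, ratr cd.2[]) (f (x, y))%:E}.
  have H n : {ae mu, forall x, if @unpickle (rat * rat)%type n is Some cd then (cd.1 < cd.2)%R ->
      0 <= \int[mu]_(y in [set` `]ratr cd.1 : R, ratr cd.2[]) (f (x, y))%:E else True}.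
    case: unpickle => [[c d]/=|]; last by apply: aeW.
    have [cd|_] := boolP (c < d)%R; last by apply: aeW.
    by move: (step _ _ cd); apply: (@filterS _ _ (ae_filter_ringOfSetsType mu)) => x H _.
  by apply: (@filterS _ _ (ae_filter_ringOfSetsType mu)) (ae_foralln H) => x Hx cd; have := Hx (pickle cd); rewrite pickleK.
have sect : {ae mu, forall x, {ae mu, forall y, (0 <= f (x, y))%R}}.
  have H2 := ae_integrable1 intf.
  apply: (@filterS2 _ _ (ae_filter_ringOfSetsType mu)) all_steps H2 => x Hx ix.
  by apply: (@filterS _ _ (ae_filter_ringOfSetsType mu)) (ae_ge0_itv ix (fun q r qr => Hx (q, r) qr)) => y; rewrite lee_fin.
(* Almost every vertical slice of this measurable set is null, so its product measure is 0. *)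
pose N : set (plane R) := [set x | (f x < 0)%R].
have mN : measurable N.
  have := emeasurable_fun_infty_o measurableT mf 0.
  by rewrite setTI; congr measurable; apply/seteqP; split => x /=; rewrite lte_fin.
exists N; split => //; last by move=> x /= /negP; rewrite -ltNge.
rewrite /leb2/= /product_measure1/= -(integral0 mu setT).
apply: ae_eq_integral => //.
  exact: measurable_fun_xsection.
apply: (@filterS _ _ (ae_filter_ringOfSetsType mu)) sect => x Hx _ /=; apply: measure_negligible; first exact: measurable_xsection.
apply: (negligibleS _ Hx) => y; rewrite /xsection/= inE /N/= => fxy /=.
by apply/negP; rewrite -ltNge.
Qed.

End positivity.

Section integrals.
Context {d : measure_display} {T : measurableType d} {R : realType}.
Variable mu : {measure set T -> \bar R}.

Lemma cvg_Rintegral (D : set T) (f_ : nat -> T -> R) (f g : T -> R) : measurable D ->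
  (forall n, measurable_fun D (f_ n)) -> mu.-integrable D (EFin \o g) ->
  (forall x, D x -> f_ n x @[n --> \oo] --> f x) -> (forall n x, D x -> `|f_ n x| <= g x) ->
  \int[mu]_(x in D) f_ n x @[n --> \oo] --> \int[mu]_(x in D) f x.
Proof.
move=> mD mf ig cf fg.
have mfl : measurable_fun D f by exact: measurable_fun_cvg mf cf.
have H := @dominated_cvg _ _ R mu D mD (fun n x => (f_ n x)%:E) (EFin \o f) (EFin \o g).
have ifl : mu.-integrable D (EFin \o f).
  apply: le_integrable ig => //; first exact/measurable_EFinP.
  move=> x Dx /=; rewrite lee_fin [leRHS]ger0_norm; last by exact: le_trans (fg 0%N _ Dx).
  have c : `|f_ n x| @[n --> \oo] --> `|f x| by apply: cvg_norm; exact: cf.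
  rewrite -(cvg_lim _ c)//; apply: limr_le; first by apply/cvg_ex; eexists; exact: c.
  by apply: nearW => n; exact: fg.
apply: fine_cvg; rewrite fineK; last exact: integrable_fin_num.
apply: H => //.
- by move=> n; apply/measurable_EFinP; exact: mf.
- by move=> x Dx; apply: cvg_EFin; [exact: nearW|exact: cf].
Qed.

Lemma Rintegral_mul_indic (D A : set T) (f : T -> R) : measurable D -> A `<=` D ->
  \int[mu]_(x in D) (f x * \1_A x) = \int[mu]_(x in A) f x.
Proof.
move=> mD AD; rewrite -[in RHS](setIidr AD) Rintegral_mkcondr.
by apply: eq_Rintegral => x _; rewrite patchE indicE; case: (x \in A); rewrite ?mulr1 ?mulr0.
Qed.

(** Passage to the limit in the definition of a weak gradient: V is a component of the gradient of
    U, and [p_] the derivatives of the test functions [q_]. Only [p_] converges; a bound m on [q_]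
    over S is enough for an inequality. *)
Lemma test_limit (D S : set T) (U V : T -> R) (p_ q_ : nat -> T -> R) (p : T -> R) (M m : R) :
  measurable D -> measurable S -> S `<=` D ->
  mu.-integrable D (EFin \o U) -> mu.-integrable D (EFin \o V) ->
  (forall n, measurable_fun D (p_ n)) -> (forall n, measurable_fun D (q_ n)) ->
  (forall x, D x -> p_ n x @[n --> \oo] --> p x) ->
  (forall n x, D x -> `|p_ n x| <= M) -> (forall n x, D x -> `|q_ n x| <= m * \1_S x) ->
  (forall n, \int[mu]_(x in D) (U x * p_ n x) = - \int[mu]_(x in D) (V x * q_ n x)) ->
  `|\int[mu]_(x in D) (U x * p x)| <= m * \int[mu]_(x in S) `|V x|.
Proof.
move=> mD mS SD iU iV mp mq cp pM qm E.
have mU : measurable_fun D U by apply/measurable_EFinP; exact: measurable_int iU.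
have mV : measurable_fun D V by apply/measurable_EFinP; exact: measurable_int iV.
have inV : mu.-integrable D (EFin \o (fun x => `|V x|)) by exact: integrable_norm.
have inU : mu.-integrable D (EFin \o (fun x => M * `|U x|)).
  by have := integrableZl mD M (integrable_norm iU); apply: eq_integrable.
have iVm : mu.-integrable D (EFin \o (fun x => `|V x| * (m * \1_S x))).
  apply: (@le_integrable _ _ _ mu D mD _ (fun x => m%:E * (`|V x|)%:E)%E).
  - apply/measurable_EFinP; apply: measurable_funM; first exact: measurableT_comp.
    by apply: measurable_funM => //; exact: measurable_indic.
  - move=> x _; rewrite -EFinM /= lee_fin !normrM mulrCA ler_wpM2l// ler_piMr//.
    by rewrite indicE; case: (_ \in _); rewrite ?normr1 ?normr0.
  - exact: integrableZl.
have c : \int[mu]_(x in D) (U x * p_ n x) @[n --> \oo] --> \int[mu]_(x in D) (U x * p x).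
  apply: (cvg_Rintegral mD _ inU).
  - by move=> n; apply: measurable_funM.
  - by move=> x Dx; apply: cvgM; [exact: cvg_cst|exact: cp].
  - by move=> n x Dx; rewrite normrM mulrC ler_wpM2r// pM.
have cn : `|\int[mu]_(x in D) (U x * p_ n x)| @[n --> \oo] --> `|\int[mu]_(x in D) (U x * p x)|.
  exact: cvg_norm.
rewrite -(cvg_lim _ cn)//; apply: limr_le; first by apply/cvg_ex; eexists; exact: cn.
apply: nearW => n; rewrite E normrN.
have iVq : mu.-integrable D (EFin \o (fun x => V x * q_ n x)).
  apply: le_integrable iVm => //; first by apply/measurable_EFinP; exact: measurable_funM.
  move=> x Dx /=; rewrite lee_fin !normrM normr_id ler_wpM2l//.
  by rewrite -normrM; apply: le_trans (qm n x Dx) (ler_norm _).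
apply: le_trans (le_normr_Rintegral mD iVq) _.
have -> : m * \int[mu]_(x in S) `|V x| = \int[mu]_(x in D) (`|V x| * (m * \1_S x)).
  rewrite -RintegralZl//; last exact: integrableS inV.
  by rewrite -(Rintegral_mul_indic _ mD SD); apply: eq_Rintegral => x _; ring.
apply: le_Rintegral => //; first exact: integrable_norm.
by move=> x Dx; rewrite normrM ler_wpM2l// qm.
Qed.

End integrals.

Section plane_tests.
Context {R : realType}.

Let norm_mul_le (m m' a b x : R) (n : nat) : 0 <= m -> m <= m' -> `|m * bump a b n x| <= m'.
Proof.
move=> m0 mm; rewrite ger0_norm; last by rewrite mulr_ge0// bump_ge0.
exact: le_trans (ler_piMr m0 (bump_le1 _ _ _ _)) mm.
Qed.
Implicit Types (f g u : R * R -> R) (G : R * R -> R * R).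

Lemma smooth_continuous f : smooth f -> [/\ continuous f,
  continuous (fun x => (grad f x).1) & continuous (fun x => (grad f x).2)].
Proof. move=> sf; have [_ c1 c2] := sf 1%N; exact: And3 (sf 0%N) c1 c2. Qed.

Lemma smooth_measurable f (D : set (plane R)) : smooth f ->
  [/\ measurable_fun D (f : plane R -> R),
      measurable_fun D ((fun x => (grad f x).1) : plane R -> R) &
      measurable_fun D ((fun x => (grad f x).2) : plane R -> R)].
Proof.
move=> /smooth_continuous[c0 c1 c2].
have m g : continuous g -> measurable_fun D (g : plane R -> R).
  by move=> cg; apply: measurable_funTS; exact: continuous_measurable_plane.
exact: And3 (m _ c0) (m _ c1) (m _ c2).
Qed.

Lemma rect_indic (a b c d : R) (x : R * R) :
  \1_(rect a b c d) x = \1_[set` `]a, b[] x.1 * \1_[set` `]c, d[] x.2 :> R.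
Proof.
rewrite !indicE /rect in_setX.
by case: (_ \in _); case: (_ \in _); rewrite ?mulr1 ?mulr0.
Qed.

Variables (Om : set (plane R)).
Hypotheses (mOm : measurable Om) (Omfin : (leb2 Om < +oo)%E).

Lemma L2_integrable u : L2 leb2 Om u -> leb2.-integrable Om (fun x : plane R => (u x)%:E).
Proof.
move=> [mu_ iu]; have i1 : leb2.-integrable Om (fun=> 1%:E : \bar R).
  by apply/integrableP; split => //; under eq_integral do rewrite /= normr1;
    rewrite integral_cst// mul1e.
have iS := integrableD mOm iu i1.
apply: (@le_integrable _ _ _ leb2 Om mOm _ _ _ _ iS); first exact/measurable_EFinP.
move=> x _; rewrite /= lee_fin [leRHS]ger0_norm ?addr_ge0 ?sqr_ge0//.
rewrite ler_norml; have := sqr_ge0 (u x - 1); have := sqr_ge0 (u x + 1).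
by move=> *; apply/andP; split; nra.
Qed.

Lemma Rintegral_rect_indic u (k a b c d a' b' c' d' k' : R) : L2 leb2 Om u ->
  rect a b c d `<=` Om -> rect a' b' c' d' `<=` Om ->
  \int[leb2]_(x in Om) (u x * (k * \1_(rect a b c d) x - k' * \1_(rect a' b' c' d') x)) =
  k * \int[leb2]_(x in rect a b c d) u x - k' * \int[leb2]_(x in rect a' b' c' d') u x.
Proof.
move=> Lu s1 s2; have iu := L2_integrable Lu.
have iI A : measurable A -> A `<=` Om -> leb2.-integrable Om (EFin \o (fun x : plane R => u x * \1_A x)).
  move=> mA AO; apply: le_integrable iu => //.
    apply/measurable_EFinP; apply: measurable_funM; first by case: Lu.
    exact: (@measurable_indic _ (plane R) R).
  move=> x _; rewrite /= lee_fin normrM ler_piMr// indicE.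
  by case: (_ \in _); rewrite ?normr1 ?normr0.
have [m1 m2] := (@measurable_rect R a b c d, @measurable_rect R a' b' c' d').
rewrite -(Rintegral_mul_indic _ _ mOm s1) -(Rintegral_mul_indic _ _ mOm s2) -!RintegralZl//; try exact: iI.
rewrite -RintegralB//.
- by apply: eq_Rintegral => x _; ring.
- by have := integrableZl mOm k (iI _ m1 s1); apply: eq_integrable.
- by have := integrableZl mOm k' (iI _ m2 s2); apply: eq_integrable.
Qed.

(** The tests are [plateau] in the first variable times [bump] in the second. Their first derivative
    tends to the weighted difference of the indicators of the box and of the slab, and
    [plateau_bound] gives the constant on the right. *)
Lemma slab_x u G (a b c d p q r s : R) : sobolev Om u G -> rect a b c d `<=` Om ->
  a <= p -> p <= q -> q <= b -> c <= r -> s <= d ->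
  `|(b - a) * \int[leb2]_(x in rect p q r s) u x - (q - p) * \int[leb2]_(x in rect a b r s) u x|
  <= (b - a) * (q - p) * \int[leb2]_(x in rect a b r s) `|(G x).1|.
Proof.
move=> [Lu LG1 LG2 wg] sub ap pq qb cr sd.
have ab : a <= b by rewrite (le_trans ap)// (le_trans pq).
have sr : rect a b r s `<=` Om.
  by apply: subset_trans sub => x /rectE[? ? ? ?]; apply/rectE; split => //; lra.
have sp : rect p q r s `<=` Om.
  by apply: subset_trans sub => x /rectE[? ? ? ?]; apply/rectE; split => //; lra.
rewrite -(Rintegral_rect_indic _ _ Lu)//.
pose f n := tensor (plateau a b p q n) (bump r s n).
have sf n : smooth (f n) by apply: smooth_tensor; [exact: smooth1_plateau|exact: smooth1_bump].
have gf n x : (grad (f n) x).1 =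
    (mass a b n * bump p q n x.1 - mass p q n * bump a b n x.1) * bump r s n x.2.
  have [_ _ ->] := derive_tensor x (smooth1_plateau a b p q n) (smooth1_bump r s n).
  by rewrite /= derive1E (@derive_val _ _ _ _ _ _ _ (is_derive_plateau a b p q n x.1)).
have tf n : test_function Om (f n).
  have n0 : (0 : R) < n.+1%:R^-1 by rewrite invr_gt0.
  apply: (test_tensor (smooth1_plateau a b p q n) (smooth1_bump r s n)
    (fun t => @plateau_eq0 R a b p q n t ap qb) (@bump_eq0 R r s n)).
  apply: subset_trans sr => x [/=]; move: (n.+1%:R^-1) n0 => e n0; rewrite !in_itv/= => /andP[? ?] /andP[? ?].
  by apply/rectE; split; lra.
apply: (@test_limit _ _ _ leb2 Om (rect a b r s) u (fun x => (G x).1) (fun n x => (grad (f n) x).1) f _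
  ((b - a) + (q - p))) => //.
- exact: measurable_rect.
- exact: L2_integrable.
- exact: L2_integrable.
- move=> n; have [_ m1 _] := smooth_measurable Om (sf n); exact: m1.
- move=> n; have [m0 _ _] := smooth_measurable Om (sf n); exact: m0.
- move=> x _; under eq_fun do rewrite gf.
  rewrite !rect_indic !mulrA -mulrBl.
  apply: cvgM; last exact: bump_cvg.
  by apply: cvgB; apply: cvgM; first [exact: mass_cvg|exact: bump_cvg].
- move=> n x _; rewrite gf.
  have /andP[m1 m2] := mass_bound n ab; have /andP[m3 m4] := mass_bound n pq.
  rewrite normrM [X in _ * X]ger0_norm ?bump_ge0//.
  apply: le_trans (ler_piMr _ (bump_le1 _ _ _ _)) _; first exact: normr_ge0.
  apply: le_trans (ler_normB _ _) _.
  exact: (lerD (norm_mul_le _ _ _ _ m1 m2) (norm_mul_le _ _ _ _ m3 m4)).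
- move=> n x _; rewrite /f /tensor normrM rect_indic.
  rewrite [X in _ * X]ger0_norm ?bump_ge0// [leRHS]mulrA; apply: ler_pM => //.
  + exact: bump_ge0.
  + rewrite indicE; have [_|xab] := boolP (x.1 \in _).
      by rewrite mulr1; exact: plateau_bound.
    rewrite plateau_eq0 ?normr0 ?mulr0// => /andP[x1 x2]; move/negP: xab; apply.
    have n0 : (0 : R) < n.+1%:R^-1 by rewrite invr_gt0.
    by move: (n.+1%:R^-1) n0 x1 x2 => e *; rewrite inE/= in_itv/=; apply/andP; split; lra.
  + exact: bump_le_indic.
- move=> n; have [E _] := wg _ (tf n); exact: E.
Qed.

(** The second half of the comparison, from the slab, which has full width, to the rectangle; only
    the vertical derivative matters. *)
Lemma slab_y u G (a b c d r s : R) : sobolev Om u G -> rect a b c d `<=` Om ->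
  c <= r -> r <= s -> s <= d ->
  `|(d - c) * \int[leb2]_(x in rect a b r s) u x - (s - r) * \int[leb2]_(x in rect a b c d) u x|
  <= (d - c) * (s - r) * \int[leb2]_(x in rect a b c d) `|(G x).2|.
Proof.
move=> [Lu LG1 LG2 wg] sub cr rs sd.
have cd : c <= d by rewrite (le_trans cr)// (le_trans rs).
have sp : rect a b r s `<=` Om.
  by apply: subset_trans sub => x /rectE[? ? ? ?]; apply/rectE; split => //; lra.
rewrite -(Rintegral_rect_indic _ _ Lu)//.
pose f n := tensor (bump a b n) (plateau c d r s n).
have sf n : smooth (f n) by apply: smooth_tensor; [exact: smooth1_bump|exact: smooth1_plateau].
have gf n x : (grad (f n) x).2 =
    bump a b n x.1 * (mass c d n * bump r s n x.2 - mass r s n * bump c d n x.2).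
  have [_ _ ->] := derive_tensor x (smooth1_bump a b n) (smooth1_plateau c d r s n).
  by rewrite /= derive1E (@derive_val _ _ _ _ _ _ _ (is_derive_plateau c d r s n x.2)).
have tf n : test_function Om (f n).
  have n0 : (0 : R) < n.+1%:R^-1 by rewrite invr_gt0.
  apply: (test_tensor (smooth1_bump a b n) (smooth1_plateau c d r s n)
    (@bump_eq0 R a b n) (fun t => @plateau_eq0 R c d r s n t cr sd)).
  apply: subset_trans sub => x [/=]; move: (n.+1%:R^-1) n0 => e n0; rewrite !in_itv/= => /andP[? ?] /andP[? ?].
  by apply/rectE; split; lra.
apply: (@test_limit _ _ _ leb2 Om (rect a b c d) u (fun x => (G x).2) (fun n x => (grad (f n) x).2) f _
  ((d - c) + (s - r))) => //.
- exact: measurable_rect.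
- exact: L2_integrable.
- exact: L2_integrable.
- move=> n; have [_ _ m2] := smooth_measurable Om (sf n); exact: m2.
- move=> n; have [m0 _ _] := smooth_measurable Om (sf n); exact: m0.
- move=> x _; under eq_fun do rewrite gf.
  rewrite !rect_indic !(mulrCA _ (\1_[set` `]a, b[] x.1)) -mulrBr.
  apply: cvgM; first exact: bump_cvg.
  by apply: cvgB; apply: cvgM; first [exact: mass_cvg|exact: bump_cvg].
- move=> n x _; rewrite gf.
  have /andP[m1 m2] := mass_bound n cd; have /andP[m3 m4] := mass_bound n rs.
  rewrite normrM [X in X * _]ger0_norm ?bump_ge0//.
  apply: le_trans (ler_piMl _ (bump_le1 _ _ _ _)) _; first exact: normr_ge0.
  apply: le_trans (ler_normB _ _) _.
  exact: (lerD (norm_mul_le _ _ _ _ m1 m2) (norm_mul_le _ _ _ _ m3 m4)).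
- move=> n x _; rewrite /f /tensor normrM rect_indic.
  rewrite [X in X * _]ger0_norm ?bump_ge0// [leRHS]mulrCA; apply: ler_pM => //.
  + exact: bump_ge0.
  + exact: bump_le_indic.
  + rewrite indicE; have [_|xab] := boolP (x.2 \in _).
      by rewrite mulr1; exact: plateau_bound.
    rewrite plateau_eq0 ?normr0 ?mulr0// => /andP[x1 x2]; move/negP: xab; apply.
    have n0 : (0 : R) < n.+1%:R^-1 by rewrite invr_gt0.
    by move: (n.+1%:R^-1) n0 x1 x2 => e *; rewrite inE/= in_itv/=; apply/andP; split; lra.
- move=> n; have [_ E] := wg _ (tf n); exact: E.
Qed.

End plane_tests.

Section integral_facts.
Context {d : measure_display} {T : measurableType d} {R : realType}.
Variable mu : {measure set T -> \bar R}.

(** The integral of (f - I / m)^2 is non-negative, I being the integral of f. *)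
Lemma sqr_Rintegral_le (D : set T) (f : T -> R) (m : R) : measurable D -> 0 < m ->
  mu D = m%:E -> measurable_fun D f ->
  (((\int[mu]_(x in D) f x) ^+ 2)%:E <= m%:E * \int[mu]_(x in D) (f x ^+ 2)%:E)%E.
Proof.
move=> mD m0 muD mf.
have mf2 : measurable_fun D (fun x => (f x ^+ 2)%:E) by apply/measurable_EFinP; exact: measurable_funX.
have [foo|ffin] := eqVneq (\int[mu]_(x in D) (f x ^+ 2)%:E)%E +oo%E.
  by rewrite foo gt0_muley ?lte_fin// leey.
have if2 : mu.-integrable D (EFin \o (fun x => f x ^+ 2)).
  apply/integrableP; split => //; under eq_integral do rewrite /= ger0_norm ?sqr_ge0//.
  by rewrite ltey.
have i1 (k : R) : mu.-integrable D (EFin \o (fun=> k)).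
  apply/integrableP; split; first exact: measurable_cst.
  by under eq_integral do rewrite /=; rewrite integral_cst// muD ltry.
have if1 : mu.-integrable D (EFin \o f).
  have iS := integrableD mD if2 (i1 1).
  apply: (@le_integrable _ _ _ mu D mD _ _ _ _ iS); first exact/measurable_EFinP.
  move=> x _; rewrite /= lee_fin [leRHS]ger0_norm ?addr_ge0 ?sqr_ge0//.
  rewrite ler_norml; have := sqr_ge0 (f x - 1); have := sqr_ge0 (f x + 1).
  by move=> *; apply/andP; split; nra.
have -> : (\int[mu]_(x in D) (f x ^+ 2)%:E)%E = (\int[mu]_(x in D) (f x ^+ 2))%:E.
  by rewrite /Rintegral fineK//; exact: integrable_fin_num.
rewrite -EFinM lee_fin; set I := \int[mu]_(x in D) f x; set I2 := \int[mu]_(x in D) (f x ^+ 2).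
have : 0 <= \int[mu]_(x in D) ((f x ^+ 2 + - (2 * (I / m)) * f x) + (I / m) ^+ 2).
  apply: Rintegral_ge0 => x _; rewrite (_ : _ + _ = (f x - I / m) ^+ 2) ?sqr_ge0//; ring.
have iZ : mu.-integrable D (EFin \o (fun x => - (2 * (I / m)) * f x)).
  by have := integrableZl mD (- (2 * (I / m))) if1; apply: eq_integrable.
rewrite RintegralD//; last by have := integrableD mD if2 iZ; apply: eq_integrable.
rewrite RintegralD// RintegralZl// Rintegral_cst// muD /= -/I -/I2.
have -> : I2 + - (2 * (I / m)) * I + (I / m) ^+ 2 * m = I2 - I ^+ 2 / m.
  by field; rewrite gt_eqF.
by rewrite subr_ge0 ler_pdivrMr// mulrC.
Qed.

End integral_facts.

Section rectangles.
Context {R : realType}.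
Notation mu := (@lebesgue_measure R).

Lemma leb2_rect (a b c d : R) : a <= b -> c <= d ->
  leb2 (rect a b c d : set (plane R)) = ((b - a) * (d - c))%:E.
Proof.
move=> ab cd; rewrite /leb2/= product_measure1E//= !lebesgue_measure_itv/= !lte_fin.
have [ab'|ab'|->] := ltgtP a b; last by rewrite mul0e subrr mul0r.
- have [cd'|cd'|->] := ltgtP c d; last by rewrite mule0 subrr mulr0.
  + by rewrite -!EFinB -EFinM.
  + by rewrite leNgt cd' in cd.
- by rewrite leNgt ab' in ab.
Qed.

Lemma rect0 (a b c d : R) : ~~ (a < b) || ~~ (c < d) -> rect a b c d = set0.
Proof.
move=> H; apply/seteqP; split => // x /rectE[ax xb cx xd].
by case/orP: H => /negP; apply; [exact: lt_trans ax xb|exact: lt_trans cx xd].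
Qed.

Lemma rectI (a b c d p q r s : R) : rect a b c d `&` rect p q r s =
  rect (Num.max a p) (Num.min b q) (Num.max c r) (Num.min d s).
Proof.
apply/seteqP; split=> x.
  by move=> [/rectE[? ? ? ?] /rectE[? ? ? ?]]; apply/rectE; split; rewrite ?gt_max ?lt_min; apply/andP.
by move=> /rectE[]; rewrite !gt_max !lt_min => /andP[? ?] /andP[? ?] /andP[? ?] /andP[? ?];
  split; apply/rectE; split.
Qed.

Lemma integral_rect (f : R * R -> \bar R) (a b c d : R) :
  measurable_fun setT (f : plane R -> \bar R) -> (forall x, 0 <= f x)%E ->
  (\int[leb2]_(x in rect a b c d) f x =
   \int[mu]_(y in [set` `]c, d[]) \int[mu]_(x in [set` `]a, b[]) f (x, y))%E.
Proof.
move=> mf f0; rewrite integral_mkcond; have mr := @measurable_rect R a b c d.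
rewrite /leb2 fubini_tonelli2; last 2 first.
- by apply/(measurable_restrictT _ _).1 => //; exact: measurable_funS mf.
- by move=> x; apply: erestrict_ge0.
rewrite [RHS]integral_mkcond; apply: eq_integral => y _; rewrite /fubini_G patchE.
case: ifPn => yc.
  rewrite [RHS]integral_mkcond; apply: eq_integral => x _.
  by rewrite !patchE /rect in_setX /= yc andbT.
apply: integral0_eq => x _; by rewrite patchE /rect in_setX /= (negbTE yc) andbF.
Qed.

End rectangles.

Section poincare.
Context {R : realType}.
Notation mu := (@lebesgue_measure R).
Variables (Om : set (plane R)) (u : R * R -> R) (G : R * R -> R * R) (a b c d : R).
Hypotheses (mOm : measurable Om) (Omfin : (leb2 Om < +oo)%E) (sob : sobolev Om u G).
Hypotheses (ab : a < b) (cd : c < d) (sub : rect a b c d `<=` Om).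

Let Q := rect a b c d.
Let m := (\int[leb2]_(x in Q) u x) / ((b - a) * (d - c)).
Let kappa := (\int[leb2]_(x in Q) `|(G x).2|) / (b - a).

Let box_average (p q r s : R) : a <= p -> p <= q -> q <= b -> c <= r -> r <= s -> s <= d ->
  `|\int[leb2]_(x in rect p q r s) u x - m * ((q - p) * (s - r))| <=
  (q - p) * \int[leb2]_(x in rect a b r s) `|(G x).1| + kappa * ((q - p) * (s - r)).
Proof.
move=> ap pq qb cr rs sd.
have := slab_x mOm Omfin sob sub ap pq qb cr sd.
have := slab_y mOm Omfin sob sub cr rs sd.
rewrite /m /kappa -/Q.
move: (\int[leb2]_(x in _) u x) (\int[leb2]_(x in _) u x) (\int[leb2]_(x in _) u x) => U W V.
move: (\int[leb2]_(x in _) `|(G x).1|) (\int[leb2]_(x in _) `|(G x).2|) => A1 A2.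
have I0 : 0 < b - a by rewrite subr_gt0.
have J0 : 0 < d - c by rewrite subr_gt0.
have a0 : 0 <= q - p by rewrite subr_ge0.
have b0 : 0 <= s - r by rewrite subr_ge0.
move: (b - a) (d - c) (q - p) (s - r) I0 J0 a0 b0 => I J al be I0 J0 a0 b0 H2 H1.
(* Box against rectangle is box against slab ([slab_x]) plus slab against rectangle ([slab_y]). *)
have -> : U - W / (I * J) * (al * be) = I^-1 * ((I * U - al * V) + al / J * (J * V - be * W)).
  by field; rewrite !gt_eqF.
rewrite normrM gtr0_norm ?invr_gt0// ler_pdivrMl//.
apply: le_trans (ler_normD _ _) _; rewrite normrM ger0_norm ?divr_ge0 ?(ltW J0)//.
have -> : I * (al * A1 + A2 / I * (al * be)) = I * al * A1 + al / J * (J * be * A2).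
  by field; rewrite !gt_eqF.
by apply: lerD => //; rewrite ler_wpM2l// divr_ge0// ltW.
Qed.

Let iu : leb2.-integrable Om (fun x : plane R => (u x)%:E).
Proof. by case: sob => Lu _ _ _; exact: L2_integrable. Qed.
Let iG1 : leb2.-integrable Om (fun x : plane R => ((G x).1)%:E).
Proof. by case: sob => _ Lu _ _; exact: L2_integrable. Qed.
Let mQ : measurable (Q : set (plane R)) := measurable_rect a b c d.

Let H : plane R -> R := (fun x => `|(G x).1|) \_ Q.
Let HE x : H x = `|(G x).1| * \1_Q x.
Proof. by rewrite /H patchE indicE; case: (_ \in _); rewrite ?mulr1 ?mulr0. Qed.
Let H_ge0 x : 0 <= H x. Proof. by rewrite HE mulr_ge0// indicE; case: (_ \in _). Qed.
Let iH : leb2.-integrable setT (EFin \o H).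
Proof.
have -> : EFin \o H = (EFin \o (fun x : plane R => `|(G x).1|)) \_ Q by rewrite restrict_EFin.
apply/(integrable_mkcond _ _).1 => //; apply: integrable_norm => //.
exact: integrableS iG1.
Qed.
Let mH : measurable_fun setT H.
Proof. by apply/measurable_EFinP; exact: measurable_int iH. Qed.

(** The integral of |(G x).1| along the row at height y. Its finite part [n y], plus [kappa], will
    bound |u - m| almost everywhere on that row. *)
Let F := fubini_G mu (EFin \o H).
Let n y := fine (F y).
Let iF : mu.-integrable setT F.
Proof.
have H0 x : (0 <= (EFin \o H) x)%E by rewrite lee_fin.
have mE : measurable_fun setT (EFin \o H) by exact/measurable_EFinP.
have F0 y : (0 <= F y)%E by apply: integral_ge0.
apply/integrableP; split; first exact: measurable_fun_fubini_tonelli_G.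
under eq_integral do rewrite gee0_abs//.
rewrite -(fubini_tonelli2 _ mE H0).
move/integrableP : iH => [_]; congr (_ < _)%E; apply: eq_integral => x _.
by rewrite gee0_abs.
Qed.
Let n_ge0 y : 0 <= n y.
Proof. by apply/fine_ge0/integral_ge0 => x _; rewrite lee_fin. Qed.
Let mn : measurable_fun setT n.
Proof. by apply: measurableT_comp => //; exact: measurable_int iF. Qed.
Let mn2 : measurable_fun setT ((fun x => n x.2) : plane R -> R).
Proof. exact: (measurableT_comp mn measurable_snd). Qed.

Let integral_n (p q r s : R) : a <= p -> p <= q -> q <= b -> c <= r -> r <= s -> s <= d ->
  (\int[leb2]_(x in rect p q r s) (n x.2)%:E =
   ((q - p) * \int[leb2]_(x in rect a b r s) `|(G x).1|)%:E)%E.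
Proof.
move=> ap pq qb cr rs sd.
have subQ : rect a b r s `<=` Q.
  by move=> x /rectE[? ? ? ?]; apply/rectE; split => //; lra.
have -> : (\int[leb2]_(x in rect a b r s) `|(G x).1|) = \int[leb2]_(x in rect a b r s) H x.
  by apply: eq_Rintegral => x; rewrite inE => /subQ Qx; rewrite HE indicE mem_set// mulr1.
rewrite /Rintegral EFinM fineK; last first.
  by apply: integrable_fin_num; [exact: measurable_rect|apply: integrableS iH => //; exact: measurable_rect].
rewrite !integral_rect; last 4 first.
- exact/measurable_EFinP.
- by move=> x; rewrite lee_fin.
- exact/measurable_EFinP.
- by move=> x; rewrite lee_fin.
have inner y : (\int[mu]_(x in [set` `]a, b[]) (H (x, y))%:E)%E = F y.
  rewrite integral_mkcond; apply: eq_integral => x _; rewrite patchE /=; case: ifPn => // xab.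
  by rewrite HE indicE /Q /rect in_setX /= (negbTE xab) mulr0.
under [in RHS]eq_integral do rewrite inner.
have inner2 y : (\int[mu]_(x in [set` `]p, q[]) (n ((x, y) : R * R).2)%:E = (q - p)%:E * (n y)%:E)%E.
  rewrite [LHS](_ : _ = \int[mu]_(x in [set` `]p, q[]) cst (n y)%:E x)%E// integral_cst//=.
  rewrite lebesgue_measure_itv/= lte_fin muleC.
  by have [pq'|qp|->] := ltgtP p q; rewrite -?EFinB// ?subrr//; rewrite leNgt qp in pq.
transitivity (\int[mu]_(y in [set` `]r, s[]) ((q - p)%:E * (n y)%:E))%E.
  by apply: eq_integral => y _; exact: inner2.
rewrite ge0_integralZl//; last 3 first.
- by apply/measurable_EFinP; exact: measurable_funTS.
- by move=> y _; rewrite lee_fin.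
- by rewrite lee_fin subr_ge0.
congr (_ * _)%E; apply: ae_eq_integral => //.
- by apply/measurable_EFinP; exact: measurable_funTS.
- by apply: measurable_funTS; exact: measurable_int iF.
- have := integrable_ae measurableT iF.
  by apply: (@filterS _ _ (ae_filter_ringOfSetsType mu)) => y /(_ I) Fy _ /=; rewrite /n fineK.
Qed.

Let QOm : Q `<=` Om := sub.
Let iuQ : leb2.-integrable Q (fun x : plane R => (u x)%:E) := integrableS mOm mQ QOm iu.
Let I0 : 0 < b - a. Proof. by rewrite subr_gt0. Qed.
Let J0 : 0 < d - c. Proof. by rewrite subr_gt0. Qed.
Let kappa_ge0 : 0 <= kappa.
Proof. by rewrite divr_ge0 ?(ltW I0)//; apply: Rintegral_ge0. Qed.
Let cst_integrable (k : R) (A : set (plane R)) : measurable A -> A `<=` Q ->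
  leb2.-integrable A (fun=> k%:E : \bar R).
Proof.
move=> mA AQ; apply: (@integrableS _ _ _ leb2 Q) => //; apply/integrableP; split => //.
under eq_integral do rewrite /=; rewrite integral_cst// /Q leb2_rect ?ltW//.
by rewrite -EFinM ltry.
Qed.

Let integrable_n : leb2.-integrable Q (fun x : plane R => (n x.2)%:E).
Proof.
apply/integrableP; split; first by apply/measurable_EFinP; exact: measurable_funTS.
under eq_integral do rewrite gee0_abs ?lee_fin//.
by rewrite integral_n ?ltry// ltW.
Qed.

(** By [box_average] the integral over every box is non-negative, so [ae_ge0_rect] applies; the two
    signs are the two halves of |u - m| <= n + kappa. *)
Let pointwise (s : R) : s = 1 \/ s = -1 ->
  {ae leb2, forall x : plane R, Q x -> 0 <= n x.2 + kappa + s * (u x - m)}.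
Proof.
move=> s1; pose w (x : plane R) := n x.2 + kappa + s * (u x - m).
have iw : leb2.-integrable Q (EFin \o w).
  have i1 := integrableD mQ integrable_n (cst_integrable kappa mQ (@subset_refl _ Q)).
  have i2 := integrableZl mQ s (integrableB mQ iuQ (cst_integrable m mQ (@subset_refl _ Q))).
  by have := integrableD mQ i1 i2; apply: eq_integrable.
have : {ae leb2, forall x : plane R, 0 <= (w \_ Q) x}.
  apply: ae_ge0_rect.
    by rewrite -restrict_EFin; apply/(integrable_mkcond _ _).1.
  move=> p q r t pq rt.
  have -> : (\int[leb2]_(x in rect p q r t) ((w \_ Q) x)%:E =
      \int[leb2]_(x in rect p q r t) (((EFin \o w) \_ Q) x))%E by rewrite restrict_EFin.
  rewrite -integral_mkcondr setIC.
  rewrite /Q rectI; set p' := Num.max a p; set q' := Num.min b q; set r' := Num.max c r; set t' := Num.min d t.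
  have [H'|H'] := boolP (~~ (p' < q') || ~~ (r' < t')); first by rewrite rect0// integral_set0.
  move: H'; rewrite negb_or !negbK => /andP[pq' rt'].
  have ap : a <= p' by rewrite le_max lexx.
  have qb : q' <= b by rewrite ge_min lexx.
  have cr : c <= r' by rewrite le_max lexx.
  have td : t' <= d by rewrite ge_min lexx.
  have mS := @measurable_rect R p' q' r' t'; set S := rect p' q' r' t'.
  have SQ : S `<=` Q by move=> x /rectE[? ? ? ?]; apply/rectE; split => //; lra.
  have iS : leb2.-integrable S (EFin \o w) by apply: integrableS iw.
  have inS : leb2.-integrable S (fun x : plane R => (n x.2)%:E) by apply: integrableS integrable_n.
  have iuS : leb2.-integrable S (fun x : plane R => (u x)%:E) by apply: integrableS iuQ.
  have iD := integrableD mS inS (cst_integrable kappa mS SQ).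
  have iB := integrableB mS iuS (cst_integrable m mS SQ).
  have -> : (\int[leb2]_(x in S) (EFin \o w) x = (\int[leb2]_(x in S) w x)%:E)%E.
    by rewrite /Rintegral fineK//; exact: integrable_fin_num.
  rewrite lee_fin /w RintegralD//; last by have := integrableZl mS s iB; apply: eq_integrable.
  rewrite RintegralD//; last exact: cst_integrable.
  rewrite RintegralZl// RintegralB//; last exact: cst_integrable.
  rewrite !Rintegral_cst// /S leb2_rect ?(ltW pq') ?(ltW rt')// -/S /=.
  have -> : \int[leb2]_(x in S) n x.2 = (q' - p') * \int[leb2]_(x in rect a b r' t') `|(G x).1|.
    by rewrite /Rintegral /S integral_n ?(ltW pq') ?(ltW rt').
  have := box_average ap (ltW pq') qb cr (ltW rt') td.
  rewrite -/S ler_norml => /andP[H1 H2].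
  by case: s1 => ->; lra.
apply: filterS => x + Qx; rewrite patchE mem_set//.
Qed.

Local Open Scope ereal_scope.

(* Integrating the weak gradient against a product of a plateau and a bump
   compares the averages of u over a small box, over the horizontal slab that
   contains it and over the rectangle; positivity of a function from its
   integrals over boxes turns this into a pointwise bound on |u - m|. *)
Lemma poincare_rect : sqint leb2 Q (fun x => u x - m)%R <=
  (2 * (b - a) ^+ 2)%:E * sqint leb2 Q (fun x => (G x).1) +
  (2 * (d - c) ^+ 2)%:E * sqint leb2 Q (fun x => (G x).2).
Proof.
have [Lu LG1 LG2 _] := sob.
have muQ : measurable_fun Q (u : plane R -> R) by apply: measurable_funS QOm _ => //; case: Lu.
have mG1Q : measurable_fun Q ((fun x => (G x).1) : plane R -> R) by apply: measurable_funS QOm _ => //; case: LG1.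
have mG2Q : measurable_fun Q ((fun x => (G x).2) : plane R -> R) by apply: measurable_funS QOm _ => //; case: LG2.
have mnQ : measurable_fun Q ((fun x => n x.2) : plane R -> R) by exact: measurable_funTS.
have slice y : ((n y) ^+ 2)%:E <= (b - a)%:E * \int[mu]_x ((H (x, y)) ^+ 2)%:E.
  have mHy : measurable_fun setT (fun x => H (x, y)) by exact: measurableT_comp.
  have Hy0 x : x \notin [set` `]a, b[] -> H (x, y) = 0%R.
    by move=> xab; rewrite HE indicE /Q /rect in_setX /= (negbTE xab) mulr0.
  have -> : n y = (\int[mu]_(x in [set` `]a, b[]) H (x, y))%R.
    rewrite /n /Rintegral integral_mkcond; congr fine; apply: eq_integral => x _.
    by rewrite patchE /=; case: ifPn => // /Hy0 ->.
  apply: le_trans (sqr_Rintegral_le (m := (b - a)%R) _ _ _ _) _ => //.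
  - by rewrite /= lebesgue_measure_itv/= lte_fin ab.
  - exact: measurable_funTS.
  apply: lee_wpmul2l; first by rewrite lee_fin ltW.
  apply: ge0_subset_integral => //.
    by apply/measurable_EFinP; exact: measurable_funX.
  by move=> x _; rewrite lee_fin sqr_ge0.
(* One factor b - a comes from Cauchy-Schwarz on a row, the other from integrating over the row a
   quantity that is constant there. *)
have nsq : \int[leb2]_(x in Q) ((n x.2) ^+ 2)%:E <= ((b - a) ^+ 2)%:E * sqint leb2 Q (fun x => (G x).1).
  have mH2 : measurable_fun setT (fun x : plane R => ((H x) ^+ 2)%:E).
    by apply/measurable_EFinP; exact: measurable_funX.
  have H20 x : 0 <= ((H x) ^+ 2)%:E by rewrite lee_fin sqr_ge0.
  rewrite (integral_rect (f := fun x => ((n x.2) ^+ 2)%:E)); last 2 first.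
  - by apply/measurable_EFinP; exact: measurable_funX.
  - by move=> x; rewrite lee_fin sqr_ge0.
  have -> : sqint leb2 Q (fun x => (G x).1) = \int[mu]_y \int[mu]_x ((H (x, y)) ^+ 2)%:E.
    rewrite /sqint -(fubini_tonelli2 (fun x => ((H x) ^+ 2)%:E))// integral_mkcond.
    apply: eq_integral => x _; rewrite patchE HE indicE; case: (x \in Q).
      by rewrite mulr1 real_normK ?num_real.
    by rewrite mulr0 expr0n.
  rewrite expr2 EFinM -muleA -ge0_integralZl//; last 3 first.
  - exact: (measurable_fun_fubini_tonelli_G _ mH2 H20).
  - by move=> y _; apply: integral_ge0.
  - by rewrite lee_fin ltW.
  rewrite -ge0_integralZl//; last 3 first.
  - by apply: measurable_funeM; exact: (measurable_fun_fubini_tonelli_G _ mH2 H20).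
  - by move=> y _; rewrite mule_ge0 ?lee_fin ?(ltW I0)//; apply: integral_ge0.
  - by rewrite lee_fin ltW.
  have mK : measurable_fun setT (fun y => (b - a)%:E * ((b - a)%:E * \int[mu]_x ((H (x, y)) ^+ 2)%:E)).
    by do 2 apply: measurable_funeM; exact: (measurable_fun_fubini_tonelli_G _ mH2 H20).
  have K0 y : 0 <= (b - a)%:E * ((b - a)%:E * \int[mu]_x ((H (x, y)) ^+ 2)%:E).
    by rewrite !mule_ge0 ?lee_fin ?(ltW I0)//; apply: integral_ge0.
  apply: (@le_trans _ _ (\int[mu]_(y in [set` `]c, d[]) ((b - a)%:E * ((b - a)%:E * \int[mu]_x ((H (x, y)) ^+ 2)%:E)))); last first.
    exact: ge0_subset_integral.
  have cst_slice (y : R) : \int[mu]_(x in [set` `]a, b[]) ((n ((x, y) : R * R).2) ^+ 2)%:E =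
      (b - a)%:E * ((n y) ^+ 2)%:E.
    rewrite [LHS](_ : _ = \int[mu]_(x in [set` `]a, b[]) cst ((n y) ^+ 2)%:E x)//.
    by rewrite integral_cst//= lebesgue_measure_itv/= lte_fin ab muleC.
  rewrite (_ : integral _ _ _ = \int[mu]_(y in [set` `]c, d[]) ((b - a)%:E * ((n y) ^+ 2)%:E)); last first.
    by apply: eq_integral => y _; exact: cst_slice.
  apply: ge0_le_integral => //.
  - by move=> y _; rewrite mule_ge0 ?lee_fin ?sqr_ge0 ?ltW.
  - by apply: measurable_funeM; apply/measurable_EFinP; apply: measurable_funX; exact: measurable_funTS.
  - exact: measurable_funTS.
  - by move=> y _; apply: lee_wpmul2l; [rewrite lee_fin ltW|exact: slice].
have ksq : (kappa ^+ 2 * ((b - a) * (d - c)))%:E <= ((d - c) ^+ 2)%:E * sqint leb2 Q (fun x => (G x).2).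
  have := @sqr_Rintegral_le _ _ _ leb2 Q (fun x => `|(G x).2|)%R ((b - a) * (d - c)) mQ (mulr_gt0 I0 J0)
    (leb2_rect (ltW ab) (ltW cd)) (measurableT_comp (@normr_measurable R setT) mG2Q).
  have -> : \int[leb2]_(x in Q) (`|(G x).2| ^+ 2)%:E = sqint leb2 Q (fun x => (G x).2).
    by apply: eq_integral => x _; rewrite real_normK ?num_real.
  rewrite /kappa; set A := (\int[leb2]_(x in Q) _)%R => HA.
  have -> : ((A / (b - a)) ^+ 2 * ((b - a) * (d - c)) = ((d - c) / (b - a)) * A ^+ 2)%R.
    by field; rewrite gt_eqF.
  have k0 : (0 <= (d - c) / (b - a))%R by rewrite divr_ge0 ?ltW.
  rewrite EFinM; apply: le_trans (lee_wpmul2l _ HA) _; first by rewrite lee_fin.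
  have E : ((d - c) / (b - a) * ((b - a) * (d - c)) = (d - c) ^+ 2)%R by field; rewrite gt_eqF.
  by rewrite muleA -EFinM E.
(* From (n + kappa)^2 <= 2 n^2 + 2 kappa^2, the origin of the factors 2 in the statement. *)
apply: (@le_trans _ _ (\int[leb2]_(x in Q) (2 * (n x.2) ^+ 2 + 2 * kappa ^+ 2)%:E)).
  apply: ae_ge0_le_integral => //.
  - by move=> x _; rewrite lee_fin sqr_ge0.
  - by apply: measurable_sqr => //; exact: measurable_funB.
  - by move=> x _; rewrite lee_fin addr_ge0// mulr_ge0// sqr_ge0.
  - apply/measurable_EFinP; apply: measurable_funD => //; apply: measurable_funM => //.
    exact: measurable_funX.
  apply: filterS2 (pointwise (or_introl erefl)) (pointwise (or_intror erefl)) => x H1 H2 Qx.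
  have {}H1 := H1 Qx; have {}H2 := H2 Qx; have := n_ge0 x.2; have k0 := kappa_ge0.
  rewrite lee_fin; move: (n x.2) (u x - m)%R H1 H2 => t v H1 H2 t0.
  have : (v ^+ 2 <= (t + kappa) ^+ 2)%R by rewrite -[leLHS]real_normK ?num_real// lerXn2r ?nnegrE ?addr_ge0// ler_norml; apply/andP; split; lra.
  by have := sqr_ge0 (t - kappa); nra.
have n2 x : 0 <= ((n x.2) ^+ 2)%:E by rewrite lee_fin sqr_ge0.
have mn2' : measurable_fun Q (fun x : plane R => ((n x.2) ^+ 2)%:E).
  by apply/measurable_EFinP; exact: measurable_funX.
under eq_integral do rewrite EFinD EFinM.
rewrite ge0_integralD//; last 3 first.
- by move=> x _; rewrite mule_ge0// lee_fin.
- exact: measurable_funeM.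
- by move=> x _; rewrite lee_fin mulr_ge0// sqr_ge0.
rewrite ge0_integralZl// integral_cst// /Q leb2_rect ?(ltW ab) ?(ltW cd)// -/Q.
apply: leeD.
  by rewrite EFinM -muleA; apply: lee_wpmul2l => //; rewrite lee_fin.
rewrite -EFinM -mulrA EFinM [X in _ <= X * _]EFinM -muleA.
by apply: lee_wpmul2l => //; rewrite lee_fin.
Qed.

End poincare.

(** * Sobolev functions and traces *)

Section smooth_functions.
Context {R : realType}.
Notation mu := (@lebesgue_measure R).
Implicit Types (f g F : R * R -> R).

Lemma derive_eq0_near F (z v : R * R) : (\forall x \near z, F x = 0) -> 'D_v F z = 0.
Proof.
move=> F0; rewrite /derive; apply: cvg_lim => //.
have F0z : F z = 0 by exact: nbhs_singleton F0.
apply: (cvg_trans (near_eq_cvg _)); last exact: cvg_cst.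
have c : h *: v + z @[h --> (0 : R)] --> 0 *: v + z.
  by apply: cvgD; [apply: cvgZl; exact: cvg_id|exact: cvg_cst].
rewrite scale0r add0r in c.
have H : \forall h \near (0 : R)^', F (h *: v + z) = 0 by exact: (nbhs_dnbhs (c _ F0)).
by near=> h; rewrite /= F0z subr0 (near H)// scaler0.
Unshelve. all: by end_near. Qed.

Lemma continuous_hline (y : R) : continuous (fun t : R => (t, y)).
Proof.
move=> t; apply: (@cvg_pair _ _ _ _ (nbhs t) (nbhs y) _ _ _ id (cst y)); first exact: cvg_id.
exact: cvg_cst.
Qed.

Lemma continuous_vline (x : R) : continuous (fun t : R => (x, t)).
Proof.
move=> t; apply: (@cvg_pair _ _ _ _ (nbhs x) (nbhs t) _ _ _ (cst x) id); first exact: cvg_cst.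
exact: cvg_id.
Qed.

Lemma continuous_box_bounded F (a b c d : R) : continuous F ->
  exists2 B, 0 <= B & forall x : R * R, ([set` `[a, b]] `*` [set` `[c, d]]) x -> `|F x| <= B.
Proof.
move=> cF; have K : compact ([set` `[a, b]] `*` [set` `[c, d]] : set (R * R)).
  by apply: compact_setX; exact: segment_compact.
have := compact_bounded (continuous_compact (continuous_subspaceT cF) K).
move=> [M [_ HM]]; exists (`|M| + 1); first by rewrite addr_ge0.
move=> x Kx; apply: (HM (`|M| + 1)); last by exists x.
by rewrite (le_lt_trans (ler_norm M))// ltrDl.
Qed.

Lemma continuous_integrable F (A : set (plane R)) (a b c d : R) : continuous F ->
  a <= b -> c <= d -> measurable A -> A `<=` rect a b c d ->
  leb2.-integrable A (fun x : plane R => (F x)%:E).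
Proof.
move=> cF ab cd mA AB; have [B B0 HB] := continuous_box_bounded a b c d cF.
have fin : (leb2 A < +oo)%E.
  apply: (@le_lt_trans _ _ (leb2 (rect a b c d : set (plane R)))).
    by apply: le_measure => //; rewrite inE//; exact: measurable_rect.
  by rewrite leb2_rect// ltry.
have mF : measurable_fun A (F : plane R -> R).
  by apply: measurable_funTS; exact: continuous_measurable_plane.
apply/integrableP; split; first exact/measurable_EFinP.
apply: (@le_lt_trans _ _ (\int[leb2]_(x in A) cst B%:E x)%E); last first.
  by rewrite integral_cst// lte_mul_pinfty.
apply: ge0_le_integral => //.
- by apply: measurableT_comp => //; exact/measurable_EFinP.
- move=> x /AB/rectE[? ? ? ?]; rewrite /= lee_fin; apply: HB.
  by split; rewrite /= in_itv/=; apply/andP; split; exact: ltW.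
Qed.

Lemma Rintegral_rect_x F (a b c d : R) : leb2.-integrable (rect a b c d) (fun x : plane R => (F x)%:E) ->
  (forall y, (\int[mu]_(x in [set` `]a, b[]) (F (x, y))%:E)%E = 0%E) ->
  \int[leb2]_(x in rect a b c d) F x = 0.
Proof.
move=> iF F0; rewrite /Rintegral integral_mkcond.
have ik := (integrable_mkcond (mu := leb2) _ (measurable_rect a b c d)).1 iF.
rewrite -(integral21_prod_meas1 ik) integral0_eq// => y _; rewrite /fubini_G.
have [yc|yc] := boolP (y \in [set` `]c, d[]); last first.
  by apply: integral0_eq => x _; rewrite patchE /rect in_setX /= (negbTE yc) andbF.
rewrite -[RHS](F0 y) [RHS]integral_mkcond; apply: eq_integral => x _.
by rewrite !patchE /rect in_setX /= yc andbT.
Qed.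

Lemma Rintegral_rect_y F (a b c d : R) : leb2.-integrable (rect a b c d) (fun x : plane R => (F x)%:E) ->
  (forall x, (\int[mu]_(y in [set` `]c, d[]) (F (x, y))%:E)%E = 0%E) ->
  \int[leb2]_(x in rect a b c d) F x = 0.
Proof.
move=> iF F0; rewrite /Rintegral integral_mkcond.
have ik := (integrable_mkcond (mu := leb2) _ (measurable_rect a b c d)).1 iF.
rewrite -(integral12_prod_meas1 ik) integral0_eq// => x _; rewrite /fubini_F.
have [xc|xc] := boolP (x \in [set` `]a, b[]); last first.
  by apply: integral0_eq => y _; rewrite patchE /rect in_setX /= (negbTE xc).
rewrite -[RHS](F0 x) [RHS]integral_mkcond; apply: eq_integral => y _.
by rewrite !patchE /rect in_setX /= xc.
Qed.

Lemma FTC_slice (g g' : R -> R) (a b : R) : a < b -> continuous g' ->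
  (forall x, is_derive x (1 : R) g (g' x)) ->
  (\int[mu]_(x in [set` `]a, b[]) (g' x)%:E = (g b - g a)%:E)%E.
Proof.
move=> ab cg' dg; have cg := is_derive_continuous dg.
rewrite -(@integral_itv_bndoo _ _ _ _ true false); last first.
  apply/measurable_EFinP; apply: measurable_funTS; exact: continuous_measurable_fun.
rewrite (@continuous_FTC2 _ g' g)//.
- exact: continuous_subspaceT.
- split.
  + by move=> x _; have [] := dg x.
  + exact: cvg_at_right_filter (cg a).
  + exact: cvg_at_left_filter (cg b).
- by move=> x _; rewrite derive1E; exact: derive_val.
Qed.

Lemma Rintegral_support (A D K : set (plane R)) F : K `<=` A -> K `<=` D ->
  (forall x, ~ K x -> F x = 0) -> \int[leb2]_(x in A) F x = \int[leb2]_(x in D) F x.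
Proof.
move=> KA KD F0.
have H B : K `<=` B -> \int[leb2]_(x in B) F x = \int[leb2]_(x in K) F x.
  move=> KB; rewrite -[in RHS](setIidr KB) Rintegral_mkcondr; apply: eq_Rintegral => x _.
  by rewrite patchE; case: ifPn => // /negP; rewrite inE => /F0.
by rewrite H// H.
Qed.

(** As phi vanishes off a compact part of Om, the integrals may be taken over a large square; there
    the partial derivative of f phi has integral 0 along every line, by the fundamental theorem of
    calculus. *)
Lemma smooth_weak_gradient (Om : set (plane R)) f : smooth f -> weak_gradient Om f (grad f).
Proof.
move=> sf phi [sphi K KOm]; set S := closure _ in K KOm.
have phi0 x : ~ S x -> \forall y \near x, phi y = 0.
  move=> Sx; have : nbhs x (~` S).
    by apply: open_nbhs_nbhs; split => //; apply: closed_openC; exact: closed_closure.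
  apply: filterS => y Sy; apply/eqP/negPn/negP => py; apply: Sy; exact: subset_closure.
have phi00 x : ~ S x -> phi x = 0 by move=> /phi0 /nbhs_singleton.
have dphi0 v x : ~ S x -> 'D_v phi x = 0 by move=> /phi0; exact: derive_eq0_near.
have [c0 c1 c2] := smooth_continuous sf; have [p0 p1 p2] := smooth_continuous sphi.
have [df _ _] := sf 1%N; have [dphi _ _] := sphi 1%N.
have [N N0 SN] : exists2 N : R, 0 < N & S `<=` rect (- N) N (- N) N.
  have [M [_ HM]] := compact_bounded K; exists (`|M| + 2); first by rewrite ltr_wpDl.
  move=> x /(HM (`|M| + 1)) H; have : `|x| <= `|M| + 1.
    by apply: H; rewrite (le_lt_trans (ler_norm M))// ltrDl.
  rewrite prod_normE ge_max => /andP[]; rewrite !ler_norml => /andP[? ?] /andP[? ?].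
  by apply/rectE; split; lra.
pose D := rect (- N) N (- N) N.
have iD g : continuous g -> leb2.-integrable D (fun x : plane R => (g x)%:E).
  by move=> cg; apply: (@continuous_integrable _ _ (- N) N (- N) N cg) => //; [lra|lra|exact: measurable_rect].
have mul (g h : R * R -> R) : continuous g -> continuous h -> continuous (fun x => g x * h x).
  by move=> cg ch x; apply: cvgM; [exact: cg|exact: ch].
have NS (x : R * R) : (x.1 = N \/ x.1 = - N) \/ (x.2 = N \/ x.2 = - N) -> ~ S x.
  by move=> H /SN/rectE[]; lra.
split.
- rewrite (@Rintegral_support Om D S)//; last by move=> x Sx; rewrite /grad/= dphi0// mulr0.
  rewrite (@Rintegral_support Om D S (fun x => (grad f x).1 * phi x))//; last by move=> x Sx; rewrite phi00// mulr0.
  apply/eqP; rewrite -addr_eq0 -RintegralD//; last 3 first.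
  + exact: measurable_rect.
  + by apply: iD; exact: mul.
  + by apply: iD; exact: mul.
  apply/eqP; apply: Rintegral_rect_x.
    by apply: iD => x; apply: cvgD; [exact: (mul _ _ c0 p1)|exact: (mul _ _ c1 p0)].
  move=> y; pose g t := f (t, y) * phi (t, y).
  have dg t : is_derive t (1 : R) g (f (t, y) * (grad phi (t, y)).1 + (grad f (t, y)).1 * phi (t, y)).
    have [[/(_ (df (t, y)).1) d1 _] e1] := partial1E f (t, y).
    have [[/(_ (dphi (t, y)).1) d2 _] e2] := partial1E phi (t, y).
    have H1 : is_derive t (1 : R) (fun t => f (t, y)) (grad f (t, y)).1.
      exact: DeriveDef d1 (esym e1).
    have H2 : is_derive t (1 : R) (fun t => phi (t, y)) (grad phi (t, y)).1.
      exact: DeriveDef d2 (esym e2).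
    by have H := is_deriveM H1 H2; apply: (is_derive_eq H); rewrite [X in _ + X]mulrC.
  rewrite (FTC_slice _ _ dg) ?gtrN//.
    by rewrite /g !phi00 ?mulr0 ?subrr//; apply: NS => /=; left; [right|left].
  have cs (k : R * R -> R) : continuous k -> continuous (fun t : R => k (t, y)).
    by move=> ck t; apply: continuous_comp; [exact: continuous_hline|exact: ck].
  by move=> t; apply: cvgD; apply: cvgM; [exact: (cs _ c0)|exact: (cs _ p1)|exact: (cs _ c1)|exact: (cs _ p0)].
- rewrite (@Rintegral_support Om D S)//; last by move=> x Sx; rewrite /grad/= dphi0// mulr0.
  rewrite (@Rintegral_support Om D S (fun x => (grad f x).2 * phi x))//; last by move=> x Sx; rewrite phi00// mulr0.
  apply/eqP; rewrite -addr_eq0 -RintegralD//; last 3 first.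
  + exact: measurable_rect.
  + by apply: iD; exact: mul.
  + by apply: iD; exact: mul.
  apply/eqP; apply: Rintegral_rect_y.
    by apply: iD => x; apply: cvgD; [exact: (mul _ _ c0 p2)|exact: (mul _ _ c2 p0)].
  move=> y; pose g t := f (y, t) * phi (y, t).
  have dg t : is_derive t (1 : R) g (f (y, t) * (grad phi (y, t)).2 + (grad f (y, t)).2 * phi (y, t)).
    have [[/(_ (df (y, t)).2) d1 _] e1] := partial2E f (y, t).
    have [[/(_ (dphi (y, t)).2) d2 _] e2] := partial2E phi (y, t).
    have H1 : is_derive t (1 : R) (fun t => f (y, t)) (grad f (y, t)).2.
      exact: DeriveDef d1 (esym e1).
    have H2 : is_derive t (1 : R) (fun t => phi (y, t)) (grad phi (y, t)).2.
      exact: DeriveDef d2 (esym e2).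
    by have H := is_deriveM H1 H2; apply: (is_derive_eq H); rewrite [X in _ + X]mulrC.
  rewrite (FTC_slice _ _ dg) ?gtrN//.
    by rewrite /g !phi00 ?mulr0 ?subrr//; apply: NS => /=; right; [right|left].
  have cs (k : R * R -> R) : continuous k -> continuous (fun t : R => k (y, t)).
    by move=> ck t; apply: continuous_comp; [exact: continuous_vline|exact: ck].
  by move=> t; apply: cvgD; apply: cvgM; [exact: (cs _ c0)|exact: (cs _ p2)|exact: (cs _ c2)|exact: (cs _ p0)].
Qed.

End smooth_functions.

Section square_norm.
Context {R : realType}.
Variables (mu : {measure set (plane R) -> \bar R}) (D : set (plane R)).
Hypothesis mD : measurable D.
Implicit Types (u v w : R * R -> R).

Definition nsq u : R := ip mu D u u.

Lemma L2_add u v : L2 mu D u -> L2 mu D v -> L2 mu D (fun x => u x + v x).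
Proof. by move=> Lu Lv; have := L2_lin mD 1 Lu Lv; under eq_fun do rewrite mul1r. Qed.

Lemma L2_diff u v : L2 mu D u -> L2 mu D v -> L2 mu D (fun x => u x - v x).
Proof.
move=> Lu Lv; have := L2_lin mD (-1) Lv Lu.
by under eq_fun do rewrite mulN1r addrC.
Qed.

Lemma bounded_L2 u B : (mu D < +oo)%E -> measurable_fun D (u : plane R -> R) ->
  (forall x, D x -> `|u x| <= B) -> L2 mu D u.
Proof.
move=> fin mu_ uB; apply/(L2P _ mD); split => //.
apply: (@le_lt_trans _ _ (\int[mu]_(x in D) cst (B ^+ 2)%:E x)%E); last first.
  by rewrite integral_cst// lte_mul_pinfty// lee_fin sqr_ge0.
apply: ge0_le_integral => //.
- by move=> x _; rewrite lee_fin sqr_ge0.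
- exact: measurable_sqr.
- move=> x /uB H; rewrite /= lee_fin -real_normK ?num_real// lerXn2r ?nnegrE//.
  exact: le_trans H.
Qed.

Lemma nsq_ge0 u : 0 <= nsq u. Proof. exact: ip_ge0. Qed.

Lemma nsqE u : L2 mu D u -> sqint mu D u = (nsq u)%:E.
Proof. exact: sqint_ip. Qed.

Lemma eq_nsq u v : (forall x, D x -> u x = v x) -> nsq u = nsq v.
Proof. by move=> uv; apply: eq_Rintegral => x; rewrite inE => /uv ->. Qed.

Lemma nsqD u v : L2 mu D u -> L2 mu D v -> nsq (fun x => u x + v x) <= 2 * nsq u + 2 * nsq v.
Proof.
move=> Lu Lv; rewrite -lee_fin -nsqE; last exact: L2_add.
by rewrite EFinD !EFinM -!nsqE//; apply: sqintD => //; [case: Lu|case: Lv].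
Qed.

Lemma nsqN u : nsq (fun x => - u x) = nsq u.
Proof. by apply: eq_Rintegral => x _; rewrite mulrNN. Qed.

Lemma L2N u : L2 mu D u -> L2 mu D (fun x => - u x).
Proof.
move=> Lu; have := L2_diff (L2_diff Lu Lu) Lu.
by under eq_fun do rewrite subrr sub0r.
Qed.

Lemma nsqB u v : L2 mu D u -> L2 mu D v -> nsq (fun x => u x - v x) <= 2 * nsq u + 2 * nsq v.
Proof. by move=> Lu Lv; have := nsqD Lu (L2N Lv); rewrite nsqN. Qed.

Lemma nsq_eq0 u : L2 mu D u -> nsq u = 0 -> {ae mu, forall x, D x -> u x = 0}.
Proof. by move=> Lu u0; apply: sqint_eq0 => //; [case: Lu|rewrite nsqE// u0]. Qed.

Lemma ae0_nsq u : L2 mu D u -> {ae mu, forall x : plane R, D x -> u x = 0} -> nsq u = 0.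
Proof.
move=> Lu u0; have : sqint mu D u = 0%E by apply: ae0_sqint => //; case: Lu.
by rewrite nsqE// => -[].
Qed.

Lemma ip_bound u v : L2 mu D u -> L2 mu D v -> ip mu D u v ^+ 2 <= nsq u * nsq v.
Proof.
move=> Lu Lv.
have H k : 0 <= nsq u * k ^+ 2 + 2 * ip mu D u v * k + nsq v.
  have Lw := L2_lin mD k Lu Lv.
  have := nsq_ge0 (fun x => k * u x + v x); rewrite /nsq ip_lin// ipC ip_lin//.
  rewrite (ipC _ _ v (fun x => k * u x + v x)) ip_lin// (ipC _ _ v u).
  by rewrite -/(nsq u) -/(nsq v); lra.
have u0 := nsq_ge0 u; have v0 := nsq_ge0 v.
have [uu0|uu0] := eqVneq (nsq u) 0.
  have [->|uv0] := eqVneq (ip mu D u v) 0; first by rewrite uu0 expr0n/= mul0r.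
  (* When u has norm 0 the polynomial in k is affine; it equals -1 at this point. *)
  have := H (- (nsq v + 1) / (2 * ip mu D u v)).
  rewrite uu0 mul0r add0r.
  have -> : 2 * ip mu D u v * (- (nsq v + 1) / (2 * ip mu D u v)) = - (nsq v + 1) by field.
  lra.
have := H (- ip mu D u v / nsq u).
have -> : nsq u * (- ip mu D u v / nsq u) ^+ 2 + 2 * ip mu D u v * (- ip mu D u v / nsq u) + nsq v
  = (nsq u * nsq v - ip mu D u v ^+ 2) / nsq u by field.
rewrite pmulr_lge0 ?invr_gt0 ?lt_def ?uu0//; lra.
Qed.

Lemma L2_sub (A : set (plane R)) u : measurable A -> A `<=` D -> L2 mu D u -> L2 mu A u.
Proof.
move=> mA AD [mu_ iu]; split; first exact: measurable_funS mu_.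
exact: integrableS iu.
Qed.

Lemma nsq_complete (u : nat -> R * R -> R) : (forall n, L2 mu D (u n)) ->
  (forall e, 0 < e -> exists n0, forall n m, (n0 <= n)%N -> (n0 <= m)%N ->
    nsq (fun x => u n x - u m x) <= e) ->
  exists2 w, L2 mu D w & forall e, 0 < e -> exists n0, forall n, (n0 <= n)%N ->
    nsq (fun x => w x - u n x) <= e.
Proof.
move=> Lu H; have [e e0|w Lw Hw] := L2_complete mD Lu _.
  have [n0 Hn] := H e e0; exists n0 => n m nn nm.
  by rewrite nsqE ?lee_fin ?Hn//; exact: L2_diff.
exists w => // e e0; have [n0 Hn] := Hw e e0; exists n0 => n nn.
by rewrite -lee_fin -nsqE ?Hn//; exact: L2_diff.
Qed.

End square_norm.

Lemma nsq_sub {R : realType} (mu : {measure set (plane R) -> \bar R}) (A D : set (plane R)) u :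
  measurable A -> measurable D -> A `<=` D -> L2 mu D u -> nsq mu A u <= nsq mu D u.
Proof.
move=> mA mD AD Lu; rewrite -lee_fin -!nsqE//; last exact: L2_sub AD _.
apply: ge0_subset_integral => //; first by apply: measurable_sqr => //; case: Lu.
by move=> x _; rewrite lee_fin sqr_ge0.
Qed.

Lemma ge0_integral_setU_le d (T : measurableType d) (R : realType)
    (mu : {measure set T -> \bar R}) (A B : set T) (f : T -> \bar R) :
  measurable A -> measurable B -> measurable_fun (A `|` B) f ->
  (forall x, (A `|` B) x -> (0 <= f x)%E) ->
  (\int[mu]_(x in A `|` B) f x <= \int[mu]_(x in A) f x + \int[mu]_(x in B) f x)%E.
Proof.
move=> mA mB mf f0; have -> : A `|` B = A `|` (B `\` A) by rewrite setUDr setDv setD0.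
have mBA : measurable (B `\` A) by exact: measurableD.
have sBA : A `|` (B `\` A) `<=` A `|` B by move=> x [|[]]; [left|right].
rewrite ge0_integral_setU//.
- apply: leeD2l; apply: ge0_subset_integral => //; last by move=> x Bx; apply: f0; right.
  exact: (measurable_funS (measurableU _ _ mA mB) (@subsetUr _ A B) mf).
- by apply: measurable_funS mf => //; exact: measurableU.
- by move=> x /sBA; exact: f0.
- by apply/disj_setPS => x [Ax []].
Qed.

Lemma nsq_setU {R : realType} (mu : {measure set (plane R) -> \bar R}) (A B : set (plane R)) u :
  measurable A -> measurable B -> A `&` B = set0 -> L2 mu (A `|` B) u ->
  nsq mu (A `|` B) u = nsq mu A u + nsq mu B u.
Proof.
move=> mA mB AB Lu; have mAB : measurable (A `|` B) by exact: measurableU.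
have LA : L2 mu A u by apply: L2_sub Lu => //; exact: subsetUl.
have LB : L2 mu B u by apply: L2_sub Lu => //; exact: subsetUr.
apply/EFin_inj; rewrite EFinD -!nsqE// /sqint ge0_integral_setU//.
- by apply: measurable_sqr => //; case: Lu.
- by move=> x _; rewrite lee_fin sqr_ge0.
- exact/disj_set2P.
Qed.

Section sobolev_space.
Context {R : realType}.
Variables (Om : set (plane R)) (a b c d : R).
Hypotheses (mOm : measurable Om) (ab : a <= b) (cd : c <= d) (bOm : Om `<=` rect a b c d).
Implicit Types (f u v g w : R * R -> R) (G H : R * R -> R * R).
Notation N := (nsq leb2 Om).
Notation B := (boundary (Om : set (R * R))).
Notation NB := (nsq hausdorff1 (B : set (plane R))).
Notation L2O := (L2 leb2 Om).
Notation L2B := (L2 hausdorff1 (B : set (plane R))).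

Lemma finite_leb2 : (leb2 Om < +oo)%E.
Proof.
apply: (@le_lt_trans _ _ (leb2 (rect a b c d : set (plane R)))).
  by apply: le_measure => //; rewrite inE//; exact: measurable_rect.
by rewrite leb2_rect// ltry.
Qed.

Lemma continuous_L2 f : continuous f -> L2O f.
Proof.
move=> cf; split.
  by apply: measurable_funTS; exact: continuous_measurable_plane.
apply: (@continuous_integrable R (fun x => f x ^+ 2) Om a b c d) => // x.
by apply: cvgM; exact: cf.
Qed.

Lemma smooth_sobolev f : smooth f -> sobolev Om f (grad f).
Proof.
move=> sf; have [c0 c1 c2] := smooth_continuous sf.
exact: And4 (continuous_L2 c0) (continuous_L2 c1) (continuous_L2 c2) (smooth_weak_gradient sf).
Qed.

Lemma sobolev_lin k u G v H : sobolev Om u G -> sobolev Om v H ->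
  sobolev Om (fun x => k * u x + v x) (fun x => (k * (G x).1 + (H x).1, k * (G x).2 + (H x).2)).
Proof.
move=> [Lu LG1 LG2 wG] [Lv LH1 LH2 wH]; split; try exact: L2_lin.
move=> f tf; have [sf _ _] := tf; have [E1 E2] := wG f tf; have [F1 F2] := wH f tf.
have [c0 c1 c2] := smooth_continuous sf.
have [L0 L1 L2] := And3 (continuous_L2 c0) (continuous_L2 c1) (continuous_L2 c2).
split.
  have := ip_lin mOm k Lu Lv L1; rewrite /ip => ->.
  have := ip_lin mOm k LG1 LH1 L0; rewrite /ip => ->.
  by rewrite E1 F1; ring.
have := ip_lin mOm k Lu Lv L2; rewrite /ip => ->.
have := ip_lin mOm k LG2 LH2 L0; rewrite /ip => ->.
by rewrite E2 F2; ring.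
Qed.

Let close u G (e : R) v H := [/\ N (fun x => u x - v x) <= e,
  N (fun x => (G x).1 - (H x).1) <= e & N (fun x => (G x).2 - (H x).2) <= e].

(** Cauchy-Schwarz bounds (X + Y)^2 by a multiple of e, because the tolerance is put on squared
    norms. With w and w' a derivative and the values of a test function, this makes the weak
    gradient relation closed. *)
Lemma ip_limit u v w w' (M : R) : L2O u -> L2O v -> L2O w -> L2O w' ->
  (forall e, 0 < e -> exists u' v', [/\ L2O u', L2O v', N (fun x => u x - u' x) <= e,
     N (fun x => v x - v' x) <= e & ip leb2 Om u' w = - ip leb2 Om v' w']) ->
  ip leb2 Om u w = - ip leb2 Om v w'.
Proof.
move=> Lu Lv Lw Lw' H.
set X := ip leb2 Om u w; set Y := ip leb2 Om v w'.
apply/eqP; rewrite -addr_eq0 -sqrf_eq0; apply/eqP.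
pose C := 2 * N w + 2 * N w'.
have C0 : 0 <= C by rewrite addr_ge0// mulr_ge0// nsq_ge0.
apply/eqP; rewrite eq_le sqr_ge0 andbT.
suff K e : 0 < e -> (X + Y) ^+ 2 <= C * e.
  apply/ler_addgt0Pr => e e0; rewrite add0r.
  have := K (e / (C + 1)); rewrite divr_gt0 ?ltr_wpDl// => /(_ isT) /le_trans; apply.
  rewrite mulrCA ler_piMr ?(ltW e0)// ler_pdivrMr ?ltr_wpDl// mul1r; lra.
move=> e0; have [u' [v' [Lu' Lv' Hu Hv E]]] := H e e0.
have EX : ip leb2 Om (fun x => u x - u' x) w = X - ip leb2 Om u' w.
  have := ip_lin mOm (-1) Lu' Lu Lw; under eq_fun do rewrite mulN1r addrC.
  by move=> ->; rewrite mulN1r addrC.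
have EY : ip leb2 Om (fun x => v x - v' x) w' = Y - ip leb2 Om v' w'.
  have := ip_lin mOm (-1) Lv' Lv Lw'; under eq_fun do rewrite mulN1r addrC.
  by move=> ->; rewrite mulN1r addrC.
have HX := ip_bound mOm (L2_diff mOm Lu Lu') Lw; have HY := ip_bound mOm (L2_diff mOm Lv Lv') Lw'.
rewrite EX in HX; rewrite EY in HY.
have -> : X + Y = (X - ip leb2 Om u' w) + (Y - ip leb2 Om v' w') by rewrite E; ring.
have w0 := nsq_ge0 leb2 Om w; have w0' := nsq_ge0 leb2 Om w'.
have : N (fun x => u x - u' x) * N w <= e * N w by rewrite ler_wpM2r.
have : N (fun x => v x - v' x) * N w' <= e * N w' by rewrite ler_wpM2r.
move: HX HY; rewrite /C; move: (X - _) (Y - _) (N w) (N w') => x y p q.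
by move=> ? ? ? ?; have := sqr_ge0 (x - y); lra.
Qed.

Lemma sobolev_closed u G : L2O u -> L2O (fun x => (G x).1) -> L2O (fun x => (G x).2) ->
  (forall e, 0 < e -> exists v H, sobolev Om v H /\ close u G e v H) -> sobolev Om u G.
Proof.
move=> Lu L1 L2 cl; split => // f tf; have [sf _ _] := tf.
have [c0 c1 c2] := smooth_continuous sf.
have [M0 M1 M2] := And3 (continuous_L2 c0) (continuous_L2 c1) (continuous_L2 c2).
split; (apply: (@ip_limit u _ _ f 0) => // e e0; have [v [H [[Lv LH1 LH2 w] [X1 X2 X3]]]] := cl e e0;
  have [E1 E2] := w f tf).
  by exists v, (fun x => (H x).1).
by exists v, (fun x => (H x).2).
Qed.

Hypothesis finB : (hausdorff1 (B : set (plane R)) < +oo)%E.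

Let mB : measurable (B : set (plane R)). Proof. exact: measurable_boundary. Qed.

Definition energy G := N (fun x => (G x).1) + N (fun x => (G x).2).

Lemma energyE G : L2O (fun x => (G x).1) -> L2O (fun x => (G x).2) ->
  (\int[leb2]_(x in Om) (dot (G x) (G x))%:E = (energy G)%:E)%E.
Proof.
move=> L1 L2; rewrite /energy EFinD -!nsqE// /sqint.
transitivity (\int[leb2]_(x in Om) (((G x).1 ^+ 2)%:E + ((G x).2 ^+ 2)%:E))%E.
  by apply: eq_integral => x _; rewrite /dot -EFinD !expr2.
apply: ge0_integralD => //.
- by move=> x _; rewrite lee_fin sqr_ge0.
- exact: (measurable_sqr L1.1).
- by move=> x _; rewrite lee_fin sqr_ge0.
- exact: (measurable_sqr L2.1).
Qed.

Definition approx u G g (e : R) f := [/\ smooth f, L2B f, N (fun x => f x - u x) <= e,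
  energy (fun x => grad f x - G x) <= e & NB (fun x => f x - g x) <= e].

Hypothesis bB : B `<=` [set` `[a, b]] `*` [set` `[c, d]].

Lemma continuous_L2B f : continuous f -> L2B f.
Proof.
move=> cf; have [M M0 HM] := continuous_box_bounded a b c d cf.
apply: (bounded_L2 mB finB (B := M)).
  by apply: measurable_funTS; exact: continuous_measurable_plane.
by move=> x Bx; apply: HM; exact: bB.
Qed.

(** Trades the sequence in [trace] for one smooth approximant per tolerance: estimates then need no
    limits, and [le_eps] removes the tolerance at the end. *)
Lemma traceP u G g : sobolev Om u G ->
  (trace Om u G g <-> L2B g /\ forall e, 0 < e -> exists f, approx u G g e f).
Proof.
move=> [Lu L1 L2 _].
have LG f : smooth f -> [/\ L2O f, L2O (fun x => (grad f x - G x).1),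
    L2O (fun x => (grad f x - G x).2) & L2B f].
  move=> sf; have [c0 c1 c2] := smooth_continuous sf.
  split; [exact: continuous_L2| | |exact: continuous_L2B].
    exact: (L2_diff mOm (continuous_L2 c1) L1).
  exact: (L2_diff mOm (continuous_L2 c2) L2).
split=> [[Lg [f sf [c1 c2 c3]]]|[Lg H]]; split => //.
  move=> e e0.
  have near (s : nat -> \bar R) : s @ \oo --> 0%E -> \forall n \near \oo, (s n <= e%:E)%E.
    move=> cs; apply: (cs [set x | (x <= e%:E)%E]).
    have : nbhs (0 : R) (fun r => (r%:E <= e%:E)%E) by
      apply/nbhs_ballP; exists e => // r; rewrite /ball/= sub0r normrN lee_fin => /ltW/(le_trans (ler_norm _)).
    exact.
  have [n [H1 H2 H3]] : exists n, [/\ N (fun x => f n x - u x) <= e,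
     energy (fun x => grad (f n) x - G x) <= e & NB (fun x => f n x - g x) <= e].
    have F := filterI (near _ c1) (filterI (near _ c2) (near _ c3)).
    have [n _ Hn] := F; have [h1 [h2 h3]] := Hn n (leqnn n).
    exists n; have [l0 l1 l2 l3] := LG _ (sf n); split; rewrite -lee_fin.
    - by rewrite -nsqE//; exact: L2_diff.
    - by rewrite -energyE.
    - by rewrite -nsqE//; exact: L2_diff.
  by have [l0 l1 l2 l3] := LG _ (sf n); exists (f n); split.
have /choice[f Hf] n := H n.+1%:R^-1 ltac:(by rewrite invr_gt0).
exists f => [n|]; first by have [] := Hf n.
have sq0 (s : nat -> \bar R) : (forall n, 0 <= s n)%E -> (forall n, s n <= (n.+1%:R^-1)%:E)%E -> s @ \oo --> 0%E.
  move=> s0 sn; apply: (squeeze_cvge (f := cst 0%E) (h := fun n => (n.+1%:R^-1)%:E)).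
  - by apply: nearW => n; rewrite s0 sn.
  - exact: cvg_cst.
  - by apply: cvg_EFin; [exact: nearW|exact: cvg_harmonic].
split; apply: sq0 => n; have [s0 lB h1 h2 h3] := Hf n; have [l0 l1 l2 l3] := LG _ s0.
- exact: sqint_ge0.
- by rewrite -/(sqint _ _ _) nsqE ?lee_fin//; exact: L2_diff.
- by rewrite energyE// lee_fin addr_ge0// nsq_ge0.
- by rewrite energyE// lee_fin.
- exact: sqint_ge0.
- by rewrite -/(sqint _ _ _) nsqE ?lee_fin//; exact: L2_diff.
Qed.

End sobolev_space.

Section traces.
Context {R : realType}.
Implicit Types (f u v g w h : R * R -> R) (G H : R * R -> R * R).

Lemma derive_lin (v x : R * R) (k : R) f g : derivable f x v -> derivable g x v ->
  derivable (fun x => k * f x + g x) x v /\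
  'D_v (fun x => k * f x + g x) x = k * 'D_v f x + 'D_v g x.
Proof.
move=> df dg; have H1 : is_derive x v f ('D_v f x) := DeriveDef df erefl.
have H2 : is_derive x v g ('D_v g x) := DeriveDef dg erefl.
by have [d e] := is_deriveD (is_deriveZ k H1) H2; split; [exact: d|exact: e].
Qed.

Lemma Ck_lin n (k : R) f g : Ck n f -> Ck n g -> Ck n (fun x => k * f x + g x).
Proof.
elim: n f g => [|n IHn] f g /=.
  by move=> cf cg x; apply: cvgD; [apply: cvgM; [exact: cvg_cst|exact: cf]|exact: cg].
move=> [df f1 f2] [dg g1 g2].
have D1 x := derive_lin k (df x).1 (dg x).1.
have D2 x := derive_lin k (df x).2 (dg x).2.
split; first by move=> x; exact: conj (D1 x).1 (D2 x).1.
  have -> : (fun x => 'D_(1, 0) (fun x0 => k * f x0 + g x0) x) = (fun x => k * (grad f x).1 + (grad g x).1).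
    by apply/funext => x; exact: (D1 x).2.
  exact: IHn.
have -> : (fun x => 'D_(0, 1) (fun x0 => k * f x0 + g x0) x) = (fun x => k * (grad f x).2 + (grad g x).2).
  by apply/funext => x; exact: (D2 x).2.
exact: IHn.
Qed.

Lemma smooth_lin (k : R) f g : smooth f -> smooth g ->
  smooth (fun x => k * f x + g x) /\
  forall x, grad (fun x => k * f x + g x) x = (k * (grad f x).1 + (grad g x).1, k * (grad f x).2 + (grad g x).2).
Proof.
move=> sf sg; split; first by move=> n; exact: Ck_lin.
have [df _ _] := sf 1%N; have [dg _ _] := sg 1%N => x.
have [_ e1] := derive_lin k (df x).1 (dg x).1; have [_ e2] := derive_lin k (df x).2 (dg x).2.
by rewrite /grad e1 e2.
Qed.

Lemma smooth_cst (k : R) : smooth (fun _ : R * R => k) /\ forall x, grad (fun _ : R * R => k) x = 0.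
Proof.
have gE (c : R) : forall x : R * R, grad (fun=> c) x = 0.
  by move=> x; rewrite /grad !derive_cst.
split=> // n; elim: n k => [|n IHn] k /=; first by move=> x; exact: cvg_cst.
split; first by move=> x; split; exact: derivable_cst.
  have -> : (fun x : R * R => 'D_(1, 0) (fun=> k) x) = (fun=> 0) by apply/funext => x; rewrite derive_cst.
  exact: IHn.
have -> : (fun x : R * R => 'D_(0, 1) (fun=> k) x) = (fun=> 0) by apply/funext => x; rewrite derive_cst.
exact: IHn.
Qed.

Lemma nsq_lin (mu : {measure set (plane R) -> \bar R}) (D : set (plane R)) (mD : measurable D) (k : R) u v :
  L2 mu D u -> L2 mu D v -> nsq mu D (fun x => k * u x + v x) <= 2 * k ^+ 2 * nsq mu D u + 2 * nsq mu D v.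
Proof.
move=> Lu Lv; have Lku : L2 mu D (fun x => k * u x).
  have := L2_lin mD k Lu (L2_diff mD Lu Lu).
  by under eq_fun do rewrite subrr addr0.
apply: le_trans (nsqD mD Lku Lv) _; rewrite lerD2r -mulrA ler_wpM2l//.
by rewrite -lee_fin EFinM -!nsqE// sqintZ//; case: Lu.
Qed.

Variables (Om : set (plane R)) (a b c d : R).
Hypotheses (mOm : measurable Om) (ab : a <= b) (cd : c <= d) (bOm : Om `<=` rect a b c d).
Notation B := (boundary (Om : set (R * R))).
Hypothesis finB : (hausdorff1 (B : set (plane R)) < +oo)%E.
Hypothesis bB : B `<=` [set` `[a, b]] `*` [set` `[c, d]].
Notation N := (nsq leb2 Om).
Notation NB := (nsq hausdorff1 (B : set (plane R))).
Let mB : measurable (B : set (plane R)). Proof. exact: measurable_boundary. Qed.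
Let tP := traceP mOm ab cd bOm finB bB.
Let cL2 := continuous_L2 mOm ab cd bOm.

Lemma approx_L2 u G g e f : sobolev Om u G -> L2 hausdorff1 (B : set (plane R)) g -> approx Om u G g e f ->
  [/\ L2 leb2 Om (fun x => f x - u x), L2 leb2 Om (fun x => (grad f x - G x).1),
      L2 leb2 Om (fun x => (grad f x - G x).2) & L2 hausdorff1 (B : set (plane R)) (fun x => f x - g x)].
Proof.
move=> [Lu L1 L2 _] Lg [sf Lf _ _ _]; have [c0 c1 c2] := smooth_continuous sf.
exact: And4 (L2_diff mOm (cL2 c0) Lu) (L2_diff mOm (cL2 c1) L1) (L2_diff mOm (cL2 c2) L2) (L2_diff mB Lf Lg).
Qed.

Lemma smooth_trace f : smooth f -> trace Om f (grad f) f.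
Proof.
move=> sf; have [c0 c1 c2] := smooth_continuous sf.
have Lb := continuous_L2B finB bB c0.
apply/(tP _ (smooth_sobolev mOm ab cd bOm sf)); split => // e e0; exists f.
have z (mu : {measure set (plane R) -> \bar R}) (D : set (plane R)) (u : R * R -> R) :
    (forall x, u x = 0) -> nsq mu D u = 0.
  by move=> u0; rewrite /nsq /ip /Rintegral integral0_eq// => x _; rewrite u0 mul0r.
have e1 x : (grad f x - grad f x).1 = 0 by rewrite subrr.
have e2 x : (grad f x - grad f x).2 = 0 by rewrite subrr.
have e3 x : f x - f x = 0 by rewrite subrr.
split; [exact: sf|exact: Lb|by rewrite (z _ _ _ e3) ltW| |by rewrite (z _ _ _ e3) ltW].
by rewrite /energy (z _ _ _ e1) (z _ _ _ e2) addr0 ltW.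
Qed.

Lemma trace_lin k u G g v H h : sobolev Om u G -> trace Om u G g ->
  sobolev Om v H -> trace Om v H h ->
  trace Om (fun x => k * u x + v x) (fun x => (k * (G x).1 + (H x).1, k * (G x).2 + (H x).2))
    (fun x => k * g x + h x).
Proof.
move=> su tu sv tv; have sw := sobolev_lin mOm ab cd bOm k su sv.
have [Lg Hu] := (tP _ su).1 tu; have [Lh Hv] := (tP _ sv).1 tv.
apply/(tP _ sw); split; first exact: L2_lin.
move=> e e0; pose C := 2 * k ^+ 2 + 2.
have C0 : 0 < C by rewrite ltr_wpDl// mulr_ge0// sqr_ge0.
have [f af] := Hu (e / C) (divr_gt0 e0 C0); have [f' af'] := Hv (e / C) (divr_gt0 e0 C0).
have [L1 L2 L3 L4] := approx_L2 su Lg af; have [M1 M2 M3 M4] := approx_L2 sv Lh af'.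
case: af af' => sf Lf h1 h2 h3 [sf' Lf' k1 k2 k3].
have [sF gF] := smooth_lin k sf sf'.
have key x y : x <= e / C -> y <= e / C -> 2 * k ^+ 2 * x + 2 * y <= e.
  move=> hx hy; have E : C * (e / C) = e by field; rewrite gt_eqF.
  have k0 : 0 <= k ^+ 2 by exact: sqr_ge0.
  have : 2 * k ^+ 2 * x <= 2 * k ^+ 2 * (e / C) by rewrite ler_wpM2l// mulr_ge0.
  by move: E; rewrite /C; move: (e / _) hx hy => z; lra.
exists (fun x => k * f x + f' x); split => //; first exact: L2_lin.
- apply: le_trans (key _ _ h1 k1); apply: le_trans (nsq_lin mOm k L1 M1).
  by rewrite (@eq_nsq _ _ _ _ (fun x => k * (f x - u x) + (f' x - v x)))// => x _; ring.
- apply: le_trans (key _ _ h2 k2); rewrite /energy !mulrDr addrACA.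
  apply: lerD.
    apply: le_trans (nsq_lin mOm k L2 M2).
    by rewrite (@eq_nsq _ _ _ _ (fun x => k * (grad f x - G x).1 + (grad f' x - H x).1))// => x _; rewrite gF /=; ring.
  apply: le_trans (nsq_lin mOm k L3 M3).
  by rewrite (@eq_nsq _ _ _ _ (fun x => k * (grad f x - G x).2 + (grad f' x - H x).2))// => x _; rewrite gF /=; ring.
- apply: le_trans (key _ _ h3 k3); apply: le_trans (nsq_lin mB k L4 M4).
  by rewrite (@eq_nsq _ _ _ _ (fun x => k * (f x - g x) + (f' x - h x)))// => x _; ring.
Qed.

Lemma trace_closed u G g : sobolev Om u G -> L2 hausdorff1 (B : set (plane R)) g ->
  (forall e, 0 < e -> exists v H h, [/\ sobolev Om v H, trace Om v H h &
     [/\ N (fun x => u x - v x) <= e, energy Om (fun x => G x - H x) <= e & NB (fun x => g x - h x) <= e]]) ->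
  trace Om u G g.
Proof.
move=> su Lg cl; apply/(tP _ su); split => // e e0.
(* An approximant of an approximant: |x - y|^2 <= 2 |x|^2 + 2 |y|^2 turns two errors e / 4 into
   e. *)
have e4 : 0 < e / 4 by rewrite divr_gt0.
have [v [H [h [sv tv [h1 h2 h3]]]]] := cl _ e4.
have [Lh /(_ _ e4)[f af]] := (tP _ sv).1 tv.
have [M1 M2 M3 M4] := approx_L2 sv Lh af.
have [Lu L1 L2 _] := su; have [Lv K1 K2 _] := sv.
case: af => sf Lf k1 k2 k3; exists f; split => //.
- rewrite (@eq_nsq _ _ _ _ (fun x => (f x - v x) - (u x - v x))); last by move=> x _; ring.
  by apply: le_trans (nsqB mOm M1 (L2_diff mOm Lu Lv)) _; lra.
- have : energy Om (fun x => grad f x - G x) <= 2 * energy Om (fun x => grad f x - H x) + 2 * energy Om (fun x => G x - H x).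
    rewrite /energy !mulrDr addrACA; apply: lerD.
      rewrite (@eq_nsq _ _ _ _ (fun x => (grad f x - H x).1 - ((G x).1 - (H x).1))); last by move=> x _ /=; ring.
      exact: (nsqB mOm M2 (L2_diff mOm L1 K1)).
    rewrite (@eq_nsq _ _ _ _ (fun x => (grad f x - H x).2 - ((G x).2 - (H x).2))); last by move=> x _ /=; ring.
    exact: (nsqB mOm M3 (L2_diff mOm L2 K2)).
  by move=> ?; lra.
- rewrite (@eq_nsq _ _ _ _ (fun x => (f x - h x) - (g x - h x))); last by move=> x _; ring.
  by apply: le_trans (nsqB mB M4 (L2_diff mB Lg Lh)) _; lra.
Qed.

End traces.

(** * Trace and Friedrichs inequalities on rectangles *)

Section sides.
Context {R : realType}.
Notation mu := (@lebesgue_measure R).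

Section one_variable.
Local Open Scope ereal_scope.
Variables (g g' : R -> R) (c d s : R).
Hypotheses (cd : (c < d)%R) (cg' : continuous g').
Hypothesis dg : forall x, is_derive x (1%R : R) g (g' x).
Hypothesis s_cd : (c <= s <= d)%R.

Let I := \int[mu]_(t in [set` `]c, d[]) ((g' t) ^+ 2)%:E.
Let J := \int[mu]_(t in [set` `]c, d[]) ((g t) ^+ 2)%:E.

Let mg : measurable_fun setT g. Proof. by apply: continuous_measurable_fun; exact: is_derive_continuous dg. Qed.
Let mg' : measurable_fun setT g'. Proof. exact: continuous_measurable_fun. Qed.

Let oscillation (t : R) : (c <= t <= d)%R -> ((g s - g t) ^+ 2)%:E <= (d - c)%:E * I.
Proof.
have I0 : 0 <= I by apply: integral_ge0 => x _; rewrite lee_fin sqr_ge0.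
suff H (p q : R) : (c <= p)%R -> (p < q)%R -> (q <= d)%R -> ((g q - g p) ^+ 2)%:E <= (d - c)%:E * I.
  case/andP: s_cd => cs sd /andP[ct td]; have [st|ts|->] := ltgtP s t.
  - by rewrite -sqrrN opprB; exact: H.
  - exact: H.
  - by rewrite subrr expr0n /= mule_ge0// lee_fin subr_ge0 ltW.
move=> cp pq qd; have E := FTC_slice pq cg' dg.
have mI : mu [set` `]p, q[] = (q - p)%:E by rewrite /= lebesgue_measure_itv/= lte_fin pq.
have := @sqr_Rintegral_le _ _ _ mu [set` `]p, q[] g' (q - p) (measurable_itv _) _ mI (measurable_funTS mg').
rewrite subr_gt0 => /(_ pq); rewrite /Rintegral E /= => /le_trans; apply.
apply: lee_pmul.
- by rewrite lee_fin subr_ge0 ltW.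
- by apply: integral_ge0 => x _; rewrite lee_fin sqr_ge0.
- by rewrite lee_fin lerB.
apply: ge0_subset_integral => //.
- by apply/measurable_EFinP; apply: measurable_funTS; exact: measurable_funX.
- by move=> x _; rewrite lee_fin sqr_ge0.
- by move=> x /=; rewrite !in_itv/= => /andP[? ?]; apply/andP; split; lra.
Qed.

Let I_fin : (d - c)%:E * I = +oo \/ exists2 r : R, (0 <= r)%R & (d - c)%:E * I = r%:E.
Proof.
have [->|H] := eqVneq ((d - c)%:E * I) +oo; [by left|right].
have I0 : 0 <= (d - c)%:E * I.
  apply: mule_ge0; first by rewrite lee_fin subr_ge0 ltW.
  by apply: integral_ge0 => x _; rewrite lee_fin sqr_ge0.
exists (fine ((d - c)%:E * I)); first exact: fine_ge0.
by rewrite fineK// ge0_fin_numE// ltey.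
Qed.

Let dc0 : (0 < d - c)%R. Proof. by rewrite subr_gt0. Qed.
Let J0 : 0 <= J. Proof. by apply: integral_ge0 => x _; rewrite lee_fin sqr_ge0. Qed.
Let I0 : 0 <= I. Proof. by apply: integral_ge0 => x _; rewrite lee_fin sqr_ge0. Qed.
Let mJ : measurable_fun [set` `]c, d[] (fun t => ((g t) ^+ 2)%:E).
Proof. by apply/measurable_EFinP; apply: measurable_funTS; exact: measurable_funX. Qed.

Let integral_cst_itv (k : R) : \int[mu]_(t in [set` `]c, d[]) k%:E = ((d - c) * k)%:E.
Proof. by rewrite integral_cst//= lebesgue_measure_itv/= lte_fin cd -EFinB -EFinM mulrC. Qed.

(** Integrate g(s)^2 <= 2 g(t)^2 + 2 (g(s) - g(t))^2 over t, the last square being bounded by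
    [oscillation]. *)
Lemma trace_1d : ((d - c) * (g s) ^+ 2)%:E <= 2%:E * J + (2 * (d - c) ^+ 2)%:E * I.
Proof.
have -> : (2 * (d - c) ^+ 2)%:E * I = (2 * (d - c))%:E * ((d - c)%:E * I).
  by rewrite muleA -EFinM expr2 mulrA.
have [->|[r r0 E]] := I_fin.
  rewrite gt0_muley ?lte_fin ?mulr_gt0// addey ?leey// gt_eqF//.
  by rewrite (lt_le_trans (ltNyr 0%R))// mule_ge0// lee_fin.
rewrite E -integral_cst_itv.
apply: (@le_trans _ _ (\int[mu]_(t in [set` `]c, d[]) (2%:E * ((g t) ^+ 2)%:E + (2 * r)%:E))).
  apply: ge0_le_integral => //.
  - by move=> x _; rewrite lee_fin sqr_ge0.
  - by apply: emeasurable_funD => //; exact: measurable_funeM.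
  - move=> t; rewrite /= in_itv/= => /andP[ct td].
    have := @oscillation t; rewrite (ltW ct) (ltW td) => /(_ isT); rewrite E lee_fin => H.
    by rewrite -EFinM -EFinD lee_fin; have := sqr_ge0 (g s - 2 * g t); move: H; nra.
rewrite ge0_integralD//; last 3 first.
- by move=> x _; rewrite mule_ge0// lee_fin ?sqr_ge0.
- exact: measurable_funeM.
- by move=> x _; rewrite lee_fin mulr_ge0.
rewrite ge0_integralZl//; last by move=> x _; rewrite lee_fin sqr_ge0.
by rewrite integral_cst_itv -/J leeD2l// -EFinM lee_fin mulrA (mulrC (d - c)%R).
Qed.

(** The inequality behind [trace_1d] with the roles of s and t exchanged. *)
Lemma friedrichs_1d : J <= (2 * (d - c))%:E * ((g s) ^+ 2)%:E + (2 * (d - c) ^+ 2)%:E * I.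
Proof.
have -> : (2 * (d - c) ^+ 2)%:E * I = (2 * (d - c))%:E * ((d - c)%:E * I).
  by rewrite muleA -EFinM expr2 mulrA.
have [->|[r r0 E]] := I_fin.
  by rewrite gt0_muley ?lte_fin ?mulr_gt0// addey ?leey.
rewrite E -!EFinM -EFinD.
apply: (@le_trans _ _ (\int[mu]_(t in [set` `]c, d[]) (2 * (g s) ^+ 2 + 2 * r)%:E)).
  apply: ge0_le_integral => //.
  - by move=> x _; rewrite lee_fin sqr_ge0.
  - move=> t; rewrite /= in_itv/= => /andP[ct td].
    have := @oscillation t; rewrite (ltW ct) (ltW td) => /(_ isT); rewrite E lee_fin => H.
    by rewrite lee_fin; have := sqr_ge0 (2 * g s - g t); move: H; nra.
by rewrite integral_cst_itv lee_fin; lra.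
Qed.

End one_variable.

Section fubini_rect.
Local Open Scope ereal_scope.
Variables (F : R * R -> \bar R) (a b c d : R).
Hypothesis mF : measurable_fun setT (F : plane R -> \bar R).
Hypothesis F0 : forall x, 0 <= F x.

Let mH : measurable (setT `*` [set` `]c, d[] : set (plane R)). Proof. exact: measurableX. Qed.
Let mV : measurable ([set` `]a, b[] `*` setT : set (plane R)). Proof. exact: measurableX. Qed.

Lemma measurable_slice1 : measurable_fun setT (fun x => \int[mu]_(y in [set` `]c, d[]) F (x, y)).
Proof.
rewrite (_ : (fun x => _) = fubini_F mu (F \_ (setT `*` [set` `]c, d[] : set (plane R)))).
  apply: measurable_fun_fubini_tonelli_F; last by move=> x; exact: erestrict_ge0.
  by apply/(measurable_restrictT _ _).1 => //; exact: measurable_funS mF.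
apply/funext => x; rewrite /fubini_F [LHS]integral_mkcond; apply: eq_integral => y _.
by rewrite !patchE in_setX in_setT.
Qed.

Lemma measurable_slice2 : measurable_fun setT (fun y => \int[mu]_(x in [set` `]a, b[]) F (x, y)).
Proof.
rewrite (_ : (fun x => _) = fubini_G mu (F \_ ([set` `]a, b[] `*` setT : set (plane R)))).
  apply: measurable_fun_fubini_tonelli_G; last by move=> x; exact: erestrict_ge0.
  by apply/(measurable_restrictT _ _).1 => //; exact: measurable_funS mF.
apply/funext => x; rewrite /fubini_G [LHS]integral_mkcond; apply: eq_integral => y _.
by rewrite !patchE in_setX in_setT andbT.
Qed.

Lemma integral_rect1 : \int[leb2]_(x in rect a b c d) F x =
   \int[mu]_(x in [set` `]a, b[]) \int[mu]_(y in [set` `]c, d[]) F (x, y).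
Proof.
rewrite integral_mkcond; have mr := @measurable_rect R a b c d.
rewrite /leb2 fubini_tonelli1; last 2 first.
- by apply/(measurable_restrictT _ _).1 => //; exact: measurable_funS mF.
- by move=> x; apply: erestrict_ge0.
rewrite [RHS]integral_mkcond; apply: eq_integral => x _; rewrite /fubini_F patchE.
case: ifPn => xa.
  rewrite [RHS]integral_mkcond; apply: eq_integral => y _.
  by rewrite !patchE /rect in_setX /= xa.
by apply: integral0_eq => y _; rewrite patchE /rect in_setX /= (negbTE xa).
Qed.

End fubini_rect.

Lemma integral_le_lin (D : set R) (p q r : R -> \bar R) (k1 k2 k3 : R) : measurable D ->
  0 <= k1 -> 0 <= k2 -> 0 <= k3 ->
  measurable_fun setT p -> measurable_fun setT q -> measurable_fun setT r ->
  (forall x, 0 <= p x)%E -> (forall x, 0 <= q x)%E -> (forall x, 0 <= r x)%E ->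
  (forall x, k1%:E * p x <= k2%:E * q x + k3%:E * r x)%E ->
  (k1%:E * \int[mu]_(x in D) p x <= k2%:E * \int[mu]_(x in D) q x + k3%:E * \int[mu]_(x in D) r x)%E.
Proof.
move=> mD k10 k20 k30 mp mq mr p0 q0 r0 H.
have m (f : R -> \bar R) : measurable_fun setT f -> measurable_fun D f by exact: measurable_funTS.
rewrite -!ge0_integralZl//; try exact: m; try by move=> *; rewrite lee_fin.
rewrite -ge0_integralD//.
- apply: ge0_le_integral => //.
  + by move=> x _; rewrite mule_ge0.
  + by apply: measurable_funeM; exact: m.
  + by apply: emeasurable_funD; apply: measurable_funeM; exact: m.
- by move=> x _; rewrite mule_ge0.
- by apply: measurable_funeM; exact: m.
- by move=> x _; rewrite mule_ge0.
- by apply: measurable_funeM; exact: m.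
Qed.

Let sq_meas (f : R * R -> R) : continuous f -> measurable_fun setT (fun x : plane R => ((f x) ^+ 2)%:E).
Proof.
move=> cf; apply/measurable_EFinP; apply: measurable_funX; exact: continuous_measurable_plane.
Qed.

Let sq_meas1 (g : R -> R) : continuous g ->
  measurable_fun (setT : set (measurableTypeR R)) (fun x : measurableTypeR R => ((g x) ^+ 2)%:E).
Proof.
move=> cg; apply/measurable_EFinP; apply: measurable_funX; exact: continuous_measurable_fun.
Qed.

Let slice_derive1 f : smooth f -> forall y t, is_derive t (1 : R) (fun t => f (t, y)) (grad f (t, y)).1.
Proof.
move=> sf y t; have [df _ _] := sf 1%N.
have [[/(_ (df (t, y)).1) d1 _] e1] := partial1E f (t, y).
exact: DeriveDef d1 (esym e1).
Qed.

Let slice_derive2 f : smooth f -> forall x t, is_derive t (1 : R) (fun t => f (x, t)) (grad f (x, t)).2.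
Proof.
move=> sf x t; have [df _ _] := sf 1%N.
have [[/(_ (df (x, t)).2) d2 _] e2] := partial2E f (x, t).
exact: DeriveDef d2 (esym e2).
Qed.

Let slice_continuous1 (f : R * R -> R) : continuous f -> forall y, continuous ((fun t => f (t, y)) : R -> R).
Proof. by move=> cf y t; apply: continuous_comp; [exact: continuous_hline|exact: cf]. Qed.

Let slice_continuous2 (f : R * R -> R) : continuous f -> forall x, continuous ((fun t => f (x, t)) : R -> R).
Proof. by move=> cf x t; apply: continuous_comp; [exact: continuous_vline|exact: cf]. Qed.

Local Open Scope ereal_scope.

Let hsegE (f : R * R -> R) (a b s : R) : continuous f ->
  sqint hausdorff1 (hseg a b s) f = \int[mu]_(t in [set` `]a, b[]) ((f (t, s)) ^+ 2)%:E.
Proof.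
move=> cf; rewrite /sqint (integral_hseg _ _ _ (f := fun x => ((f x) ^+ 2)%:E)).
- apply: (@integral_itv_bndoo _ _ _ _ true false); apply: measurable_funTS.
  exact: sq_meas1 (@slice_continuous1 _ cf s).
- exact: sq_meas.
- by move=> x; rewrite lee_fin sqr_ge0.
Qed.

Let vsegE (f : R * R -> R) (a b s : R) : continuous f ->
  sqint hausdorff1 (vseg a b s) f = \int[mu]_(t in [set` `]a, b[]) ((f (s, t)) ^+ 2)%:E.
Proof.
move=> cf; rewrite /sqint (integral_vseg _ _ _ (f := fun x => ((f x) ^+ 2)%:E)).
- apply: (@integral_itv_bndoo _ _ _ _ true false); apply: measurable_funTS.
  exact: sq_meas1 (@slice_continuous2 _ cf s).
- exact: sq_meas.
- by move=> x; rewrite lee_fin sqr_ge0.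
Qed.

Lemma trace_hseg f (a b c d s : R) : smooth f -> (c < d)%R -> (c <= s <= d)%R ->
  (d - c)%:E * sqint hausdorff1 (hseg a b s) f <=
  2%:E * sqint leb2 (rect a b c d) f +
  (2 * (d - c) ^+ 2)%:E * sqint leb2 (rect a b c d) (fun x => (grad f x).2).
Proof.
move=> sf cd scd; have [c0 c1 c2] := smooth_continuous sf.
rewrite hsegE// /sqint !integral_rect1//; try exact: sq_meas; try by move=> x; rewrite lee_fin sqr_ge0.
apply: integral_le_lin => //.
- by rewrite subr_ge0 ltW.
- by rewrite mulr_ge0// sqr_ge0.
- exact: sq_meas1 (@slice_continuous1 _ c0 s).
- by apply: (measurable_slice1 (F := fun x => ((f x) ^+ 2)%:E)) => [|x]; [exact: sq_meas|rewrite lee_fin sqr_ge0].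
- by apply: (measurable_slice1 (F := fun x => ((grad f x).2 ^+ 2)%:E)) => [|x]; [exact: sq_meas|rewrite lee_fin sqr_ge0].
- by move=> x; rewrite ?lee_fin ?sqr_ge0//; apply: integral_ge0 => y _; rewrite lee_fin sqr_ge0.
- by move=> x; rewrite ?lee_fin ?sqr_ge0//; apply: integral_ge0 => y _; rewrite lee_fin sqr_ge0.
- by move=> x; rewrite ?lee_fin ?sqr_ge0//; apply: integral_ge0 => y _; rewrite lee_fin sqr_ge0.
- move=> x; rewrite -EFinM.
  exact: (trace_1d cd (@slice_continuous2 _ c2 x) (slice_derive2 sf x) scd).
Qed.

Lemma friedrichs_hseg f (a b c d s : R) : smooth f -> (c < d)%R -> (c <= s <= d)%R ->
  sqint leb2 (rect a b c d) f <= (2 * (d - c))%:E * sqint hausdorff1 (hseg a b s) f +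
  (2 * (d - c) ^+ 2)%:E * sqint leb2 (rect a b c d) (fun x => (grad f x).2).
Proof.
move=> sf cd scd; have [c0 c1 c2] := smooth_continuous sf.
rewrite hsegE// /sqint !integral_rect1//; try exact: sq_meas; try by move=> x; rewrite lee_fin sqr_ge0.
rewrite -[leLHS]mul1e; apply: integral_le_lin => //.
- by rewrite mulr_ge0// subr_ge0 ltW.
- by rewrite mulr_ge0// sqr_ge0.
- by apply: (measurable_slice1 (F := fun x => ((f x) ^+ 2)%:E)) => [|x]; [exact: sq_meas|rewrite lee_fin sqr_ge0].
- exact: sq_meas1 (@slice_continuous1 _ c0 s).
- by apply: (measurable_slice1 (F := fun x => ((grad f x).2 ^+ 2)%:E)) => [|x]; [exact: sq_meas|rewrite lee_fin sqr_ge0].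
- by move=> x; rewrite ?lee_fin ?sqr_ge0//; apply: integral_ge0 => y _; rewrite lee_fin sqr_ge0.
- by move=> x; rewrite ?lee_fin ?sqr_ge0//; apply: integral_ge0 => y _; rewrite lee_fin sqr_ge0.
- by move=> x; rewrite ?lee_fin ?sqr_ge0//; apply: integral_ge0 => y _; rewrite lee_fin sqr_ge0.
- move=> x; rewrite mul1e.
  exact: (friedrichs_1d cd (@slice_continuous2 _ c2 x) (slice_derive2 sf x) scd).
Qed.

Lemma trace_vseg f (a b c d s : R) : smooth f -> (a < b)%R -> (a <= s <= b)%R ->
  (b - a)%:E * sqint hausdorff1 (vseg c d s) f <=
  2%:E * sqint leb2 (rect a b c d) f +
  (2 * (b - a) ^+ 2)%:E * sqint leb2 (rect a b c d) (fun x => (grad f x).1).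
Proof.
move=> sf cd scd; have [c0 c1 c2] := smooth_continuous sf.
have M0 := sq_meas c0; have M1 := sq_meas c1.
have P (F : R * R -> R) x : 0 <= ((F x) ^+ 2)%:E by rewrite lee_fin sqr_ge0.
rewrite (vsegE _ _ _ c0) /sqint (integral_rect a b c d M0 (P _)) (integral_rect a b c d M1 (P _)).
apply: integral_le_lin => //.
- by rewrite subr_ge0 ltW.
- by rewrite mulr_ge0// sqr_ge0.
- exact: sq_meas1 (@slice_continuous2 _ c0 s).
- exact: (measurable_slice2 _ _ M0 (P _)).
- exact: (measurable_slice2 _ _ M1 (P _)).
- by move=> x; rewrite ?lee_fin ?sqr_ge0//; apply: integral_ge0 => y _; rewrite lee_fin sqr_ge0.
- by move=> x; rewrite ?lee_fin ?sqr_ge0//; apply: integral_ge0 => y _; rewrite lee_fin sqr_ge0.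
- move=> y; rewrite -EFinM.
  exact: (trace_1d cd (@slice_continuous1 _ c1 y) (slice_derive1 sf y) scd).
Qed.

End sides.

(** * Minimizers of Rayleigh quotients *)

Section direct_method.
Context {R : realType} {V : lmodType R}.
Implicit Types (S : set V) (a b : V -> V -> R) (u v w : V).

Definition linear_set S := forall k u v, S u -> S v -> S (k *: u + v).

(** Relative to S because the forms will be integrals, which are bilinear on square integrable
    functions only, while V consists of all functions. *)
Definition semi_inner S a :=
  [/\ forall u v, S u -> S v -> a u v = a v u,
      forall k u v w, S u -> S v -> S w -> a (k *: u + v) w = k * a u w + a v w
    & forall u, S u -> 0 <= a u u].

Lemma semi_inner_quad S a k u v : linear_set S -> semi_inner S a -> S u -> S v ->
  a (k *: u + v) (k *: u + v) = k ^+ 2 * a u u + 2 * k * a u v + a v v.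
Proof.
move=> SL [sym lin _] Su Sv; have Sw := SL k _ _ Su Sv.
rewrite lin// (sym u)// (sym v)// !lin// (sym v u)//; ring.
Qed.

Lemma cauchy_schwarz S a u v : linear_set S -> semi_inner S a -> S u -> S v ->
  a u v ^+ 2 <= a u u * a v v.
Proof.
move=> SL Sa Su Sv; have [sym lin pos] := Sa.
have H k := @semi_inner_quad S a k u v SL Sa Su Sv.
have P k : 0 <= k ^+ 2 * a u u + 2 * k * a u v + a v v.
  by rewrite -H; apply: pos; apply: SL.
have auu := pos _ Su; have avv := pos _ Sv.
have [uu0|uu0] := eqVneq (a u u) 0.
  have [->|uv0] := eqVneq (a u v) 0; first by rewrite uu0 expr0n/= mul0r.
  have := P (- (a v v + 1) / (2 * a u v)).
  rewrite uu0 mulr0 add0r.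
  have -> : 2 * (- (a v v + 1) / (2 * a u v)) * a u v = - (a v v + 1) by field.
  lra.
have := P (- a u v / a u u).
have -> : (- a u v / a u u) ^+ 2 * a u u + 2 * (- a u v / a u u) * a u v + a v v
  = (a u u * a v v - a u v ^+ 2) / a u u by field.
rewrite pmulr_lge0 ?invr_gt0 ?lt_def ?uu0//; lra.
Qed.

Lemma rayleigh_critical S a nu u w : linear_set S -> semi_inner S a ->
  forall b, semi_inner S b -> S u -> S w ->
  (forall k, nu * b (k *: w + u) (k *: w + u) <= a (k *: w + u) (k *: w + u)) ->
  a u u <= nu * b u u -> a u w = nu * b u w.
Proof.
move=> SL Sa b Sb Su Sw H auu; have [syma _ _] := Sa; have [symb _ _] := Sb.
rewrite syma// (symb u)//; apply/eqP; rewrite -subr_eq0; apply/eqP.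
set c := _ - _; set q := a w w - nu * b w w.
have P k : 0 <= k ^+ 2 * q + 2 * k * c.
  have := H k; rewrite (semi_inner_quad k SL Sa Sw Su) (semi_inner_quad k SL Sb Sw Su) /q /c; nra.
have [//|c0] := eqVneq c 0.
(* As t > q and t > 0, the point k = - c / t makes k^2 q + 2 k c = (c / t)^2 (q - 2 t) negative
   unless c = 0. *)
pose t := `|q| + 1.
have t0 : 0 < t by rewrite ltr_wpDl.
have qt : q < t by rewrite (le_lt_trans (ler_norm q))// ltrDl.
have := P (- c / t).
have -> : (- c / t) ^+ 2 * q + 2 * (- c / t) * c = (c / t) ^+ 2 * (q - 2 * t).
  by field; rewrite gt_eqF.
have : 0 < (c / t) ^+ 2 by rewrite exprn_even_gt0//= mulf_neq0// invr_eq0 gt_eqF.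
nra.
Qed.

(** Bolzano-Weierstrass with an explicit rate. The indices need not increase: k <= s k is all that
    the minimizing sequence asks for. *)
Lemma subsequence_cvg N (x : nat -> 'rV[R]_N) (M : R) :
  (forall n i, `|x n ord0 i| <= M) ->
  exists (z : 'rV[R]_N) (s : nat -> nat), forall k, (k <= s k)%N /\
    forall i, `|z ord0 i - x (s k) ord0 i| < k.+1%:R^-1.
Proof.
move=> xM.
have cA := @rV_compact _ N (fun=> [set` `[- M, M]]) (fun=> @segment_compact R _ _).
have xA : (x n @[n --> \oo]) [set v : 'rV[R]_N | forall i, [set` `[- M, M]] (v ord0 i)].
  by exists 0%N => // n _ i /=; rewrite in_itv/= -ler_norml.
have [z [_ zc]] := cA _ _ xA.
have P k : exists n, (k <= n)%N /\ forall i, `|z ord0 i - x n ord0 i| < k.+1%:R^-1.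
  have k0 : 0 < k.+1%:R^-1 :> R by [].
  have [] := zc [set x n | n in [set n | (k <= n)%N]] (ball z k.+1%:R^-1).
    by exists k => // n /= kn; exists n.
    exact: nbhsx_ballx.
  move=> _ [[n /= kn <-] zx]; exists n; split => // i.
  exact: (zx.2 ord0 i).
have [s sP] := choice P; by exists z, s.
Qed.

(* By the parallelogram identity a minimizing sequence of the Rayleigh quotient
   along which the finitely many functionals l converge is Cauchy. *)
Lemma direct_method S a b N (l : 'I_N -> V -> R) (K C : R) (e phi : V) :
  linear_set S -> semi_inner S a -> semi_inner S b ->
  (forall s : nat -> V, (forall n, S (s n)) ->
    (forall eps, 0 < eps -> exists n0, forall n m, (n0 <= n)%N -> (n0 <= m)%N ->
      a (s n - s m) (s n - s m) + b (s n - s m) (s n - s m) <= eps) ->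
    exists2 u, S u & forall eps, 0 < eps -> exists n0, forall n, (n0 <= n)%N ->
      a (u - s n) (u - s n) + b (u - s n) (u - s n) <= eps) ->
  0 <= K ->
  (forall u, S u -> b u u <= K * a u u + \sum_(i < N) l i u ^+ 2) ->
  (forall i k u v, S u -> S v -> l i (k *: u + v) = k * l i u + l i v) ->
  (forall i u, S u -> l i u ^+ 2 <= C * (a u u + b u u)) ->
  S e -> a e e = 0 -> 0 < b e e ->
  S phi -> b phi e = 0 -> 0 < b phi phi -> K * a phi phi < b phi phi ->
  exists u lambda, [/\ S u, 0 < b u u, b u e = 0,
    lambda * b phi phi <= a phi phi & forall w, S w -> a u w = lambda * b u w].
Proof.
move=> SL Sa Sb compl K0 loc llin lbd Se aee bee Sphi bphie bphi Kphi.
have [syma lina posa] := Sa; have [symb linb posb] := Sb.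
have S0 : S 0 by have := SL (-1) _ _ Se Se; rewrite scaleN1r addNr.
have Sscale k u : S u -> S (k *: u) by move=> Su; have := SL k _ _ Su S0; rewrite addr0.
have SB u v : S u -> S v -> S (u - v).
  by move=> Su Sv; have := SL (-1) _ _ Sv Su; rewrite scaleN1r addrC.
have f0 f w : semi_inner S f -> S w -> f 0 w = 0.
  by move=> [_ linf _] Sw; have := linf (-1) 0 0 w S0 S0 Sw; rewrite scaler0 addr0; lra.
have fZ f k u w : semi_inner S f -> S u -> S w -> f (k *: u) w = k * f u w.
  by move=> Sf Su Sw; have [_ linf _] := Sf; have := linf k u 0 w Su S0 Sw; rewrite !addr0 f0// addr0.
have fZZ f k u : semi_inner S f -> S u -> f (k *: u) (k *: u) = k ^+ 2 * f u u.
  move=> Sf Su; have [symf _ _] := Sf; have Sku := Sscale k _ Su.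
  by rewrite fZ// symf// fZ//; ring.
have fB f u v : semi_inner S f -> S u -> S v ->
    f (u - v) (u - v) = f u u - 2 * f u v + f v v.
  move=> Sf Su Sv; have [symf _ _] := Sf; rewrite addrC -scaleN1r (semi_inner_quad (-1) SL Sf Sv Su).
  by rewrite (symf u)//; ring.
pose E := [set a u u | u in [set u | [/\ S u, b u u = 1 & b u e = 0]]].
have normalize v : S v -> b v e = 0 -> 0 < b v v -> E (a v v / b v v).
  move=> Sv bve bvv; exists ((Num.sqrt (b v v))^-1 *: v); last first.
    by rewrite fZZ// exprVn sqr_sqrtr ?ltW// mulrC.
  split; [exact: Sscale| |by rewrite fZ// bve mulr0].
  by rewrite fZZ// exprVn sqr_sqrtr ?ltW// mulVf// gt_eqF.
have E0 : has_lbound E by exists 0 => _ [u [Su _ _] <-]; exact: posa.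
have Ei : has_inf E by split => //; exists (a phi phi / b phi phi); exact: normalize.
pose nu := inf E.
have nu0 : 0 <= nu by apply: lb_le_inf; [exact: Ei.1 | move=> _ [u [Su _ _] <-]; exact: posa].
have nule v : S v -> b v e = 0 -> nu * b v v <= a v v.
  move=> Sv bve; have := posb _ Sv; rewrite le_eqVlt => /predU1P[<-|bvv].
    by rewrite mulr0 posa.
  by rewrite -ler_pdivlMr//; apply: inf_lbound => //; exact: normalize.
have nuphi := nule _ Sphi bphie.
(* The test function phi puts the infimum strictly below 1 / K, which allows the term K a of the
   hypothesis on b to be absorbed. *)
have Knu : K * nu < 1.
  rewrite -(ltr_pM2r bphi) mul1r; apply: le_lt_trans Kphi.
  by rewrite -mulrA ler_wpM2l.
have ex n : exists u, [/\ S u, b u u = 1, b u e = 0 & a u u <= nu + n.+1%:R^-1].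
  have n0 : 0 < n.+1%:R^-1 :> R by rewrite invr_gt0.
  have [_ [u [Su bu1 bue] <-] au] := inf_adherent n0 Ei.
  by exists u; split => //; exact: ltW.
have [u0 u0P] := choice ex.
pose M := C * (nu + 2) + 1.
have lM n i : `|(\row_j l j (u0 n)) ord0 i| <= M.
  rewrite mxE; have [Su bu _ au] := u0P n.
  have au1 : a (u0 n) (u0 n) <= nu + 1.
    by apply: le_trans au _; rewrite lerD2l invf_le1 ?ler1n.
  have := lbd i _ Su; rewrite bu -real_normK ?num_real// => H.
  have C0 : 0 <= C.
    rewrite -(@pmulr_lge0 _ (a (u0 n) (u0 n) + 1)) ?ltr_wpDl ?posa//.
    by apply: le_trans H; rewrite sqr_ge0.
  have {}H : `|l i (u0 n)| ^+ 2 <= C * (nu + 2).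
    by apply: le_trans H _; rewrite ler_wpM2l//; lra.
  have := sqr_ge0 (`|l i (u0 n)| - 1); rewrite /M; nra.
have [z [s sP]] := subsequence_cvg lM.
pose v k := u0 (s k).
have vP k : [/\ S (v k), b (v k) (v k) = 1, b (v k) e = 0 & a (v k) (v k) <= nu + k.+1%:R^-1].
  have [? ? ? au] := u0P (s k); split => //; apply: le_trans au _.
  by rewrite lerD2l lef_pV2 ?posrE// ler_nat ltnS; have [] := sP k.
(* For the difference d of two terms, the parallelogram identity gives a(d) <= nu b(d) + 4 eta, and
   the hypothesis on b gives b(d) <= K a(d) + 4 N eta. Eliminating a(d) yields b(d) <= c1 eta, and
   then a(d) + b(d) <= c2 eta. *)
pose c1 := (4 * K + 4 * N%:R) / (1 - K * nu).
have K1 : 0 <= 1 - K * nu by lra.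
have c10 : 0 <= c1.
  by apply: divr_ge0 => //; rewrite addr_ge0// mulr_ge0.
pose c2 := (nu + 1) * c1 + 4.
have c20 : 0 < c2 by rewrite ltr_wpDl// mulr_ge0// addr_ge0.
have cauchy n0 n m : (n0 <= n)%N -> (n0 <= m)%N ->
    a (v n - v m) (v n - v m) + b (v n - v m) (v n - v m) <= c2 * n0.+1%:R^-1.
  set eta : R := n0.+1%:R^-1 => nn mm.
  have eta0 : 0 < eta by rewrite invr_gt0.
  have eta1 : eta <= 1 by rewrite invf_le1 ?ler1n.
  have le_eta k : (n0 <= k)%N -> k.+1%:R^-1 <= eta.
    by move=> ?; rewrite lef_pV2 ?posrE// ler_nat ltnS.
  have [Sn bn bne an] := vP n; have [Sm bm bme am] := vP m.
  have {}an := le_trans an (lerD (lexx nu) (le_eta _ nn)).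
  have {}am := le_trans am (lerD (lexx nu) (le_eta _ mm)).
  have SS : S (v n + v m) by have := SL 1 _ _ Sn Sm; rewrite scale1r.
  have Sd := SB _ _ Sn Sm.
  have bs : b (v n + v m) e = 0 by have := linb 1 _ _ _ Sn Sm Se; rewrite scale1r bne bme; lra.
  have := nule _ SS bs.
  have par f : semi_inner S f -> f (v n + v m) (v n + v m) =
      2 * f (v n) (v n) + 2 * f (v m) (v m) - f (v n - v m) (v n - v m).
    move=> Sf; rewrite fB//; have := semi_inner_quad 1 SL Sf Sn Sm.
    by rewrite scale1r => ->; ring.
  rewrite !par// bn bm.
  set A := a _ _ in an *; set A' := a (v m) _ in am *; set ad := a _ _; set bd := b _ _ => H1.
  have H2 : bd <= K * ad + 4 * N%:R * eta.
    apply: le_trans (loc _ Sd) _; rewrite lerD2l.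
    apply: (@le_trans _ _ (\sum_(i < N) 4 * eta)); last first.
      by rewrite sumr_const card_ord -mulr_natr; lra.
    apply: ler_sum => i _.
    have -> : l i (v n - v m) = l i (v n) - l i (v m).
      by rewrite addrC -scaleN1r llin//; ring.
    have := (sP n).2 i; have := (sP m).2 i; rewrite !mxE -/(v n) -/(v m).
    move=> /lt_le_trans/(_ (le_eta _ mm)); rewrite ltr_norml => /andP[? ?].
    move=> /lt_le_trans/(_ (le_eta _ nn)); rewrite ltr_norml => /andP[? ?].
    nra.
  have H3 : bd <= c1 * eta.
    rewrite /c1 mulrAC ler_pdivlMr ?subr_gt0//; nra.
  rewrite /c2; nra.
have [||u Su uP] := compl v; [by move=> n; have [] := vP n| |].
  move=> eps eps0; exists (Num.bound (c2 / eps)) => n m nn mm.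
  apply: le_trans (cauchy _ _ _ nn mm) _.
  rewrite ler_pdivrMr// mulrC -ler_pdivrMr//.
  by rewrite (le_trans (ltW (archi_boundP _)))// ?divr_ge0 ?ltW// ltr_nat.
have near eps : 0 < eps -> exists k, [/\ a (u - v k) (u - v k) <= eps,
    b (u - v k) (u - v k) <= eps & k.+1%:R^-1 <= eps].
  move=> eps0; have [n0 n0P] := uP _ eps0.
  pose k := maxn n0 (Num.bound eps^-1).
  have Sd : S (u - v k) by apply: SB => //; have [] := vP k.
  have := n0P k (leq_maxl _ _); have := posa _ Sd; have := posb _ Sd.
  exists k; split; [lra|lra|].
  rewrite invf_ple ?posrE//; apply: (le_trans (ltW (archi_boundP _))); first by rewrite invr_ge0 ltW.
  by rewrite ler_nat leqW// leq_maxr.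
have bue : b u e = 0.
  apply/eqP; rewrite -sqrf_eq0 eq_le sqr_ge0 andbT; apply/ler_addgt0Pr => eps eps0.
  rewrite add0r; have [|k [_ bk _]] := near (eps / b e e); first by rewrite divr_gt0.
  have [Sk _ bke _] := vP k.
  have -> : b u e = b (u - v k) e.
    by rewrite addrC -scaleN1r linb// bke; ring.
  apply: (le_trans (cauchy_schwarz SL Sb (SB _ _ Su Sk) Se)).
  by rewrite -ler_pdivlMr.
have young f t x y : semi_inner S f -> 0 < t -> S x -> S y ->
    f x x <= (1 + t) * f y y + (1 + t^-1) * f (x - y) (x - y).
  move=> Sf t0 Sx Sy; have [symf _ posf] := Sf.
  have Sd := SB _ _ Sx Sy.
  have := semi_inner_quad 1 SL Sf Sd Sy; rewrite scale1r subrK => ->.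
  have := posf _ (SL (- t) _ _ Sy Sd); rewrite (semi_inner_quad (- t) SL Sf Sy Sd) (symf y)//.
  set r := f y y; set q := f (x - y) y; set p := f (x - y) (x - y) => H.
  have -> : 1 ^+ 2 * p + 2 * 1 * q + r =
    (1 + t) * r + (1 + t^-1) * p - ((- t) ^+ 2 * r + 2 * (- t) * q + p) / t.
    by field; rewrite gt_eqF.
  by rewrite gerBl divr_ge0// ltW.
have auu : a u u <= nu.
  apply/ler_addgt0Pr => eps eps0.
  (* With a(u - v) <= t^2 and the Young parameter t, the error is at most t (nu + 4), which this t
     keeps below eps. *)
  pose t := eps / (5 * (nu + 1 + eps)).
  have n1 : 0 < nu + 1 + eps by lra.
  have t0 : 0 < t by rewrite divr_gt0// mulr_gt0.
  have tE : t * (5 * (nu + 1 + eps)) = eps by rewrite divfK// mulf_neq0// gt_eqF.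
  have t1 : t <= 1 by rewrite ler_pdivrMr ?mulr_gt0//; lra.
  have [|k [ak _ kt]] := near (t ^+ 2); first by rewrite exprn_gt0.
  have [Sk _ _ av] := vP k.
  have := young a t _ _ Sa t0 Su Sk.
  have : (1 + t^-1) * a (u - v k) (u - v k) <= (1 + t^-1) * t ^+ 2.
    by rewrite ler_pM2l// addr_gt0// invr_gt0.
  have -> : (1 + t^-1) * t ^+ 2 = t ^+ 2 + t by field; rewrite gt_eqF.
  have t2 : t ^+ 2 <= t by rewrite expr2 ler_piMl// ltW.
  have : (1 + t) * a (v k) (v k) <= (1 + t) * (nu + t ^+ 2).
    by rewrite ler_wpM2l ?(le_trans av) ?lerD2l//; lra.
  nra.
have buu : 1 <= b u u.
  apply/ler_addgt0Pr => eps eps0.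
  pose t := eps / (5 * (b u u + 1 + eps)).
  have b0 := posb _ Su.
  have n1 : 0 < b u u + 1 + eps by lra.
  have t0 : 0 < t by rewrite divr_gt0// mulr_gt0.
  have tE : t * (5 * (b u u + 1 + eps)) = eps by rewrite divfK// mulf_neq0// gt_eqF.
  have t1 : t <= 1 by rewrite ler_pdivrMr ?mulr_gt0//; lra.
  have [|k [_ bk kt]] := near (t ^+ 2); first by rewrite exprn_gt0.
  have [Sk bv _ _] := vP k.
  have := young b t _ _ Sb t0 Sk Su; rewrite bv.
  have -> : b (v k - u) (v k - u) = b (u - v k) (u - v k).
    by rewrite !fB// (symb u)//; ring.
  have : (1 + t^-1) * b (u - v k) (u - v k) <= (1 + t^-1) * t ^+ 2.
    by rewrite ler_pM2l// addr_gt0// invr_gt0.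
  have -> : (1 + t^-1) * t ^+ 2 = t ^+ 2 + t by field; rewrite gt_eqF.
  nra.
exists u, nu; split => //; first by lra.
have aue w : S w -> a e w = 0.
  move=> Sw; apply/eqP; rewrite -sqrf_eq0 eq_le sqr_ge0 andbT.
  by apply: le_trans (cauchy_schwarz SL Sa Se Sw) _; rewrite aee mul0r.
move=> w Sw.
(* The minimum is known only against directions orthogonal to e, so w is projected; the component
   along e contributes nothing, as a e vanishes on S and b u e = 0. *)
pose c := b w e / b e e.
pose w0 := - c *: e + w.
have Sw0 : S w0 by exact: SL.
have bw0 : b w0 e = 0 by rewrite linb// /c; field; rewrite gt_eqF.
have : a u w0 = nu * b u w0.
  apply: (rayleigh_critical SL Sa Sb Su Sw0) => [k|]; last by nra.
  apply: nule; first exact: SL.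
  by rewrite linb// bw0 bue; ring.
rewrite syma ?(symb u)// lina// linb// aue// (symb e)// bue (syma w)// (symb w)//.
by rewrite !mulr0 !add0r.
Qed.

End direct_method.

(** * Inequalities on the dumbbell *)

Section geometry.
Context {R : realType}.
Variables (l L w h : R).

Definition thin := [/\ 0 < w, w < h, h < 1, w <= l & l <= 1 /\ 1 <= L].
Hypothesis th : thin.

Lemma thin_admissible : admissible l L w h.
Proof. by case: th => ? ? ? ? [? ?]; split; lra. Qed.

Notation Om := (dumbbell l L w h : set (R * R)).
Notation B := (boundary Om).

Definition sides (a b c d : R) : set (R * R) :=
  hseg a b c `|` hseg a b d `|` (vseg c d a `|` vseg c d b).

Definition room1 : set (plane R) := rect (-1) 0 0 1.
Definition room2 : set (plane R) := rect 0 l 0 w.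
Definition room3 : set (plane R) := rect l (l + L) 0 h.

Lemma measurable_sides a b c d : measurable (sides a b c d : set (plane R)).
Proof.
by apply: measurableU; apply: measurableU; [exact: measurable_hseg..|exact: measurable_vseg|exact: measurable_vseg].
Qed.

Lemma hseg_sub (a b c a' b' : R) : a' <= a -> b <= b' -> hseg a b c `<=` hseg a' b' c.
Proof.
move=> aa bb _ [t /= + <-]; rewrite in_itv/= => /andP[? ?]; exists t => //=.
by rewrite in_itv/=; apply/andP; split; lra.
Qed.

Lemma vseg_sub (a b c a' b' : R) : a' <= a -> b <= b' -> vseg a b c `<=` vseg a' b' c.
Proof.
move=> aa bb _ [t /= + <-]; rewrite in_itv/= => /andP[? ?]; exists t => //=.
by rewrite in_itv/=; apply/andP; split; lra.
Qed.

(** The right side is larger, as it contains the doorways, but it consists of the full perimeters of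
    three rectangles, to which [smooth_sides] applies. *)
Lemma boundary_sub_sides : B `<=` sides (-1) 0 0 1 `|` (sides 0 l 0 w `|` sides l (l + L) 0 h).
Proof.
have ad := thin_admissible; case: th => ? ? ? ? [? ?].
move=> x /(boundary_dumbbell_sub ad)[|[|[|[|[|[|[|]]]]]]] H.
- move: H => [t /= + <-]; rewrite in_itv/= => /andP[t1 t2].
  have hin (a b : R) : a <= t -> t <= b -> hseg a b 0 (t, 0).
    by move=> ? ?; exists t => //=; rewrite in_itv/=; apply/andP.
  have [t0|t0] := leP t 0; first by left; left; left; exact: hin.
  have [tl|tl] := leP t l; first by right; left; left; left; apply: hin => //; lra.
  by right; right; left; left; apply: hin => //; lra.
- by left; right; left.
- by right; right; right; right.
- by right; left; left; right.
- by left; right; right; apply: vseg_sub H; lra.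
- by left; left; right.
- by right; right; right; left; apply: vseg_sub H; lra.
- by right; right; left; right.
Qed.

Lemma hausdorff1_sides a b c d : a <= b -> c <= d ->
  (hausdorff1 (sides a b c d : set (plane R)) <= (2 * (b - a) + 2 * (d - c))%:E)%E.
Proof.
move=> ab cd.
have len (p q : R) : p <= q -> lebesgue_measure ([set` `[p, q]] : set R) = (q - p)%:E.
  by move=> pq; rewrite lebesgue_measure_itv/= lte_fin; case: ltgtP pq => // -> _; rewrite subrr.
have U (X Y : set (plane R)) : (hausdorff1 (X `|` Y) <= hausdorff1 X + hausdorff1 Y)%E.
  exact: outer_measureU2.
apply: le_trans (U _ _) _; apply: le_trans (leeD (U _ _) (U _ _)) _.
rewrite !hausdorff1_hseg !hausdorff1_vseg !len// -!EFinD lee_fin; lra.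
Qed.

Lemma hausdorff1_boundary : (hausdorff1 (B : set (plane R)) <= (2 * L + 10)%:E)%E.
Proof.
case: th => ? ? ? ? [? ?].
have U (X Y : set (plane R)) : (hausdorff1 (X `|` Y) <= hausdorff1 X + hausdorff1 Y)%E.
  exact: outer_measureU2.
apply: le_trans (le_hausdorff1 boundary_sub_sides) _.
apply: le_trans (U _ _) _; apply: le_trans (leeD2l _ (U _ _)) _.
have H1 := @hausdorff1_sides (-1) 0 0 1 ltac:(lra) ltac:(lra).
have H2 := @hausdorff1_sides 0 l 0 w ltac:(lra) ltac:(lra).
have H3 := @hausdorff1_sides l (l + L) 0 h ltac:(lra) ltac:(lra).
apply: le_trans (leeD H1 (leeD H2 H3)) _.
by rewrite -!EFinD lee_fin; lra.
Qed.

Lemma finite_boundary : (hausdorff1 (B : set (plane R)) < +oo)%E.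
Proof. exact: le_lt_trans hausdorff1_boundary (ltry _). Qed.

Lemma bottom_sub (a b : R) : -1 <= a -> b <= l + L -> hseg a b 0 `<=` B.
Proof.
move=> ? ?; apply: subset_trans (bottom_sub_boundary thin_admissible).
exact: hseg_sub.
Qed.

Lemma dumbbell_box : Om `<=` rect (-2) (L + 2) (-1) 2.
Proof.
case: th => ? ? ? ? [? ?].
move=> x /(dumbbellE thin_admissible)[? ? ? H]; apply/rectE.
by case: H => [|[]|[]] *; split; lra.
Qed.

Lemma boundary_box : B `<=` [set` `[(-2), L + 2]] `*` [set` `[(-1), 2]].
Proof.
have ad := thin_admissible; case: th => ? ? ? ? [? ?].
have H (a b c : R) : -2 <= a -> b <= L + 2 -> -1 <= c -> c <= 2 ->
    hseg a b c `<=` [set` `[(-2), L + 2]] `*` [set` `[(-1), 2]].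
  move=> ? ? ? ? _ [t /= + <-]; rewrite in_itv/= => /andP[? ?].
  by split; rewrite /= in_itv/=; apply/andP; split; lra.
have V (a b c : R) : -1 <= a -> b <= 2 -> -2 <= c -> c <= L + 2 ->
    vseg a b c `<=` [set` `[(-2), L + 2]] `*` [set` `[(-1), 2]].
  move=> ? ? ? ? _ [t /= + <-]; rewrite in_itv/= => /andP[? ?].
  by split; rewrite /= in_itv/=; apply/andP; split; lra.
move=> x /(boundary_dumbbell_sub ad)[|[|[|[|[|[|[|]]]]]]].
all: first [by apply: H; lra|by apply: V; lra].
Qed.

Lemma rect_sub_dumbbell (a b c d : R) :
  [\/ [/\ -1 <= a, b <= l + L, 0 <= c & d <= w], [/\ -1 <= a, b <= 0, 0 <= c & d <= 1]
    | [/\ l <= a, b <= l + L, 0 <= c & d <= h]] -> rect a b c d `<=` Om.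
Proof.
have ad := thin_admissible; case: th => ? ? ? ? [? ?].
move=> H x /rectE[? ? ? ?]; apply/(dumbbellE ad).
case: H => [[? ? ? ?]|[? ? ? ?]|[? ? ? ?]].
- by split; [lra..|apply: Or31; lra].
- by split; [lra..|apply: Or32; lra].
- by split; [lra..|apply: Or33; lra].
Qed.

Lemma room1_sub : room1 `<=` Om.
Proof. by apply: rect_sub_dumbbell; apply: Or32. Qed.
Lemma room2_sub : room2 `<=` Om.
Proof. by case: th => ? ? ? ? [? ?]; apply: rect_sub_dumbbell; apply: Or31; split; lra. Qed.
Lemma room3_sub : room3 `<=` Om.
Proof. by apply: rect_sub_dumbbell; apply: Or33. Qed.

Lemma measurable_Om : measurable (Om : set (plane R)).
Proof. exact: measurable_dumbbell. Qed.

Lemma leb2_dumbbell : L * h <= 1 -> (1 <= leb2 (Om : set (plane R)) <= 5%:E)%E.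
Proof.
move=> Lh; have mO := measurable_Om; case: th => ? ? ? ? [? ?]; apply/andP; split.
  have <- : leb2 room1 = 1%E by rewrite leb2_rect//; congr EFin; ring.
  by apply: le_measure; rewrite ?inE//; [exact: measurable_rect|exact: room1_sub].
have m := @measurable_rect R.
rewrite /dumbbell; apply: le_trans (measureU2 _ _ _) _; [exact: measurableU| |]; first exact: m.
apply: le_trans (leeD2r _ (measureU2 _ _ _)) _; [exact: m|exact: m|].
have H1 : (leb2 (rect (-1) 0 0 1 : set (plane R)) <= 1%:E)%E by rewrite leb2_rect// lee_fin; lra.
have H2 : (leb2 (rect (-1) (l + L) 0 w : set (plane R)) <= 3%:E)%E.
  by rewrite leb2_rect//; [rewrite lee_fin; nra|lra|lra].
have H3 : (leb2 (rect l (l + L) 0 h : set (plane R)) <= 1%:E)%E.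
  by rewrite leb2_rect//; [rewrite lee_fin; lra|lra|lra].
by apply: le_trans (leeD (leeD H1 H2) H3) _; rewrite -!EFinD lee_fin; lra.
Qed.

(** The doorways lie on the two null lines x.1 = 0 and x.1 = l. *)
Lemma dumbbell_ae_rooms : exists2 V : set (plane R), measurable V /\ leb2 V = 0%E &
  Om `\` V `<=` room1 `|` (room2 `|` room3).
Proof.
have ad := thin_admissible; case: th => ? ? ? ? [? ?].
exists ([set 0] `*` setT `|` [set l] `*` setT); last first.
  move=> x [/(dumbbellE ad)[? ? ? H] V].
  have x0 : x.1 != 0 by apply/eqP => x0; apply: V; left.
  have xl : x.1 != l by apply/eqP => xl; apply: V; right.
  have [xn|xp|] := ltgtP x.1 0; last by move/eqP: x0.
    by left; apply/rectE; split; [lra..|case: H => [|[]|[]]; lra].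
  have [xn'|xp'|] := ltgtP x.1 l; last by move/eqP: xl.
    by right; left; apply/rectE; split; [lra..|case: H => [|[]|[]]; lra].
  by right; right; apply/rectE; split; [lra..|case: H => [|[]|[]]; lra].
have z (t : R) : leb2 ([set t] `*` setT : set (plane R)) = 0%E.
  by rewrite /leb2/= product_measure1E//= lebesgue_measure_set1 mul0e.
have m (t : R) : measurable ([set t] `*` setT : set (plane R)) by exact: measurableX.
split; first exact: measurableU.
apply/eqP; rewrite -measure_le0.
by apply: le_trans (measureU2 _ _ _) _ => //; rewrite [X in (X + _)%E]z [X in (_ + X)%E]z adde0.
Qed.

Lemma nsq_rooms u : L2 leb2 (Om : set (plane R)) u ->
  nsq leb2 Om u <= nsq leb2 room1 u + nsq leb2 room2 u + nsq leb2 room3 u.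
Proof.
move=> Lu; have mO := measurable_Om.
have m1 : measurable room1 by exact: measurable_rect.
have m2 : measurable room2 by exact: measurable_rect.
have m3 : measurable room3 by exact: measurable_rect.
have L1 := L2_sub mO m1 room1_sub Lu; have L2' := L2_sub mO m2 room2_sub Lu; have L3 := L2_sub mO m3 room3_sub Lu.
have [V [mV V0] sub] := dumbbell_ae_rooms.
rewrite -addrA -lee_fin !EFinD -!nsqE// /sqint.
have m2O := measurable_sqr Lu.1.
have p0 : forall x : plane R, Om x -> (0 <= ((u x) ^+ 2)%:E)%E by move=> x _; rewrite lee_fin sqr_ge0.
rewrite (ge0_negligible_integral mV mO m2O p0 V0).
have sU : room1 `|` (room2 `|` room3) `<=` Om.
  by move=> x [/room1_sub//|[/room2_sub//|/room3_sub//]].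
apply: (@le_trans _ _ (\int[leb2]_(x in room1 `|` (room2 `|` room3)) ((u x) ^+ 2)%:E)%E).
  apply: ge0_subset_integral => //.
  - exact: measurableD.
  - by apply: measurableU => //; exact: measurableU.
  - exact: measurable_funS sU m2O.
  - by move=> x _; rewrite lee_fin sqr_ge0.
apply: le_trans (ge0_integral_setU_le _ _ _ _ _) _ => //.
- exact: measurableU.
- exact: measurable_funS sU m2O.
- by move=> x _; rewrite lee_fin sqr_ge0.
apply: leeD2l; apply: ge0_integral_setU_le => //.
- by apply: measurable_funS m2O => // x [/room2_sub//|/room3_sub//].
- by move=> x _; rewrite lee_fin sqr_ge0.
Qed.

End geometry.

Section norms.
Context {R : realType}.
Variable mu : {measure set (plane R) -> \bar R}.

Lemma nsq_setU_le (A A' : set (plane R)) u : measurable A -> measurable A' -> L2 mu (A `|` A') u ->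
  nsq mu (A `|` A') u <= nsq mu A u + nsq mu A' u.
Proof.
move=> mA mB Lu; have mAB : measurable (A `|` A') by exact: measurableU.
have LA : L2 mu A u by apply: L2_sub Lu => //; exact: subsetUl.
have LB : L2 mu A' u by apply: L2_sub Lu => //; exact: subsetUr.
rewrite -lee_fin EFinD -!nsqE//; apply: ge0_integral_setU_le => //.
  exact: measurable_sqr Lu.1.
by move=> x _; rewrite lee_fin sqr_ge0.
Qed.

Lemma L2_cst (A : set (plane R)) (k : R) : measurable A -> (mu A < +oo)%E -> L2 mu A (fun=> k).
Proof. by move=> mA fA; apply: (bounded_L2 mA fA (B := `|k|)). Qed.

Lemma nsq_cst (A : set (plane R)) (k m : R) : measurable A -> mu A = m%:E -> nsq mu A (fun=> k) = k ^+ 2 * m.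
Proof. by move=> mA Am; rewrite /nsq /ip Rintegral_cst// Am /= expr2. Qed.

(** On the overlap r, the constant al - be is the difference of u - be and u - al. *)
Lemma mean_gap (A A' r : set (plane R)) u (al be p q m : R) :
  measurable A -> measurable A' -> measurable r -> r `<=` A -> r `<=` A' -> mu r = m%:E ->
  L2 mu A (fun x => u x - al) -> L2 mu A' (fun x => u x - be) ->
  nsq mu A (fun x => u x - al) <= p -> nsq mu A' (fun x => u x - be) <= q ->
  (al - be) ^+ 2 * m <= 2 * p + 2 * q.
Proof.
move=> mA mA' mr rA rA' rm LA LA' Hp Hq.
have := nsqB mr (L2_sub mA' mr rA' LA') (L2_sub mA mr rA LA).
rewrite (@eq_nsq _ _ _ _ (fun=> al - be)); last by move=> x _; ring.
rewrite (nsq_cst _ mr rm) => /le_trans; apply.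
have := nsq_sub mr mA rA LA; have := nsq_sub mr mA' rA' LA'; lra.
Qed.

Lemma nsq_shift (A : set (plane R)) u (al be m : R) : measurable A -> mu A = m%:E ->
  L2 mu A (fun x => u x - al) ->
  nsq mu A (fun x => u x - be) <= 2 * nsq mu A (fun x => u x - al) + 2 * (al - be) ^+ 2 * m.
Proof.
move=> mA Am LA; have fA : (mu A < +oo)%E by rewrite Am ltry.
have := nsqD mA LA (L2_cst (al - be) mA fA); rewrite (nsq_cst _ mA Am).
rewrite (@eq_nsq _ _ _ _ (fun x => u x - be)); last by move=> x _; ring.
by rewrite mulrA.
Qed.

End norms.

Section smooth_sides.
Context {R : realType}.
Implicit Types f : R * R -> R.

Lemma continuous_L2_finite (mu : {measure set (plane R) -> \bar R}) (A : set (plane R)) f (a b c d : R) :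
  continuous f -> measurable A -> (mu A < +oo)%E -> A `<=` [set` `[a, b]] `*` [set` `[c, d]] -> L2 mu A f.
Proof.
move=> cf mA fA Ab; have [M M0 HM] := continuous_box_bounded a b c d cf.
apply: (bounded_L2 mA fA (B := M)); last by move=> x Ax; apply: HM; exact: Ab.
by apply: measurable_funTS; exact: continuous_measurable_plane.
Qed.

Lemma sides_box (a b c d : R) : a <= b -> c <= d -> sides a b c d `<=` [set` `[a, b]] `*` [set` `[c, d]].
Proof.
move=> ab cd x [[|]|[|]] [t /= + <-]; rewrite in_itv/= => /andP[? ?];
  by split => /=; rewrite ?in_itv/=; apply/andP; split => //; lra.
Qed.

Lemma rect_box (a b c d : R) : rect a b c d `<=` [set` `[a, b]] `*` [set` `[c, d]].
Proof. by move=> x /rectE[? ? ? ?]; split; rewrite /= in_itv/=; apply/andP; split; exact: ltW. Qed.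

Lemma smooth_L2_rect f (a b c d : R) : smooth f -> a <= b -> c <= d ->
  [/\ L2 leb2 (rect a b c d) f, L2 leb2 (rect a b c d) (fun x => (grad f x).1) &
      L2 leb2 (rect a b c d) (fun x => (grad f x).2)].
Proof.
move=> sf ab cd; have [c0 c1 c2] := smooth_continuous sf.
have mr := @measurable_rect R a b c d.
have fr : (leb2 (rect a b c d : set (plane R)) < +oo)%E by rewrite leb2_rect// ltry.
have L g : continuous g -> L2 leb2 (rect a b c d) g.
  by move=> cg; apply: (continuous_L2_finite cg mr fr (@rect_box a b c d)).
exact: And3 (L _ c0) (L _ c1) (L _ c2).
Qed.

Lemma finite_sides (a b c d : R) : a <= b -> c <= d ->
  (hausdorff1 (sides a b c d : set (plane R)) < +oo)%E.
Proof. by move=> ab cd; apply: le_lt_trans (hausdorff1_sides ab cd) (ltry _). Qed.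

Let sides_arith (p q r x y I J : R) : 2 * x * p + 2 * J * r + (2 * x * p + 2 * J * r) +
    (2 * y * p + 2 * I * q + (2 * y * p + 2 * I * q)) <= (4 * x + 4 * y) * p + 4 * I * q + 4 * J * r.
Proof. by lra. Qed.

Lemma smooth_sides f (a b c d : R) : smooth f -> a < b -> c < d ->
  nsq hausdorff1 (sides a b c d) f <=
  (4 / (d - c) + 4 / (b - a)) * nsq leb2 (rect a b c d) f +
  4 * (b - a) * nsq leb2 (rect a b c d) (fun x => (grad f x).1) +
  4 * (d - c) * nsq leb2 (rect a b c d) (fun x => (grad f x).2).
Proof.
move=> sf ab cd; have [c0 c1 c2] := smooth_continuous sf.
have [La Lb Lc] := smooth_L2_rect sf (ltW ab) (ltW cd).
have Ls := continuous_L2_finite c0 (measurable_sides a b c d) (finite_sides (ltW ab) (ltW cd)) (sides_box (ltW ab) (ltW cd)).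
have mh s : measurable (hseg a b s : set (plane R)) by exact: measurable_hseg.
have mv s : measurable (vseg c d s : set (plane R)) by exact: measurable_vseg.
have mH : measurable (hseg a b c `|` hseg a b d : set (plane R)) by exact: measurableU.
have mV : measurable (vseg c d a `|` vseg c d b : set (plane R)) by exact: measurableU.
have LH : L2 hausdorff1 (hseg a b c `|` hseg a b d) f.
  by apply: (L2_sub (measurable_sides a b c d) mH) Ls => x ?; left.
have LV : L2 hausdorff1 (vseg c d a `|` vseg c d b) f.
  by apply: (L2_sub (measurable_sides a b c d) mV) Ls => x ?; right.
have := nsq_setU_le mH mV Ls; have := nsq_setU_le (mh c) (mh d) LH; have := nsq_setU_le (mv a) (mv b) LV.
have I0 : 0 < b - a by rewrite subr_gt0.
have J0 : 0 < d - c by rewrite subr_gt0.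
have hs s : c <= s <= d -> L2 hausdorff1 (hseg a b s) f -> nsq hausdorff1 (hseg a b s) f <=
    2 / (d - c) * nsq leb2 (rect a b c d) f + 2 * (d - c) * nsq leb2 (rect a b c d) (fun x => (grad f x).2).
  move=> scd Lh; have := trace_hseg a b sf cd scd.
  rewrite !nsqE//; try exact: measurable_rect.
  rewrite -!EFinM -EFinD lee_fin -ler_pdivlMl// => /le_trans; apply.
  by rewrite le_eqVlt; apply/orP; left; apply/eqP; field; rewrite gt_eqF.
have vs s : a <= s <= b -> L2 hausdorff1 (vseg c d s) f -> nsq hausdorff1 (vseg c d s) f <=
    2 / (b - a) * nsq leb2 (rect a b c d) f + 2 * (b - a) * nsq leb2 (rect a b c d) (fun x => (grad f x).1).
  move=> scd Lh; have := trace_vseg c d sf ab scd.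
  rewrite !nsqE//; try exact: measurable_rect.
  rewrite -!EFinM -EFinD lee_fin -ler_pdivlMl// => /le_trans; apply.
  by rewrite le_eqVlt; apply/orP; left; apply/eqP; field; rewrite gt_eqF.
have h1 := hs c ltac:(by rewrite lexx ltW) ltac:(by apply: (L2_sub mH (mh _)) LH => x ?; left).
have h2 := hs d ltac:(by rewrite lexx ltW) ltac:(by apply: (L2_sub mH (mh _)) LH => x ?; right).
have v1 := vs a ltac:(by rewrite lexx ltW) ltac:(by apply: (L2_sub mV (mv _)) LV => x ?; left).
have v2 := vs b ltac:(by rewrite lexx ltW) ltac:(by apply: (L2_sub mV (mv _)) LV => x ?; right).
move=> H1 H2 H3.
apply: (le_trans H3); apply: (le_trans (lerD H2 H1)); apply: (le_trans (lerD (lerD h1 h2) (lerD v1 v2))).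
exact: sides_arith.
Qed.

Lemma smooth_friedrichs f (a b c d : R) : smooth f -> a <= b -> c < d ->
  nsq leb2 (rect a b c d) f <= 2 * (d - c) * nsq hausdorff1 (hseg a b c) f +
  2 * (d - c) ^+ 2 * nsq leb2 (rect a b c d) (fun x => (grad f x).2).
Proof.
move=> sf ab cd; have [c0 c1 c2] := smooth_continuous sf.
have [La Lb Lc] := smooth_L2_rect sf ab (ltW cd).
have Ls := continuous_L2_finite c0 (measurable_sides a b c d) (finite_sides ab (ltW cd)) (sides_box ab (ltW cd)).
have mh : measurable (hseg a b c : set (plane R)) by exact: measurable_hseg.
have Lh : L2 hausdorff1 (hseg a b c) f.
  by apply: (L2_sub (measurable_sides a b c d) mh) Ls => x ?; left; left.
have := friedrichs_hseg a b sf cd (s := c); rewrite lexx (ltW cd) => /(_ isT).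
by rewrite !nsqE//; exact: measurable_rect.
Qed.

End smooth_sides.

Section arithmetic.
Context {R : realType}.

Lemma le_eps (x y C : R) : 0 <= C -> (forall e, 0 < e -> x <= y + C * e) -> x <= y.
Proof.
move=> C0 H; apply/ler_addgt0Pr => e e0.
have D : 0 < C + 1 by lra.
apply: le_trans (H (e / (C + 1)) (divr_gt0 e0 D)) _; rewrite lerD2l mulrCA ler_piMr ?(ltW e0)//.
by rewrite ler_pdivrMr// mul1r; lra.
Qed.

Lemma boundary_arith (l L w h n1 n2 n3 a1 a2 a3 b1 b2 b3 e1 e2 : R) :
  0 < w -> w < h -> h < 1 -> w <= l -> l <= 1 -> 1 <= L ->
  0 <= n1 -> 0 <= n2 -> 0 <= n3 -> 0 <= a1 <= e1 -> 0 <= a2 <= e1 -> 0 <= a3 <= e1 ->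
  0 <= b1 <= e2 -> 0 <= b2 <= e2 -> 0 <= b3 <= e2 ->
  (4 / (1 - 0) + 4 / (0 - -1)) * n1 + 4 * (0 - -1) * a1 + 4 * (1 - 0) * b1 +
  ((4 / (w - 0) + 4 / (l - 0)) * n2 + 4 * (l - 0) * a2 + 4 * (w - 0) * b2 +
   ((4 / (h - 0) + 4 / (l + L - l)) * n3 + 4 * (l + L - l) * a3 + 4 * (h - 0) * b3)) <=
  8 * (n1 + w^-1 * n2 + h^-1 * n3) + 12 * L * (e1 + e2).
Proof.
move=> w0 wh h1 wl l1 L1 n10 n20 n30 /andP[a10 a11] /andP[a20 a21] /andP[a30 a31] /andP[b10 b11] /andP[b20 b21] /andP[b30 b31].
have -> : l + L - l = L by ring.
rewrite !subr0 sub0r opprK !divr1.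
have il : l^-1 <= w^-1 by rewrite lef_pV2 ?posrE//; lra.
have iL : L^-1 <= h^-1 by rewrite lef_pV2 ?posrE//; lra.
have p2 : l^-1 * n2 <= w^-1 * n2 by rewrite ler_wpM2r.
have p3 : L^-1 * n3 <= h^-1 * n3 by rewrite ler_wpM2r.
have q1 : l * a2 <= e1 by nra.
have q2 : w * b2 <= e2 by nra.
have q3 : h * b3 <= e2 by nra.
have q4 : L * a3 <= L * e1 by rewrite ler_wpM2l//; lra.
have q5 : e1 <= L * e1 by rewrite ler_peMl//; lra.
have q6 : e2 <= L * e2 by rewrite ler_peMl//; lra.
rewrite (mulrDl (4 / w)) (mulrDl (4 / h)) -!mulrA.
lra.
Qed.

Lemma trace_arith (x y p n1 n2 n3 m1 m2 m3 w h L E E' e : R) : 0 < w -> 0 < h -> 0 < L ->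
  x <= 2 * y + 2 * p -> p <= e -> y <= 8 * (n1 + w^-1 * n2 + h^-1 * n3) + 12 * L * E' ->
  n1 <= 2 * e + 2 * m1 -> n2 <= 2 * e + 2 * m2 -> n3 <= 2 * e + 2 * m3 -> E' <= 2 * e + 2 * E ->
  x <= 32 * (m1 + w^-1 * m2 + h^-1 * m3) + 48 * L * E +
   (2 + 32 * (1 + w^-1 + h^-1) + 48 * L) * e.
Proof.
move=> w0 h0 L0 H1 H2 H3 H4 H5 H6 H7.
have w' : 0 < w^-1 by rewrite invr_gt0.
have h' : 0 < h^-1 by rewrite invr_gt0.
move: (w^-1) (h^-1) w' h' H3 => W H W0 H0 H3.
have := ler_wpM2l (ltW W0) H5; have := ler_wpM2l (ltW H0) H6; have := ler_wpM2l (ltW L0) H7.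
lra.
Qed.

Lemma gap_arith (c1 cS c3' c3 w h L E : R) : 0 < w -> 0 < h ->
  (c1 - cS) ^+ 2 * w <= 2 * (2 * E) + 2 * (18 * E) ->
  (cS - c3') ^+ 2 * w <= 2 * (18 * E) + 2 * (2 * E) ->
  (c3' - c3) ^+ 2 * h <= 2 * (2 * E) + 2 * (2 * L ^+ 2 * E) -> 0 <= E -> 1 <= L ->
  [/\ (c1 - cS) ^+ 2 <= 40 * w^-1 * E, (cS - c3) ^+ 2 <= (80 * w^-1 + 16 * (L ^+ 2 * h^-1)) * E &
      (c1 - c3) ^+ 2 <= (240 * w^-1 + 32 * (L ^+ 2 * h^-1)) * E].
Proof.
have dv (X Y z : R) : 0 < z -> X * z <= Y -> X <= z^-1 * Y by move=> z0 H; rewrite ler_pdivlMl// mulrC.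
have sq (x y X Y : R) : x ^+ 2 <= X -> y ^+ 2 <= Y -> (x + y) ^+ 2 <= 2 * X + 2 * Y.
  by move=> *; have := sqr_ge0 (x - y); nra.
move=> w0 h0 /(dv _ _ _ w0) H1 /(dv _ _ _ w0) H2 /(dv _ _ _ h0) H3 E0 L1.
have h' : 0 < h^-1 by rewrite invr_gt0.
have L2 : E <= L ^+ 2 * E by rewrite ler_peMl// expr_ge1//; lra.
have L3 := ler_wpM2l (ltW h') L2.
have := sq _ _ _ _ H2 H3; have := sq _ _ _ _ H1 (sq _ _ _ _ H2 H3).
have -> : c1 - cS + (cS - c3' + (c3' - c3)) = c1 - c3 by ring.
have -> : cS - c3' + (c3' - c3) = cS - c3 by ring.
by move=> K1 K2; split; lra.
Qed.

Lemma friedrichs_arith (d x y p q : R) : 0 < d -> d <= 1 -> x <= p -> y <= q -> 0 <= y -> 0 <= x ->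
  2 * d * x + 2 * d ^+ 2 * y <= 2 * p + 2 * q.
Proof.
move=> d0 d1 xp yq y0 x0; apply: lerD.
  have H : d * x <= x by rewrite ler_piMl.
  by lra.
have H : d ^+ 2 * y <= y by rewrite ler_piMl// expr_le1// ltW.
by lra.
Qed.

Lemma sum3_arith (p q r : R) : 0 <= r ->
  2 * p + 2 * q + (2 * p + 2 * q) + (2 * p + 2 * q) <= 6 * p + 6 * (r + q).
Proof. by lra. Qed.

Lemma trace_friedrichs_arith (x y p q z t E E' e : R) : x <= 2 * y + 2 * e -> y <= 6 * z + 6 * E' ->
  z <= 2 * t + 2 * e -> E' <= 2 * e + 2 * E -> x <= 24 * t + 24 * E + 50 * e.
Proof. by lra. Qed.

Lemma energy_arith (p q p' q' P Q e : R) : P <= 2 * p + 2 * p' -> Q <= 2 * q + 2 * q' -> p + q <= e ->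
  P + Q <= 2 * e + 2 * (p' + q').
Proof. by lra. Qed.

End arithmetic.

Section inequalities.
Context {R : realType}.
Variables (l L w h : R).
Hypothesis th : thin l L w h.
Notation Om := (dumbbell l L w h : set (plane R)).
Notation B := (boundary (dumbbell l L w h) : set (plane R)).
Notation N := (nsq leb2 Om).
Notation NB := (nsq hausdorff1 B).
Notation En := (energy Om).
Notation N1 := (nsq leb2 (room1 : set (plane R))).
Notation N2 := (nsq leb2 (room2 l w)).
Notation N3 := (nsq leb2 (room3 l L h)).
Implicit Types (f u g : R * R -> R) (G : R * R -> R * R).

Let L_box : -2 <= L + 2 :> R. Proof. by case: th => ? ? ? ? [? ?]; lra. Qed.
Let box_y : -1 <= 2 :> R. Proof. by lra. Qed.
Let mO := measurable_Om l L w h.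
Let mB : measurable B. Proof. exact: measurable_boundary. Qed.
Let bO := dumbbell_box th.
Let bB := boundary_box th.
Notation fB := (finite_boundary th).
Let m1 : measurable (room1 : set (plane R)). Proof. exact: measurable_rect. Qed.
Let m2 : measurable (room2 l w). Proof. exact: measurable_rect. Qed.
Let m3 : measurable (room3 l L h). Proof. exact: measurable_rect. Qed.

Let nums : [/\ 0 < l, l < l + L, 0 < h & 0 < w].
Proof. by case: th => ? ? ? ? [? ?]; split; lra. Qed.

Let num_box : [/\ -2 <= -1 :> R, 0 <= L + 2, l <= L + 2 & l + L <= L + 2] /\ [/\ w <= 2, h <= 2, -2 <= l & -1 <= l] .
Proof. by case: th => ? ? ? ? [? ?]; split; split; lra. Qed.

(** The weights 1, 1 / w, 1 / h are the inverse heights of the rooms, produced by the trace on their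
    horizontal sides; they dominate the inverse widths. *)
Lemma smooth_boundary f : smooth f ->
  NB f <= 8 * (N1 f + w^-1 * N2 f + h^-1 * N3 f) + 12 * L * En (grad f).
Proof.
have [[l0 X0 h0 w0] [[b1 b2 b3 b4] [b5 b6 b7 b8]]] := (nums, num_box).
have [_ wh h1 wl [l1 L1]] := th.
have le0 : [/\ 0 <= l, l <= l + L, 0 <= h & 0 <= w] by split; exact: ltW.
have [l0' X0' h0' w0'] := le0.
have bx a b c d : -2 <= a -> a <= b -> b <= L + 2 -> -1 <= c -> c <= d -> d <= 2 ->
    sides a b c d `<=` [set` `[(-2), L + 2]] `*` [set` `[(-1), 2]].
  move=> ? ab ? ? cd ? x /(sides_box ab cd)[/=].
  by rewrite !in_itv/= => /andP[? ?] /andP[? ?]; split; apply/andP; split; lra.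
have n12 : (1 : R) <= 2 by lra.
have n20 : (-2 : R) <= 0 by lra.
have n01 : (-1 : R) < 0 by lra.
have n10 : (-1 : R) <= 0 by lra.
move=> sf; have [c0 c1 c2] := smooth_continuous sf.
have [K0 K1 K2 _] := smooth_sobolev mO L_box box_y bO sf.
have S1 := smooth_sides sf n01 ltr01.
have S2 := smooth_sides sf l0 w0.
have S3 := smooth_sides sf X0 h0.
have mS a b c d := @measurable_sides R a b c d.
pose s1 : set (plane R) := sides (-1) 0 0 1; pose s2 : set (plane R) := sides 0 l 0 w.
pose s3 : set (plane R) := sides l (l + L) 0 h.
have ms1 : measurable s1 by exact: mS.
have ms2 : measurable s2 by exact: mS.
have ms3 : measurable s3 by exact: mS.
have ms23 : measurable (s2 `|` s3) by exact: measurableU.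
have ms : measurable (s1 `|` (s2 `|` s3)) by exact: measurableU.
have L123 : L2 hausdorff1 (s1 `|` (s2 `|` s3)) f.
  apply: (continuous_L2_finite c0 ms (a := -2) (b := L + 2) (c := -1) (d := 2)).
    have U (X Y : set (plane R)) : (hausdorff1 (X `|` Y) <= hausdorff1 X + hausdorff1 Y)%E.
      exact: outer_measureU2.
    apply: le_lt_trans (U _ _) _; apply: le_lt_trans (leeD2l _ (U _ _)) _.
    by rewrite !lte_add_pinfty//; apply: finite_sides.
  by move=> x [|[|]]; apply: bx.
have L23 : L2 hausdorff1 (s2 `|` s3) f by apply: (L2_sub ms ms23) L123 => x; right.
apply: (le_trans (nsq_sub mB ms (boundary_sub_sides th) L123)).
apply: (le_trans (nsq_setU_le ms1 ms23 L123)).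
apply: (le_trans (lerD (lexx _) (nsq_setU_le ms2 ms3 L23))).
apply: (le_trans (lerD S1 (lerD S2 S3))).
have sb g A : L2 leb2 Om g -> measurable A -> A `<=` Om -> 0 <= nsq leb2 A g <= N g.
  by move=> Lg mA AO; rewrite nsq_ge0/= nsq_sub.
have sub1 := @room1_sub R l L w h th; have sub2 := room2_sub th; have sub3 := room3_sub th.
by apply: (boundary_arith w0 wh h1 wl l1 L1); first [exact: nsq_ge0|exact: sb].
Qed.

(** Every room stands on the bottom side and has height at most 1, which gives a constant 2 for each
    of the three. *)
Lemma smooth_friedrichs_dumbbell f : smooth f -> N f <= 6 * NB f + 6 * En (grad f).
Proof.
have [[l0 X0 h0 w0] [_ wh h1 wl [l1 L1]]] := (nums, th).
have q : [/\ (-1 : R) <= -1, (-1 : R) <= 0, -1 <= l & 0 <= l + L] by split; lra.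
have [q1 q2 q3 q4] := q; have q5 : l <= l + L by exact: ltW.
have q6 : [/\ 0 <= l, w <= 1 & h <= 1] by split; lra.
have [q7 q8 q9] := q6.
move=> sf; have [c0 c1 c2] := smooth_continuous sf.
have [K0 K1 K2 _] := smooth_sobolev mO L_box box_y bO sf.
have LB := continuous_L2B fB bB c0.
apply: (le_trans (nsq_rooms th K0)).
have fr (a b d : R) : -1 <= a -> a <= b -> b <= l + L -> 0 < d -> d <= 1 -> rect a b 0 d `<=` Om ->
    nsq leb2 (rect a b 0 d) f <= 2 * NB f + 2 * N (fun x => (grad f x).2).
  move=> a1 ab bL d0 d1 sub; apply: (le_trans (smooth_friedrichs sf ab d0)).
  have mh : measurable (hseg a b 0 : set (plane R)) by exact: measurable_hseg.
  have hb := nsq_sub mh mB (bottom_sub th a1 bL) LB.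
  have hr := nsq_sub (@measurable_rect R a b 0 d) mO sub K2.
  have := nsq_ge0 hausdorff1 (hseg a b 0) f.
  have := nsq_ge0 leb2 (rect a b 0 d) (fun x => (grad f x).2).
  by rewrite subr0 => ? ?; exact: friedrichs_arith.
have F1 := fr (-1) 0 1 q1 q2 q4 ltr01 (lexx _) (@room1_sub R l L w h th).
have F2 := fr 0 l w q2 q7 q5 w0 q8 (room2_sub th).
have F3 := fr l (l + L) h q3 q5 (lexx _) h0 q9 (room3_sub th).
apply: (le_trans (lerD (lerD F1 F2) F3)); rewrite /energy.
by apply: sum3_arith; exact: nsq_ge0.
Qed.

Lemma shift_sobolev u G k : sobolev Om u G -> sobolev Om (fun x => u x - k) G.
Proof.
move=> su; have [sk gk] := @smooth_cst R (- k).
have H := sobolev_lin mO L_box box_y bO 1 su (smooth_sobolev mO L_box box_y bO sk).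
congr (sobolev _ _ _): H; apply: funext => x /=; rewrite mul1r//.
by move: (gk x); rewrite /grad => -[-> ->]; rewrite !addr0 mul1r -surjective_pairing.
Qed.

Lemma shift_trace u G g k : sobolev Om u G -> trace Om u G g -> trace Om (fun x => u x - k) G (fun x => g x - k).
Proof.
move=> su tu; have [sk gk] := @smooth_cst R (- k).
have Sk := smooth_sobolev mO L_box box_y bO sk.
have Tk := smooth_trace mO L_box box_y bO fB bB sk.
have H := trace_lin mO L_box box_y bO fB bB 1 su tu Sk Tk.
congr (trace _ _ _ _): H; apply: funext => x /=; rewrite mul1r//.
by move: (gk x); rewrite /grad => -[-> ->]; rewrite !addr0 mul1r -surjective_pairing.
Qed.

Let approx_energy u G g e f : sobolev Om u G -> L2 hausdorff1 B g -> approx Om u G g e f ->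
  En (grad f) <= 2 * e + 2 * En G.
Proof.
move=> su Lg af; have [_ L1 L2' _] := su.
have [_ D1 D2 _] := approx_L2 mO L_box box_y bO su Lg af.
have [_ _ _ Ee _] := af.
have H1 := nsqD mO D1 L1; have H2 := nsqD mO D2 L2'.
rewrite (@eq_nsq _ _ _ _ (fun x => (grad f x).1)) in H1; last by move=> x _ /=; ring.
rewrite (@eq_nsq _ _ _ _ (fun x => (grad f x).2)) in H2; last by move=> x _ /=; ring.
exact: energy_arith H1 H2 Ee.
Qed.

Let approx_room A u G g e f : measurable A -> A `<=` Om -> sobolev Om u G -> L2 hausdorff1 B g ->
  approx Om u G g e f -> nsq leb2 A f <= 2 * e + 2 * nsq leb2 A u.
Proof.
move=> mA AO su Lg af; have [Lu _ _ _] := su.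
have [D _ _ _] := approx_L2 mO L_box box_y bO su Lg af.
have [_ _ Ne _ _] := af.
have H := nsqD mA (L2_sub mO mA AO D) (L2_sub mO mA AO Lu).
rewrite (@eq_nsq _ _ _ _ f) in H; last by move=> x _ /=; ring.
apply: (le_trans H); rewrite lerD2r ler_pM2l//.
exact: le_trans (nsq_sub mA mO AO D) Ne.
Qed.

(** [smooth_boundary] for an approximant within e. The error is multiplied by a large constant
    depending on w and h, which disappears as e tends to 0. *)
Lemma trace_bound u G g : sobolev Om u G -> trace Om u G g ->
  NB g <= 32 * (N1 u + w^-1 * N2 u + h^-1 * N3 u) + 48 * L * En G.
Proof.
have [l0 X0 h0 w0] := nums; have L0 : 0 < L by case: th => ? ? ? ? [? ?]; lra.
have C0 : 0 <= 2 + 32 * (1 + w^-1 + h^-1) + 48 * L.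
  by rewrite ?(addr_ge0, mulr_ge0)// ?invr_ge0 ltW.
move=> su tu; apply: le_eps C0 _ => e e0.
have [Lg /(_ e e0)[f af]] := (traceP mO L_box box_y bO fB bB g su).1 tu.
have [_ _ _ D] := approx_L2 mO L_box box_y bO su Lg af.
have [sf Lf Ne Ee Be] := af.
have H1 := nsqB mB Lf D; rewrite (@eq_nsq _ _ _ _ g) in H1; last by move=> x _ /=; ring.
have sub1 := @room1_sub R l L w h th; have sub2 := room2_sub th; have sub3 := room3_sub th.
apply: (trace_arith w0 h0 L0 H1 Be (smooth_boundary sf)).
- exact: approx_room su Lg af.
- exact: approx_room su Lg af.
- exact: approx_room su Lg af.
- exact: approx_energy su Lg af.
Qed.

(** Energy plus boundary mass controls the mass inside: this makes the Steklov space complete, and a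
    function without energy and with null trace vanish. *)
Lemma trace_friedrichs u G g : sobolev Om u G -> trace Om u G g -> N u <= 24 * NB g + 24 * En G.
Proof.
have C0 : (0 : R) <= 50 by [].
move=> su tu; apply: le_eps C0 _ => e e0.
have [Lg /(_ e e0)[f af]] := (traceP mO L_box box_y bO fB bB g su).1 tu.
have [D _ _ D'] := approx_L2 mO L_box box_y bO su Lg af.
have [sf Lf Ne Ee Be] := af; have [Lu _ _ _] := su.
have [Lf' _ _ _] := smooth_sobolev mO L_box box_y bO sf.
have H1 := nsqB mO Lf' D; rewrite (@eq_nsq _ _ _ _ u) in H1; last by move=> x _ /=; ring.
have H2 := nsqD mB D' Lg; rewrite (@eq_nsq _ _ _ _ f) in H2; last by move=> x _ /=; ring.
have H1' := le_trans H1 (lerD (lexx _) (ler_wpM2l (ler0n R 2) Ne)).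
have H2' := le_trans H2 (lerD (ler_wpM2l (ler0n R 2) Be) (lexx _)); rewrite addrC in H2'.
exact: trace_friedrichs_arith H1' (smooth_friedrichs_dumbbell sf) H2' (approx_energy su Lg af).
Qed.

End inequalities.

Section arithmetic.
Context {R : realType}.

Lemma neumann_poincare_arith (l L w h E n1 n2 n3 k2 k3 : R) :
  0 < w -> w < h -> 0 < l -> l <= 1 -> 1 <= L -> 0 <= E ->
  n1 <= 2 * E -> n2 <= 2 * (18 * E) + 2 * k2 * (l * w) -> k2 <= 40 * w^-1 * E ->
  n3 <= 2 * (2 * L ^+ 2 * E) + 2 * k3 * (L * h) -> k3 <= (240 * w^-1 + 32 * (L ^+ 2 * h^-1)) * E ->
  n1 + n2 + n3 <= 700 * L ^+ 3 * (h * w^-1) * E.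
Proof.
move=> w0 wh l0 l1 L1 E0 H1 H2 K2 H3 K3.
have h0 : 0 < h by lra.
have lw : 0 <= l * w by rewrite mulr_ge0// ltW.
have Lh : 0 <= L * h by rewrite mulr_ge0//; lra.
have P2 := ler_wpM2r lw K2; have P3 := ler_wpM2r Lh K3.
have E2 : 40 * w^-1 * E * (l * w) = 40 * l * E by field; lra.
have E3 : (240 * w^-1 + 32 * (L ^+ 2 * h^-1)) * E * (L * h) = 240 * (L * (h * w^-1)) * E + 32 * L ^+ 3 * E.
  by field; apply/andP; split; lra.
have e1 : 1 <= h * w^-1 by rewrite ler_pdivlMr//; lra.
have lE : l * E <= E by rewrite ler_piMl.
have L3 : 1 <= L ^+ 3 by rewrite expr_ge1//; lra.
have L23 : L ^+ 2 <= L ^+ 3 by rewrite exprS ler_peMl// sqr_ge0.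
have L13 : L <= L ^+ 3 by rewrite exprS ler_peMr//; [lra|rewrite expr_ge1//; lra].
rewrite E2 in P2; rewrite E3 in P3.
move: (h * w^-1) e1 P3 => r r1 P3; clear E2 E3 K3 K2.
have rE : E <= r * E by rewrite ler_peMl.
have Z : 0 <= L ^+ 3 by lra.
have q1 : E <= L ^+ 3 * (r * E) by apply: (le_trans rE); exact: (ler_peMl (le_trans E0 rE) L3).
have q2 : L ^+ 2 * E <= L ^+ 3 * (r * E) by apply: ler_pM => //; exact: sqr_ge0.
have q3 : L * (r * E) <= L ^+ 3 * (r * E) by apply: ler_pM => //; lra.
have q4 : L ^+ 3 * E <= L ^+ 3 * (r * E) by rewrite ler_wpM2l.
lra.
Qed.

Lemma steklov_poincare_arith (l L w h E x n1 n2 n3 k1 k2 : R) :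
  0 < w -> w < 1 -> 0 < h -> h < 1 -> 0 < l -> l <= 1 -> 1 <= L -> 0 <= E ->
  x <= 32 * (n1 + w^-1 * n2 + h^-1 * n3) + 48 * L * E ->
  n1 <= 2 * (2 * E) + 2 * k1 * 1 -> n2 <= 2 * (18 * E) + 2 * k2 * (l * w) -> n3 <= 2 * L ^+ 2 * E ->
  k1 <= (240 * w^-1 + 32 * (L ^+ 2 * h^-1)) * E -> k2 <= (80 * w^-1 + 16 * (L ^+ 2 * h^-1)) * E ->
  x <= 150 ^+ 2 * (w^-1 + L ^+ 2 * h^-1) * E.
Proof.
move=> w0 w1 h0 h1 l0 l1 L1 E0 Hx H1 H2 H3 K1 K2.
have w' : 0 < w^-1 by rewrite invr_gt0.
have h' : 0 < h^-1 by rewrite invr_gt0.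
have P2 := ler_wpM2l (ltW w') H2; have P3 := ler_wpM2l (ltW h') H3.
have E2 : w^-1 * (2 * (18 * E) + 2 * k2 * (l * w)) = 36 * (w^-1 * E) + 2 * (l * k2) by field; lra.
rewrite E2 in P2; clear E2.
have wE : E <= w^-1 * E by rewrite ler_peMl// invf_ge1//; lra.
have L2h : L * E <= L ^+ 2 * h^-1 * E.
  rewrite ler_wpM2r// expr2 -mulrA ler_peMr//; first by lra.
  by rewrite mulr_ege1// invf_ge1//; lra.
have K2' := ler_wpM2l (ltW l0) K2.
have q0 : 0 <= L ^+ 2 * h^-1 * E by exact: mulr_ge0 (mulr_ge0 (sqr_ge0 _) (ltW h')) E0.
have q0' : 0 <= w^-1 * E by exact: mulr_ge0 (ltW w') E0.
have q : 0 <= (80 * w^-1 + 16 * (L ^+ 2 * h^-1)) * E.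
  by lra.
have K2'' : l * ((80 * w^-1 + 16 * (L ^+ 2 * h^-1)) * E) <= (80 * w^-1 + 16 * (L ^+ 2 * h^-1)) * E by rewrite ler_piMl.
lra.
Qed.

Lemma neumann_gap_arith (l L w h E n1 n2 n3 c1 c2 c3 : R) :
  0 < w -> w < 1 -> 0 < h -> h < 1 -> 0 < l -> l <= 1 -> 1 <= L -> 0 <= E ->
  n1 <= 2 * (2 * E) + 2 * c1 ^+ 2 * 1 -> n2 <= 2 * (2 * l ^+ 2 * E) + 2 * c2 ^+ 2 * (l * w) ->
  n3 <= 2 * (2 * L ^+ 2 * E) + 2 * c3 ^+ 2 * (L * h) ->
  n1 + n2 + n3 <= 12 * L ^+ 2 * E + ((2 * c1) ^+ 2 + (2 * c2) ^+ 2 + (2 * L * c3) ^+ 2).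
Proof.
move=> w0 w1 h0 h1 l0 l1 L1 E0 H1 H2 H3.
have a1 : l ^+ 2 * E <= E by rewrite ler_piMl// expr_le1// ltW.
have a2 : E <= L ^+ 2 * E by rewrite ler_peMl// expr_ge1//; lra.
have b1 := sqr_ge0 c1; have b2 : c2 ^+ 2 * (l * w) <= c2 ^+ 2.
  by rewrite ler_piMr ?sqr_ge0// mulr_ile1// ltW.
have b3 : c3 ^+ 2 * (L * h) <= c3 ^+ 2 * L ^+ 2.
  by rewrite ler_wpM2l ?sqr_ge0// expr2 ler_wpM2l//; lra.
have := sqr_ge0 c2; have := mulr_ge0 (sqr_ge0 c3) (sqr_ge0 L).
rewrite !exprMn; lra.
Qed.

Lemma steklov_gap_arith (l L w h E x n1 n2 n3 c1 c2 c3 : R) :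
  0 < w -> w < 1 -> 0 < h -> h < 1 -> 0 < l -> l <= 1 -> 1 <= L -> 0 <= E ->
  x <= 32 * (n1 + w^-1 * n2 + h^-1 * n3) + 48 * L * E ->
  n1 <= 2 * (2 * E) + 2 * c1 ^+ 2 * 1 -> n2 <= 2 * (2 * l ^+ 2 * E) + 2 * c2 ^+ 2 * (l * w) ->
  n3 <= 2 * (2 * L ^+ 2 * E) + 2 * c3 ^+ 2 * (L * h) ->
  x <= 304 * (l ^+ 2 * w^-1 + L ^+ 2 * h^-1) * E + ((8 * c1) ^+ 2 + (8 * c2) ^+ 2 + (8 * L * c3) ^+ 2).
Proof.
move=> w0 w1 h0 h1 l0 l1 L1 E0 Hx H1 H2 H3.
have w' : 0 < w^-1 by rewrite invr_gt0.
have h' : 0 < h^-1 by rewrite invr_gt0.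
have P2 := ler_wpM2l (ltW w') H2; have P3 := ler_wpM2l (ltW h') H3.
have E2 : w^-1 * (2 * (2 * l ^+ 2 * E) + 2 * c2 ^+ 2 * (l * w)) =
  4 * (l ^+ 2 * w^-1 * E) + 2 * (c2 ^+ 2 * l) by field; lra.
have E3 : h^-1 * (2 * (2 * L ^+ 2 * E) + 2 * c3 ^+ 2 * (L * h)) =
  4 * (L ^+ 2 * h^-1 * E) + 2 * (c3 ^+ 2 * L) by field; lra.
rewrite E2 in P2; rewrite E3 in P3; clear E2 E3.
have L2h : L * E <= L ^+ 2 * h^-1 * E.
  rewrite ler_wpM2r// expr2 -mulrA ler_peMr//; first by lra.
  by rewrite mulr_ege1// invf_ge1//; lra.
have LE : E <= L * E by rewrite ler_peMl.
have b2 : c2 ^+ 2 * l <= c2 ^+ 2 by rewrite ler_piMr ?sqr_ge0.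
have b3 : c3 ^+ 2 * L <= c3 ^+ 2 * L ^+ 2 by rewrite ler_wpM2l ?sqr_ge0// expr2 ler_peMl//; lra.
have q : 0 <= l ^+ 2 * w^-1 * E by rewrite !mulr_ge0 ?sqr_ge0// ltW.
rewrite !exprMn; lra.
Qed.

End arithmetic.

(** * Mean values and Poincare inequalities on the dumbbell *)

Section gaps.
Context {R : realType}.
Variables (l L w h : R).
Hypothesis th : thin l L w h.
Notation Om := (dumbbell l L w h : set (plane R)).
Notation B := (boundary (dumbbell l L w h) : set (plane R)).
Notation N := (nsq leb2 Om).
Notation NB := (nsq hausdorff1 B).
Notation En := (energy Om).
Implicit Types (f u g : R * R -> R) (G : R * R -> R * R).

Let mO := measurable_Om l L w h.

Definition mean u (a b c d : R) := (\int[leb2]_(x in rect a b c d) u x) / ((b - a) * (d - c)).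
Definition mean1 u := mean u (-1) 0 0 1.
Definition mean2 u := mean u 0 l 0 w.
Definition mean3 u := mean u l (l + L) 0 h.

Let finO : (leb2 Om < +oo)%E.
Proof.
apply: (finite_leb2 (a := -2) (b := L + 2) (c := -1) (d := 2)) => //; [|lra|exact: dumbbell_box].
by case: th => ? ? ? ? [? ?]; lra.
Qed.

Let box_arith (p q p' q' x y X : R) : 0 <= x -> x <= X -> 0 <= y -> y <= X -> 0 <= p -> 0 <= q ->
  p <= p' -> q <= q' -> 2 * x ^+ 2 * p + 2 * y ^+ 2 * q <= 2 * X ^+ 2 * (p' + q').
Proof.
move=> x0 xX y0 yX p0 q0 pp qq.
have H1 : x ^+ 2 * p <= X ^+ 2 * p'.
  by apply: ler_pM => //; rewrite ?sqr_ge0// ler_pXn2r// nnegrE; exact: le_trans xX.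
have H2 : y ^+ 2 * q <= X ^+ 2 * q'.
  by apply: ler_pM => //; rewrite ?sqr_ge0// ler_pXn2r// nnegrE; exact: le_trans yX.
by lra.
Qed.

(** [poincare_rect] with a single bound X on both dimensions, and the energy of the whole dumbbell
    on the right. *)
Lemma box_poincare u G (a b d X : R) : sobolev Om u G -> a < b -> 0 < d -> b - a <= X -> d <= X ->
  rect a b 0 d `<=` Om ->
  L2 leb2 (rect a b 0 d) (fun x => u x - mean u a b 0 d) /\
  nsq leb2 (rect a b 0 d) (fun x => u x - mean u a b 0 d) <= 2 * X ^+ 2 * En G.
Proof.
move=> su ab d0 bX dX sub; have mr : measurable (rect a b 0 d : set (plane R)) by exact: measurable_rect.
have [L0 L1 L2' _] := shift_sobolev th (mean u a b 0 d) su.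
have LA := L2_sub mO mr sub L0; split=> //.
have d0' : 0 < d - 0 by rewrite subr0.
have := poincare_rect mO finO su ab d0 sub.
have := nsqE mr LA; rewrite /mean => ->.
rewrite (nsqE mr (L2_sub mO mr sub L1)) (nsqE mr (L2_sub mO mr sub L2')) -!EFinM -EFinD lee_fin => H.
apply: (le_trans H); rewrite subr0; apply: box_arith; rewrite ?nsq_ge0 ?nsq_sub// ?(ltW d0)//.
by rewrite subr_ge0 ltW.
Qed.

Section inequalities.
Variables (u : R * R -> R) (G : R * R -> R * R).
Hypothesis su : sobolev Om u G.
Notation E := (En G).
Notation R1 := (room1 : set (plane R)).
Notation R2 := (room2 l w).
Notation R3 := (room3 l L h).
Notation c1 := (mean1 u).
Notation c2 := (mean2 u).
Notation c3 := (mean3 u).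
Notation S := (rect (-1) (l + 1) 0 w : set (plane R)).
Notation S3 := (rect l (l + 1) 0 h : set (plane R)).
Notation cS := (mean u (-1) (l + 1) 0 w).
Notation cS3 := (mean u l (l + 1) 0 h).

Let mr a b c d : measurable (rect a b c d : set (plane R)). Proof. exact: measurable_rect. Qed.

Lemma energy_ge0 H : 0 <= En H.
Proof. by apply: addr_ge0; exact: nsq_ge0. Qed.

Let nums : [/\ [/\ 0 < l, 0 < w, 0 < h & 0 < L], [/\ w < 1, h < 1, l <= 1 & 1 <= L] & w <= l /\ w < h].
Proof. by case: th => ? ? ? ? [? ?]; split; split; lra. Qed.

Let subS : S `<=` Om.
Proof. by apply: rect_sub_dumbbell => //; case: th => ? ? ? ? [? ?]; apply: Or31; split; lra. Qed.
Let subS3 : S3 `<=` Om.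
Proof. by apply: rect_sub_dumbbell => //; case: th => ? ? ? ? [? ?]; apply: Or33; split; lra. Qed.

Lemma room1_poincare : L2 leb2 R1 (fun x => u x - c1) /\ nsq leb2 R1 (fun x => u x - c1) <= 2 * E.
Proof.
have [//|||||A H] := box_poincare (a := -1) (b := 0) (d := 1) (X := 1) su; try lra.
  exact: room1_sub.
by split=> //; apply: (le_trans H); rewrite expr1n mulr1.
Qed.

Lemma room2_poincare : L2 leb2 R2 (fun x => u x - c2) /\ nsq leb2 R2 (fun x => u x - c2) <= 2 * l ^+ 2 * E.
Proof.
have [[l0 w0 h0 L0] [w1 h1 l1 L1] [wl wh]] := nums.
by apply: box_poincare => //; [lra|exact: room2_sub].
Qed.

Lemma room3_poincare : L2 leb2 R3 (fun x => u x - c3) /\ nsq leb2 R3 (fun x => u x - c3) <= 2 * L ^+ 2 * E.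
Proof.
have [[l0 w0 h0 L0] [w1 h1 l1 L1] [wl wh]] := nums.
by apply: box_poincare => //; [lra|lra|lra|exact: room3_sub].
Qed.

(** The strip enters the second chamber by 1 only, so that its length is at most 3 whatever L is (18
    = 2 * 3^2). Continued to the end it would cost L^2 / w; instead the box S3, of length 1 and full
    height h, links it to the chamber at the cost L^2 / h. *)
Let strip_poincare : L2 leb2 S (fun x => u x - cS) /\ nsq leb2 S (fun x => u x - cS) <= 18 * E.
Proof.
have [[l0 w0 h0 L0] [w1 h1 l1 L1] [wl wh]] := nums.
have -> : (18 : R) = 2 * 3 ^+ 2 by ring.
by apply: box_poincare => //; lra.
Qed.

Let end_poincare : L2 leb2 S3 (fun x => u x - cS3) /\ nsq leb2 S3 (fun x => u x - cS3) <= 2 * E.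
Proof.
have [[l0 w0 h0 L0] [w1 h1 l1 L1] [wl wh]] := nums.
have -> : 2 * E = 2 * 1 ^+ 2 * E by ring.
by apply: box_poincare => //; lra.
Qed.

(* Adjacent rooms are compared through their overlaps with the horizontal strip S. *)
Lemma mean_gaps :
  [/\ (c1 - cS) ^+ 2 <= 40 * w^-1 * E, (cS - c3) ^+ 2 <= (80 * w^-1 + 16 * (L ^+ 2 * h^-1)) * E &
      (c1 - c3) ^+ 2 <= (240 * w^-1 + 32 * (L ^+ 2 * h^-1)) * E].
Proof.
have [[l0 w0 h0 L0] [w1 h1 l1 L1] [wl wh]] := nums; have E0 := energy_ge0 G.
have [A1 B1] := room1_poincare; have [A3 B3] := room3_poincare.
have [AS BS] := strip_poincare; have [AS3 BS3] := end_poincare.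
have ri (a b c d p q r s : R) : a <= p -> q <= b -> c <= r -> s <= d -> rect p q r s `<=` rect a b c d.
  by move=> ? ? ? ? x /rectE[? ? ? ?]; apply/rectE; split; lra.
have G1 : (c1 - cS) ^+ 2 * w <= 2 * (2 * E) + 2 * (18 * E).
  apply: (mean_gap (mr _ _ _ _) (mr _ _ _ _) (mr (-1) 0 0 w) _ _ _ A1 AS B1 BS).
  - by apply: ri => //; exact: ltW.
  - by apply: ri => //; lra.
  - by rewrite leb2_rect ?(ltW w0)//; congr EFin; ring.
have G2 : (cS - cS3) ^+ 2 * w <= 2 * (18 * E) + 2 * (2 * E).
  apply: (mean_gap (mr _ _ _ _) (mr _ _ _ _) (mr l (l + 1) 0 w) _ _ _ AS AS3 BS BS3).
  - by apply: ri => //; lra.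
  - by apply: ri => //; exact: ltW.
  - by rewrite leb2_rect ?(ltW w0)//; [congr EFin; ring|lra].
have G3 : (cS3 - c3) ^+ 2 * h <= 2 * (2 * E) + 2 * (2 * L ^+ 2 * E).
  apply: (mean_gap (mr _ _ _ _) (mr _ _ _ _) (mr l (l + 1) 0 h) _ _ _ AS3 A3 BS3 B3) => //.
  - by apply: ri => //; lra.
  - by rewrite leb2_rect ?(ltW h0)//; [congr EFin; ring|lra].
exact: gap_arith w0 h0 G1 G2 G3 E0 L1.
Qed.

Let area1 : leb2 R1 = 1%:E.
Proof. by rewrite leb2_rect//; congr EFin; ring. Qed.
Let area2 : leb2 R2 = (l * w)%:E.
Proof. by have [[l0 w0 h0 L0] _ _] := nums; rewrite leb2_rect ?(ltW l0) ?(ltW w0)//; congr EFin; ring. Qed.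
Let area3 : leb2 R3 = (L * h)%:E.
Proof. by have [[l0 w0 h0 L0] _ _] := nums; rewrite leb2_rect ?(ltW h0)//; [congr EFin; ring|lra]. Qed.

Let room2_strip k : nsq leb2 R2 (fun x => u x - k) <= 2 * (18 * E) + 2 * (cS - k) ^+ 2 * (l * w).
Proof.
have [[l0 w0 h0 L0] [w1 h1 l1 L1] [wl wh]] := nums.
have sub : R2 `<=` S by move=> x /rectE[? ? ? ?]; apply/rectE; split; lra.
have [A H] := strip_poincare; have A2 := L2_sub (mr _ _ _ _) (mr 0 l 0 w) sub A.
apply: (le_trans (nsq_shift k (mr _ _ _ _) area2 A2)); rewrite lerD2r ler_pM2l//.
exact: le_trans (nsq_sub (mr 0 l 0 w) (mr _ _ _ _) sub A) H.
Qed.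

Let shift_arith (x y z p m : R) : x <= 2 * y + 2 * p * m -> y <= z -> x <= 2 * z + 2 * p * m.
Proof. by lra. Qed.

Let room1_shift k : nsq leb2 R1 (fun x => u x - k) <= 2 * (2 * E) + 2 * (c1 - k) ^+ 2 * 1.
Proof.
by have [A H] := room1_poincare; exact: shift_arith (nsq_shift k (mr (-1) 0 0 1) area1 A) H.
Qed.

Let room3_shift k : nsq leb2 R3 (fun x => u x - k) <= 2 * (2 * L ^+ 2 * E) + 2 * (c3 - k) ^+ 2 * (L * h).
Proof.
by have [A H] := room3_poincare; exact: shift_arith (nsq_shift k (mr l (l + L) 0 h) area3 A) H.
Qed.

Let room2_shift k : nsq leb2 R2 (fun x => u x - k) <= 2 * (2 * l ^+ 2 * E) + 2 * (c2 - k) ^+ 2 * (l * w).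
Proof.
by have [A H] := room2_poincare; exact: shift_arith (nsq_shift k (mr 0 l 0 w) area2 A) H.
Qed.

(** Centred on the first chamber, so that the gaps, of order 1 / w, are multiplied by the areas l w
    and L h of the other rooms. The gain of the factor h is what makes mu_1 at least of order w / h
    when L = 1. *)
Lemma neumann_poincare : N (fun x => u x - c1) <= 700 * L ^+ 3 * (h * w^-1) * E.
Proof.
have [[l0 w0 h0 L0] [w1 h1 l1 L1] [wl wh]] := nums; have E0 := energy_ge0 G.
have [K1 _ K3] := mean_gaps; have [_ H1] := room1_poincare.
have H2 := room2_strip c1; have H3 := room3_shift c1.
have [Lu _ _ _] := shift_sobolev th c1 su.
apply: (le_trans (nsq_rooms th Lu)).
by apply: (neumann_poincare_arith w0 wh l0 l1 L1 E0 H1 H2 _ H3); rewrite -(sqrrN (_ - c1)) opprB.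
Qed.

(* A Poincare inequality modulo three linear functionals, whose constant does
   not see the thinness of the corridor: it replaces the compactness of the
   embedding of H^1 in L^2. *)
Lemma neumann_gap :
  N u <= 12 * L ^+ 2 * E + ((2 * c1) ^+ 2 + (2 * c2) ^+ 2 + (2 * L * c3) ^+ 2).
Proof.
have [[l0 w0 h0 L0] [w1 h1 l1 L1] [wl wh]] := nums; have E0 := energy_ge0 G.
have H1 := room1_shift 0; have H2 := room2_shift 0; have H3 := room3_shift 0.
have e A : nsq leb2 A (fun x => u x - 0) = nsq leb2 A u by apply: eq_nsq => x _; rewrite subr0.
rewrite !e !subr0 in H1 H2 H3; have [Lu _ _ _] := su.
apply: (le_trans (nsq_rooms th Lu)).
exact: neumann_gap_arith w0 w1 h0 h1 l0 l1 L1 E0 H1 H2 H3.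
Qed.

Variable g : R * R -> R.
Hypothesis tu : trace Om u G g.

(** Centred on the second chamber: centred on the first, the gap between the chambers would be
    multiplied by the length L of the second, giving L / w. For L = e^-2 the two terms w^-1 and L^2
    / h balance. *)
Lemma steklov_poincare : NB (fun x => g x - c3) <= 150 ^+ 2 * (w^-1 + L ^+ 2 * h^-1) * E.
Proof.
have [[l0 w0 h0 L0] [w1 h1 l1 L1] [wl wh]] := nums; have E0 := energy_ge0 G.
have [_ K2 K1] := mean_gaps; have [_ H3] := room3_poincare.
have H2 := room2_strip c3; have H1 := room1_shift c3.
have T := trace_bound th (shift_sobolev th c3 su) (shift_trace th c3 su tu).
exact: (steklov_poincare_arith w0 w1 h0 h1 l0 l1 L1 E0 T H1 H2 H3 K1 K2).
Qed.

(** Each room is compared with its own mean, so the weight 1 / w of the corridor only meets its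
    Poincare constant l^2 and no gap appears. *)
Lemma steklov_gap : NB g <= 304 * (l ^+ 2 * w^-1 + L ^+ 2 * h^-1) * E +
  ((8 * c1) ^+ 2 + (8 * c2) ^+ 2 + (8 * L * c3) ^+ 2).
Proof.
have [[l0 w0 h0 L0] [w1 h1 l1 L1] [wl wh]] := nums; have E0 := energy_ge0 G.
have H1 := room1_shift 0; have H2 := room2_shift 0; have H3 := room3_shift 0.
have e A : nsq leb2 A (fun x => u x - 0) = nsq leb2 A u by apply: eq_nsq => x _; rewrite subr0.
rewrite !e !subr0 in H1 H2 H3; have T := trace_bound th su tu.
exact: steklov_gap_arith w0 w1 h0 h1 l0 l1 L1 E0 T H1 H2 H3.
Qed.

End inequalities.

End gaps.

(** * Eigenvalue bounds *)

Section eigenvalue_bounds.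
Context {R : realType}.
Implicit Types (Om : set (R * R)) (u v : R * R -> R).

(** Two functions that are constant almost everywhere cannot be free, so one of any two free
    eigenfunctions has its eigenvalue at K or above. *)
Lemma nth_eigenvalue1_ge Om (eig : R -> (R * R -> R) -> Prop) (K : R) :
  (forall lambda u, eig lambda u -> lambda < K ->
    exists c, {ae leb2, forall x : plane R, Om x -> u x = c}) ->
  (K%:E <= nth_eigenvalue Om eig 1)%E.
Proof.
move=> H; apply: le_ereal_inf_tmp => _ /= [t [lambda [u [fu eu]]] <-].
rewrite lee_fin leNgt; apply/negP => tK.
have {}H i : exists c, {ae leb2, forall x : plane R, Om x -> u i x = c}.
  by have [e le] := eu i; apply: H e _; exact: le_lt_trans tK.
have [c0 H0] := H ord0; have [c1 H1] := H ord_max.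
have S (k : 'I_2 -> R) : k ord0 * c0 + k ord_max * c1 = 0 -> forall i, k i = 0.
  move=> k0; apply: fu.
  apply: (@filterS2 _ _ (ae_filter_ringOfSetsType leb2) _ _ _ _ H0 H1) => x x0 x1 Ox.
  by rewrite !big_ord_recl big_ord0 addr0 x0// (_ : lift _ _ = ord_max) ?x1//; exact: val_inj.
(* These coefficients kill the combination, so freeness gives c0 = c1 = 0; but then the sum of the
   two functions vanishes as well. *)
pose k (i : 'I_2) : R := if i == ord0 then c1 else - c0.
have K0 : forall i, k i = 0 by apply: S; rewrite /k /=; ring.
have /= := K0 ord0; have := K0 ord_max; rewrite /k /= => /eqP; rewrite oppr_eq0 => /eqP c00 c10.
have e : (1 : R) * c0 + 1 * c1 = 0 by rewrite c00 c10 !mulr0 addr0.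
by have /eqP := S (fun=> 1) e ord0; rewrite oner_eq0.
Qed.

Lemma nth_eigenvalue1_le Om (eig : R -> (R * R -> R) -> Prop) u v (lambda : R) :
  eig 0 u -> eig lambda v -> 0 <= lambda ->
  (forall k k' : R, {ae leb2, forall x : plane R, Om x -> k * u x + k' * v x = 0} -> k = 0 /\ k' = 0) ->
  (nth_eigenvalue Om eig 1 <= lambda%:E)%E.
Proof.
move=> eu ev l0 fr; apply: ereal_inf_lbound; exists lambda => //=.
pose w (i : 'I_2) := if i == ord0 then u else v.
exists (fun i : 'I_2 => if i == ord0 then 0 else lambda), w; split.
  move=> k H; have [|k0 k1] := fr (k ord0) (k ord_max).
    apply: (@filterS _ _ (ae_filter_ringOfSetsType leb2) _ _ _ H) => x Hx /Hx.
    rewrite !big_ord_recl big_ord0 addr0 /w /= => <-.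
    by congr (_ + k _ * _); exact: val_inj.
  by move=> i; have [->//|->//] : i = ord0 \/ i = ord_max;
    case: i => -[|[|//]] ?; [left|right]; exact: val_inj.
by move=> i; rewrite /w; case: eqP.
Qed.

(** Orthogonality to 1 makes 0 the nearest constant; this lets the centre k of a Poincare inequality
    be arbitrary. *)
Lemma nsq_mean0 (mu : {measure set (plane R) -> \bar R}) (D : set (plane R)) u (k : R) :
  measurable D -> (mu D < +oo)%E -> L2 mu D u -> ip mu D u (fun=> 1) = 0 ->
  nsq mu D u <= nsq mu D (fun x => u x - k).
Proof.
move=> mD fD Lu u0.
have L1 : L2 mu D (fun=> 1) by apply: (bounded_L2 mD fD (B := `|1|)).
have Lw : L2 mu D (fun x => - k * 1 + u x) by exact: L2_lin.
rewrite (@eq_nsq _ _ _ (fun x => u x - k) (fun x => - k * 1 + u x)); last by move=> x _; ring.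
rewrite /nsq ip_lin// (ipC _ _ (fun=> 1)) (ipC _ _ u) !ip_lin// (ipC _ _ (fun=> 1) u) u0.
have := nsq_ge0 mu D (fun=> 1); rewrite /nsq => n1; nra.
Qed.

End eigenvalue_bounds.

Section energy_form.
Context {R : realType}.
Variables (Om : set (plane R)) (a b c d : R).
Hypotheses (mOm : measurable Om) (ab : a <= b) (cd : c <= d) (bOm : Om `<=` rect a b c d).
Implicit Types (u v w : R * R -> R) (G H : R * R -> R * R).

Definition form G H : R := ip leb2 Om (fun x => (G x).1) (fun x => (H x).1) +
  ip leb2 Om (fun x => (G x).2) (fun x => (H x).2).

Lemma Rintegral_dot u G w H : sobolev Om u G -> sobolev Om w H ->
  \int[leb2]_(x in Om) dot (G x) (H x) = form G H.
Proof.
move=> [_ A1 A2 _] [_ B1 B2 _]; rewrite /dot /form /ip RintegralD//; exact: integrable_mul.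
Qed.

Lemma form_energy G : form G G = energy Om G. Proof. by []. Qed.

Lemma neumann_eigenfunctionP lambda u : neumann_eigenfunction Om lambda u <->
  exists2 G, sobolev Om u G & forall w H, sobolev Om w H -> form G H = lambda * ip leb2 Om u w.
Proof.
split=> -[G su H]; exists G => // w G' sw.
  by rewrite -(Rintegral_dot su sw) (H _ _ sw).
by rewrite (Rintegral_dot su sw) (H _ _ sw).
Qed.

Lemma steklov_eigenfunctionP lambda u : steklov_eigenfunction Om lambda u <->
  exists G g, [/\ sobolev Om u G, trace Om u G g & forall w H h, sobolev Om w H -> trace Om w H h ->
    form G H = lambda * ip hausdorff1 (boundary (Om : set (R * R)) : set (plane R)) g h].
Proof.
split=> -[G [g [su tu H]]]; exists G, g; split=> // w G' h sw tw.
  by rewrite -(Rintegral_dot su sw) (H _ _ _ sw tw).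
by rewrite (Rintegral_dot su sw) (H _ _ _ sw tw).
Qed.

(** Testing with u itself, the energy is lambda times the squared norm, which for lambda < 0 forces
    u = 0. *)
Lemma neumann_eigenvalue1_ge0 : (0 <= neumann_eigenvalue Om 1)%E.
Proof.
apply: nth_eigenvalue1_ge => lambda u /neumann_eigenfunctionP[G su H] l0; exists 0.
have [Lu _ _ _] := su; apply: nsq_eq0 => //; apply/eqP; rewrite eq_le nsq_ge0 andbT.
have := H _ _ su; rewrite form_energy => Hu.
have : 0 <= energy Om G by apply: addr_ge0; exact: nsq_ge0.
by rewrite Hu nmulr_rge0.
Qed.

Let cst_sobolev (k : R) : sobolev Om (fun=> k) (fun=> 0).
Proof.
have [sk gk] := @smooth_cst R k; have := smooth_sobolev mOm ab cd bOm sk.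
by congr (sobolev _ _ _); apply: funext => x; exact: gk.
Qed.

Let finO : (leb2 Om < +oo)%E. Proof. exact: finite_leb2 ab cd bOm. Qed.

Lemma form0 G : form G (fun=> 0) = 0.
Proof.
have z u : ip leb2 Om u (fun=> 0) = 0.
  rewrite /ip; have -> : (fun x => u x * 0) = fun=> 0 by apply: funext => x; exact: mulr0.
  by rewrite Rintegral_cst// mul0r.
rewrite /form.
exact: etrans (f_equal2 _ (z _) (z _)) (addr0 _).
Qed.

Let spectral_gap_arith (K lambda E n m : R) : 0 <= n -> lambda * K < 1 -> 0 <= K -> n <= m -> m <= K * E -> E = lambda * n -> n = 0.
Proof.
move=> n0 lK K0 nm mE EE; rewrite EE in mE.
have H : n * (1 - lambda * K) <= 0 by move: mE; lra.
have D : 0 < 1 - lambda * K by lra.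
by apply/eqP; rewrite eq_le n0 andbT; move: H; rewrite pmulr_lle0.
Qed.

(** Testing with 1 shows that lambda = 0 or that u has mean 0. In the first case the energy is null
    and u is constant; in the second |u|^2 <= |u - k|^2 <= K lambda |u|^2 with K lambda < 1, so u =
    0. *)
Lemma neumann_eigenvalue1_ge K : 0 < K ->
  (forall u G, sobolev Om u G -> exists k, nsq leb2 Om (fun x => u x - k) <= K * energy Om G) ->
  ((K^-1)%:E <= neumann_eigenvalue Om 1)%E.
Proof.
move=> K0 P; apply: nth_eigenvalue1_ge => lambda u /neumann_eigenfunctionP[G su H] lK.
have {}lK : lambda * K < 1 by rewrite -ltr_pdivlMr// div1r.
have [Lu _ _ _] := su; have [k Hk] := P _ _ su.
have := H _ _ (cst_sobolev 1); rewrite form0 => /esym/eqP; rewrite mulf_eq0 => /orP[/eqP l0|/eqP u0].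
  exists k; have E0 : energy Om G = 0 by have := H _ _ su; rewrite form_energy l0 mul0r.
  have L1 : L2 leb2 Om (fun=> k) by have [] := cst_sobolev k.
  have H0 : {ae leb2, forall x : plane R, Om x -> u x - k = 0}.
    apply: nsq_eq0 => //; first exact: L2_diff.
    by apply/eqP; rewrite eq_le nsq_ge0 andbT; move: Hk; rewrite E0 mulr0.
  by apply: (@filterS _ _ (ae_filter_ringOfSetsType leb2) _ _ _ H0) => x Hx /Hx /eqP; rewrite subr_eq0 => /eqP.
exists 0; apply: nsq_eq0 => //.
have M := nsq_mean0 k mOm finO Lu u0.
exact: (spectral_gap_arith (nsq_ge0 _ _ _) lK (ltW K0) M Hk (H _ _ su)).
Qed.

Notation B := (boundary (Om : set (R * R)) : set (plane R)).
Hypothesis finB : (hausdorff1 B < +oo)%E.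
Hypothesis bB : B `<=` [set` `[a, b]] `*` [set` `[c, d]].
Let mB : measurable B. Proof. exact: measurable_boundary. Qed.

(** The argument of [neumann_eigenvalue1_ge] on the boundary. The boundary norm does not see the
    interior: the second hypothesis is what makes a function of null energy constant in Om. *)
Lemma steklov_eigenvalue1_ge K : 0 < K ->
  (forall u G g, sobolev Om u G -> trace Om u G g ->
    exists2 k, nsq hausdorff1 B (fun x => g x - k) <= K * energy Om G &
      energy Om G = 0 -> nsq leb2 Om (fun x => u x - k) = 0) ->
  ((K^-1)%:E <= steklov_eigenvalue Om 1)%E.
Proof.
move=> K0 P; apply: nth_eigenvalue1_ge => lambda u /steklov_eigenfunctionP[G [g [su tu H]]] lK.
have {}lK : lambda * K < 1 by rewrite -ltr_pdivlMr// div1r.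
have [Lu _ _ _] := su; have [k Hk Ek] := P _ _ _ su tu.
suff E0 : energy Om G = 0.
  exists k; have L1 : L2 leb2 Om (fun=> k) by have [] := cst_sobolev k.
  have H0 : {ae leb2, forall x : plane R, Om x -> u x - k = 0}.
    by apply: nsq_eq0; [by []|exact: L2_diff|exact: Ek].
  by apply: (@filterS _ _ (ae_filter_ringOfSetsType leb2) _ _ _ H0) => x Hx /Hx /eqP; rewrite subr_eq0 => /eqP.
have T1 : trace Om (fun=> 1) (fun=> 0) (fun=> 1).
  have [s1 g1] := @smooth_cst R 1; have := smooth_trace mOm ab cd bOm finB bB s1.
  by congr (trace _ _ _ _); apply: funext => x; exact: g1.
have Eu := H _ _ _ su tu; rewrite form_energy in Eu; rewrite Eu.
have := H _ _ _ (cst_sobolev 1) T1; rewrite form0 => /esym/eqP; rewrite mulf_eq0 => /orP[/eqP ->|/eqP u0].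
  by rewrite mul0r.
have [Lg _] := tu; have M := nsq_mean0 k mB finB Lg u0.
rewrite (_ : ip _ _ _ _ = 0) ?mulr0//.
exact: (spectral_gap_arith (nsq_ge0 _ _ _) lK (ltW K0) M Hk Eu).
Qed.

End energy_form.

Section null_functions.
Context {R : realType}.
Variables (Om : set (plane R)) (a b c d : R).
Hypotheses (mOm : measurable Om) (ab : a <= b) (cd : c <= d) (bOm : Om `<=` rect a b c d).
Implicit Types (u v w : R * R -> R) (G H : R * R -> R * R).

Let finO : (leb2 Om < +oo)%E. Proof. exact: finite_leb2 ab cd bOm. Qed.

(** The indicator of a rectangle is a bounded limit of products of bumps. *)
Lemma weak_null v : L2 leb2 Om v -> (forall f, test_function Om f -> \int[leb2]_(x in Om) (v x * f x) = 0) ->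
  forall p q r s, rect p q r s `<=` Om -> \int[leb2]_(x in rect p q r s) v x = 0.
Proof.
move=> Lv null p q r s sub.
have mQ : measurable (rect p q r s : set (plane R)) by exact: measurable_rect.
have iv := L2_integrable mOm finO Lv.
pose f n : R * R -> R := tensor (bump p q n) (bump r s n).
have tf n : test_function Om (f n).
  apply: (@test_tensor _ _ _ _ (p + n.+1%:R^-1) (q - n.+1%:R^-1) (r + n.+1%:R^-1) (s - n.+1%:R^-1));
    [exact: smooth1_bump|exact: smooth1_bump|by move=> t; exact: bump_eq0|by move=> t; exact: bump_eq0|].
  have n0 : (0 : R) < n.+1%:R^-1 by rewrite invr_gt0.
  move: (n.+1%:R^-1) n0 => e e0; apply: subset_trans sub => x [/= ].
  by rewrite !in_itv/= => /andP[? ?] /andP[? ?]; apply/rectE; split; lra.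
have f01 n x : 0 <= f n x <= 1.
  have := bump_ge0 p q n x.1; have := bump_ge0 r s n x.2; have := bump_le1 p q n x.1; have := bump_le1 r s n x.2.
  by rewrite /f /tensor => ? ? ? ?; rewrite mulr_ge0//= mulr_ile1.
have mf n : measurable_fun Om (f n : plane R -> R).
  by have [sf _ _] := tf n; have [m _ _] := smooth_measurable Om sf.
have C : \int[leb2]_(x in Om) (v x * f n x) @[n --> \oo] --> \int[leb2]_(x in Om) (v x * \1_(rect p q r s) x).
  refine (@cvg_Rintegral _ _ _ leb2 Om (fun n x => v x * f n x) _ (fun x => `|v x|) mOm _ _ _ _).
  - by move=> n; apply: measurable_funM => //; exact: (Lv.1).
  - by apply: integrable_norm.
  - move=> x Ox; apply: cvgM; first exact: cvg_cst.
    by rewrite rect_indic; apply: cvgM; exact: bump_cvg.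
  - move=> n x Ox; rewrite normrM ler_piMr//.
    by have /andP[f0 f1] := f01 n x; rewrite ger0_norm.
rewrite -(Rintegral_mul_indic leb2 v mOm sub).
move: C; under eq_cvg do rewrite null//.
by move=> C; apply: (@cvg_unique _ (@Rhausdorff R) _ _ _ _ C); exact: cvg_cst.
Qed.

(** [ae_ge0_rect] applied to v and to - v, cut off outside the rectangle. *)
Lemma null_integral_rect v p q r s : L2 leb2 Om v -> rect p q r s `<=` Om ->
  (forall p q r s, rect p q r s `<=` Om -> \int[leb2]_(x in rect p q r s) v x = 0) ->
  nsq leb2 (rect p q r s) v = 0.
Proof.
move=> Lv sub null; pose Q : set (plane R) := rect p q r s.
have mQ : measurable Q by exact: measurable_rect.
have LQ := L2_sub mOm mQ sub Lv.
have iv : leb2.-integrable Q (fun x : plane R => (v x)%:E).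
  exact: integrableS mOm mQ sub (L2_integrable mOm finO Lv).
have pos (k : R) : {ae leb2, forall x : plane R, 0 <= ((fun x => k * v x) \_ Q) x}.
  have ik : leb2.-integrable Q (fun x : plane R => (k * v x)%:E).
    by under eq_fun do rewrite EFinM; exact: integrableZl.
  apply: ae_ge0_rect.
    by rewrite -restrict_EFin; apply/(integrable_mkcond _ _).1.
  move=> a' b' c' d' _ _; set Q' : set (plane R) := rect a' b' c' d'.
  have -> : (\int[leb2]_(x in Q') (((fun x => k * v x) \_ Q) x)%:E =
             \int[leb2]_(x in Q' `&` Q) (k * v x)%:E)%E.
    by rewrite [RHS]integral_mkcondr; apply: eq_integral => x _; rewrite !patchE; case: ifP.
  have mQ' : measurable (Q' `&` Q) by apply: measurableI => //; exact: measurable_rect.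
  have sQ : Q' `&` Q `<=` Q by move=> x [].
  have ik' := integrableS mQ mQ' sQ ik.
  rewrite -(fineK (integrable_fin_num mQ' ik')) -[fine _]/(Rintegral _ _ _) RintegralZl//; last exact: integrableS iv.
  by rewrite /Q' /Q rectI null ?mulr0// -rectI => x [_ /sub].
apply: ae0_nsq => //.
apply: (@filterS2 _ _ (ae_filter_ringOfSetsType leb2) _ _ _ _ (pos 1) (pos (-1))) => x.
by rewrite !patchE => H1 H2 Qx; move: H1 H2; rewrite (mem_set Qx); lra.
Qed.

(** Uniqueness of the weak gradient, rectangle by rectangle: a null function has null integrals
    against all derivatives of test functions, hence so has its gradient against all test
    functions. *)
Lemma null_gradient u G : sobolev Om u G -> nsq leb2 Om u = 0 ->
  forall p q r s, rect p q r s `<=` Om ->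
  nsq leb2 (rect p q r s) (fun x => (G x).1) = 0 /\ nsq leb2 (rect p q r s) (fun x => (G x).2) = 0.
Proof.
move=> [Lu L1 L2' wk] u0.
have z f : L2 leb2 Om f -> \int[leb2]_(x in Om) (u x * f x) = 0.
  move=> Lf; apply/eqP; rewrite -sqrf_eq0 eq_le sqr_ge0 andbT.
  by have := ip_bound mOm Lu Lf; rewrite u0 mul0r.
have n v : L2 leb2 Om v -> (forall f, test_function Om f -> \int[leb2]_(x in Om) (v x * f x) = 0) ->
    forall p q r s, rect p q r s `<=` Om -> nsq leb2 (rect p q r s) v = 0.
  by move=> Lv H p q r s sub; apply: null_integral_rect => //; exact: weak_null.
have H f : test_function Om f -> \int[leb2]_(x in Om) ((G x).1 * f x) = 0 /\ \int[leb2]_(x in Om) ((G x).2 * f x) = 0.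
  move=> tf; have [sf _ _] := tf; have [_ g1 g2 _] := smooth_sobolev mOm ab cd bOm sf.
  have [/esym/eqP] := wk f tf; rewrite (z _ g1) oppr_eq0 => /eqP -> /esym/eqP.
  by rewrite (z _ g2) oppr_eq0 => /eqP ->.
move=> p q r s sub; split; [apply: n L1 _ _ _ _ _ sub|apply: n L2' _ _ _ _ _ sub] => f /H[] //.
Qed.

End null_functions.

Section completeness.
Context {R : realType}.
Variables (Om : set (plane R)) (a b c d : R).
Hypotheses (mOm : measurable Om) (ab : a <= b) (cd : c <= d) (bOm : Om `<=` rect a b c d).
Implicit Types (u v w : R * R -> R) (G H : R * R -> R * R).
Notation N := (nsq leb2 Om).

(** The function and the two components of its gradient converge separately in L^2; [sobolev_closed]
    then relates the limits. *)
Lemma sobolev_complete (u : nat -> R * R -> R) (G : nat -> R * R -> R * R) :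
  (forall n, sobolev Om (u n) (G n)) ->
  (forall e, 0 < e -> exists n0, forall n m, (n0 <= n)%N -> (n0 <= m)%N ->
    energy Om (fun x => G n x - G m x) + N (fun x => u n x - u m x) <= e) ->
  exists v H, sobolev Om v H /\ forall e, 0 < e -> exists n0, forall n, (n0 <= n)%N ->
    energy Om (fun x => H x - G n x) + N (fun x => v x - u n x) <= e.
Proof.
move=> su cau.
have cauchy (f : nat -> R * R -> R) : (forall n, L2 leb2 Om (f n)) ->
    (forall n m, N (fun x => f n x - f m x) <=
      energy Om (fun x => G n x - G m x) + N (fun x => u n x - u m x)) ->
    exists2 w, L2 leb2 Om w & forall e, 0 < e -> exists n0, forall n, (n0 <= n)%N -> N (fun x => w x - f n x) <= e.
  move=> Lf le; apply: nsq_complete => // e e0; have [n0 H] := cau _ e0.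
  by exists n0 => n m nn mm; exact: le_trans (le n m) (H n m nn mm).
have n0 := nsq_ge0 leb2 Om.
have [v Lv Cv] : exists2 w, L2 leb2 Om w & forall e, 0 < e -> exists n0, forall n, (n0 <= n)%N -> N (fun x => w x - u n x) <= e.
  apply: cauchy => [n|n m]; first by have [] := su n.
  by rewrite lerDr addr_ge0.
have [H1 L1 C1] : exists2 w, L2 leb2 Om w & forall e, 0 < e -> exists n0, forall n, (n0 <= n)%N -> N (fun x => w x - (G n x).1) <= e.
  apply: cauchy => [n|n m]; first by have [] := su n.
  by rewrite /energy -addrA lerDl addr_ge0.
have [H2 L2' C2] : exists2 w, L2 leb2 Om w & forall e, 0 < e -> exists n0, forall n, (n0 <= n)%N -> N (fun x => w x - (G n x).2) <= e.
  apply: cauchy => [n|n m]; first by have [] := su n.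
  by rewrite /energy [X in X + _]addrC -addrA lerDl addr_ge0.
exists v, (fun x => (H1 x, H2 x)); split.
  apply: (sobolev_closed (G := fun x => (H1 x, H2 x)) mOm ab cd bOm Lv L1 L2') => e e0.
  have [nv Hv] := Cv _ e0; have [n1 Hn1] := C1 _ e0; have [n2 Hn2] := C2 _ e0.
  pose n := maxn nv (maxn n1 n2); exists (u n), (G n); split=> //.
  by split=> //=; [apply: Hv|apply: Hn1|apply: Hn2]; rewrite /n !leq_max leqnn ?orbT.
move=> e e0; have e3 : 0 < e / 3 by lra.
have [nv Hv] := Cv _ e3; have [n1 Hn1] := C1 _ e3; have [n2 Hn2] := C2 _ e3.
exists (maxn nv (maxn n1 n2)) => n; rewrite !geq_max => /andP[/Hv hv /andP[/Hn1 h1 /Hn2 h2]].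
rewrite (_ : e = e / 3 + e / 3 + e / 3); last by field.
by rewrite /energy; apply: lerD => //; apply: lerD.
Qed.

Lemma mean_lin k u v (p q r s : R) : rect p q r s `<=` Om -> L2 leb2 Om u -> L2 leb2 Om v ->
  mean (fun x => k * u x + v x) p q r s = k * mean u p q r s + mean v p q r s.
Proof.
move=> sub Lu Lv; have mr : measurable (rect p q r s : set (plane R)) by exact: measurable_rect.
have finO : (leb2 Om < +oo)%E by exact: finite_leb2 ab cd bOm.
have iu := integrableS mOm mr sub (L2_integrable mOm finO Lu).
have iv := integrableS mOm mr sub (L2_integrable mOm finO Lv).
have ik : leb2.-integrable (rect p q r s) (fun x : plane R => (k * u x)%:E).
  by under eq_fun do rewrite EFinM; exact: integrableZl.
by rewrite /mean (RintegralD mr ik iv) RintegralZl// mulrDl mulrA.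
Qed.

Lemma mean_sqr u (p q r s : R) : rect p q r s `<=` Om -> p < q -> r < s -> L2 leb2 Om u ->
  mean u p q r s ^+ 2 <= ((q - p) * (s - r))^-1 * N u.
Proof.
move=> sub pq rs Lu; have mr : measurable (rect p q r s : set (plane R)) by exact: measurable_rect.
have m0 : 0 < (q - p) * (s - r) by rewrite mulr_gt0 ?subr_gt0.
have Lr := L2_sub mOm mr sub Lu.
have := sqr_Rintegral_le mr m0 (leb2_rect (ltW pq) (ltW rs)) Lr.1.
have := nsqE mr Lr; rewrite /sqint => ->; rewrite -EFinM lee_fin => H.
rewrite /mean; move: ((q - p) * (s - r)) m0 H => m m0 H.
have {}H : (\int[leb2]_(x in rect p q r s) u x) ^+ 2 <= m * N u.
  by apply: (le_trans H); rewrite ler_pM2l//; exact: nsq_sub.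
rewrite exprMn exprVn ler_pdivrMr ?exprn_gt0// mulrAC expr2 mulrA mulVf ?gt_eqF// mul1r.
exact: H.
Qed.

End completeness.

Lemma nsq_le {R : realType} (mu : {measure set (plane R) -> \bar R}) (D : set (plane R)) (u v : R * R -> R) :
  measurable D -> L2 mu D u -> L2 mu D v -> (forall x, D x -> u x ^+ 2 <= v x ^+ 2) -> nsq mu D u <= nsq mu D v.
Proof.
move=> mD Lu Lv uv; apply: le_Rintegral => //; first exact: integrable_mul.
  exact: integrable_mul.
Qed.

Lemma nsq_null {R : realType} (mu : {measure set (plane R) -> \bar R}) (D : set (plane R)) (u : R * R -> R) :
  measurable D -> (forall x, D x -> u x = 0) -> nsq mu D u = 0.
Proof.
move=> mD u0; rewrite (@eq_nsq _ _ _ u (fun=> 0))//.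
rewrite /nsq /ip (_ : (fun _ => _) = fun=> 0); last by apply: funext => x; rewrite mulr0.
by rewrite Rintegral_cst// mul0r.
Qed.

Section test.
Context {R : realType}.
Variables (l L w h : R).
Hypothesis th : thin l L w h.
Notation Om := (dumbbell l L w h : set (plane R)).
Notation N := (nsq leb2 Om).
Notation En := (energy Om).

Let mO := measurable_Om l L w h.

(** The primitive in x.1 of a bump on ]0, l[, divided by the mass of the bump. A bump of mass more
    than l / 2 keeps the slope below 2 / l, and (2 / l)^2 times the area l w of the corridor is 4 w
    / l. *)
Lemma ramp : exists f : R * R -> R, [/\ smooth f, forall x, x.1 <= 0 -> f x = 0,
  forall x, l <= x.1 -> f x = 1 & En (grad f) <= 4 * w / l].
Proof.
have [w0 wh h1 wl [l1 L1]] := th; have l0 : 0 < l by lra.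
have [n mn] : exists n, l / 2 < mass 0 l n.
  have C := @mass_cvg R 0 l (ltW l0); rewrite subr0 in C.
  have H : l / 2 < l by lra.
  by have [N _ HN] := cvgr_gt _ C _ H; exists N; apply: HN => /=.
pose m := mass 0 l n; have m0 : 0 < m by rewrite /m; lra.
have s1 := @smooth1_bump R 0 l n; have sc := smooth1_continuous s1.
have z t : ~ (0 < t < l) -> bump 0 l n t = 0 by exact: bump_eq0_itv.
have zl t : t < 0 -> bump 0 l n t = 0 by move=> t0; apply: z => /andP[? _]; lra.
have zr t : l < t -> bump 0 l n t = 0 by move=> t0; apply: z => /andP[_ ?]; lra.
have H : m^-1 <= 2 / l by rewrite -[leLHS]div1r ler_pdivrMr// mulrAC ler_pdivlMr//; rewrite /m; lra.
have m0' : 0 <= m^-1 by rewrite invr_ge0 ltW.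
have l0' : 0 <= 2 / l by rewrite divr_ge0// ltW.
have lw : 0 <= l * w by rewrite mulr_ge0// ltW.
have Hm : m^-1 ^+ 2 * (l * w) <= 4 * w / l.
  have H2 : m^-1 ^+ 2 <= (2 / l) ^+ 2 by rewrite ler_pXn2r ?nnegrE.
  apply: (le_trans (ler_wpM2r lw H2)).
  by rewrite (_ : (2 / l) ^+ 2 * (l * w) = 4 * w / l)//; field; rewrite gt_eqF.
pose T t : R := m^-1 * prim (bump 0 l n) t.
have sT : smooth1 T.
  by move=> k; apply: (C1kM (f := cst m^-1)); [exact: C1k_cst|exact: C1k_prim s1 z].
have s1' : smooth1 (cst (1 : R)) by move=> k; exact: C1k_cst.
have dT t : derive1 T t = m^-1 * bump 0 l n t.
  have D := is_derive_prim t sc z.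
  by rewrite derive1E; apply: derive_val.
pose f : R * R -> R := tensor T (cst 1).
have gf x : grad f x = (m^-1 * bump 0 l n x.1, 0).
  have [_ _ ->] := derive_tensor x sT s1'; rewrite dT mulr1.
  by rewrite (derive1_cst (1 : R)) mulr0.
have sf : smooth f by exact: smooth_tensor.
exists f; split=> //.
- by move=> x x0; rewrite /f /tensor /T (prim_left z x0) mulr0 mul0r.
- by move=> x xl; rewrite /f /tensor /T (prim_right z xl) mulr1 mulVf// gt_eqF.
have b1 : -2 <= L + 2 by lra.
have b2 : -1 <= (2 : R) by lra.
have [_ L1' L2' _] := smooth_sobolev mO b1 b2 (dumbbell_box th) sf.
have N2 : N (fun x => (grad f x).2) = 0.
  by apply: ae0_nsq => //; apply: aeW => x _; rewrite gf.
have -> : En (grad f) = N (fun x => (grad f x).1) by exact: etrans (f_equal _ N2) (addr0 _).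
have NR := nsq_rooms th L1'.
apply: (le_trans NR).
have mr (a b c d : R) : measurable (rect a b c d : set (plane R)) by exact: measurable_rect.
have z1 : nsq leb2 (room1 : set (plane R)) (fun x => (grad f x).1) = 0.
  apply: (nsq_null leb2 (mr (-1) 0 0 1)) => x /rectE[? x0 ? ?].
  by rewrite gf /= zl ?mulr0.
have z3 : nsq leb2 (room3 l L h) (fun x => (grad f x).1) = 0.
  apply: (nsq_null leb2 (mr l (l + L) 0 h)) => x /rectE[xl ? ? ?].
  by rewrite gf /= zr ?mulr0.
have a2 : leb2 (room2 l w) = (l * w)%:E by rewrite leb2_rect ?(ltW l0) ?(ltW w0)//; congr EFin; ring.
have f2 : (leb2 (room2 l w) < +oo)%E by rewrite a2 ltry.
have m2 : measurable (room2 l w) by exact: mr.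
rewrite z1 z3 add0r addr0.
apply: (@le_trans _ _ (nsq leb2 (room2 l w) (fun=> m^-1))).
  apply: (nsq_le m2 (L2_sub mO m2 (room2_sub th) L1') (L2_cst m^-1 m2 f2)).
  by move=> x _; rewrite gf /= exprMn ler_piMr ?sqr_ge0// expr_le1 ?bump_ge0 ?bump_le1.
by rewrite (nsq_cst _ m2 a2).
Qed.

End test.

Section ramp_gap.
Context {R : realType}.

Let ramp_arith (k m : R) : 0 < m -> m / (1 + m) <= k ^+ 2 + (1 - k) ^+ 2 * m.
Proof.
move=> m0; rewrite ler_pdivrMr; last by lra.
have -> : (k ^+ 2 + (1 - k) ^+ 2 * m) * (1 + m) = m + (k * (1 + m) - m) ^+ 2 by ring.
by rewrite lerDl sqr_ge0.
Qed.

(** m / (1 + m) is the minimum over k of k^2 + (1 - k)^2 m, the contribution of the sets A and A',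
    of measures 1 and m, where f is 0 and 1. *)
Lemma ramp_nsq (mu : {measure set (plane R) -> \bar R}) (D A A' : set (plane R)) (f : R * R -> R) (k m : R) :
  measurable D -> measurable A -> measurable A' -> A `<=` D -> A' `<=` D -> A `&` A' = set0 ->
  mu A = 1%E -> mu A' = m%:E -> 0 < m -> L2 mu D (fun x => f x - k) ->
  (forall x, A x -> f x = 0) -> (forall x, A' x -> f x = 1) ->
  m / (1 + m) <= nsq mu D (fun x => f x - k).
Proof.
move=> mD mA mA' AD A'D AA' A1 A'm m0 Lf f0 f1.
have sub : A `|` A' `<=` D by move=> x [/AD|/A'D].
have mU : measurable (A `|` A') by exact: measurableU.
apply: le_trans (nsq_sub mU mD sub Lf); rewrite (nsq_setU mA mA' AA' (L2_sub mD mU sub Lf)).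
apply: le_trans (ramp_arith k m0) _; apply: lerD.
  rewrite (@eq_nsq _ _ _ (fun x => f x - k) (fun=> - k)); last by move=> x /f0 ->; rewrite sub0r.
  by rewrite (nsq_cst _ mA A1) sqrrN mulr1.
rewrite (@eq_nsq _ _ _ (fun x => f x - k) (fun=> 1 - k)); last by move=> x /f1 ->.
by rewrite (nsq_cst _ mA' A'm).
Qed.

Lemma centered (mu : {measure set (plane R) -> \bar R}) (D : set (plane R)) (f : R * R -> R) :
  measurable D -> (mu D < +oo)%E -> (0 < mu D)%E -> L2 mu D f -> exists k, ip mu D (fun x => f x - k) (fun=> 1) = 0.
Proof.
move=> mD fD D0 Lf; have L1 := L2_cst 1 mD fD.
have n1 : ip mu D (fun=> 1) (fun=> 1) = fine (mu D) by rewrite /ip Rintegral_cst// mulr1 mul1r.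
have p : 0 < fine (mu D) by rewrite fine_gt0// D0.
pose k := ip mu D f (fun=> 1) / fine (mu D); exists k.
rewrite (_ : (fun x => f x - k) = (fun x => - k * 1 + f x)); last by apply: funext => x; ring.
by rewrite ip_lin// n1 /k mulNr divfK ?gt_eqF// addrC subrr.
Qed.

End ramp_gap.

(** * Existence of eigenfunctions *)

Section existence.
Context {R : realType}.
Variables (l L w h : R).
Hypothesis th : thin l L w h.
Notation Om := (dumbbell l L w h : set (plane R)).
Notation B := (boundary (dumbbell l L w h) : set (plane R)).
Notation N := (nsq leb2 Om).

Let mO := measurable_Om l L w h.
Let mB : measurable B. Proof. exact: measurable_boundary. Qed.
Let L_box : -2 <= L + 2 :> R. Proof. by case: th => ? ? ? ? [? ?]; lra. Qed.
Let box_y : -1 <= 2 :> R. Proof. by lra. Qed.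
Let bO := dumbbell_box th.
Let bB := boundary_box th.
Notation fB := (finite_boundary th).

(* The components are a function, the two components of its gradient and its trace. *)
Definition quad := ((R * R -> R^o) * (R * R -> R^o) * (R * R -> R^o) * (R * R -> R^o))%type.
Implicit Types x y : quad.
Definition fct x : R * R -> R := x.1.1.1.
Definition grd x : R * R -> R * R := fun z => (x.1.1.2 z, x.1.2 z).
Definition bdv x : R * R -> R := x.2.

Definition energy_form x y := form Om (grd x) (grd y).
Definition mass_form x y := ip leb2 Om (fct x) (fct y).
Definition boundary_form x y := ip hausdorff1 B (bdv x) (bdv y).
Definition neumann_space : set quad := [set x | sobolev Om (fct x) (grd x)].
Definition steklov_space : set quad :=
  [set x | sobolev Om (fct x) (grd x) /\ trace Om (fct x) (grd x) (bdv x)].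

Lemma linear_neumann : linear_set neumann_space.
Proof. by move=> k x y sx sy; exact: (sobolev_lin mO L_box box_y bO k sx sy). Qed.

Lemma linear_steklov : linear_set steklov_space.
Proof.
move=> k x y [sx tx] [sy ty]; split; first exact: (sobolev_lin mO L_box box_y bO k sx sy).
exact: (trace_lin mO L_box box_y bO fB bB k sx tx sy ty).
Qed.

Lemma semi_inner_mass : semi_inner neumann_space mass_form.
Proof.
split=> [x y _ _|k x y z [Lx _ _ _] [Ly _ _ _] [Lz _ _ _]|x _].
- exact: ipC.
- exact: (ip_lin mO k Lx Ly Lz).
- exact: nsq_ge0.
Qed.

Lemma semi_inner_energy : semi_inner neumann_space energy_form.
Proof.
split=> [x y _ _|k x y z [_ X1 X2 _] [_ Y1 Y2 _] [_ Z1 Z2 _]|x _].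
- by congr (_ + _); exact: ipC.
- have H1 := ip_lin mO k X1 Y1 Z1; have H2 := ip_lin mO k X2 Y2 Z2.
  by apply: (etrans (f_equal2 _ H1 H2)); rewrite /energy_form /form; ring.
- by apply: addr_ge0; exact: nsq_ge0.
Qed.

Lemma semi_innerS (S S' : set quad) b : S `<=` S' -> semi_inner S' b -> semi_inner S b.
Proof.
move=> SS [b1 b2 b3]; split=> [x y /SS Sx /SS Sy|k x y z /SS Sx /SS Sy /SS Sz|x /SS Sx].
- exact: b1.
- exact: b2.
- exact: b3.
Qed.

Lemma semi_inner_boundary : semi_inner steklov_space boundary_form.
Proof.
split=> [x y _ _|k x y z [_ [Lx _]] [_ [Ly _]] [_ [Lz _]]|x _].
- exact: ipC.
- exact: (ip_lin mB k Lx Ly Lz).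
- exact: nsq_ge0.
Qed.

Let lin_bound_arith (k m A n X C1 C2 C0 : R) : m ^+ 2 <= A * n -> 0 <= A -> n <= C0 * X -> 0 <= X -> 0 <= C0 ->
  k ^+ 2 * A <= C1 -> C1 <= C2 -> (k * m) ^+ 2 <= C2 * C0 * X.
Proof.
move=> H1 A0 H2 X0 C00 H3 H4; rewrite exprMn.
apply: (le_trans (ler_wpM2l (sqr_ge0 k) H1)); rewrite mulrA.
have CX : 0 <= C0 * X by rewrite mulr_ge0.
have kA : 0 <= k ^+ 2 * A by rewrite mulr_ge0// sqr_ge0.
apply: (le_trans (ler_wpM2l kA H2)); rewrite -[leRHS]mulrA ler_wpM2r//.
exact: le_trans H4.
Qed.

Let nums : [/\ [/\ 0 < l, 0 < w, 0 < h & 0 < L], [/\ w < 1, h < 1, l <= 1 & 1 <= L] & w <= l /\ w < h].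
Proof. by case: th => ? ? ? ? [? ?]; split; split; lra. Qed.

(** The common instance of [direct_method] for both problems: b is the mass or the boundary mass,
    and the functionals are multiples of the means over the three rooms. Control of the L^2 norm by
    C0 makes them continuous. *)
Lemma constrained_minimizer (S : set quad) b (k C0 K : R) e phi :
  linear_set S -> S `<=` neumann_space -> semi_inner S b -> 0 <= C0 ->
  (forall x, S x -> N (fct x) <= C0 * (energy_form x x + b x x)) ->
  (forall s : nat -> quad, (forall n, S (s n)) ->
    (forall eps, 0 < eps -> exists n0, forall n m, (n0 <= n)%N -> (n0 <= m)%N ->
      energy_form (s n - s m) (s n - s m) + b (s n - s m) (s n - s m) <= eps) ->
    exists2 u, S u & forall eps, 0 < eps -> exists n0, forall n, (n0 <= n)%N ->
      energy_form (u - s n) (u - s n) + b (u - s n) (u - s n) <= eps) ->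
  0 <= K ->
  (forall x, S x -> b x x <= K * energy_form x x +
    ((k * mean1 (fct x)) ^+ 2 + (k * mean2 l w (fct x)) ^+ 2 + (k * L * mean3 l L h (fct x)) ^+ 2)) ->
  S e -> energy_form e e = 0 -> 0 < b e e ->
  S phi -> b phi e = 0 -> 0 < b phi phi -> K * energy_form phi phi < b phi phi ->
  exists u lambda, [/\ S u, 0 < b u u, b u e = 0,
    lambda * b phi phi <= energy_form phi phi & forall x, S x -> energy_form u x = lambda * b u x].
Proof.
move=> SL SN Sb C00 N0 cpl K0 gap Se e0 be Sphi pe bphi gphi.
have [[l0 w0 h0 L0] [w1 h1 l1 L1] [wl wh]] := nums.
pose F (i : 'I_3) x : R :=
  nth 0 [:: k * mean1 (fct x); k * mean2 l w (fct x); k * L * mean3 l L h (fct x)] i.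
pose A1 : R := ((0 - -1) * (1 - 0))^-1; pose A2 : R := ((l - 0) * (w - 0))^-1.
pose A3 : R := ((l + L - l) * (h - 0))^-1.
have A10 : 0 <= A1 by rewrite invr_ge0 subr0 sub0r opprK mulr1.
have A20 : 0 <= A2 by rewrite invr_ge0 !subr0 mulr_ge0// ltW.
have A30 : 0 <= A3 by rewrite invr_ge0 subr0 addrAC subrr add0r mulr_ge0// ltW.
pose C := k ^+ 2 * A1 + (k ^+ 2 * A2 + (k * L) ^+ 2 * A3).
have p1 : 0 <= k ^+ 2 * A1 by rewrite mulr_ge0// sqr_ge0.
have p2 : 0 <= k ^+ 2 * A2 by rewrite mulr_ge0// sqr_ge0.
have p3 : 0 <= (k * L) ^+ 2 * A3 by rewrite mulr_ge0// sqr_ge0.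
have C1 : k ^+ 2 * A1 <= C by rewrite /C; lra.
have C2 : k ^+ 2 * A2 <= C by rewrite /C; lra.
have C3 : (k * L) ^+ 2 * A3 <= C by rewrite /C; lra.
have q01 : (-1 : R) < 0 by lra.
have q3 : l < l + L by lra.
have r1 := @room1_sub R l L w h th; have r2 := room2_sub th; have r3 := room3_sub th.
have Sa := semi_innerS SN semi_inner_energy.
apply: (direct_method (l := F) (C := C * C0) SL Sa Sb cpl K0 _ _ _ Se e0 be Sphi pe bphi gphi).
- move=> x Sx; rewrite !big_ord_recl big_ord0 addr0; have := gap x Sx; rewrite -[_ + _ + (k * L * _) ^+ 2]addrA; exact.
- have lin (r t : R) (p q p' q' : R) x y : rect p q p' q' `<=` Om -> S x -> S y ->
      t * mean (fct (r *: x + y)) p q p' q' = r * (t * mean (fct x) p q p' q') + t * mean (fct y) p q p' q'.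
    move=> sub /SN [Lx _ _ _] /SN [Ly _ _ _].
    have -> : mean (fct (r *: x + y)) p q p' q' = r * mean (fct x) p q p' q' + mean (fct y) p q p' q'.
      exact: (mean_lin mO L_box box_y bO r sub Lx Ly).
    by rewrite mulrDr mulrCA.
  by move=> [[|[|[|//]]] ?] r x y Sx Sy; apply: lin.
- have X0 x : S x -> 0 <= energy_form x x + b x x.
    by move=> Sx; have [_ _ a0] := Sa; have [_ _ b0] := Sb; rewrite addr_ge0 ?a0 ?b0.
  have ms (p q p' q' : R) x : rect p q p' q' `<=` Om -> p < q -> p' < q' -> S x ->
      mean (fct x) p q p' q' ^+ 2 <= ((q - p) * (q' - p'))^-1 * N (fct x).
    by move=> sub pq pq' /SN [Lx _ _ _]; exact: mean_sqr.
  move=> [[|[|[|//]]] ?] x Sx.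
  + exact: lin_bound_arith (ms _ _ _ _ x r1 q01 ltr01 Sx) A10 (N0 x Sx) (X0 x Sx) C00 C1 (lexx _).
  + exact: lin_bound_arith (ms _ _ _ _ x r2 l0 w0 Sx) A20 (N0 x Sx) (X0 x Sx) C00 C2 (lexx _).
  + exact: lin_bound_arith (ms _ _ _ _ x r3 q3 h0 Sx) A30 (N0 x Sx) (X0 x Sx) C00 C3 (lexx _).
Qed.

End existence.

Section independence.
Context {R : realType}.
Variables (mu : {measure set (plane R) -> \bar R}) (D : set (plane R)).
Hypotheses (mD : measurable D) (fD : (mu D < +oo)%E).
Implicit Types (u v w : R * R -> R).

Lemma ip_lin2 (k k' : R) u v w : L2 mu D u -> L2 mu D v -> L2 mu D w ->
  ip mu D (fun x => k * u x + k' * v x) w = k * ip mu D u w + k' * ip mu D v w.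
Proof.
move=> Lu Lv Lw; have L0 := L2_cst 0 mD fD.
have z : ip mu D (fun=> 0) w = 0.
  rewrite /ip; have -> : (fun x => 0 * w x) = fun=> 0 by apply: funext => x; exact: mul0r.
  by rewrite Rintegral_cst// mul0r.
have e : (fun x => k' * v x + 0) = (fun x => k' * v x) by apply: funext => x; exact: addr0.
have Lv' := L2_lin mD k' Lv L0; have H := ip_lin mD k' Lv L0 Lw.
by rewrite e in Lv' H; rewrite (ip_lin mD k Lu Lv' Lw) H z addr0.
Qed.

Lemma orthogonal_free (k k' : R) u v : L2 mu D u -> L2 mu D v -> ip mu D u v = 0 ->
  0 < nsq mu D u -> 0 < nsq mu D v -> nsq mu D (fun x => k * u x + k' * v x) = 0 -> k = 0 /\ k' = 0.
Proof.
move=> Lu Lv uv u0 v0.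
have Lz : L2 mu D (fun x => k * u x + k' * v x).
  have := L2_lin mD k Lu (L2_lin mD k' Lv (L2_cst 0 mD fD)).
  by congr (L2 _ _ _); apply: funext => x; rewrite addr0.
rewrite /nsq (ip_lin2 _ _ Lu Lv Lz) !(ipC _ _ _ (fun x => k * u x + k' * v x)).
rewrite (ip_lin2 _ _ Lu Lv Lu) (ip_lin2 _ _ Lu Lv Lv) (ipC _ _ v u) uv !mulr0 add0r addr0.
rewrite !mulrA -!expr2 => H.
have ku : 0 <= k ^+ 2 * ip mu D u u by rewrite mulr_ge0 ?sqr_ge0// ltW.
have kv : 0 <= k' ^+ 2 * ip mu D v v by rewrite mulr_ge0 ?sqr_ge0// ltW.
move/eqP: H; rewrite paddr_eq0// !mulf_eq0 (gt_eqF u0) (gt_eqF v0) !orbF !orbb.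
by move=> /andP[/eqP ? /eqP ?].
Qed.

End independence.

Section upper_bounds.
Context {R : realType}.
Variables (l L w h : R).
Hypothesis th : thin l L w h.
Notation Om := (dumbbell l L w h : set (plane R)).
Notation B := (boundary (dumbbell l L w h) : set (plane R)).
Notation N := (nsq leb2 Om).
Notation NB := (nsq hausdorff1 B).
Notation En := (energy Om).

Let mO := measurable_Om l L w h.
Let mB : measurable B. Proof. exact: measurable_boundary. Qed.
Let L_box : -2 <= L + 2 :> R. Proof. by case: th => ? ? ? ? [? ?]; lra. Qed.
Let box_y : -1 <= 2 :> R. Proof. by lra. Qed.
Let bO := dumbbell_box th.
Let bB := boundary_box th.
Notation fB := (finite_boundary th).

Lemma finite_dumbbell : (leb2 Om < +oo)%E.
Proof. exact: finite_leb2 L_box box_y bO. Qed.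
Notation fO := finite_dumbbell.

Let nums : [/\ [/\ 0 < l, 0 < w, 0 < h & 0 < L], [/\ w < 1, h < 1, l <= 1 & 1 <= L] & w <= l /\ w < h].
Proof. by case: th => ? ? ? ? [? ?]; split; split; lra. Qed.

Let cst_sobolev (k : R) : sobolev Om (fun=> k) (fun=> 0).
Proof.
have [sk gk] := @smooth_cst R k; have := smooth_sobolev mO L_box box_y bO sk.
by congr (sobolev _ _ _); apply: funext => x; exact: gk.
Qed.

Let cst_trace (k : R) : trace Om (fun=> k) (fun=> 0) (fun=> k).
Proof.
have [sk gk] := @smooth_cst R k; have := smooth_trace mO L_box box_y bO fB bB sk.
by congr (trace _ _ _ _); apply: funext => x; exact: gk.
Qed.

Let form0l G : form Om (fun=> 0) G = 0.
Proof. by rewrite -(form0 mO G); congr (_ + _); exact: ipC. Qed.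

Let area1 : leb2 (room1 : set (plane R)) = 1%E.
Proof. by rewrite leb2_rect//; congr EFin; ring. Qed.
Let area3 : leb2 (room3 l L h) = (L * h)%:E.
Proof. by have [[l0 w0 h0 L0] _ _] := nums; rewrite leb2_rect ?(ltW h0)//; [congr EFin; ring|lra]. Qed.

Let m1 : measurable (room1 : set (plane R)). Proof. exact: measurable_rect. Qed.
Let m3 : measurable (room3 l L h). Proof. exact: measurable_rect. Qed.

Let measure_Om_gt0 : (0 < leb2 Om)%E.
Proof.
apply: (@lt_le_trans _ _ (leb2 (room1 : set (plane R)))); first by rewrite area1 lte01.
by apply: le_measure; rewrite ?inE//; exact: room1_sub.
Qed.

Let nsq1_gt0 (mu : {measure set (plane R) -> \bar R}) (D : set (plane R)) :
  measurable D -> (mu D < +oo)%E -> (0 < mu D)%E -> 0 < nsq mu D (fun=> 1).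
Proof. by move=> mD fD D0; rewrite /nsq /ip Rintegral_cst// !mul1r fine_gt0// D0. Qed.

Let rayleigh_arith (lambda E b p q : R) : 0 < p -> p <= b -> lambda * b <= E -> E <= q -> 0 <= lambda -> lambda <= q / p.
Proof.
move=> p0 pb lE Eq l0; rewrite ler_pdivlMr//; apply: le_trans Eq; apply: le_trans lE.
by rewrite ler_wpM2l.
Qed.

Let unit_quad : quad (R := R) := (fun=> 1, fun=> 0, fun=> 0, fun=> 1).
Let mk_quad (u : R * R -> R) (G : R * R -> R * R) (g : R * R -> R) : quad (R := R) :=
  (u, fun z => (G z).1, fun z => (G z).2, g).

Let grd_mk u G g : grd (mk_quad u G g) = G.
Proof. by apply: funext => z; rewrite /grd -surjective_pairing. Qed.

Lemma complete_neumann (s : nat -> quad (R := R)) : (forall n, neumann_space l L w h (s n)) ->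
  (forall eps, 0 < eps -> exists n0, forall n m, (n0 <= n)%N -> (n0 <= m)%N ->
    energy_form l L w h (s n - s m) (s n - s m) + mass_form l L w h (s n - s m) (s n - s m) <= eps) ->
  exists2 u, neumann_space l L w h u & forall eps, 0 < eps -> exists n0, forall n, (n0 <= n)%N ->
    energy_form l L w h (u - s n) (u - s n) + mass_form l L w h (u - s n) (u - s n) <= eps.
Proof.
move=> Ss cau.
have [v [H [svH C]]] := sobolev_complete mO L_box box_y bO (u := fun n => fct (s n)) (G := fun n => grd (s n)) Ss cau.
exists (mk_quad v H (fun=> 0)); first by rewrite /neumann_space /mkset grd_mk.
exact: C.
Qed.

(** The test function is the ramp minus its mean: its energy is at most 4 w / l and its mass at
    least p, as the chambers have areas 1 and L h. The hypothesis is the smallness condition of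
    [direct_method], with the constant of [neumann_gap]. *)
Lemma neumann_eigenvalue1_le (p := L * h / (1 + L * h)) :
  12 * L ^+ 2 * (4 * w / l) < p -> (neumann_eigenvalue Om 1 <= (4 * w / l / p)%:E)%E.
Proof.
have [[l0 w0 h0 L0] [w1 h1 l1 L1] [wl wh]] := nums.
have Lh0 : 0 < L * h by rewrite mulr_gt0.
have p0 : 0 < p by rewrite /p divr_gt0//; lra.
have K0 : 0 <= 12 * L ^+ 2 by rewrite mulr_ge0// sqr_ge0.
have d13 : (room1 : set (plane R)) `&` room3 l L h = set0.
  by rewrite -subset0 => x [/rectE[? ? ? ?] /rectE[? ? ? ?]]; lra.
move=> gap; have [f [sf f0 f1 Ef]] := ramp th.
have Sf := smooth_sobolev mO L_box box_y bO sf; have [Lf _ _ _] := Sf.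
have [k pk] := centered mO fO measure_Om_gt0 Lf.
have Sk := shift_sobolev th k Sf; have [Lk _ _ _] := Sk.
pose phi := mk_quad (fun x => f x - k) (grad f) (fun=> 0).
have bphi : p <= mass_form l L w h phi phi.
  apply: (ramp_nsq mO m1 m3 (@room1_sub R l L w h th) (room3_sub th) d13 area1 area3 Lh0 Lk).
    by move=> x /rectE[? x0 ? ?]; apply: f0; exact: ltW.
  by move=> x /rectE[x0 ? ? ?]; apply: f1; exact: ltW.
have Se : neumann_space l L w h unit_quad by exact: (cst_sobolev 1).
have Sphi : neumann_space l L w h phi by rewrite /neumann_space /mkset grd_mk.
have e0 : energy_form l L w h unit_quad unit_quad = 0 by exact: form0l.
have be : 0 < mass_form l L w h unit_quad unit_quad by exact: (nsq1_gt0 mO fO measure_Om_gt0).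
have gphi : 12 * L ^+ 2 * energy_form l L w h phi phi < mass_form l L w h phi phi.
  by apply: lt_le_trans bphi; apply: le_lt_trans gap; rewrite ler_wpM2l.
have lin := linear_neumann th; have sm := @semi_inner_mass R l L w h.
have [_ a_sym a_ge0] := semi_inner_energy l L w h.
have N0 (x : quad) : neumann_space l L w h x ->
    N (fct x) <= 1 * (energy_form l L w h x x + mass_form l L w h x x).
  by move=> Sx; rewrite mul1r lerDr; exact: a_ge0.
have gapN (x : quad) : neumann_space l L w h x -> mass_form l L w h x x <= 12 * L ^+ 2 * energy_form l L w h x x +
    ((2 * mean1 (fct x)) ^+ 2 + (2 * mean2 l w (fct x)) ^+ 2 + (2 * L * mean3 l L h (fct x)) ^+ 2).
  by move=> Sx; have Sx' : sobolev Om (fct x) (grd x) := Sx; exact: (neumann_gap th Sx').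
have [u [lambda [Su bu ue Ru eu]]] := constrained_minimizer th lin (@subset_refl _ _) sm ler01 N0
  (@complete_neumann) K0 gapN Se e0 be Sphi pk (lt_le_trans p0 bphi) gphi.
have lambda0 : 0 <= lambda.
  by rewrite -(pmulr_lge0 _ bu) -eu//; exact: a_ge0.
have [Lu _ _ _] := Su; have [Lc _ _ _] := cst_sobolev 1.
apply: (@le_trans _ _ lambda%:E); last by rewrite lee_fin; exact: rayleigh_arith p0 bphi Ru Ef lambda0.
apply: (nth_eigenvalue1_le (u := fun=> 1) (v := fct u)) => //.
- apply/(neumann_eigenfunctionP mO); exists (fun=> 0) => // v H _.
  by rewrite form0l mul0r.
- apply/(neumann_eigenfunctionP mO); exists (grd u) => // v H sv.
  have Sv : neumann_space l L w h (mk_quad v H v) by rewrite /neumann_space /mkset grd_mk.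
  by have := eu _ Sv; rewrite /energy_form grd_mk.
- move=> r r' H; apply: (orthogonal_free mO fO Lc Lu (etrans (ipC _ _ _ _) ue) be bu).
  apply: ae0_nsq => //; have := L2_lin mO r Lc (L2_lin mO r' Lu (L2_cst 0 mO fO)).
  by congr (L2 _ _ _); apply: funext => x; rewrite addr0.
Qed.

Let steklov_sub : steklov_space l L w h `<=` neumann_space l L w h.
Proof. by move=> x []. Qed.

Let steklov_mass (x : quad) : steklov_space l L w h x ->
  N (fct x) <= 24 * (energy_form l L w h x x + boundary_form l L w h x x).
Proof. by move=> [sx tx]; have H := trace_friedrichs th sx tx; rewrite mulrDr addrC; exact: H. Qed.

Let cauchy_arith (E n nb e : R) : n <= 24 * (E + nb) -> 0 <= nb -> E + nb <= e / 25 -> E + n <= e.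
Proof. by lra. Qed.

Let limit_arith (E n nb e : R) : 0 <= n -> E + n <= e / 2 -> nb <= e / 2 -> E + nb <= e.
Proof. by lra. Qed.

Lemma complete_steklov (s : nat -> quad (R := R)) : (forall n, steklov_space l L w h (s n)) ->
  (forall eps, 0 < eps -> exists n0, forall n m, (n0 <= n)%N -> (n0 <= m)%N ->
    energy_form l L w h (s n - s m) (s n - s m) + boundary_form l L w h (s n - s m) (s n - s m) <= eps) ->
  exists2 u, steklov_space l L w h u & forall eps, 0 < eps -> exists n0, forall n, (n0 <= n)%N ->
    energy_form l L w h (u - s n) (u - s n) + boundary_form l L w h (u - s n) (u - s n) <= eps.
Proof.
move=> Ss cau.
have Sd n m : steklov_space l L w h (s n - s m).
  by have := linear_steklov th (-1) (Ss m) (Ss n); rewrite scaleN1r addrC.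
have Sn n : neumann_space l L w h (s n) by exact: steklov_sub.
have [_ _ b0] := @semi_inner_boundary R l L w h.
have [_ _ a0] := @semi_inner_energy R l L w h.
have [|v [H [svH C]]] := sobolev_complete mO L_box box_y bO (u := fun n => fct (s n)) (G := fun n => grd (s n)) Sn.
  (* 25 = 1 + 24: energy plus mass is at most 25 times energy plus boundary mass, by
     [steklov_mass]. *)
  move=> e e0; have e25 : 0 < e / 25 by rewrite divr_gt0.
  have [n0 Hn] := cau _ e25; exists n0 => n m n1 m1'.
  exact: cauchy_arith (steklov_mass (Sd n m)) (b0 _ (Sd n m)) (Hn n m n1 m1').
have Ls n : L2 hausdorff1 B (bdv (s n)) by have [_ []] := Ss n.
have [|g Lg Cg] := nsq_complete mB Ls.
  move=> e e0; have [n0 Hn] := cau _ e0; exists n0 => n m n1 m1'.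
  by apply: le_trans (Hn n m n1 m1'); rewrite lerDr; apply: a0; exact: steklov_sub.
exists (mk_quad v H g).
  rewrite /steklov_space /mkset grd_mk; split=> //.
  apply: (trace_closed mO L_box box_y bO fB bB svH Lg) => e e0.
  have [n1 H1] := C _ e0; have [n2 H2] := Cg _ e0; pose n := maxn n1 n2.
  exists (fct (s n)), (grd (s n)), (bdv (s n)); have [sn tn] := Ss n; split=> //.
  have Cn := H1 n (leq_maxl _ _); split; last exact: (H2 n (leq_maxr _ _)).
    by apply: le_trans Cn; rewrite lerDr addr_ge0// nsq_ge0.
  by apply: le_trans Cn; rewrite lerDl nsq_ge0.
move=> e e0; have e2 : 0 < e / 2 by rewrite divr_gt0.
have [n1 H1] := C _ e2; have [n2 H2] := Cg _ e2; exists (maxn n1 n2) => n.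
rewrite geq_max => /andP[/H1 Hn /H2 Hn'].
exact: limit_arith (nsq_ge0 _ _ _) Hn Hn'.
Qed.

(** A null function has null energy by [null_gradient], and [trace_bound] concludes. It is needed
    because freeness is tested in Om, whereas the Steklov eigenfunctions are orthogonal on the
    boundary. *)
Lemma null_trace u G g : sobolev Om u G -> trace Om u G g -> N u = 0 -> NB g = 0.
Proof.
move=> su tu u0; have [Lu L1 L2' _] := su.
have mr (a b c d : R) : measurable (rect a b c d : set (plane R)) by exact: measurable_rect.
have z (p q r s : R) : rect p q r s `<=` Om -> nsq leb2 (rect p q r s) u = 0.
  move=> sub; apply/eqP; rewrite eq_le nsq_ge0 andbT -u0; exact: nsq_sub.
have s1 := @room1_sub R l L w h th; have s2 := room2_sub th; have s3 := room3_sub th.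
have ng := null_gradient mO L_box box_y bO su u0.
have [a1 b1] := ng _ _ _ _ s1; have [a2 b2] := ng _ _ _ _ s2; have [a3 b3] := ng _ _ _ _ s3.
have E0 : En G = 0.
  have H1 := nsq_rooms th L1; have H2 := nsq_rooms th L2'.
  rewrite a1 a2 a3 !addr0 in H1; rewrite b1 b2 b3 !addr0 in H2.
  apply/eqP; rewrite /energy paddr_eq0 ?nsq_ge0//.
  by rewrite !eq_le !nsq_ge0 H1 H2.
have := trace_bound th su tu; rewrite E0 (z _ _ _ _ s1) (z _ _ _ _ s2) (z _ _ _ _ s3).
rewrite !mulr0 !addr0 mulr0 => H.
by apply/eqP; rewrite eq_le nsq_ge0 H.
Qed.

Let length (a b : R) : a <= b -> hausdorff1 (hseg a b 0 : set (plane R)) = (b - a)%:E.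
Proof.
move=> ab; rewrite hausdorff1_hseg /= lebesgue_measure_itv/= lte_fin.
by case: ltgtP ab => // -> _; rewrite subrr.
Qed.

(** As for Neumann, with the bottom sides of the two chambers, of lengths 1 and L, instead of their
    areas, and with the constant of [steklov_gap]. *)
Lemma steklov_eigenvalue1_le (p := L / (1 + L)) :
  304 * (l ^+ 2 * w^-1 + L ^+ 2 * h^-1) * (4 * w / l) < p ->
  (steklov_eigenvalue Om 1 <= (4 * w / l / p)%:E)%E.
Proof.
have [[l0 w0 h0 L0] [w1 h1 l1 L1] [wl wh]] := nums.
have p0 : 0 < p by rewrite /p divr_gt0//; lra.
pose K := 304 * (l ^+ 2 * w^-1 + L ^+ 2 * h^-1).
have K0 : 0 <= K by rewrite /K mulr_ge0// addr_ge0// mulr_ge0 ?sqr_ge0// invr_ge0 ltW.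
pose A : set (plane R) := hseg (-1) 0 0; pose A' : set (plane R) := hseg l (l + L) 0.
have mA : measurable A by exact: measurable_hseg.
have mA' : measurable A' by exact: measurable_hseg.
have q1 : -1 <= l by lra.
have q2 : 0 <= l + L by lra.
have q3 : l <= l + L by lra.
have q4 : (-1 : R) <= 0 by lra.
have AB : A `<=` B by exact: (bottom_sub th (lexx _) q2).
have A'B : A' `<=` B by exact: (bottom_sub th q1 (lexx _)).
have HA : hausdorff1 A = 1%E by rewrite /A (length q4) sub0r opprK.
have HA' : hausdorff1 A' = L%:E by rewrite /A' (length q3); congr EFin; ring.
have AA' : A `&` A' = set0.
  rewrite -subset0 => x [[t /= t0 <-] [t' /= + [tt]]].
  by move: t0; rewrite tt !in_itv/= => /andP[? ?] /andP[? ?]; lra.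
have B0 : (0 < hausdorff1 B)%E.
  by apply: (@lt_le_trans _ _ (hausdorff1 A)); [rewrite HA lte01|exact: le_hausdorff1].
move=> gap; have [f [sf f0 f1 Ef]] := ramp th.
have Sf := smooth_sobolev mO L_box box_y bO sf.
have Tf := smooth_trace mO L_box box_y bO fB bB sf; have [Lf _] := Tf.
have [k pk] := centered mB fB B0 Lf.
have Sk := shift_sobolev th k Sf; have Tk := shift_trace th k Sf Tf; have [Lk _] := Tk.
pose phi := mk_quad (fun x => f x - k) (grad f) (fun x => f x - k).
have bphi : p <= boundary_form l L w h phi phi.
  apply: (ramp_nsq mB mA mA' AB A'B AA' HA HA' L0 Lk).
    by move=> _ [t /= + <-]; rewrite in_itv/= => /andP[_ t0]; exact: f0.
  by move=> _ [t /= + <-]; rewrite in_itv/= => /andP[t0 _]; exact: f1.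
have Se : steklov_space l L w h unit_quad by split; [exact: (cst_sobolev 1)|exact: (cst_trace 1)].
have Sphi : steklov_space l L w h phi by rewrite /steklov_space /mkset grd_mk.
have e0 : energy_form l L w h unit_quad unit_quad = 0 by exact: form0l.
have be : 0 < boundary_form l L w h unit_quad unit_quad by exact: (nsq1_gt0 mB fB B0).
have gphi : K * energy_form l L w h phi phi < boundary_form l L w h phi phi.
  by apply: lt_le_trans bphi; apply: le_lt_trans gap; rewrite /K ler_wpM2l.
have lin := linear_steklov th; have sm := @semi_inner_boundary R l L w h.
have [_ _ a_ge0] := semi_inner_energy l L w h.
have gapS (x : quad) : steklov_space l L w h x -> boundary_form l L w h x x <= K * energy_form l L w h x x +
    ((8 * mean1 (fct x)) ^+ 2 + (8 * mean2 l w (fct x)) ^+ 2 + (8 * L * mean3 l L h (fct x)) ^+ 2).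
  by move=> [sx tx]; exact: (steklov_gap th sx tx).
have [u [lambda [Su bu ue Ru eu]]] := constrained_minimizer th lin steklov_sub sm (ler0n R 24) steklov_mass
  (@complete_steklov) K0 gapS Se e0 be Sphi pk (lt_le_trans p0 bphi) gphi.
have lambda0 : 0 <= lambda.
  by rewrite -(pmulr_lge0 _ bu) -eu//; apply: a_ge0; exact: steklov_sub.
have [su tu] := Su; have [Lu _ _ _] := su; have [Lg _] := tu.
have [Lc _ _ _] := cst_sobolev 1; have [Lc' _] := cst_trace 1.
apply: (@le_trans _ _ lambda%:E); last by rewrite lee_fin; exact: rayleigh_arith p0 bphi Ru Ef lambda0.
apply: (nth_eigenvalue1_le (u := fun=> 1) (v := fct u)) lambda0 _.
- apply/(steklov_eigenfunctionP mO); exists (fun=> 0), (fun=> 1); split.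
  + exact: cst_sobolev.
  + exact: cst_trace.
  + by move=> v H g _ _; rewrite form0l mul0r.
- apply/(steklov_eigenfunctionP mO); exists (grd u), (bdv u); split => // v H g sv tv.
  have Sv : steklov_space l L w h (mk_quad v H g) by rewrite /steklov_space /mkset grd_mk.
  by have := eu _ Sv; rewrite /energy_form grd_mk.
- move=> r r' H; have sz := sobolev_lin mO L_box box_y bO r' su (cst_sobolev r).
  have tz := trace_lin mO L_box box_y bO fB bB r' su tu (cst_sobolev r) (cst_trace r).
  have [Lz _ _ _] := sz; have Nz : N (fun x => r' * fct u x + r) = 0.
    apply: (ae0_nsq mO Lz).
    apply: (@filterS _ _ (ae_filter_ringOfSetsType leb2) _ _ _ H) => x Hx Ox.
    by rewrite addrC -{1}(mulr1 r); exact: Hx.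
  have := null_trace sz tz Nz.
  rewrite (@eq_nsq _ _ _ _ (fun x => r * 1 + r' * bdv u x)); last by move=> x _; rewrite mulr1 addrC.
  exact: (orthogonal_free mB fB Lc' Lg (etrans (ipC _ _ _ _) ue) be bu).
Qed.

End upper_bounds.

(** * Choice of the parameters *)

Section parameters.
Context {R : realType}.
Implicit Types (e : R).

Lemma small_scale (C d b : R) : 0 < C -> 0 < d -> 0 < b -> exists e, [/\ 0 < e, e < b & C * e <= d].
Proof.
move=> C0 d0 b0; exists (Num.min (b / 2) (d / C)); split.
- by rewrite lt_min !divr_gt0.
- by rewrite gt_min; apply/orP; left; lra.
- by rewrite mulrC -ler_pdivlMr// ge_min lexx orbT.
Qed.

Lemma thin_long e : 0 < e -> e < 1 / 100 -> thin e (e ^- 2) (e ^+ 6) (e ^+ 2).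
Proof.
move=> e0 e1; have e2 : 0 < e ^+ 2 by rewrite exprn_gt0.
have e2' : e ^+ 2 < 1 by rewrite expr_lt1//; lra.
have e4 : e ^+ 4 < 1 by rewrite expr_lt1//; lra.
have e5 : e ^+ 5 < 1 by rewrite expr_lt1//; lra.
split; rewrite ?exprn_gt0//.
- by rewrite (exprD e 2 4) gtr_pMr.
- by rewrite (exprD e 1 5) expr1 ger_pMr// ltW.
- by split; [lra|rewrite invf_ge1// ltW].
Qed.

Lemma thin_short e : 0 < e -> e < 1 / 100 -> thin e 1 (e ^+ 6) (e ^+ 2).
Proof. by move=> e0 e1; have [? ? ? ? [? ?]] := thin_long e0 e1; split. Qed.

(** L h = 1 makes the right side 1 / 2, and the power 6 in w makes the left side 48 e. *)
Lemma long_neumann_gap e (L := e ^- 2) : 0 < e -> e < 1 / 100 ->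
  12 * L ^+ 2 * (4 * e ^+ 6 / e) < L * e ^+ 2 / (1 + L * e ^+ 2).
Proof.
move=> e0 e1; have en : e != 0 by rewrite gt_eqF.
have -> : L * e ^+ 2 = 1 by rewrite /L mulVf// expf_neq0.
have -> : 12 * L ^+ 2 * (4 * e ^+ 6 / e) = 48 * e by rewrite /L; field.
by rewrite ltr_pdivlMr; lra.
Qed.

Lemma short_neumann_gap e : 0 < e -> e < 1 / 100 ->
  12 * 1 ^+ 2 * (4 * e ^+ 6 / e) < 1 * e ^+ 2 / (1 + 1 * e ^+ 2).
Proof.
move=> e0 e1; have en : e != 0 by rewrite gt_eqF.
have -> : 12 * 1 ^+ 2 * (4 * e ^+ 6 / e) = 48 * e ^+ 3 * e ^+ 2 by field.
have e2 : 0 < e ^+ 2 by rewrite exprn_gt0.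
have e2' : e ^+ 2 < 1 by rewrite expr_lt1//; lra.
have e3 : e ^+ 3 <= e by rewrite exprS ler_piMr ?(ltW e0)// ltW.
rewrite !mul1r ltr_pdivlMr; last by lra.
rewrite mulrAC -[ltRHS]mul1r ltr_pM2r//.
have e30 : 0 <= e ^+ 3 by rewrite exprn_ge0// ltW.
have : 48 * e ^+ 3 * (1 + e ^+ 2) <= 48 * e * 2 by apply: ler_pM; lra.
lra.
Qed.

(** The left side is 1216 (e + e^3), which explains the smaller threshold on e. *)
Lemma short_steklov_gap e : 0 < e -> e < 1 / 100 / 100 ->
  304 * (e ^+ 2 * (e ^+ 6)^-1 + 1 ^+ 2 * (e ^+ 2)^-1) * (4 * e ^+ 6 / e) < 1 / (1 + 1).
Proof.
move=> e0 e1; have en : e != 0 by rewrite gt_eqF.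
have -> : 304 * (e ^+ 2 * (e ^+ 6)^-1 + 1 ^+ 2 * (e ^+ 2)^-1) * (4 * e ^+ 6 / e) = 1216 * (e + e ^+ 3) by field.
have e3 : e ^+ 3 <= e by rewrite exprS ler_piMr ?(ltW e0)// expr_le1 ?(ltW e0)//; lra.
by rewrite ltr_pdivlMr; lra.
Qed.

Lemma fine_bounds (x : \bar R) (a b : R) : (a%:E <= x)%E -> (x <= b%:E)%E -> a <= fine x <= b.
Proof. by case: x => [r| |]; rewrite ?lee_fin//= => -> ->. Qed.

(** The numerator is at most 8 e^5 * 5, and the denominator at least e^6 / (2 c) times the length
    e^-2, because w^-1 and L^2 / h are both e^-6. *)
Lemma small_ratio e c mu1 area sigma1 per : 0 < e -> 0 < c -> 0 <= mu1 -> mu1 <= 4 * e ^+ 6 / e / (1 / (1 + 1)) ->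
  0 <= area -> area <= 5 -> (c * ((e ^+ 6)^-1 + (e ^- 2) ^+ 2 * (e ^+ 2)^-1))^-1 <= sigma1 ->
  e ^- 2 <= per -> mu1 * area / (sigma1 * per) <= 80 * c * e.
Proof.
move=> e0 c0 m0 m1 a0 a1 s1 p1; have en : e != 0 by rewrite gt_eqF.
have cn : c != 0 by rewrite gt_eqF.
have c2 : 0 < 2 * c by rewrite mulr_gt0.
have e2 : 0 < e ^- 2 by rewrite invr_gt0 exprn_gt0.
have E1 : 4 * e ^+ 6 / e / (1 / (1 + 1)) = 8 * e ^+ 5 by field.
have E2 : (c * ((e ^+ 6)^-1 + (e ^- 2) ^+ 2 * (e ^+ 2)^-1))^-1 = e ^+ 6 / (2 * c).
  by field; rewrite en cn.
rewrite E1 in m1; rewrite E2 in s1.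
have s0 : 0 < sigma1 by apply: lt_le_trans s1; rewrite divr_gt0// exprn_gt0.
have p0 : 0 < per by exact: lt_le_trans p1.
have H1 : mu1 * area <= 8 * e ^+ 5 * 5 by exact: ler_pM.
have H2 : e ^+ 6 / (2 * c) * e ^- 2 <= sigma1 * per.
  by apply: ler_pM => //; [rewrite divr_ge0// ?exprn_ge0//|]; exact: ltW.
rewrite ler_pdivrMr ?mulr_gt0//; apply: (le_trans H1).
have H3 : 80 * c * e * (e ^+ 6 / (2 * c) * e ^- 2) <= 80 * c * e * (sigma1 * per).
  by rewrite ler_wpM2l// ?mulr_ge0// ltW.
apply: le_trans H3.
by rewrite (_ : 80 * c * e * _ = 8 * e ^+ 5 * 5)//; field; rewrite en cn.
Qed.

(** The numerator is at least e^4 / c, as h / w = e^-4, and the denominator at most 8 e^5 * 12. *)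
Lemma large_ratio e c mu1 area sigma1 per : 0 < e -> 0 < c ->
  (c * 1 ^+ 3 * (e ^+ 2 * (e ^+ 6)^-1))^-1 <= mu1 -> 1 <= area ->
  0 < sigma1 -> sigma1 <= 4 * e ^+ 6 / e / (1 / (1 + 1)) -> 0 < per -> per <= 12 ->
  (c * 96 * e)^-1 <= mu1 * area / (sigma1 * per).
Proof.
move=> e0 c0 m1 a1 s0 s1 p0 p1; have en : e != 0 by rewrite gt_eqF.
have cn : c != 0 by rewrite gt_eqF.
have E1 : 4 * e ^+ 6 / e / (1 / (1 + 1)) = 8 * e ^+ 5 by field.
have E2 : (c * 1 ^+ 3 * (e ^+ 2 * (e ^+ 6)^-1))^-1 = e ^+ 4 / c.
  by field; rewrite en cn.
rewrite E1 in s1; rewrite E2 in m1.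
have m0 : 0 <= e ^+ 4 / c by rewrite divr_ge0 ?exprn_ge0// ltW.
have H1 : e ^+ 4 / c * 1 <= mu1 * area by exact: ler_pM.
have H2 : sigma1 * per <= 8 * e ^+ 5 * 12 by apply: ler_pM => //; exact: ltW.
rewrite ler_pdivlMr ?mulr_gt0//; apply: le_trans H1.
have i0 : 0 <= (c * 96 * e)^-1 by rewrite invr_ge0 !mulr_ge0// ltW.
apply: (le_trans (ler_wpM2l i0 H2)).
by rewrite (_ : (c * 96 * e)^-1 * _ = e ^+ 4 / c * 1)//; field; rewrite en cn.
Qed.

End parameters.

Section ratios.
Context {R : realType}.

Let c_gt0 : 0 < 150 ^+ 2 :> R. Proof. by rewrite exprn_gt0. Qed.

Lemma ratio_ge0 (Om : set (R * R)) : bounded_lipschitz_open Om -> (0 < steklov_eigenvalue Om 1)%E ->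
  0 <= neumann_steklov_ratio Om.
Proof.
move=> [_ oO _ _] s0; have mO := open_measurable_plane oO.
rewrite /neumann_steklov_ratio divr_ge0// mulr_ge0// fine_ge0//.
- exact: neumann_eigenvalue1_ge0 mO.
- exact: ltW.
Qed.

Lemma steklov_lower (l L w h : R) : thin l L w h ->
  (((150 ^+ 2 * (w^-1 + L ^+ 2 * h^-1))^-1)%:E <= steklov_eigenvalue (dumbbell l L w h) 1)%E.
Proof.
move=> th; have [w0 wh h1 wl [l1 L1]] := th.
have K0 : 0 < 150 ^+ 2 * (w^-1 + L ^+ 2 * h^-1).
  apply: mulr_gt0 c_gt0 _; apply: addr_gt0; first by rewrite invr_gt0.
  by rewrite mulr_gt0 ?exprn_gt0 ?invr_gt0//; lra.
have b1 : -2 <= L + 2 by lra.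
have b2 : -1 <= (2 : R) by lra.
apply: (steklov_eigenvalue1_ge (measurable_Om l L w h) b1 b2 (dumbbell_box th) (finite_boundary th) (boundary_box th) K0) => u G g su tu.
exists (mean3 l L h u); first exact: (steklov_poincare th su tu).
move=> E0; have H := steklov_poincare th su tu.
have F := trace_friedrichs th (shift_sobolev th (mean3 l L h u) su) (shift_trace th (mean3 l L h u) su tu).
apply/eqP; rewrite eq_le nsq_ge0 andbT; apply: (le_trans F).
rewrite E0 mulr0 in H; rewrite E0 mulr0 addr0.
by rewrite mulr_ge0_le0.
Qed.

Lemma neumann_lower (l L w h : R) : thin l L w h ->
  (((700 * L ^+ 3 * (h * w^-1))^-1)%:E <= neumann_eigenvalue (dumbbell l L w h) 1)%E.
Proof.
move=> th; have [w0 wh h1 wl [l1 L1]] := th.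
have K0 : 0 < 700 * L ^+ 3 * (h * w^-1).
  apply: mulr_gt0; last by rewrite divr_gt0//; lra.
  by apply: mulr_gt0 (ltr0Sn R 699) _; rewrite exprn_gt0//; lra.
have b1 : -2 <= L + 2 by lra.
have b2 : -1 <= (2 : R) by lra.
apply: (neumann_eigenvalue1_ge (measurable_Om l L w h) b1 b2 (dumbbell_box th) K0) => u G su.
by exists (mean1 u); exact: (neumann_poincare th su).
Qed.

Lemma perimeter_ge (l L w h : R) : thin l L w h -> (L%:E <= perimeter (dumbbell l L w h))%E.
Proof.
move=> th; have [w0 wh h1 wl [l1 L1]] := th.
have q : -1 <= l + L by lra.
have q' : l + L <= l + L by [].
have H := le_hausdorff1 (@bottom_sub R l L w h th (-1) (l + L) (lexx _) q').
apply: le_trans H; rewrite hausdorff1_hseg /= lebesgue_measure_itv/= lte_fin ifT; last by lra.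
by rewrite lee_fin; lra.
Qed.

Lemma long_dumbbell e (Om := dumbbell e (e ^- 2) (e ^+ 6) (e ^+ 2) : set (R * R)) : 0 < e -> e < 1 / 100 ->
  [/\ bounded_lipschitz_open Om, (0 < steklov_eigenvalue Om 1)%E & neumann_steklov_ratio Om <= 80 * 150 ^+ 2 * e].
Proof.
move=> e0 e1; have th := thin_long e0 e1.
have en : e != 0 by rewrite gt_eqF.
have Lh : e ^- 2 * e ^+ 2 = 1 by rewrite mulVf// expf_neq0.
have mu_le := neumann_eigenvalue1_le th (long_neumann_gap e0 e1).
have si_ge := steklov_lower th; have P_ge := perimeter_ge th.
have P_le := hausdorff1_boundary th.
have Lh' : e ^- 2 * e ^+ 2 <= 1 by rewrite Lh.
have /andP[A_ge A_le] := leb2_dumbbell th Lh'.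
have mu_ge := @neumann_eigenvalue1_ge0 R Om (measurable_Om _ _ _ _).
have s0 : 0 < (150 ^+ 2 * ((e ^+ 6)^-1 + (e ^- 2) ^+ 2 * (e ^+ 2)^-1))^-1.
  rewrite invr_gt0; apply: mulr_gt0 c_gt0 _.
  by rewrite addr_gt0 ?mulr_gt0// ?exprn_gt0 ?invr_gt0 ?exprn_gt0.
split; first exact: bounded_lipschitz_open_dumbbell (thin_admissible th).
  by apply: lt_le_trans si_ge; rewrite lte_fin.
rewrite Lh in mu_le.
have /andP[M0 M1] := fine_bounds mu_ge mu_le; have /andP[A0 A1] := fine_bounds A_ge A_le.
have /andP[P0 P1] := fine_bounds P_ge P_le.
have A0' := le_trans ler01 A0.
rewrite /neumann_steklov_ratio.
(* Finiteness of sigma_1 is not established here: if it were +oo, [fine] would make it 0 and the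
   ratio, a division by 0, would be 0, which also satisfies the bound. *)
case: (steklov_eigenvalue Om 1) si_ge => [s| |] //= si_ge; last first.
  by rewrite mul0r invr0 mulr0 mulr_ge0// ltW.
exact: (small_ratio e0 c_gt0).
Qed.

Lemma short_dumbbell e (Om := dumbbell e 1 (e ^+ 6) (e ^+ 2) : set (R * R)) : 0 < e -> e < 1 / 100 / 100 ->
  [/\ bounded_lipschitz_open Om, (0 < steklov_eigenvalue Om 1)%E & (700 * 96 * e)^-1 <= neumann_steklov_ratio Om].
Proof.
move=> e0 e1; have e1' : e < 1 / 100 by lra.
have th := thin_short e0 e1'.
have en : e != 0 by rewrite gt_eqF.
have mu_le := neumann_eigenvalue1_le th (short_neumann_gap e0 e1').
have si_le := steklov_eigenvalue1_le th (short_steklov_gap e0 e1).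
have mu_ge := neumann_lower th.
have si_ge := steklov_lower th; have P_ge := perimeter_ge th.
have P_le := hausdorff1_boundary th.
have Lh' : 1 * e ^+ 2 <= 1 by rewrite mul1r expr_le1 ?(ltW e0)//; lra.
have /andP[A_ge A_le] := leb2_dumbbell th Lh'.
have s0 : 0 < (150 ^+ 2 * ((e ^+ 6)^-1 + 1 ^+ 2 * (e ^+ 2)^-1))^-1.
  rewrite invr_gt0; apply: mulr_gt0 c_gt0 _.
  by rewrite addr_gt0 ?mulr_gt0// ?exprn_gt0 ?invr_gt0 ?exprn_gt0.
have p12 : 2 * 1 + 10 = 12 :> R by ring.
rewrite p12 in P_le.
split; first exact: bounded_lipschitz_open_dumbbell (thin_admissible th).
  by apply: lt_le_trans si_ge; rewrite lte_fin.
have /andP[M0 M1] := fine_bounds mu_ge mu_le; have /andP[A0 A1] := fine_bounds A_ge A_le.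
have /andP[P0 P1] := fine_bounds P_ge P_le; have /andP[S0 S1] := fine_bounds si_ge si_le.
exact: large_ratio e0 (ltr0Sn R 699) M0 A0 (lt_le_trans s0 S0) S1 (lt_le_trans ltr01 P0) P1.
Qed.

End ratios.

Local Open Scope classical_set_scope.
Local Open Scope ereal_scope.

Theorem proposition2p1 (R : realType) :
  ereal_inf [set (neumann_steklov_ratio Omega)%:E | Omega in
    [set Omega : set (R * R) |
      bounded_lipschitz_open Omega /\ 0 < steklov_eigenvalue Omega 1]] = 0 /\
  ereal_sup [set (neumann_steklov_ratio Omega)%:E | Omega in
    [set Omega : set (R * R) |
      bounded_lipschitz_open Omega /\ 0 < steklov_eigenvalue Omega 1]] = +oo.
Proof.
split.
  apply/eqP; rewrite eq_le; apply/andP; split; last first.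
    by apply: le_ereal_inf_tmp => _ [Om [bl s0] <-]; rewrite lee_fin ratio_ge0.
  (* Long dumbbells, with e so small that 80 * 150^2 e <= d; for the supremum below, short ones with
     700 * 96 e <= 1 / A. *)
  apply/lee_addgt0Pr => d d0; rewrite add0e.
  have c0 : (0 < 80 * 150 ^+ 2 :> R)%R by rewrite mulr_gt0// exprn_gt0.
  have b0 : (0 < 1 / 100 :> R)%R by rewrite divr_gt0.
  have [e [e0 e1 ed]] := small_scale c0 d0 b0.
  have [bl s0 F] := long_dumbbell e0 e1.
  apply: (@le_trans _ _ (80 * 150 ^+ 2 * e)%:E); last by rewrite lee_fin.
  by apply: le_trans (_ : (neumann_steklov_ratio (dumbbell e (e ^- 2) (e ^+ 6) (e ^+ 2)))%:E <= _);
    [apply: ereal_inf_lbound; eexists; first split; [exact: bl|exact: s0|]|rewrite lee_fin].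
apply/eqyP => A A0.
have c0 : (0 < 700 * 96 :> R)%R by exact: mulr_gt0 (ltr0Sn R 699) (ltr0Sn R 95).
have b0 : (0 < 1 / 100 / 100 :> R)%R by rewrite !divr_gt0.
have A0' : (0 < A^-1)%R by rewrite invr_gt0.
have [e [e0 e1 ed]] := small_scale c0 A0' b0.
have eA : (A <= (700 * 96 * e)^-1)%R.
  by rewrite -[leLHS]invrK lef_pV2// posrE ?(mulr_gt0 c0 e0).
have [bl s0 F] := short_dumbbell e0 e1.
apply: (@le_trans _ _ (neumann_steklov_ratio (dumbbell e 1 (e ^+ 6) (e ^+ 2)))%:E).
  by rewrite lee_fin (le_trans eA F).
by apply: ereal_sup_ubound; eexists; first split; [exact: bl|exact: s0|].
Qed.
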